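(* Let $f:\mathbb{C}\to\mathbb{C}$ be a transcendental entire function of finite order, and let $a\in\mathbb{C}$ be neither a critical value of $f$ nor a locally omitted value of $f$. Then there exists a simply connected region $D\subset\mathbb{C}$ which does not contain $a$ and such that $f^{-1}(D)$ is connected.
   Context: $B(a,r)$ denotes the open disc of radius $r$ centered at $a\in\mathbb{C}$. A point $a\in\mathbb{C}$ is locally omitted by $f$ if there exist $r>0$ and a connected component $G$ of $f^{-1}(B(a,r))$ such that $f(z)\neq a$ for all $z\in G$. A point $a$ is a critical value of $f$ if $a=f(c)$ for some $c\in\mathbb{C}$ with $f'(c)=0$. An entire function $f$ has finite order if there are constants $C,\rho>0$ with $|f(z)|\le C\exp(|z|^{\rho})$ for all $z\in\mathbb{C}$. A region is a non-empty connected open subset of $\mathbb{C}$. An entire function is transcendental if it is not a polynomial. *)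

(* Defs.v *)
From HB Require Import structures.
From mathcomp Require Import all_boot all_order all_algebra.
From mathcomp Require Import complex.
From mathcomp Require Import all_classical all_reals all_analysis.

Set Implicit Arguments.
Unset Strict Implicit.
Unset Printing Implicit Defensive.

Import Order.TTheory GRing.Theory Num.Theory.
Import numFieldNormedType.Exports.

Local Open Scope classical_set_scope.
Local Open Scope complex_scope.
Local Open Scope ring_scope.

(* Equip R[i] with the Euclidean topology and its normed module structure over
   itself, so that derivatives below are complex derivatives. *)
HB.instance Definition _ (R : realType) := PseudoPointedMetric.copy R[i] R[i]^o.
HB.instance Definition _ (R : realType) := GRing.ComAlgebra.copy R[i] R[i]^o.
HB.instance Definition _ (R : realType) := Vector.copy R[i] R[i]^o.
HB.instance Definition _ (R : realType) := NormedModule.copy R[i] R[i]^o.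

Section EntireFunctions.
Variable R : realType.
Implicit Types (f : R[i] -> R[i]) (a z c : R[i]) (D : set R[i]).

Definition entire f := forall z, derivable f z 1.

Definition transcendental_entire f :=
  entire f /\ ~ exists p : {poly R[i]}, forall z, f z = p.[z].

(* The norm `|z| on R[i] takes (real) values in R[i], whence the coercion Re. *)
Definition modulus z : R := complex.Re `|z|.

Definition finite_order f :=
  exists C rho : R, [/\ 0 < C, 0 < rho &
    forall z, modulus (f z) <= C * expR (modulus z `^ rho)].

Definition critical_value f a := exists c, derive1 f c = 0 /\ f c = a.

(* connected_component A z is only a genuine (non-empty) component of A when
   z belongs to A. The radius of a ball in R[i] has type R[i]. *)
Definition locally_omitted f a :=
  exists (r : R) (G : set R[i]),
    [/\ 0 < r,
        exists2 z0, (f @^-1` ball a r%:C) z0 &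
                    G = connected_component (f @^-1` ball a r%:C) z0
      & forall z, G z -> f z <> a].

Definition region D := [/\ D !=set0, open D & connected D].

(* Curves in D are parametrized by the unit interval; values outside of it are
   irrelevant. *)
Definition loop_in D (g : R -> R[i]) :=
  [/\ {within `[0, 1], continuous g},
      forall t : R, t \in `[0, 1] -> D (g t)
    & g 0 = g 1].

Definition null_homotopic_in D (g : R -> R[i]) :=
  exists H : R * R -> R[i],
    [/\ {within `[0, 1] `*` `[0, 1], continuous H},
        forall s t : R, s \in `[0, 1] -> t \in `[0, 1] -> D (H (s, t)),
        forall t : R, t \in `[0, 1] -> H (0, t) = g t,
        forall t : R, t \in `[0, 1] -> H (1, t) = g 0
      & forall s : R, s \in `[0, 1] -> H (s, 0) = g 0 /\ H (s, 1) = g 0].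

Definition simply_connected_region D :=
  region D /\ forall g, loop_in D g -> null_homotopic_in D g.

End EntireFunctions.

(* Main.v *)
(* Translate so that a = 0, and descend: lift through f paths whose logarithm moves towards
   -oo. By Gross's theorem, from a regular point almost all directions of descent are
   unobstructed.
   Call a point lost if no chain of descending segments leads from it to a zero of f.
   As f has finite order, circles on which |f| is not too small exist at all scales, whence
   - ln |f z| <= C (1 + |z|)^n at lost points z. As 0 is not locally omitted, some descending
   segment from a lost point is blocked, and the points reached on the two sides of a blocked
   segment cannot be joined where |f| is small; iterating, one gets n lost points
   with pairwise disjoint fans of descending rays, for every n. By a length-area
   estimate on these fans, |ln |f|| would grow too fast for large n: no point is lost.
   Hence small modifications produce a curve Gamma from oo to 0, of the form
   exp (x + i g x), such that for every regular z in the preimage of Gamma the lift of Gamma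
   from z descends to a zero of f. Take for D the complement of Gamma and 0. Near any
   point of the plane the points of the preimage of D can all be moved, parallel to Gamma,
   to a punctured neighbourhood of one zero slit along one curve, thus lie in one clopen part
   of that preimage; as the preimage is dense, it is connected. *)
Require Import Defs.
From mathcomp Require Import all_boot all_order all_algebra.
From mathcomp Require Import complex.
From mathcomp Require Import all_classical all_reals all_analysis.
Import numFieldNormedType.Exports.
From mathcomp Require Import ring lra zify.
Set Implicit Arguments.
Unset Strict Implicit.
Unset Printing Implicit Defensive.
Import Order.TTheory GRing.Theory Num.Theory.
Local Open Scope classical_set_scope.
Local Open Scope complex_scope.
Local Open Scope ring_scope.

(** * Modulus and topology of the complex numbers *)

Section ComplexNorm.
Variable R : realType.
Implicit Types (z w u : R[i]) (x y : R).

Definition nm z : R := complex.Re `|z|.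

Lemma normE z : `|z| = (nm z)%:C.
Proof. by rewrite /nm; case: z. Qed.

Lemma nm_ge0 z : 0 <= nm z.
Proof. by rewrite -(ler0c (nm z)) -normE. Qed.

Lemma nm0 : nm 0 = 0.
Proof. by rewrite /nm normr0. Qed.

Lemma nm1 : nm 1 = 1.
Proof. by rewrite /nm normr1. Qed.

Lemma nm_eq0 z : (nm z == 0) = (z == 0).
Proof. by rewrite -(normr_eq0 z) normE eq_complex /= eqxx andbT. Qed.

Lemma nm_gt0 z : (0 < nm z) = (z != 0).
Proof. by rewrite lt_neqAle nm_ge0 andbT eq_sym nm_eq0. Qed.

Lemma nmN z : nm (- z) = nm z.
Proof. by rewrite /nm normrN. Qed.

Lemma nmB z w : nm (z - w) = nm (w - z).
Proof. by rewrite /nm distrC. Qed.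

Lemma nmM z w : nm (z * w) = nm z * nm w.
Proof. by rewrite /nm normrM !normE -rmorphM. Qed.

Lemma nmV z : nm z^-1 = (nm z)^-1.
Proof.
have [->|z0] := eqVneq z 0; first by rewrite invr0 nm0 invr0.
apply: (mulfI (x := nm z)); first by rewrite nm_eq0.
by rewrite -nmM !divff ?nm1 ?nm_eq0.
Qed.

Lemma nmX z n : nm (z ^+ n) = nm z ^+ n.
Proof. by elim: n => [|n IH]; rewrite ?expr0 ?nm1// !exprS nmM IH. Qed.

Lemma nmD z w : nm (z + w) <= nm z + nm w.
Proof. by rewrite -lecR rmorphD /= -!normE ler_normD. Qed.

Lemma nmDB z w : nm z - nm w <= nm (z - w).
Proof. by have := nmD (z - w) w; rewrite subrK; lra. Qed.

Lemma nm_sub_trans w z u : nm (z - u) <= nm (z - w) + nm (w - u).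
Proof. by have := nmD (z - w) (w - u); rewrite addrA subrK. Qed.

Lemma nmC x : nm x%:C = `|x|.
Proof. by rewrite /nm normc_def /= expr0n /= addr0 sqrtr_sqr. Qed.

Lemma nmE z : nm z = Num.sqrt (complex.Re z ^+ 2 + complex.Im z ^+ 2).
Proof. by rewrite /nm normc_def. Qed.

Lemma nm_sqr z : nm z ^+ 2 = complex.Re z ^+ 2 + complex.Im z ^+ 2.
Proof. by rewrite nmE sqr_sqrtr// addr_ge0// sqr_ge0. Qed.

Lemma Re_le_nm z : `|complex.Re z| <= nm z.
Proof.
rewrite -(ler_pXn2r (n := 2)) ?nnegrE ?nm_ge0//.
by rewrite nm_sqr real_normK ?num_real// lerDl sqr_ge0.
Qed.

Lemma Im_le_nm z : `|complex.Im z| <= nm z.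
Proof.
rewrite -(ler_pXn2r (n := 2)) ?nnegrE ?nm_ge0//.
by rewrite nm_sqr real_normK ?num_real// lerDr sqr_ge0.
Qed.

Lemma nm_le_ReIm z : nm z <= `|complex.Re z| + `|complex.Im z|.
Proof.
rewrite -(ler_pXn2r (n := 2)) ?nnegrE ?nm_ge0 ?addr_ge0//.
have := normr_ge0 (complex.Re z); have := normr_ge0 (complex.Im z).
rewrite nm_sqr -(real_normK (num_real (complex.Re z))) -(real_normK (num_real (complex.Im z))).
by move=> h1 h2; nra.
Qed.

Lemma nm_sum (I : Type) (s : seq I) (F : I -> R[i]) :
  nm (\sum_(i <- s) F i) <= \sum_(i <- s) nm (F i).
Proof.
elim: s => [|i s IH]; first by rewrite !big_nil nm0.
by rewrite !big_cons; apply: (le_trans (nmD _ _)); rewrite lerD2l.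
Qed.

Lemma nm_prod (I : Type) (s : seq I) (F : I -> R[i]) :
  nm (\prod_(i <- s) F i) = \prod_(i <- s) nm (F i).
Proof. by elim: s => [|i s IH]; rewrite ?big_nil ?nm1// !big_cons nmM IH. Qed.

Lemma nm_small0 z : (forall e : R, 0 < e -> nm z <= e) -> z = 0.
Proof.
move=> h; apply/eqP; rewrite -nm_eq0 eq_le nm_ge0 andbT leNgt.
apply/negP => z0; have := h (nm z / 2) ltac:(by lra); lra.
Qed.

Lemma nbhs_nm z (A : set R[i]) :
  nbhs z A <-> exists2 d : R, 0 < d & forall u, nm (u - z) < d -> A u.
Proof.
split=> [/nbhs_normP[e /= e0 eA]|[d d0 dA]].
  move: e e0 eA => [e i] /=; rewrite ltcE /= => /andP[/eqP-> e0] eA.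
  by exists e => // u ue; apply: eA; rewrite /ball_ /= distrC normE ltcR.
apply/nbhs_normP; exists d%:C; first by rewrite /= ltcR.
by move=> u /=; rewrite /ball_ /= distrC normE ltcR => /dA.
Qed.

Lemma continuous_nmP (T : topologicalType) (g : T -> R[i]) (x : T) :
  {for x, continuous g} <->
  forall e : R, 0 < e -> \forall y \near x, nm (g y - g x) < e.
Proof.
split=> [cg e e0|h].
  by apply: (cg [set u | nm (u - g x) < e]); apply/nbhs_nm; exists e.
by move=> A /nbhs_nm[d d0 dA]; near=> y; apply: dA; near: y; exact: h.
Unshelve. all: by end_near. Qed.

Lemma continuous_epsP (g : R[i] -> R[i]) z :
  {for z, continuous g} <->
  forall e : R, 0 < e -> exists2 d : R, 0 < d &
    forall u, nm (u - z) < d -> nm (g u - g z) < e.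
Proof.
rewrite continuous_nmP; split => h e e0.
  by have /nbhs_nm := h e e0.
by apply/nbhs_nm; exact: h.
Qed.

Lemma nbhs_realP x (A : set R) :
  nbhs x A <-> exists2 d : R, 0 < d & forall y, `|y - x| < d -> A y.
Proof.
split=> [/nbhs_normP[e /= e0 eA]|[d d0 dA]].
  by exists e => // y yx; apply: eA; rewrite /ball_ /= distrC.
by apply/nbhs_normP; exists d => //= y /=; rewrite /ball_ /= distrC; exact: dA.
Qed.

Lemma continuous_realP (g : R -> R[i]) x :
  {for x, continuous g} <->
  forall e : R, 0 < e -> exists2 d : R, 0 < d &
    forall y, `|y - x| < d -> nm (g y - g x) < e.
Proof.
rewrite continuous_nmP; split => h e e0.
  by have /nbhs_realP := h e e0.
by apply/nbhs_realP; exact: h.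
Qed.

Lemma continuous_nm : continuous nm.
Proof.
move=> z A /nbhs_realP[d d0 dA]; apply/nbhs_nm; exists d => // u uz.
apply: dA; apply: le_lt_trans uz; rewrite ler_norml.
by have := nmDB u z; have := nmDB z u; rewrite (nmB z u); lra.
Qed.

Lemma continuous_Re : continuous (@complex.Re R).
Proof.
move=> z A /nbhs_realP[d d0 dA]; apply/nbhs_nm; exists d => // u uz.
by apply: dA; apply: le_lt_trans uz; rewrite -raddfB Re_le_nm.
Qed.

Lemma continuous_Im : continuous (@complex.Im R).
Proof.
move=> z A /nbhs_realP[d d0 dA]; apply/nbhs_nm; exists d => // u uz.
by apply: dA; apply: le_lt_trans uz; rewrite -raddfB Im_le_nm.
Qed.

Lemma continuous_RtoC : continuous (fun x : R => x%:C).
Proof.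
move=> x; apply/continuous_realP => e e0; exists e => // y.
by rewrite -rmorphB nmC.
Qed.

Lemma continuous_complex (T : topologicalType) (g h : T -> R) :
  continuous g -> continuous h -> continuous (fun t : T => (g t +i* h t)%C).
Proof.
move=> cg ch.
rewrite (_ : (fun t : T => _) = (fun t : T => (g t)%:C + 'i * (h t)%:C)); last first.
  by apply/funext => t; apply/eqP; rewrite eq_complex /=; apply/andP; split; apply/eqP; ring.
move=> x.
apply: cvgD; first exact: (continuous_comp (cg x) (@continuous_RtoC _)).
apply: cvgM; first exact: cvg_cst.
exact: (continuous_comp (ch x) (@continuous_RtoC _)).
Qed.

Lemma closed_le_fun (u : R[i] -> R) (M : R) :
  continuous u -> closed [set z | u z <= M].
Proof.
move=> cu; apply: (@preimage_closed R[i] R u [set x | x <= M]).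
  by move=> z _; exact: cu.
exact: closed_le.
Qed.

Lemma cont_add (T : topologicalType) (g h : T -> R[i]) :
  continuous g -> continuous h -> continuous (fun t : T => g t + h t).
Proof. by move=> cg ch t; apply: cvgD; [exact: cg|exact: ch]. Qed.

Lemma cont_sub (T : topologicalType) (g h : T -> R[i]) :
  continuous g -> continuous h -> continuous (fun t : T => g t - h t).
Proof. by move=> cg ch t; apply: cvgB; [exact: cg|exact: ch]. Qed.

Lemma cont_mul (T : topologicalType) (g h : T -> R[i]) :
  continuous g -> continuous h -> continuous (fun t : T => g t * h t).
Proof. by move=> cg ch t; apply: cvgM; [exact: cg|exact: ch]. Qed.

Lemma cont_comp (T U V : topologicalType) (g : T -> U) (h : U -> V) :
  continuous g -> continuous h -> continuous (fun t : T => h (g t)).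
Proof. by move=> cg ch t; exact: (continuous_comp (cg t) (ch (g t))). Qed.

Lemma cont_cst (T U : topologicalType) (c : U) : continuous (fun _ : T => c).
Proof. by move=> t; exact: cst_continuous. Qed.

Lemma cont_id (T : topologicalType) : continuous (fun t : T => t).
Proof. by move=> t A. Qed.

Lemma cont_inv (T : topologicalType) (g : T -> R[i]) :
  continuous g -> (forall t, g t != 0) -> continuous (fun t : T => (g t)^-1).
Proof. by move=> cg g0 t; apply: cvgV => //; exact: cg. Qed.

Lemma compact_nm_le (M : R) : compact [set z : R[i] | nm z <= M].
Proof.
pose S := (fun p : R * R => (p.1 +i* p.2)%C) @` (`[- M, M] `*` `[- M, M]).
have cS : compact S.
  apply: continuous_compact; last by apply: compact_setX; exact: segment_compact.
  apply: continuous_subspaceT; apply: continuous_complex.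
    by move=> p; exact: cvg_fst.
  by move=> p; exact: cvg_snd.
apply: (subclosed_compact _ cS).
  exact: closed_le_fun continuous_nm.
move=> z /= zM; exists (complex.Re z, complex.Im z); last by case: z zM.
have := le_trans (Re_le_nm z) zM; have := le_trans (Im_le_nm z) zM.
by rewrite !ler_norml /= !in_itv /= => -> ->.
Qed.

Lemma closed_nm_le c (M : R) : closed [set z : R[i] | nm (z - c) <= M].
Proof.
apply: closed_le_fun => z.
apply: (continuous_comp (f := fun z => z - c) (g := nm)); last exact: continuous_nm.
by apply: cont_sub; [exact: cont_id|exact: cont_cst].
Qed.

Lemma compact_closed_bounded (K : set R[i]) (M : R) :
  closed K -> (forall z, K z -> nm z <= M) -> compact K.
Proof. by move=> cK KM; exact: (subclosed_compact cK (@compact_nm_le M)). Qed.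

Lemma compact_ball_le c (M : R) : compact [set z : R[i] | nm (z - c) <= M].
Proof.
apply: (@compact_closed_bounded _ (M + nm c)); first exact: closed_nm_le.
by move=> z /= zM; have := nmD (z - c) c; rewrite subrK; lra.
Qed.

Lemma compact_attains_min (K : set R[i]) (u : R[i] -> R) :
  K !=set0 -> compact K -> continuous u ->
  exists2 c, K c & forall z, K z -> u c <= u z.
Proof.
move=> K0 cK cu.
have [c cKc h] := @compact_EVT_min R[i] R u K K0 cK (continuous_subspaceT cu).
by exists c; [rewrite inE in cKc|move=> z Kz; apply: h; rewrite inE].
Qed.

Lemma compact_attains_max (K : set R[i]) (u : R[i] -> R) :
  K !=set0 -> compact K -> continuous u ->
  exists2 c, K c & forall z, K z -> u z <= u c.
Proof.
move=> K0 cK cu.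
have [c cKc h] := @compact_EVT_max R[i] R u K K0 cK (continuous_subspaceT cu).
by exists c; [rewrite inE in cKc|move=> z Kz; apply: h; rewrite inE].
Qed.

End ComplexNorm.

Lemma interval_cousin (R : realType) (a b : R) (Q : R -> R -> Prop) :
  a <= b ->
  (forall x y z, a <= x -> x <= y -> y <= z -> z <= b -> Q x y -> Q y z -> Q x z) ->
  (forall t, a <= t <= b -> exists2 d : R, 0 < d & forall x y,
     a <= x -> x <= t -> t <= y -> y <= b -> t - d < x -> y < t + d -> Q x y) ->
  Q a b.
Proof.
move=> ab Qt Ql.
pose S := [set t | a <= t <= b /\ Q a t].
have Sa : S a.
  split; first by rewrite lexx.
  have [|d d0 h] := Ql a; first by rewrite lexx.
  by apply: h => //; lra.
have ubS : ubound S b by move=> t [/andP[]].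
have hS : has_sup S by split; [exists a|exists b].
set s := sup S.
have sS t : S t -> t <= s by move=> St; apply: sup_ubound => //; exists b.
have sab : a <= s <= b.
  by rewrite sS//=; apply: sup_le_ub => //; exists a.
have [d d0 h] := Ql s sab.
have [t St ts] := sup_adherent d0 hS.
have [/andP[at_ tb] Qat] := St.
have ts' := sS _ St.
have Qas y : s <= y -> y <= b -> y < s + d -> Q a y.
  move=> sy yb ysd; apply: (Qt a t y) => //; first by rewrite (le_trans ts').
  by apply: h => //; move: ts; rewrite -/s; lra.
case/andP: sab => as_ sb.
have [sltb|bles] := ltP s b.
  pose y := Num.min b (s + d / 2).
  have ysb : s <= y by rewrite /y le_min sb; lra.
  have : y <= s.
    apply: sS; split; first by rewrite (le_trans as_ ysb) ge_min lexx.
    by apply: Qas; rewrite ?ge_min ?lexx// gt_min; apply/orP; right; lra.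
  by rewrite /y ge_min => /orP[|]; lra.
by apply: Qas => //; lra.
Qed.

(** * Complex exponential and logarithm *)

Section ComplexExp.
Variable R : realType.
Implicit Types (z w u : R[i]) (x y t : R).

Lemma is_derive_eps (f : R -> R) x d : is_derive x 1 f d ->
  forall e : R, 0 < e -> exists2 r : R, 0 < r &
    forall y, `|y - x| < r -> `|f y - f x - d * (y - x)| <= e * `|y - x|.
Proof.
move=> [df <-] e e0.
have h : (fun h : R => h^-1 *: (f (h *: 1 + x) - f x)) @ 0^' --> 'D_1 f x.
  exact: df.
have /nbhs_realP[r r0 hr] : \forall h \near 0^',
    `|h^-1 *: (f (h *: 1 + x) - f x) - 'D_1 f x| < e.
  by move/cvgrPdist_lt : h => /(_ e e0); apply: filterS => t; rewrite distrC.
exists r => // y yx.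
have [->|xy] := eqVneq y x; first by rewrite !subrr mulr0 subr0 normr0 mulr0.
have := hr (y - x); rewrite subr0 => /(_ yx); rewrite subr_eq0 => /(_ xy).
rewrite /= /GRing.scale /= mulr1 subrK.
have yx0 : `|y - x| != 0 by rewrite normr_eq0 subr_eq0.
rewrite -(ltr_pM2r (x := `|y - x|)) ?normr_gt0 ?subr_eq0//.
rewrite -normrM mulrBl => /ltW; congr (`|_| <= _); congr (_ - _).
by rewrite mulrAC mulVf ?mul1r// subr_eq0.
Qed.

Lemma eps_is_derive (f : R -> R) x d :
  (forall e : R, 0 < e -> exists2 r : R, 0 < r &
    forall y, `|y - x| < r -> `|f y - f x - d * (y - x)| <= e * `|y - x|) ->
  is_derive x 1 f d.
Proof.
move=> h.
have c : (fun h : R => h^-1 *: (f (h *: 1 + x) - f x)) @ 0^' --> d.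
  apply/cvgrPdist_lt => e e0.
  have e2 : 0 < e / 2 by rewrite divr_gt0.
  have [r r0 hr] := h _ e2.
  apply/nbhs_realP; exists r => // t; rewrite subr0 => tr t0.
  rewrite /= /GRing.scale /= mulr1 distrC.
  have := hr (t + x); rewrite addrK => /(_ tr) ht.
  have tn0 : 0 < `|t| by rewrite normr_gt0.
  rewrite -(ltr_pM2r tn0) -normrM mulrBl mulrAC mulVf// mul1r.
  by apply: (le_lt_trans ht); rewrite ltr_pM2r//; lra.
by split; [apply/cvg_ex; exists d|exact: cvg_lim c].
Qed.

Definition cder (f : R[i] -> R[i]) z d :=
  forall e : R, 0 < e -> exists2 r : R, 0 < r &
    forall u, nm (u - z) < r -> nm (f u - f z - d * (u - z)) <= e * nm (u - z).

Definition cexp z : R[i] :=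
  ((expR (complex.Re z) * cos (complex.Im z)) +i* (expR (complex.Re z) * sin (complex.Im z)))%C.

Lemma cexpD z w : cexp (z + w) = cexp z * cexp w.
Proof.
case: z w => [a b] [c d]; apply/eqP; rewrite eq_complex /= expRD cosD sinD.
by apply/andP; split; apply/eqP; ring.
Qed.

Lemma cexp0 : cexp 0 = 1.
Proof. by apply/eqP; rewrite eq_complex /= expR0 cos0 sin0 !mul1r !eqxx. Qed.

Lemma nm_cexp z : nm (cexp z) = expR (complex.Re z).
Proof.
rewrite nmE /= !exprMn -mulrDr cos2Dsin2 mulr1 sqrtr_sqr gtr0_norm//.
exact: expR_gt0.
Qed.

Lemma cexp_neq0 z : cexp z != 0.
Proof. by rewrite -nm_gt0 nm_cexp expR_gt0. Qed.

Lemma cexpN z : cexp (- z) = (cexp z)^-1.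
Proof.
apply: (mulfI (cexp_neq0 z)).
by rewrite -cexpD subrr cexp0 divff// cexp_neq0.
Qed.

Lemma cexpB z w : cexp (z - w) = cexp z / cexp w.
Proof. by rewrite cexpD cexpN. Qed.

Lemma cexp_der0 : cder cexp 0 1.
Proof.
move=> e e0; pose e' := Num.min (e / 8) (1 / 2).
have e'0 : 0 < e' by rewrite lt_min !divr_gt0.
have [e'1 e'2] : e' <= e / 8 /\ e' <= 1 / 2 by rewrite !ge_min !lexx orbT.
clearbody e'.
have [r1 r10 h1] := is_derive_eps (is_derive_expR 0) e'0.
have [r2 r20 h2] := is_derive_eps (is_derive_cos 0) e'0.
have [r3 r30 h3] := is_derive_eps (is_derive_sin 0) e'0.
exists (Num.min e' (Num.min r1 (Num.min r2 r3))).
  by rewrite !lt_min e'0 r10 r20 r30.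
case=> [x y]; rewrite subr0 !lt_min => /and4P[].
have := Re_le_nm (x +i* y)%C; have := Im_le_nm (x +i* y)%C.
set n := nm _ => /= yn xn ne n1 n2 n3.
have := h1 x; rewrite subr0 expR0 => /(_ (le_lt_trans xn n1)); rewrite mul1r => hx.
have := h2 y; rewrite subr0 cos0 sin0 oppr0 mul0r subr0 => /(_ (le_lt_trans yn n2)) hc.
have := h3 y; rewrite subr0 sin0 subr0 cos0 mul1r => /(_ (le_lt_trans yn n3)) hs.
rewrite cexp0 mul1r; apply: (le_trans (nm_le_ReIm _)) => /=.
rewrite !subr0.
have n0 : 0 <= n := nm_ge0 _.
have hx' : `|expR x - 1 - x| <= e' * n by apply: (le_trans hx); rewrite ler_pM2l.
have hc' : `|cos y - 1| <= e' * n by apply: (le_trans hc); rewrite ler_pM2l.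
have hs' : `|sin y - y| <= e' * n by apply: (le_trans hs); rewrite ler_pM2l.
have E1 : `|expR x - 1| <= 2 * n.
  rewrite (_ : expR x - 1 = (expR x - 1 - x) + x); last by ring.
  by apply: (le_trans (ler_normD _ _)); clear - e'2 xn n0 hx'; nra.
have E2 : `|expR x| <= 2.
  rewrite (_ : expR x = (expR x - 1) + 1); last by ring.
  by apply: (le_trans (ler_normD _ _)); rewrite normr1; clear - e'2 ne E1; lra.
have ->: expR x * cos y - 1 - x = (expR x - 1 - x) + expR x * (cos y - 1) by ring.
have ->: expR x * sin y - y = expR x * (sin y - y) + (expR x - 1) * y by ring.
have T1 : `|(expR x - 1 - x) + expR x * (cos y - 1)| <= e' * n + 2 * (e' * n).
  by apply: (le_trans (ler_normD _ _)); rewrite normrM lerD// ler_pM.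
have T2 : `|expR x * (sin y - y) + (expR x - 1) * y| <= 2 * (e' * n) + 2 * n * e'.
  apply: (le_trans (ler_normD _ _)); rewrite !normrM lerD// ler_pM//.
  by rewrite (le_trans yn)// ltW.
by apply: (le_trans (lerD T1 T2)); clear - e'0 e'1 n0; nra.
Qed.

Lemma cexp_der z : cder cexp z (cexp z).
Proof.
move=> e e0; have c0 : 0 < nm (cexp z) by rewrite nm_gt0 cexp_neq0.
have [r r0 h] := cexp_der0 (divr_gt0 e0 c0).
exists r => // u uz.
have -> : cexp u - cexp z - cexp z * (u - z) =
          cexp z * (cexp (u - z) - cexp 0 - 1 * (u - z - 0)).
  have -> : cexp u = cexp z * cexp (u - z) by rewrite -cexpD addrC subrK.
  by rewrite cexp0; ring.
have := h (u - z); rewrite subr0 => /(_ uz) h'.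
rewrite nmM -(subr0 (u - z)) in h' *; rewrite (le_trans (ler_wpM2l (ltW c0) h'))//.
by rewrite subr0 mulrA mulrCA divff ?gt_eqF// mulr1.
Qed.

Lemma cder_cont f z d : cder f z d -> {for z, continuous f}.
Proof.
move=> h; apply/continuous_epsP => e e0.
have [r r0 hr] := h 1 ltr01.
have d1 : 0 < nm d + 1 by have := nm_ge0 d; lra.
exists (Num.min r (e / (nm d + 1))); first by rewrite lt_min r0 divr_gt0.
move=> u; rewrite lt_min => /andP[ur ue].
have := hr _ ur; rewrite mul1r => h1.
have -> : f u - f z = (f u - f z - d * (u - z)) + d * (u - z) by ring.
apply: (le_lt_trans (nmD _ _)); rewrite nmM.
rewrite ltr_pdivlMr// in ue; lra.
Qed.

Lemma cexp_cont : continuous cexp.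
Proof. by move=> z; exact: cder_cont (cexp_der z). Qed.

Definition per (k : int) : R[i] := (0 +i* (2 * pi * k%:~R))%C.

Lemma cexp_per1 : cexp (per 1) = 1.
Proof.
apply/eqP; rewrite eq_complex /= expR0 !mul1r mulr1 mulr_natl.
by rewrite cos2pi sin2pi !eqxx.
Qed.

Lemma perD k l : per (k + l) = per k + per l.
Proof. by apply/eqP; rewrite eq_complex /= addr0 rmorphD mulrDr !eqxx. Qed.

Lemma perN k : per (- k) = - per k.
Proof. by apply/eqP; rewrite eq_complex /= oppr0 rmorphN mulrN !eqxx. Qed.

Lemma cexp_per k : cexp (per k) = 1.
Proof.
have nat n : cexp (per (Posz n)) = 1.
  elim: n => [|n IH]; last by rewrite -addn1 PoszD perD cexpD IH cexp_per1 mulr1.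
  by rewrite -[RHS]cexp0; congr cexp; apply/eqP; rewrite eq_complex /= mulr0 !eqxx.
by case: k => n //; rewrite NegzE perN cexpN nat invr1.
Qed.

Lemma pi2_gt0 : 0 < 2 * pi :> R.
Proof. by rewrite mulr_gt0// pi_gt0. Qed.

Lemma cexp_eq1 z : cexp z = 1 -> exists k, z = per k.
Proof.
move=> h; have hr : complex.Re z = 0.
  by apply: expR_inj; rewrite -nm_cexp h nm1 expR0.
pose k := Num.floor (complex.Im z / (2 * pi)).
exists k; pose r := complex.Im z - 2 * pi * k%:~R.
have p0 := pi2_gt0.
have r0 : 0 <= r.
  have := Num.Theory.floor_le (complex.Im z / (2 * pi)); rewrite ler_pdivlMr// -/k /r; lra.
have r1 : r < 2 * pi.
  have := Num.Theory.floorD1_gt (complex.Im z / (2 * pi)).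
  rewrite ltr_pdivrMr// -/k rmorphD /r /=; lra.
have : cexp (z - per k) = 1 by rewrite cexpB h cexp_per divr1.
move/eqP; rewrite eq_complex /cexp (raddfB (@complex.Re R)) (raddfB (@complex.Im R)).
rewrite /= hr subr0 expR0 !mul1r -/r => /andP[/eqP c /eqP s].
suff r00 : r = 0.
  by apply/eqP; rewrite eq_complex /= hr eqxx /= -subr_eq0 -/r r00.
have pp := pi_gt0 R.
have [rp|pr|rp] := ltgtP r pi.
- have [->//|rn0] := eqVneq r 0.
  have : 0 < sin r by apply: sin_gt0_pi; rewrite rp andbT lt_neqAle eq_sym rn0.
  by rewrite s ltxx.
- have : 0 < sin (r - pi) by apply: sin_gt0_pi; apply/andP; split; lra.
  by rewrite -(opprK (sin _)) -sinDpi subrK s oppr0 ltxx.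
- by move: c; rewrite rp cospi => h1; lra.
Qed.

Lemma cexp_inj_mod z w : cexp z = cexp w -> exists k, z = w + per k.
Proof.
move=> h; have [k hk] : exists k, z - w = per k.
  by apply: cexp_eq1; rewrite cexpB h divff// cexp_neq0.
by exists k; rewrite -hk addrC subrK.
Qed.

Definition Log u : R[i] :=
  (ln (nm u) +i* (2 * atan (complex.Im u / (nm u + complex.Re u))))%C.

Definition slit u := 0 < nm u + complex.Re u.

Lemma slit_neq0 u : slit u -> u != 0.
Proof. by move=> s; apply: contraTneq s => ->; rewrite /slit nm0 add0r ltxx. Qed.

Lemma cexp_Log u : slit u -> cexp (Log u) = u.
Proof.
move=> s; have n0 : 0 < nm u by rewrite nm_gt0 slit_neq0.
have n2 := nm_sqr u.
rewrite /cexp /= lnK ?posrE// !(mulrC 2) mulr_natr mulr2n cosD sinD.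
have h t : cos (atan t) * cos (atan t) = (1 + t ^+ 2)^-1.
  rewrite cos_atan -invfM -expr2 sqr_sqrtr//; have := sqr_ge0 t; lra.
have hs t : sin (atan t) = t * cos (atan t).
  rewrite -{2}(atanK t) /tan mulfVK//.
  rewrite cos_atan invr_neq0// gt_eqF// sqrtr_gt0; have := sqr_ge0 t; lra.
set t := _ / _.
have D : 1 + t ^+ 2 = 2 * nm u / (nm u + complex.Re u).
  have s0 : nm u + complex.Re u != 0 by rewrite gt_eqF.
  rewrite /t expr_div_n; apply/eqP; rewrite -subr_eq0; apply/eqP.
  have -> : complex.Im u ^+ 2 = nm u ^+ 2 - complex.Re u ^+ 2 by rewrite n2; ring.
  by field.
have s0 : nm u + complex.Re u != 0 by rewrite gt_eqF.
have nn0 : nm u != 0 by rewrite gt_eqF.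
have C2 := h t; rewrite D in C2.
rewrite hs.
have -> : cos (atan t) * cos (atan t) - t * cos (atan t) * (t * cos (atan t)) =
   (2 - (1 + t ^+ 2)) * (cos (atan t) * cos (atan t)) by ring.
have -> : t * cos (atan t) * cos (atan t) + cos (atan t) * (t * cos (atan t)) =
   2 * t * (cos (atan t) * cos (atan t)) by ring.
rewrite C2 D /t; apply/eqP; rewrite eq_complex /=.
by apply/andP; split; apply/eqP; field; rewrite s0 nn0.
Qed.

Lemma Log1 : Log 1 = 0.
Proof. by apply/eqP; rewrite eq_complex /= nm1 ln1 mul0r atan0 mulr0 !eqxx. Qed.

Lemma Log_cont u : slit u -> {for u, continuous Log}.
Proof.
move=> s; have n0 : 0 < nm u by rewrite nm_gt0 slit_neq0.
apply/continuous_nmP => e e0.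
have e2 : 0 < e / 2 by rewrite divr_gt0.
have c1 : {for u, continuous (fun v : R[i] => ln (nm v))}.
  apply: (continuous_comp (f := @nm R) (g := @ln R)); first exact: continuous_nm.
  exact: continuous_ln.
have c2 : {for u, continuous (fun v : R[i] => 2 * atan (complex.Im v / (nm v + complex.Re v)))}.
  have catan : continuous (fun t : R => 2 * atan t).
    by move=> t; apply: cvgM; [exact: cst_continuous|exact: continuous_atan].
  apply: (continuous_comp (f := fun v : R[i] => complex.Im v / (nm v + complex.Re v)) (g := fun t : R => 2 * atan t)); last exact: catan.
  have ci : {for u, continuous (fun v : R[i] => (nm v + complex.Re v)^-1)}.
    apply: (continuous_comp (f := fun v : R[i] => nm v + complex.Re v) (g := fun t : R => t^-1)).
      by apply: continuousD; [exact: continuous_nm|exact: continuous_Re].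
    by apply: inv_continuous; rewrite gt_eqF.
  by apply: continuousM => //; exact: continuous_Im.
move/cvgrPdist_lt : c1 => /(_ _ e2) c1; move/cvgrPdist_lt : c2 => /(_ _ e2) c2.
near=> v; apply: (le_lt_trans (nm_le_ReIm _)).
have h1 : `|ln (nm u) - ln (nm v)| < e / 2 by near: v.
have h2 : `|2 * atan (complex.Im u / (nm u + complex.Re u)) -
  2 * atan (complex.Im v / (nm v + complex.Re v))| < e / 2 by near: v.
rewrite distrC in h1; rewrite distrC in h2.
by rewrite [e]splitr; exact: ltrD.
Unshelve. all: by end_near. Qed.

Lemma slit_near1 u : nm (u - 1) < 1 -> slit u.
Proof.
move=> h; rewrite /slit; have := le_lt_trans (Re_le_nm (u - 1)) h.
rewrite raddfB /= ltr_norml => /andP[h1 _].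
by have := nm_ge0 u; lra.
Qed.

Lemma slit_im u : complex.Im u != 0 -> slit u.
Proof.
move=> h; rewrite /slit; have := nm_sqr u; have := nm_ge0 u.
have : 0 < complex.Im u ^+ 2 by rewrite exprn_even_gt0.
by move=> h1 h2 h3; nra.
Qed.

Lemma slit_re u : 0 < complex.Re u -> slit u.
Proof. by rewrite /slit; have := nm_ge0 u; lra. Qed.

Lemma cexp_surj w : w != 0 -> exists z, cexp z = w.
Proof.
move=> w0; have [s|] := boolP (slit w); first by exists (Log w); exact: cexp_Log.
rewrite -leNgt => s.
have s' : slit (- w).
  rewrite /slit nmN raddfN /=; have : 0 < nm w by rewrite nm_gt0.
  lra.
exists (Log (- w) + (0 +i* pi)%C); rewrite cexpD cexp_Log//.
apply/eqP; case: (w) => a b; rewrite eq_complex /= expR0 cospi sinpi.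
by apply/andP; split; apply/eqP; ring.
Qed.

End ComplexExp.

(** * Cauchy's theorem *)

Section Goursat.
Variable R : realType.
Implicit Types (z w u a b c d : R[i]) (x y t s : R) (f g : R[i] -> R[i]).

Lemma cder_cst c z : cder (fun=> c) z 0.
Proof.
move=> e e0; exists 1 => // u _.
by rewrite subrr mul0r subr0 nm0 mulr_ge0 ?nm_ge0 ?ltW.
Qed.

Lemma cder_id z : cder id z 1.
Proof.
move=> e e0; exists 1 => // u _.
by rewrite mul1r subrr nm0 mulr_ge0 ?nm_ge0 ?ltW.
Qed.

Lemma cder_lip f z d : cder f z d -> exists2 r : R, 0 < r &
  forall u, nm (u - z) < r -> nm (f u - f z) <= (nm d + 1) * nm (u - z).
Proof.
move=> h; have [r r0 hr] := h 1 ltr01; exists r => // u /hr h1.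
have -> : f u - f z = (f u - f z - d * (u - z)) + d * (u - z) by ring.
by apply: (le_trans (nmD _ _)); rewrite nmM; lra.
Qed.

Lemma cder_add f g z a b : cder f z a -> cder g z b ->
  cder (fun u => f u + g u) z (a + b).
Proof.
move=> hf hg e e0; have e2 : 0 < e / 2 by rewrite divr_gt0.
have [r r0 hr] := hf _ e2; have [s s0 hs] := hg _ e2.
exists (Num.min r s); first by rewrite lt_min r0.
move=> u; rewrite lt_min => /andP[/hr h1 /hs h2].
have -> : f u + g u - (f z + g z) - (a + b) * (u - z) =
  (f u - f z - a * (u - z)) + (g u - g z - b * (u - z)) by ring.
by apply: (le_trans (nmD _ _)); lra.
Qed.

Lemma cder_mul f g z a b : cder f z a -> cder g z b ->
  cder (fun u => f u * g u) z (a * g z + f z * b).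
Proof.
move=> hf hg e e0.
have [M0 M1] : 0 < nm (g z) + nm (f z) + nm a + 1 /\ 0 <= nm (g z) + nm (f z) + nm a.
  by have := nm_ge0 (g z); have := nm_ge0 (f z); have := nm_ge0 a; lra.
set M := _ + 1 in M0.
have e3 : 0 < e / (3 * M) by rewrite divr_gt0 ?mulr_gt0.
have [r r0 hr] := hf _ e3; have [s s0 hs] := hg _ e3.
have /continuous_epsP cg := cder_cont hg.
have [p p0 hp] := cg _ e3; have [q q0 hq] := cg _ ltr01.
exists (Num.min (Num.min r s) (Num.min p q)); first by rewrite !lt_min r0 s0 p0 q0.
move=> u; rewrite !lt_min => /andP[/andP[/hr h1 /hs h2] /andP[/hp h3 /hq h4]].
have -> : f u * g u - f z * g z - (a * g z + f z * b) * (u - z) =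
  g u * (f u - f z - a * (u - z)) + (f z * (g u - g z - b * (u - z)) +
  a * (u - z) * (g u - g z)) by ring.
have gu : nm (g u) <= M.
  have := nmDB (g u) (g z); rewrite /M; have := nm_ge0 (f z); have := nm_ge0 a; clear - h4; lra.
have fM : nm (f z) <= M by rewrite /M; have := nm_ge0 (g z); have := nm_ge0 a; clear; lra.
have aM : nm a <= M by rewrite /M; have := nm_ge0 (g z); have := nm_ge0 (f z); clear; lra.
have n0 := nm_ge0 (u - z).
have t1 : M * (e / (3 * M) * nm (u - z)) = e / 3 * nm (u - z).
  by field; rewrite gt_eqF.
apply: (le_trans (nmD _ _)); rewrite nmM.
have b1 : nm (g u) * nm (f u - f z - a * (u - z)) <= e / 3 * nm (u - z).
  by rewrite -t1 ler_pM ?nm_ge0.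
have b2 : nm (f z * (g u - g z - b * (u - z))) <= e / 3 * nm (u - z).
  by rewrite -t1 nmM ler_pM ?nm_ge0.
have b3 : nm (a * (u - z) * (g u - g z)) <= e / 3 * nm (u - z).
  rewrite -t1 !nmM -mulrA ler_pM ?mulr_ge0 ?nm_ge0//.
  by rewrite mulrC ler_wpM2r// ltW.
have b4 := nmD (f z * (g u - g z - b * (u - z))) (a * (u - z) * (g u - g z)).
lra.
Qed.

Lemma cder_comp f g z a b : cder f z a -> cder g (f z) b ->
  cder (fun u => g (f u)) z (b * a).
Proof.
move=> hf hg e e0.
have a1 : 0 < nm a + 1 by have := nm_ge0 a; lra.
have b1 : 0 < nm b + 1 by have := nm_ge0 b; lra.
have [r r0 hr] := hg (e / 2 / (nm a + 1)) ltac:(by rewrite !divr_gt0).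
have [s s0 hs] := hf (e / 2 / (nm b + 1)) ltac:(by rewrite !divr_gt0).
have [l l0 hl] := cder_lip hf.
have /continuous_epsP/(_ r r0)[p p0 hp] := cder_cont hf.
exists (Num.min s (Num.min l p)); first by rewrite !lt_min s0 l0 p0.
move=> u; rewrite !lt_min => /and3P[/hs h1 /hl h2 /hp /hr h3].
have -> : g (f u) - g (f z) - b * a * (u - z) =
  (g (f u) - g (f z) - b * (f u - f z)) + b * (f u - f z - a * (u - z)) by ring.
apply: (le_trans (nmD _ _)); rewrite nmM.
have n0 := nm_ge0 (u - z).
have t1 : e / 2 / (nm a + 1) * ((nm a + 1) * nm (u - z)) = e / 2 * nm (u - z).
  by field; rewrite gt_eqF.
have t2 : (nm b + 1) * (e / 2 / (nm b + 1) * nm (u - z)) = e / 2 * nm (u - z).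
  by field; rewrite gt_eqF.
have h3' : nm (g (f u) - g (f z) - b * (f u - f z)) <= e / 2 * nm (u - z).
  by rewrite -t1 (le_trans h3)// ler_wpM2l// ltW// !divr_gt0.
have h1' : nm b * nm (f u - f z - a * (u - z)) <= e / 2 * nm (u - z).
  by rewrite -t2 ler_pM ?nm_ge0//; clear; lra.
clear - h3' h1'; lra.
Qed.

Lemma cder_scale f z a c : cder f z a -> cder (fun u => c * f u) z (c * a).
Proof.
by move=> h; have := cder_mul (cder_cst c z) h; rewrite mul0r add0r.
Qed.

Lemma cder_sub f g z a b : cder f z a -> cder g z b ->
  cder (fun u => f u - g u) z (a - b).
Proof.
move=> hf hg; have := cder_add hf (cder_scale (-1) hg).
by rewrite mulN1r (_ : (fun u => _) = (fun u => f u - g u))//; apply/funext => u; rewrite mulN1r.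
Qed.

Lemma cder_eqd f z a b : cder f z a -> a = b -> cder f z b.
Proof. by move=> h <-. Qed.

Lemma cder_ext f g z a : (forall u, f u = g u) -> cder f z a -> cder g z a.
Proof. by move=> /funext ->. Qed.

Lemma cder_near f g z a r : 0 < r -> (forall u, nm (u - z) < r -> f u = g u) ->
  cder f z a -> cder g z a.
Proof.
move=> r0 h hf e e0; have [s s0 hs] := hf e e0.
exists (Num.min r s); first by rewrite lt_min r0.
move=> u; rewrite lt_min => /andP[ur us].
by rewrite -!h ?subrr ?nm0//; exact: hs.
Qed.

Definition rder (P : R -> R[i]) t d :=
  forall e : R, 0 < e -> exists2 r : R, 0 < r &
    forall s, `|s - t| < r -> nm (P s - P t - (s - t)%:C * d) <= e * `|s - t|.

Lemma rder_mean (P dP : R -> R[i]) (M : R) :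
  (forall t, 0 <= t <= 1 -> rder P t (dP t)) ->
  (forall t, 0 <= t <= 1 -> nm (dP t) <= M) -> nm (P 1 - P 0) <= M.
Proof.
move=> hP hM; set D := P 1 - P 0.
have [D0|D0] := eqVneq D 0.
  by rewrite D0 nm0 (le_trans (nm_ge0 (dP 0)))// hM// lexx ler01.
pose Q w := complex.Re D * complex.Re w + complex.Im D * complex.Im w.
have QB w1 w2 : Q (w1 - w2) = Q w1 - Q w2.
  by case: w1 w2 => [p q] [p' q']; rewrite /Q /=; ring.
have Qle w : `|Q w| <= nm D * nm w.
  rewrite -(ler_pXn2r (n := 2)) ?nnegrE ?mulr_ge0 ?nm_ge0//.
  rewrite real_normK ?num_real// exprMn !nm_sqr /Q.
  have := sqr_ge0 (complex.Re D * complex.Im w - complex.Im D * complex.Re w).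
  by move=> h; nra.
have dQ t : 0 <= t <= 1 -> is_derive t 1 (fun t => Q (P t)) (Q (dP t)).
  move=> t01; apply: eps_is_derive => e e0.
  have n1 : 0 < nm D by rewrite nm_gt0.
  have [r r0 hr] := hP t t01 (e / nm D) ltac:(by rewrite divr_gt0).
  exists r => // s /hr h.
  have -> : Q (dP t) * (s - t) = Q ((s - t)%:C * dP t).
    by case: (dP t) => p q; rewrite /Q /=; ring.
  rewrite -!QB (le_trans (Qle _))//.
  rewrite (le_trans (ler_wpM2l (ltW n1) h))// mulrA mulrCA divff ?gt_eqF// mulr1.
  by [].
have [||t t01 E] := @MVT_segment R (fun t => Q (P t)) (fun t => Q (dP t)) 0 1 ler01.
- move=> t; rewrite in_itv /= => /andP[t0 t1].
  by apply: dQ; rewrite !ltW.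
- apply: derivable_within_continuous => t; rewrite in_itv /= => t01.
  by have [] := dQ t t01.
rewrite in_itv /= in t01.
have hQ : nm D ^+ 2 <= nm D * M.
  have -> : nm D ^+ 2 = Q (dP t).
    rewrite subr0 mulr1 in E.
    rewrite -E -QB -/D nm_sqr /Q; ring.
  apply: (le_trans (ler_norm _)); apply: (le_trans (Qle _)).
  by rewrite ler_wpM2l ?nm_ge0 ?hM.
by move: hQ; rewrite expr2 ler_pM2l ?nm_gt0.
Qed.

Lemma rder_add P Q t a b : rder P t a -> rder Q t b ->
  rder (fun s => P s + Q s) t (a + b).
Proof.
move=> hf hg e e0; have e2 : 0 < e / 2 by rewrite divr_gt0.
have [r r0 hr] := hf _ e2; have [s s0 hs] := hg _ e2.
exists (Num.min r s); first by rewrite lt_min r0.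
move=> u; rewrite lt_min => /andP[/hr h1 /hs h2].
have -> : P u + Q u - (P t + Q t) - (u - t)%:C * (a + b) =
  (P u - P t - (u - t)%:C * a) + (Q u - Q t - (u - t)%:C * b) by ring.
by apply: (le_trans (nmD _ _)); lra.
Qed.

Lemma rder_scale P t a c : rder P t a -> rder (fun s => c * P s) t (c * a).
Proof.
move=> h e e0; have c1 : 0 < nm c + 1 by have := nm_ge0 c; lra.
have [r r0 hr] := h (e / (nm c + 1)) ltac:(by rewrite divr_gt0).
exists r => // s /hr h1.
have -> : c * P s - c * P t - (s - t)%:C * (c * a) =
  c * (P s - P t - (s - t)%:C * a) by ring.
rewrite nmM; apply: (@le_trans _ _ ((nm c + 1) * (e / (nm c + 1) * `|s - t|))).
  by rewrite ler_pM ?nm_ge0//; lra.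
by rewrite mulrA mulrCA divff ?gt_eqF// mulr1.
Qed.

Lemma rder_affine P t p q a : rder P (p * t + q) a ->
  rder (fun s => P (p * s + q)) t (p%:C * a).
Proof.
move=> h e e0; have p1 : 0 < `|p| + 1 by have := normr_ge0 p; lra.
have [r r0 hr] := h (e / (`|p| + 1)) ltac:(by rewrite divr_gt0).
exists (r / (`|p| + 1)); first by rewrite divr_gt0.
move=> s st.
have E : p * s + q - (p * t + q) = p * (s - t) by ring.
have ht : `|p * s + q - (p * t + q)| < r.
  rewrite E normrM; rewrite ltr_pdivlMr// in st.
  have := normr_ge0 (s - t); nra.
have := hr _ ht; rewrite E rmorphM /= => h1.
rewrite (_ : (s - t)%:C * (p%:C * a) = p%:C * (s - t)%:C * a); last by ring.
apply: (le_trans h1); rewrite normrM.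
have t1 : e / (`|p| + 1) * ((`|p| + 1) * `|s - t|) = e * `|s - t|.
  by field; rewrite gt_eqF.
rewrite -t1; apply: ler_wpM2l; first by rewrite ltW ?divr_gt0.
have := normr_ge0 (s - t).
clear; nra.
Qed.

Lemma cder_line f a b t d : cder f (a + t%:C * (b - a)) d ->
  rder (fun s => f (a + s%:C * (b - a))) t (d * (b - a)).
Proof.
move=> h e e0; have p1 : 0 < nm (b - a) + 1 by have := nm_ge0 (b - a); lra.
have [r r0 hr] := h (e / (nm (b - a) + 1)) ltac:(by rewrite divr_gt0).
exists (r / (nm (b - a) + 1)); first by rewrite divr_gt0.
move=> s st.
have E : a + s%:C * (b - a) - (a + t%:C * (b - a)) = (s - t)%:C * (b - a).
  by rewrite rmorphB /=; ring.
have ht : nm (a + s%:C * (b - a) - (a + t%:C * (b - a))) < r.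
  rewrite E nmM nmC; rewrite ltr_pdivlMr// in st.
  have := normr_ge0 (s - t); nra.
have := hr _ ht; rewrite E => h1.
rewrite (_ : (s - t)%:C * (d * (b - a)) = d * ((s - t)%:C * (b - a))); last by ring.
apply: (le_trans h1); rewrite nmM nmC.
have t1 : e / (nm (b - a) + 1) * ((nm (b - a) + 1) * `|s - t|) = e * `|s - t|.
  by field; rewrite gt_eqF.
rewrite -t1; apply: ler_wpM2l; first by rewrite ltW ?divr_gt0.
have := normr_ge0 (s - t).
nra.
Qed.

Lemma mean_value f (df : R[i] -> R[i]) a b (M : R) :
  (forall t, 0 <= t <= 1 -> cder f (a + t%:C * (b - a)) (df (a + t%:C * (b - a)))) ->
  (forall t, 0 <= t <= 1 -> nm (df (a + t%:C * (b - a))) <= M) ->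
  nm (f b - f a) <= M * nm (b - a).
Proof.
move=> hf hM.
have := @rder_mean (fun s => f (a + s%:C * (b - a)))
  (fun s => df (a + s%:C * (b - a)) * (b - a)) (M * nm (b - a)).
rewrite rmorph1 rmorph0 mul1r mul0r addr0 (addrC a) subrK; apply.
  by move=> t t01; apply: cder_line; exact: hf.
by move=> t t01; rewrite nmM ler_wpM2r ?nm_ge0 ?hM.
Qed.

Lemma real_primitive (g : R -> R) : continuous g ->
  exists G : R -> R, forall t, 0 <= t <= 1 -> is_derive t 1 G (g t).
Proof.
move=> cg; pose mu := @lebesgue_measure R.
have ig : mu.-integrable `[-1, 2] (EFin \o g).
  apply: continuous_compact_integrable; first exact: segment_compact.
  exact: continuous_subspaceT.
exists (fun x => (\int[mu]_(t in [set` `[-1, x]]) g t)%R).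
move=> t /andP[t0 t1].
have t2 : t < 2 by lra.
have t3 : -1 < t by lra.
have [dG eG] := continuous_FTC1_closed t2 ig t3 (cg t).
by split; [exact: dG|rewrite -derive1E; exact: eG].
Qed.

Lemma exists_primitive (g : R -> R[i]) : continuous g ->
  exists P : R -> R[i], forall t, 0 <= t <= 1 -> rder P t (g t).
Proof.
move=> cg.
have [P hP] := real_primitive (cont_comp cg (@continuous_Re R)).
have [Q hQ] := real_primitive (cont_comp cg (@continuous_Im R)).
exists (fun t => (P t +i* Q t)%C) => t t01 e e0.
have e2 : 0 < e / 2 by rewrite divr_gt0.
have [r r0 hr] := is_derive_eps (hP t t01) e2.
have [s s0 hs] := is_derive_eps (hQ t t01) e2.
exists (Num.min r s); first by rewrite lt_min r0.
move=> y; rewrite lt_min => /andP[/hr h1 /hs h2].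
apply: (le_trans (nm_le_ReIm _)); case: (g t) h1 h2 => p q /=.
rewrite !mul0r subr0 addr0 !(mulrC (y - t)); lra.
Qed.

Definition segint f a b : R[i] :=
  let P := xget (fun=> 0) [set P : R -> R[i] |
     forall t, 0 <= t <= 1 -> rder P t (f (a + t%:C * (b - a)))] in
  (b - a) * (P 1 - P 0).

Lemma cont_line a b : continuous (fun t : R => a + t%:C * (b - a)).
Proof.
apply: cont_add; first exact: cont_cst.
by apply: cont_mul; [exact: continuous_RtoC|exact: cont_cst].
Qed.

Lemma segintE f a b P : continuous f ->
  (forall t, 0 <= t <= 1 -> rder P t (f (a + t%:C * (b - a)))) ->
  segint f a b = (b - a) * (P 1 - P 0).
Proof.
move=> cf hP; rewrite /segint; set S := mkset _; set Q := xget _ S.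
have hQ : S Q by apply: xgetPex; exists P.
congr (_ * _); apply/eqP; rewrite -subr_eq0 -nm_eq0 eq_le nm_ge0 andbT.
have -> : Q 1 - Q 0 - (P 1 - P 0) = (Q 1 + -1 * P 1) - (Q 0 + -1 * P 0) by ring.
apply: (@rder_mean (fun t => Q t + -1 * P t) (fun=> 0)) => t t01.
  have := rder_add (hQ t t01) (rder_scale (-1) (hP t t01)).
  by rewrite mulN1r subrr.
by rewrite nm0.
Qed.

Lemma segint_primitive f a b : continuous f ->
  exists P, (forall t, 0 <= t <= 1 -> rder P t (f (a + t%:C * (b - a)))) /\
  segint f a b = (b - a) * (P 1 - P 0).
Proof.
move=> cf; have [P hP] := exists_primitive (cont_comp (@cont_line a b) cf).
by exists P; split => //; exact: segintE.
Qed.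

Lemma segintN f a b : continuous f -> segint f b a = - segint f a b.
Proof.
move=> cf; have [P [hP ->]] := segint_primitive a b cf.
rewrite (@segintE f b a (fun t => -1 * P (-1 * t + 1)) cf).
  by rewrite !mulr1 mulr0 add0r addNr; ring.
move=> t t01.
have t01' : 0 <= -1 * t + 1 <= 1 by apply/andP; split; lra.
have := rder_scale (-1) (rder_affine (hP _ t01')).
congr rder; rewrite rmorphN rmorph1 mulrA mulrNN !mul1r; congr f.
by rewrite rmorphD rmorphM /= rmorphN !rmorph1; ring.
Qed.

Lemma segint_half f a b : continuous f ->
  segint f a b = segint f a ((a + b) / 2) + segint f ((a + b) / 2) b.
Proof.
move=> cf; have [P [hP ->]] := segint_primitive a b cf.
have n2 : (2 : R[i]) != 0 by rewrite pnatr_eq0.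
have h2 : (2^-1)%:C = 2^-1 :> R[i] by rewrite fmorphV rmorph_nat.
rewrite (@segintE f a _ (fun t => 2 * P (2^-1 * t + 0)) cf); last first.
  move=> t /andP[t0 t1]; have t01' : 0 <= 2^-1 * t + 0 <= 1 by apply/andP; split; lra.
  have := rder_scale 2 (rder_affine (hP _ t01')).
  congr rder; rewrite mulrA h2 divff// mul1r; congr f.
  by rewrite rmorphD rmorphM /= h2 rmorph0; field.
rewrite (@segintE f _ b (fun t => 2 * P (2^-1 * t + 2^-1)) cf); last first.
  move=> t /andP[t0 t1]; have t01' : 0 <= 2^-1 * t + 2^-1 <= 1 by apply/andP; split; lra.
  have := rder_scale 2 (rder_affine (hP _ t01')).
  congr rder; rewrite mulrA h2 divff// mul1r; congr f.
  by rewrite rmorphD rmorphM /= h2; field.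
have -> : 2^-1 * 1 + 0 = 2^-1 :> R by ring.
have -> : 2^-1 * 0 + 0 = 0 :> R by ring.
have -> : 2^-1 * 0 + 2^-1 = 2^-1 :> R by ring.
have -> : 2^-1 * 1 + 2^-1 = 1 :> R by field.
by field.
Qed.

Lemma segint_le f a b (M : R) : continuous f ->
  (forall t, 0 <= t <= 1 -> nm (f (a + t%:C * (b - a))) <= M) ->
  nm (segint f a b) <= nm (b - a) * M.
Proof.
move=> cf hM; have [P [hP ->]] := segint_primitive a b cf.
by rewrite nmM ler_wpM2l ?nm_ge0//; exact: rder_mean hP hM.
Qed.

Lemma segint_sub f g a b : continuous f -> continuous g ->
  segint (fun z => f z - g z) a b = segint f a b - segint g a b.
Proof.
move=> cf cg; have [P [hP ->]] := segint_primitive a b cf.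
have [Q [hQ ->]] := segint_primitive a b cg.
rewrite (@segintE _ a b (fun t => P t + -1 * Q t)); first by ring.
  exact: (cont_sub cf cg).
by move=> t t01; have := rder_add (hP t t01) (rder_scale (-1) (hQ t t01)); rewrite mulN1r.
Qed.

Lemma segint_der (F f : R[i] -> R[i]) a b : continuous f ->
  (forall z, cder F z (f z)) -> segint f a b = F b - F a.
Proof.
move=> cf hF; have [->|ab] := eqVneq a b.
  by rewrite /segint subrr mul0r subrr.
have ba : b - a != 0 by rewrite subr_eq0 eq_sym.
rewrite (@segintE f a b (fun t => (b - a)^-1 * F (a + t%:C * (b - a))) cf).
  by rewrite rmorph1 rmorph0 mul0r addr0 mul1r (addrC a) subrK; field.
move=> t _; have := rder_scale (b - a)^-1 (cder_line (hF (a + t%:C * (b - a)))).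
by congr rder; field.
Qed.

End Goursat.

Section Cauchy.
Variable R : realType.
Implicit Types (z w u a b c d : R[i]) (x y t s r : R) (f g : R[i] -> R[i]).

Lemma expn2_small (e : R) : 0 < e -> exists n : nat, 1 / 2 ^+ n < e.
Proof.
move=> e0; have [n hn] : exists n : nat, e^-1 < n%:R.
  exists (Num.bound e^-1); have := archi_boundP (ltW (_ : 0 < e^-1)).
  by rewrite invr_gt0; apply.
exists n; rewrite mul1r -(invrK e) ltf_pV2 ?posrE ?invr_gt0 ?exprn_gt0//.
by apply: (lt_le_trans hn); rewrite -natrX ler_nat ltnW// ltn_expl.
Qed.

Lemma bounded_cluster (a : nat -> R[i]) (M : R) :
  (forall n, nm (a n) <= M) ->
  exists z, forall e, 0 < e -> forall n, exists2 m, (n <= m)%N & nm (a m - z) < e.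
Proof.
move=> aM; have cK := @compact_nm_le R M.
have [|z [_ clz]] := cK (a @ \oo) _.
  by exists 0%N => // n _; exact: aM.
exists z => e e0 n.
have [||u [[m nm_ <-] ue]] := clz [set u | exists2 m, (n <= m)%N & a m = u] [set u | nm (u - z) < e].
- by exists n => // m /= nm_; exists m.
- by apply/nbhs_nm; exists e.
by exists m.
Qed.

Lemma geometric_cvg (a : nat -> R[i]) (p : R) :
  (forall n, nm (a n.+1 - a n) <= p / 2 ^+ n) ->
  exists z, forall n, nm (a n - z) <= 2 * p / 2 ^+ n.
Proof.
move=> h.
have p0 : 0 <= p by have := h 0%N; rewrite expr0 divr1; apply: le_trans; exact: nm_ge0.
have hk n k : nm (a (n + k)%N - a n) <= 2 * p / 2 ^+ n - 2 * p / 2 ^+ (n + k).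
  elim: k => [|k IH]; first by rewrite addn0 !subrr nm0.
  rewrite addnS; apply: (le_trans (nm_sub_trans (a (n + k)%N) _ _)).
  have -> : 2 * p / 2 ^+ (n + k).+1 = p / 2 ^+ (n + k).
    by rewrite exprS; field; rewrite expf_neq0// pnatr_eq0.
  have := h (n + k)%N.
  by lra.
have pos n : 0 <= 2 * p / 2 ^+ n by rewrite divr_ge0 ?mulr_ge0 ?exprn_ge0.
have [|z hz] := @bounded_cluster a (nm (a 0%N) + 2 * p).
  move=> n; have := hk 0%N n; rewrite add0n expr0 divr1 => h1.
  have := nmDB (a n) (a 0%N); have := pos n; lra.
exists z => n; apply/ler_addgt0Pr => e e0.
have [m nm_ hm] := hz e e0 n.
have := hk n (m - n)%N; rewrite subnKC// => h1.
apply: (le_trans (nm_sub_trans (a m) _ _)); rewrite (nmB (a n)).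
have := pos m; lra.
Qed.

Definition tri f a b c := segint f a b + segint f b c + segint f c a.

Definition perim a b c := nm (b - a) + nm (c - b) + nm (a - c).

Lemma nm_half z : nm (z / 2) = nm z / 2.
Proof. by rewrite nmM nmV -(rmorph_nat (real_complex R)) nmC ger0_norm. Qed.

Lemma tri_quarter f a b c : continuous f -> exists p : R[i] * R[i] * R[i],
  [/\ nm (tri f a b c) <= 4 * nm (tri f p.1.1 p.1.2 p.2),
      perim p.1.1 p.1.2 p.2 <= perim a b c / 2 &
      nm (p.1.1 - a) <= perim a b c].
Proof.
move=> cf; pose m1 := (a + b) / 2; pose m2 := (b + c) / 2; pose m3 := (c + a) / 2.
have E : tri f a b c = tri f a m1 m3 + tri f m1 b m2 + tri f m3 m2 c + tri f m2 m3 m1.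
  rewrite /tri (segint_half a b cf) (segint_half b c cf) (segint_half c a cf).
  rewrite -/m1 -/m2 -/m3 (segintN m1 m3 cf) (segintN m2 m1 cf) (segintN m3 m2 cf).
  by ring.
have n2 : (2 : R[i]) != 0 by rewrite pnatr_eq0.
have h0 := nm_ge0 (b - a); have h1 := nm_ge0 (c - b); have h2 := nm_ge0 (a - c).
have e1 : nm (m1 - a) = nm (b - a) / 2 by rewrite -nm_half /m1; congr nm; field.
have e2 : nm (m3 - m1) = nm (c - b) / 2 by rewrite -nm_half /m1 /m3; congr nm; field.
have e3 : nm (a - m3) = nm (a - c) / 2 by rewrite -nm_half /m3; congr nm; field.
have e4 : nm (b - m1) = nm (b - a) / 2 by rewrite -nm_half /m1; congr nm; field.
have e5 : nm (m2 - b) = nm (c - b) / 2 by rewrite -nm_half /m2; congr nm; field.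
have e6 : nm (m1 - m2) = nm (a - c) / 2 by rewrite -nm_half /m1 /m2; congr nm; field.
have e7 : nm (m2 - m3) = nm (b - a) / 2 by rewrite -nm_half /m2 /m3; congr nm; field.
have e8 : nm (c - m2) = nm (c - b) / 2 by rewrite -nm_half /m2; congr nm; field.
have e9 : nm (m3 - c) = nm (a - c) / 2 by rewrite -nm_half /m3; congr nm; field.
have [q|q1] := leP (nm (tri f a b c)) (4 * nm (tri f a m1 m3)).
  exists (a, m1, m3); split => //=; rewrite /perim ?e1 ?e2 ?e3 ?subrr ?nm0; clear - h0 h1 h2; lra.
have [q|q2] := leP (nm (tri f a b c)) (4 * nm (tri f m1 b m2)).
  exists (m1, b, m2); split => //=; rewrite /perim ?e1 ?e4 ?e5 ?e6; clear - h0 h1 h2; lra.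
have [q|q3] := leP (nm (tri f a b c)) (4 * nm (tri f m3 m2 c)).
  by exists (m3, m2, c); split => //=; rewrite /perim ?e7 ?e8 ?e9 1?nmB ?e3; clear - h0 h1 h2; lra.
exists (m2, m3, m1); split => /=.
- have := nmD (tri f a m1 m3 + tri f m1 b m2 + tri f m3 m2 c) (tri f m2 m3 m1).
  have := nmD (tri f a m1 m3 + tri f m1 b m2) (tri f m3 m2 c).
  have := nmD (tri f a m1 m3) (tri f m1 b m2); rewrite E in q1 q2 q3 *; lra.
- by rewrite /perim (nmB m3) e7 (nmB m1) e2 (nmB m2) e6; clear; lra.
- have := nm_sub_trans m1 m2 a; rewrite (nmB m2 m1) e6 e1 /perim; clear - h0 h1 h2; lra.
Qed.

Lemma goursat f (df : R[i] -> R[i]) a b c : (forall z, cder f z (df z)) ->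
  tri f a b c = 0.
Proof.
move=> hf; have cf : continuous f by move=> z; exact: cder_cont (hf z).
have [g hg] := choice (fun p : R[i] * R[i] * R[i] => tri_quarter p.1.1 p.1.2 p.2 cf).
pose T n := iter n g (a, b, c).
pose P := perim a b c.
have P0 : 0 <= P by rewrite /P /perim !addr_ge0 ?nm_ge0.
have hper n : perim (T n).1.1 (T n).1.2 (T n).2 <= P / 2 ^+ n.
  elim: n => [|n IH]; first by rewrite expr0 divr1.
  have [_ h _] := hg (T n); rewrite -/(T n.+1) in h.
  rewrite exprS invfM mulrCA mulrC; lra.
have htri n : nm (tri f a b c) <= 4 ^+ n * nm (tri f (T n).1.1 (T n).1.2 (T n).2).
  elim: n => [|n IH]; first by rewrite expr0 mul1r.
  have [h _ _] := hg (T n); rewrite -/(T n.+1) in h.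
  rewrite exprS (mulrC 4) -mulrA (le_trans IH)// ler_wpM2l// exprn_ge0//.
have [n|z hz] := @geometric_cvg (fun n => (T n).1.1) P.
  by have [_ _ h] := hg (T n); exact: (le_trans h).
apply: nm_small0 => e e0.
have e' : 0 < e / (3 * P ^+ 2 + 1).
  by rewrite divr_gt0//; have := sqr_ge0 P; lra.
have [r r0 hr] := hf z _ e'.
have [n hn] := @expn2_small (r / (3 * P + 1)) ltac:(by rewrite divr_gt0//; lra).
have q0 : 0 < 2 ^+ n :> R by rewrite exprn_gt0.
have hn' : 3 * P / 2 ^+ n < r.
  move: hn; rewrite ltr_pdivlMr ?mul1r; last by lra.
  have : 0 < (2 ^+ n)^-1 :> R by rewrite invr_gt0.
  by rewrite (mulrC (3 * P)); move=> i0; nra.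
have [l lE] : exists l : R[i] -> R[i], forall u, l u = f z + df z * (u - z).
  by exists (fun u => f z + df z * (u - z)).
have cl : continuous l.
  rewrite (_ : l = (fun u => f z + df z * (u - z))); last exact/funext.
  apply: cont_add; first exact: cont_cst.
  by apply: cont_mul; [exact: cont_cst|apply: cont_sub; [exact: cont_id|exact: cont_cst]].
have crest : continuous (fun u => f u - l u) := cont_sub cf cl.
have lint u v : segint l u v =
   (f z * v + (df z / 2) * ((v - z) * (v - z))) - (f z * u + (df z / 2) * ((u - z) * (u - z))).
  apply: (segint_der (F := fun v => f z * v + (df z / 2) * ((v - z) * (v - z)))) => // q.
  have d1 : cder (fun v => v - z) q 1.
    by have := cder_sub (cder_id q) (cder_cst z q); rewrite subr0.
  apply: (cder_eqd (cder_add (cder_scale (f z) (cder_id q)) (cder_scale (df z / 2) (cder_mul d1 d1)))).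
  by rewrite lE /=; field.
have := hz n; have := hper n; have := htri n.
case: (T n) => [[u v] w] /=; rewrite /perim => h1 h2 h3.
have E : tri f u v w = tri (fun q => f q - l q) u v w.
  by rewrite /tri !segint_sub// !lint; ring.
have near q : nm (q - u) <= P / 2 ^+ n ->
    nm (f q - l q) <= e / (3 * P ^+ 2 + 1) * (3 * P / 2 ^+ n).
  move=> qu; have qz : nm (q - z) <= 3 * P / 2 ^+ n.
    apply: (le_trans (nm_sub_trans u _ _)).
    by move: h3 qu; rewrite -!mulrA; lra.
  rewrite lE opprD addrA (le_trans (hr q _))//; first exact: le_lt_trans hn'.
  by rewrite ler_wpM2l// ltW.
have g1 := nm_ge0 (v - u); have g2 := nm_ge0 (w - v); have g3 := nm_ge0 (u - w).
have tle t z1 : 0 <= t <= 1 -> nm (t%:C * z1) <= nm z1.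
  move=> /andP[t0 t1]; rewrite nmM nmC ger0_norm//; have := nm_ge0 z1; nra.
set K := _ * (_ / _) in near.
have s1 : nm (segint (fun q => f q - l q) u v) <= nm (v - u) * K.
  apply: segint_le => // t t01; apply: near; rewrite (addrC u) addrK.
  by have := tle t (v - u) t01; clear - h2 g2 g3; lra.
have s2 : nm (segint (fun q => f q - l q) v w) <= nm (w - v) * K.
  apply: segint_le => // t t01; apply: near.
  have -> : v + t%:C * (w - v) - u = (v - u) + t%:C * (w - v) by ring.
  by apply: (le_trans (nmD _ _)); have := tle t (w - v) t01; clear - h2 g3; lra.
have s3 : nm (segint (fun q => f q - l q) w u) <= nm (u - w) * K.
  apply: segint_le => // t t01; apply: near.
  have -> : w + t%:C * (u - w) - u = - ((1 - t)%:C * (u - w)) by rewrite rmorphB rmorph1; ring.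
  have t01' : 0 <= 1 - t <= 1 by clear - t01; lra.
  rewrite nmN; have := tle (1 - t) (u - w) t01'; clear - h2 g1 g2; lra.
have K0 : 0 <= K by rewrite !mulr_ge0 ?divr_ge0 ?mulr_ge0 ?invr_ge0 ?exprn_ge0// ?ltW//; have := sqr_ge0 P; clear; lra.
have tb : nm (tri f u v w) <= P / 2 ^+ n * K.
  rewrite E /tri; apply: (le_trans (nmD _ _)); have := nmD (segint (fun q => f q - l q) u v) (segint (fun q => f q - l q) v w).
  by clear - s1 s2 s3 h2 K0; nra.
apply: (le_trans h1); apply: (@le_trans _ _ (4 ^+ n * (P / 2 ^+ n * K))).
  by rewrite ler_wpM2l// exprn_ge0.
have -> : 4 ^+ n * (P / 2 ^+ n * K) = e * ((3 * P ^+ 2) / (3 * P ^+ 2 + 1)).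
  rewrite /K (_ : 4 = 2 * 2); last by rewrite -natrM.
  rewrite exprMn; field; rewrite ?(gt_eqF q0) ?andbT /= gt_eqF//; have := sqr_ge0 P; clear; lra.
apply: ler_piMr; first exact: ltW.
have P2 := sqr_ge0 P; rewrite ler_pdivrMr ?mul1r; clear - P2; lra.
Qed.

Lemma primitive f (df : R[i] -> R[i]) : (forall z, cder f z (df z)) ->
  exists F : R[i] -> R[i], forall z, cder F z (f z).
Proof.
move=> hf; have cf : continuous f by move=> z; exact: cder_cont (hf z).
exists (fun z => segint f 0 z) => z e e0.
have /continuous_epsP/(_ e e0)[r r0 hr] := cf z.
exists r => // u uz.
have E : segint f 0 u - segint f 0 z = segint f z u.
  have := goursat 0 z u hf; rewrite /tri (segintN 0 u cf) => /eqP.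
  by rewrite subr_eq0 => /eqP <-; ring.
have Ez : segint (fun=> f z) z u = f z * (u - z).
  have hd q : cder (fun v => f z * v) q (f z).
    by apply: (cder_eqd (cder_scale (f z) (cder_id q))); rewrite mulr1.
  by rewrite (@segint_der R (fun v => f z * v) (fun=> f z) z u (@cont_cst _ _ (f z)) hd) mulrBr.
have cz : continuous (fun _ : R[i] => f z) by exact: cont_cst.
rewrite E -Ez -(segint_sub z u cf cz) mulrC.
apply: (@segint_le R (fun q => f q - f z) z u e (cont_sub cf cz)).
move=> t /andP[t0 t1]; apply/ltW/hr; rewrite (addrC z) addrK nmM nmC ger0_norm//.
by apply: le_lt_trans uz; have := nm_ge0 (u - z); nra.
Qed.

End Cauchy.

(** * Zeros and values of entire functions *)

Section Entire.
Variable R : realType.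
Implicit Types (z w u a b c d : R[i]) (x y t s r e M : R) (f g : R[i] -> R[i]).

Definition holo f := forall z, exists d, cder f z d.

Definition dz f z := xget 0 [set d | cder f z d].

Lemma holo_dz f z : holo f -> cder f z (dz f z).
Proof. by move=> /(_ z)[d hd]; exact: (@xgetPex _ 0 [set d | cder f z d] (ex_intro _ d hd)). Qed.

Lemma cder_uniq f z a b : cder f z a -> cder f z b -> a = b.
Proof.
move=> h1 h2; apply/eqP; rewrite -subr_eq0; apply/eqP; apply: nm_small0 => e e0.
have e2 : 0 < e / 2 by rewrite divr_gt0.
have [r r0 hr] := h1 _ e2; have [s s0 hs] := h2 _ e2.
pose t := Num.min r s / 2.
have m0 : 0 < Num.min r s by rewrite lt_min r0.
have t0 : 0 < t by rewrite divr_gt0.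
have tu : nm (z + t%:C - z) = t by rewrite addrC addKr nmC gtr0_norm.
have tm : t < Num.min r s by rewrite /t; lra.
move: (tm); rewrite lt_min -tu => /andP[/hr + /hs]; rewrite tu => k1 k2.
have : nm ((a - b) * (z + t%:C - z)) <= e * t.
  have -> : (a - b) * (z + t%:C - z) =
    (f (z + t%:C) - f z - b * (z + t%:C - z)) - (f (z + t%:C) - f z - a * (z + t%:C - z)) by ring.
  by apply: (le_trans (nmD _ _)); rewrite nmN; lra.
by rewrite nmM tu ler_pM2r.
Qed.

Lemma dz_eq f z d : cder f z d -> dz f z = d.
Proof. by move=> h; apply: (@cder_uniq f z) => //; apply: (@xgetPex _ 0 [set d | cder f z d]); exists d. Qed.

Lemma holo_cont f : holo f -> continuous f.
Proof. by move=> h z; exact: cder_cont (holo_dz z h). Qed.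

Lemma holo_add f g : holo f -> holo g -> holo (fun z => f z + g z).
Proof. by move=> hf hg z; exists (dz f z + dz g z); apply: cder_add; exact: holo_dz. Qed.

Lemma holo_sub f g : holo f -> holo g -> holo (fun z => f z - g z).
Proof. by move=> hf hg z; exists (dz f z - dz g z); apply: cder_sub; exact: holo_dz. Qed.

Lemma holo_mul f g : holo f -> holo g -> holo (fun z => f z * g z).
Proof.
by move=> hf hg z; exists (dz f z * g z + f z * dz g z); apply: cder_mul; exact: holo_dz.
Qed.

Lemma holo_comp f g : holo f -> holo g -> holo (fun z => g (f z)).
Proof.
by move=> hf hg z; exists (dz g (f z) * dz f z); apply: cder_comp; exact: holo_dz.
Qed.

Lemma holo_cst c : holo (fun=> c).
Proof. by move=> z; exists 0; exact: cder_cst. Qed.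

Lemma holo_id : holo id.
Proof. by move=> z; exists 1; exact: cder_id. Qed.

Lemma holo_shift c : holo (fun z => z - c).
Proof. exact: holo_sub holo_id (holo_cst c). Qed.

Lemma holo_exp : holo (@cexp R).
Proof. by move=> z; exists (cexp z); exact: cexp_der. Qed.

Lemma mean_value_all f (df : R[i] -> R[i]) a b M :
  (forall z, cder f z (df z)) ->
  (forall t, 0 <= t <= 1 -> nm (df (a + t%:C * (b - a))) <= M) ->
  nm (f b - f a) <= M * nm (b - a).
Proof. by move=> h; apply: mean_value => t _; exact: h. Qed.

Lemma der0_cst f : (forall z, cder f z 0) -> forall a b, f a = f b.
Proof.
move=> h a b; apply/eqP; rewrite eq_sym -subr_eq0 -nm_eq0 eq_le nm_ge0 andbT.
rewrite -(mul0r (nm (b - a))); apply: (mean_value_all h) => t _.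
by rewrite nm0.
Qed.

Lemma periodic_mean (k : R[i] -> R[i]) (A xi : R[i]) M : holo k ->
  (forall z, k (z + per R 1) = k z) ->
  (forall e, 0 < e -> exists z, forall t, 0 <= t <= 1 -> nm (k (z + t%:C * per R 1) - A) <= e) ->
  (forall t, 0 <= t <= 1 -> nm (k (xi + t%:C * per R 1)) <= M) -> nm A <= M.
Proof.
move=> hk kper klim kM.
have [K hK] := primitive (fun z => holo_dz z hk).
have n0 : 0 < nm (per R 1).
  by rewrite nm_gt0 eq_complex /= eqxx /= mulr1 gt_eqF// pi2_gt0.
have cK : forall z w, K (z + per R 1) - K z = K (w + per R 1) - K w.
  apply: (@der0_cst (fun z => K (z + per R 1) - K z)) => z.
  have h1 : cder (fun z => z + per R 1) z 1.
    by have := cder_add (cder_id z) (cder_cst (per R 1) z); rewrite addr0.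
  have := cder_sub (cder_comp h1 (hK (z + per R 1))) (hK z).
  by rewrite mulr1 kper subrr.
have cA : K (xi + per R 1) - K xi = A * per R 1.
  apply/eqP; rewrite -subr_eq0; apply/eqP; apply: nm_small0 => e e0.
  have [z hz] := klim (e / nm (per R 1)) ltac:(by rewrite divr_gt0).
  have -> : K (xi + per R 1) - K xi - A * per R 1 =
     (K (z + per R 1) - A * (z + per R 1)) - (K z - A * z) by rewrite (cK xi z); ring.
  have := @mean_value_all (fun z => K z - A * z) (fun z => k z - A) z (z + per R 1) (e / nm (per R 1)).
  rewrite (addrC z) addrK divfK ?gt_eqF//; apply => // q.
  by apply: (cder_eqd (cder_sub (hK q) (cder_scale A (cder_id q)))); rewrite mulr1.
have := @mean_value_all K k xi (xi + per R 1) M hK.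
by rewrite (addrC xi) addrK => /(_ kM); rewrite addrC cA nmM ler_pM2r.
Qed.

Lemma nm_cexp_circle x t : nm (cexp (x%:C + t%:C * per R 1)) = expR x.
Proof. by rewrite nm_cexp /= !mul0r mulr0 subrr addr0. Qed.

Lemma weak_mean f c r M : holo f -> 0 < r ->
  (forall u, nm (u - c) = r -> nm (f u) <= M) -> nm (f c) <= M.
Proof.
move=> hf r0 hM.
apply: (@periodic_mean (fun z => f (c + cexp z)) (f c) ((ln r)%:C)).
- by apply: (holo_comp (f := fun z => c + cexp z)) => //; apply: holo_add; [exact: holo_cst|exact: holo_exp].
- by move=> z; rewrite cexpD cexp_per mulr1.
- move=> e e0; have /continuous_epsP/(_ e e0)[d d0 hd] := @holo_cont f hf c.
  exists ((ln (d / 2))%:C) => t _; apply/ltW/hd.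
  by rewrite (addrC c) addrK nm_cexp_circle lnK ?posrE ?divr_gt0//; lra.
- by move=> t _; apply: hM; rewrite (addrC c) addrK nm_cexp_circle lnK ?posrE.
Qed.

Lemma cauchy_est f c r M : holo f -> 0 < r ->
  (forall u, nm (u - c) = r -> nm (f u - f c) <= M) -> nm (dz f c) <= M / r.
Proof.
move=> hf r0 hM.
apply: (@periodic_mean (fun z => (f (c + cexp z) - f c) * cexp (- z)) (dz f c) ((ln r)%:C)).
- apply: holo_mul.
    apply: holo_sub (holo_cst _); apply: (holo_comp (f := fun z => c + cexp z)) => //.
    by apply: holo_add; [exact: holo_cst|exact: holo_exp].
  apply: (holo_comp (f := fun z => - z)); last exact: holo_exp.
  by move=> z; exists (-1); apply: (cder_ext _ (cder_eqd (cder_scale (-1) (cder_id z)) _)) => [u|]; rewrite ?mulN1r ?mulr1.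
- by move=> z; rewrite opprD !cexpD cexp_per mulr1 -perN cexp_per mulr1.
- move=> e e0; have [d d0 hd] := holo_dz c hf e0.
  exists ((ln (d / 2))%:C) => t _.
  pose z := (ln (d / 2))%:C + t%:C * per R 1; rewrite -/z.
  have zn : nm (cexp z) = d / 2 by rewrite nm_cexp_circle lnK ?posrE ?divr_gt0.
  have E : c + cexp z - c = cexp z by rewrite (addrC c) addrK.
  have := hd (c + cexp z); rewrite E zn => /(_ ltac:(lra)) h.
  have z0 := cexp_neq0 z.
  have -> : (f (c + cexp z) - f c) * cexp (- z) - dz f c =
    (f (c + cexp z) - f c - dz f c * cexp z) * (cexp z)^-1 by rewrite cexpN; field.
  by rewrite nmM nmV zn ler_pdivrMr ?divr_gt0.
- move=> t _; rewrite nmM cexpN nmV nm_cexp_circle lnK ?posrE//.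
  rewrite ler_pM2r ?invr_gt0//; apply: hM.
  by rewrite (addrC c) addrK nm_cexp_circle lnK ?posrE.
Qed.

Lemma unif_cont f M e : continuous f -> 0 < e -> exists2 d, 0 < d &
  forall u v : R[i], nm u <= M -> nm (v - u) < d -> nm (f v - f u) < e.
Proof.
move=> cf e0; apply: contrapT => hn.
have hs n : exists p : R[i] * R[i], [/\ nm p.1 <= M, nm (p.2 - p.1) < 1 / 2 ^+ n & e <= nm (f p.2 - f p.1)].
  apply: contrapT => hn'; apply: hn; exists (1 / 2 ^+ n); first by rewrite divr_gt0 ?exprn_gt0.
  move=> u v uM uv; rewrite ltNge; apply/negP => h; apply: hn'; by exists (u, v).
have [p hp] := choice hs.
have [|z hz] := @bounded_cluster R (fun n => (p n).1) M; first by move=> n; have [] := hp n.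
have e2 : 0 < e / 2 by rewrite divr_gt0.
have /continuous_epsP/(_ _ e2)[d d0 hd] := cf z.
have d2 : 0 < d / 2 by rewrite divr_gt0.
have [n hn'] := expn2_small d2.
have [m nm_ hm] := hz _ d2 n.
have [h1 h2 h3] := hp m.
have h4 : 1 / 2 ^+ m <= 1 / 2 ^+ n :> R.
  by rewrite !mul1r lef_pV2 ?posrE ?exprn_gt0// ler_eXn2l// ltr1n.
have k1 := hd (p m).1 ltac:(lra).
have k2 : nm (f (p m).2 - f z) < e / 2.
  by apply: hd; have := nm_sub_trans (p m).1 (p m).2 z; clear - hn' hm h2 h4; lra.
have := nm_sub_trans (f z) (f (p m).2) (f (p m).1); rewrite (nmB (f z)); clear - h3 k1 k2; lra.
Qed.

Lemma cder_shift f h z d : cder f (z + h) d -> cder (fun u => f (u + h)) z d.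
Proof.
move=> hf; have h1 : cder (fun u => u + h) z 1.
  by have := cder_add (cder_id z) (cder_cst h z); rewrite addr0.
by have := cder_comp h1 hf; rewrite mulr1.
Qed.

Lemma holo_translate f h : holo f -> holo (fun u => f (u + h)).
Proof. by move=> hf z; exists (dz f (z + h)); apply: cder_shift; exact: holo_dz. Qed.

Lemma dz_cont f : holo f -> continuous (dz f).
Proof.
move=> hf z; apply/continuous_epsP => e e0.
have e4 : 0 < e / 4 by rewrite divr_gt0.
have [d d0 hd] := @unif_cont f (nm z + 1) (e / 4) (holo_cont hf) e4.
exists d => // u uz.
have hg : holo (fun v => f (v + (u - z)) - f v).
  by apply: holo_sub => //; exact: holo_translate.
have E : dz (fun v => f (v + (u - z)) - f v) z = dz f u - dz f z.
  apply: dz_eq; apply: cder_sub (holo_dz z hf); apply: cder_shift.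
  by rewrite (addrC u) addrA subrr add0r; exact: holo_dz.
rewrite -E; apply: (@le_lt_trans _ _ ((e / 2) / 1)); last by rewrite divr1; lra.
apply: cauchy_est => // v vz.
have vs : nm (v + (u - z) - v) < d by rewrite (addrC v) addrK.
have zs : nm (z + (u - z) - z) < d by rewrite (addrC z) addrK.
have := hd v (v + (u - z)) ltac:(have := nmD (v - z) z; rewrite subrK; lra) vs.
have := hd z (z + (u - z)) ltac:(lra) zs.
have := nmD (f (v + (u - z)) - f v) (- (f (z + (u - z)) - f z)); rewrite nmN; lra.
Qed.

Lemma holo_dz_holo f : holo f -> holo (dz f).
Proof.
move=> hf z0.
have cd := dz_cont hf.
pose D h v := (f (v + h) - f v) / h.
have hD h : h != 0 -> forall v, cder (D h) v ((dz f (v + h) - dz f v) / h).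
  move=> h0 v; rewrite /D mulrC.
  apply: (cder_ext (f := fun v => h^-1 * (f (v + h) - f v))) => [q|]; first by rewrite mulrC.
  by apply: cder_scale; apply: cder_sub; [apply: cder_shift|]; exact: holo_dz.
have key e : 0 < e -> exists2 d, 0 < d & forall h k, h != 0 -> k != 0 -> nm h < d -> nm k < d ->
    nm ((dz f (z0 + h) - dz f z0) / h - (dz f (z0 + k) - dz f z0) / k) <= e.
  move=> e0; have e4 : 0 < e / 4 by rewrite divr_gt0.
  have [d d0 hd] := @unif_cont (dz f) (nm z0 + 1) (e / 4) cd e4.
  have Dd h v : h != 0 -> nm h < d -> nm v <= nm z0 + 1 -> nm (D h v - dz f v) <= e / 4.
    move=> h0 hd' vM.
    have : nm ((f (v + h) - dz f v * (v + h)) - (f v - dz f v * v)) <= e / 4 * nm (v + h - v).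
      apply: (@mean_value_all (fun q => f q - dz f v * q) (fun q => dz f q - dz f v)) => [q|t /andP[t0 t1]].
        by apply: (cder_eqd (cder_sub (holo_dz q hf) (cder_scale (dz f v) (cder_id q)))); rewrite mulr1.
      apply/ltW/hd => //; rewrite (_ : v + _ - v = t%:C * h); last by ring.
      rewrite nmM nmC ger0_norm//.
      by apply: le_lt_trans hd'; have := nm_ge0 h; nra.
    have -> : v + h - v = h by ring.
    have -> : f (v + h) - dz f v * (v + h) - (f v - dz f v * v) = (D h v - dz f v) * h.
      by rewrite /D; field.
    by rewrite nmM ler_pM2r ?nm_gt0.
  exists d => // h k h0 k0 hd1 kd1.
  have hg : holo (fun v => D h v - D k v).
    by apply: holo_sub => v; [exists ((dz f (v + h) - dz f v) / h)|exists ((dz f (v + k) - dz f v) / k)]; exact: hD.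
  have := @cauchy_est _ z0 1 e hg ltr01; rewrite divr1.
  rewrite (dz_eq (cder_sub (hD h h0 z0) (hD k k0 z0))); apply => u uz.
  have uM : nm u <= nm z0 + 1 by have := nmD (u - z0) z0; rewrite subrK; lra.
  have zM : nm z0 <= nm z0 + 1 by lra.
  have -> : D h u - D k u - (D h z0 - D k z0) = ((D h u - dz f u) - (D k u - dz f u)) -
     ((D h z0 - dz f z0) - (D k z0 - dz f z0)) by ring.
  have := Dd h u h0 hd1 uM; have := Dd k u k0 kd1 uM.
  have := Dd h z0 h0 hd1 zM; have := Dd k z0 k0 kd1 zM.
  have := nmD (D h u - dz f u) (- (D k u - dz f u)); rewrite nmN.
  have := nmD (D h z0 - dz f z0) (- (D k z0 - dz f z0)); rewrite nmN.
  have := nmD (D h u - dz f u - (D k u - dz f u)) (- (D h z0 - dz f z0 - (D k z0 - dz f z0))).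
  by rewrite nmN; clear; lra.
have [d1 d10 h1] := key 1 ltr01.
have [N hN] := expn2_small d10.
pose q n := (1 / 2 ^+ (n + N))%:C : R[i].
have q0 n : q n != 0.
  by rewrite -nm_eq0 nmC normr_eq0 mulf_neq0 ?oner_eq0// invr_eq0 expf_neq0// pnatr_eq0.
have nq n : nm (q n) = 1 / 2 ^+ (n + N).
  by rewrite nmC ger0_norm// divr_ge0 ?exprn_ge0.
have pow n m : (n <= m)%N -> 1 / 2 ^+ m <= 1 / 2 ^+ n :> R.
  by move=> nm_; rewrite !mul1r lef_pV2 ?posrE ?exprn_gt0// ler_eXn2l// ltr1n.
have qd n : nm (q n) < d1.
  by rewrite nq; apply: le_lt_trans hN; apply: pow; exact: leq_addl.
pose G h := (dz f (z0 + h) - dz f z0) / h.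
have [|c hc] := @bounded_cluster R (fun n => G (q n)) (nm (G (q 0%N)) + 1).
  move=> n; have := h1 (q n) (q 0%N) (q0 n) (q0 0%N) (qd n) (qd 0%N).
  by have := nmDB (G (q n)) (G (q 0%N)); rewrite -/(G _) -/(G _); lra.
exists c => e e0; have e2 : 0 < e / 2 by rewrite divr_gt0.
have [d d0 hd] := key _ e2; exists d => // u uz.
have [->|uz0] := eqVneq u z0; first by rewrite !subrr mulr0 subr0 nm0 mulr0.
have h0 : u - z0 != 0 by rewrite subr_eq0.
have [n hn] := expn2_small d0.
have [m nm_ hm] := hc _ e2 n.
have qmd : nm (q m) < d.
  by rewrite nq; apply: le_lt_trans hn; apply: pow; exact: (leq_trans nm_ (leq_addr _ _)).
have := hd (u - z0) (q m) h0 (q0 m) uz qmd; rewrite -/(G _) -/(G _) => hGG.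
have : nm (G (u - z0) - c) <= e by have := nm_sub_trans (G (q m)) (G (u - z0)) c; clear - hm hGG; lra.
rewrite -(ler_pM2r (x := nm (u - z0))) ?nm_gt0// -nmM.
rewrite /G (addrC z0) subrK; congr (nm _ <= _); field; exact: h0.
Qed.

End Entire.

Section Local.
Variable R : realType.
Implicit Types (z w u a b c d : R[i]) (x y t s r e M : R) (f g : R[i] -> R[i]).

Lemma ball_attains_max c r (v : R[i] -> R) : 0 <= r -> continuous v ->
  exists2 p, nm (p - c) <= r & forall z, nm (z - c) <= r -> v z <= v p.
Proof.
move=> r0 cv; apply: (compact_attains_max _ (@compact_ball_le R c r) cv).
by exists c; rewrite /= subrr nm0.
Qed.

Lemma ball_attains_min c r (v : R[i] -> R) : 0 <= r -> continuous v ->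
  exists2 p, nm (p - c) <= r & forall z, nm (z - c) <= r -> v p <= v z.
Proof.
move=> r0 cv; apply: (compact_attains_min _ (@compact_ball_le R c r) cv).
by exists c; rewrite /= subrr nm0.
Qed.

Lemma cder_inv z : z != 0 -> cder (fun u : R[i] => u^-1) z (- z ^- 2).
Proof.
move=> z0 e e0; have n0 : 0 < nm z by rewrite nm_gt0.
exists (Num.min (nm z / 2) (e * nm z ^+ 3 / 2)).
  by rewrite lt_min !divr_gt0// mulr_gt0// exprn_gt0.
move=> u; rewrite lt_min => /andP[h1 h2].
have u2 : nm z / 2 <= nm u by have := nmDB z u; rewrite nmB; lra.
have u0 : u != 0 by rewrite -nm_gt0; lra.
have -> : u^-1 - z^-1 - - z ^- 2 * (u - z) = (u - z) * ((u - z) * (u^-1 * (z ^+ 2)^-1)).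
  by field; rewrite z0.
rewrite nmM mulrC ler_wpM2r ?nm_ge0// !nmM !nmV nmX.
have k1 : (nm u)^-1 <= 2 / nm z.
  by rewrite -(invrK (2 / nm z)) lef_pV2 ?posrE ?invr_gt0 ?divr_gt0 ?nm_gt0// invf_div.
apply: (@le_trans _ _ (e * nm z ^+ 3 / 2 * (2 / nm z * (nm z ^+ 2)^-1))).
  apply: ler_pM; rewrite ?nm_ge0 ?mulr_ge0 ?invr_ge0 ?exprn_ge0 ?nm_ge0//; first exact: ltW.
  by rewrite ler_wpM2r// invr_ge0 exprn_ge0// nm_ge0.
by rewrite le_eqVlt; apply/orP; left; apply/eqP; field; rewrite gt_eqF.
Qed.

Definition quo f c z := if z == c then dz f c else (f z - f c) / (z - c).

Lemma quoE f c z : f z = f c + (z - c) * quo f c z.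
Proof.
rewrite /quo; case: eqVneq => [->|zc]; first by rewrite subrr mul0r addr0.
by rewrite mulrC divfK ?subr_eq0// addrC subrK.
Qed.

Lemma holo_quo f c : holo f -> holo (quo f c).
Proof.
move=> hf z; have [->|zc] := eqVneq z c.
  have hdf := holo_dz_holo hf; pose d := dz (dz f) c / 2.
  exists d => e e0.
  have [r r0 hr] := holo_dz c hdf e0; exists r => // u uc.
  have [->|uc0] := eqVneq u c; first by rewrite !subrr mulr0 subr0 nm0 mulr0.
  have u0 : u - c != 0 by rewrite subr_eq0.
  rewrite /quo eqxx (negbTE uc0).
  pose r2 v := f v - dz f c * v - d * ((v - c) * (v - c)).
  have hr2 v : cder r2 v (dz f v - dz f c - dz (dz f) c * (v - c)).
    have d1 : cder (fun v => v - c) v 1.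
      by have := cder_sub (cder_id v) (cder_cst c v); rewrite subr0.
    apply: (cder_eqd (cder_sub (cder_sub (holo_dz v hf) (cder_scale (dz f c) (cder_id v)))
      (cder_scale d (cder_mul d1 d1)))).
    by rewrite /d; field.
  have := mean_value_all hr2 (a := c) (b := u) (M := e * nm (u - c)).
  have -> : r2 u - r2 c = ((f u - f c) / (u - c) - dz f c - d * (u - c)) * (u - c).
    by rewrite /r2; field.
  rewrite nmM ler_pM2r ?nm_gt0//; apply => t /andP[t0 t1].
  have tc : c + t%:C * (u - c) - c = t%:C * (u - c) by ring.
  have tn : nm (t%:C * (u - c)) <= nm (u - c).
    by rewrite nmM nmC ger0_norm//; have := nm_ge0 (u - c); nra.
  have := hr (c + t%:C * (u - c)); rewrite tc => /(_ (le_lt_trans tn uc)) h.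
  by apply: (le_trans h); rewrite ler_wpM2l// ltW.
have z0 : z - c != 0 by rewrite subr_eq0.
have h1 : cder (fun v => v - c) z 1.
  by have := cder_sub (cder_id z) (cder_cst c z); rewrite subr0.
have h2 := cder_mul (cder_sub (holo_dz z hf) (cder_cst (f c) z)) (cder_comp h1 (cder_inv z0)).
eexists; apply: (cder_near (r := nm (z - c))) h2; first by rewrite nm_gt0.
move=> u uz; rewrite /quo ifF//; apply/negP => /eqP uc.
by move: uz; rewrite uc nmB ltxx.
Qed.

Lemma vanish_order f c : holo f -> (exists z, f z != 0) ->
  exists m (g : R[i] -> R[i]), [/\ holo g, g c != 0 & forall z, f z = (z - c) ^+ m * g z].
Proof.
move=> hf [z1 fz1]; apply: contrapT => hn.
have hall m : exists g, holo g /\ forall z, f z = (z - c) ^+ m * g z.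
  elim: m => [|m [g [hg fg]]]; first by exists f; split => // z; rewrite expr0 mul1r.
  have [g0|g0] := eqVneq (g c) 0; last by case: hn; exists m, g.
  exists (quo g c); split; first exact: holo_quo.
  by move=> z; rewrite fg (quoE g c z) g0 add0r exprSr mulrA.
pose rho := 3 * nm (z1 - c) + 1.
have n0 := nm_ge0 (z1 - c).
have rho0 : 0 < rho by rewrite /rho; lra.
have [p _ hp] := @ball_attains_max z1 rho _ (ltW rho0)
  (cont_comp (holo_cont hf) (@continuous_nm R)).
move/negP : fz1; apply; apply/eqP; apply: nm_small0 => e e0.
have M1 : 0 < nm (f p) + 1 by have := nm_ge0 (f p); lra.
have [n hn'] := expn2_small (divr_gt0 e0 M1).
have [g [hg fg]] := hall n.
pose q := rho - nm (z1 - c).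
have q0 : 0 < q by rewrite /q /rho; lra.
have gb : nm (g z1) <= (nm (f p) + 1) / q ^+ n.
  apply: (@weak_mean R g z1 rho) => // u ur.
  have uc : q <= nm (u - c).
    by have := nm_sub_trans c u z1; rewrite ur (nmB c) /q; lra.
  have h := hp u; rewrite ur lexx in h; have {}h := h isT.
  rewrite ler_pdivlMr ?exprn_gt0// mulrC.
  apply: (@le_trans _ _ (nm (u - c) ^+ n * nm (g u))).
    by rewrite ler_wpM2r ?nm_ge0// lerXn2r ?nnegrE ?nm_ge0// ltW.
  by rewrite -nmX -nmM -fg; lra.
rewrite fg nmM nmX; apply: (@le_trans _ _ (nm (z1 - c) ^+ n * ((nm (f p) + 1) / q ^+ n))).
  by rewrite ler_wpM2l// exprn_ge0.
have h2 : nm (z1 - c) ^+ n / q ^+ n <= 1 / 2 ^+ n.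
  have h3 : nm (z1 - c) / q <= 2^-1 by rewrite ler_pdivrMr// /q /rho; lra.
  by rewrite mul1r -expr_div_n -exprVn lerXn2r ?nnegrE ?invr_ge0 ?divr_ge0// ltW.
rewrite mulrCA mulrC.
move: hn'; rewrite ltr_pdivlMr// => hn'.
apply: (le_trans (ler_wpM2r (ltW M1) h2)); exact: ltW.
Qed.

Definition noncst f := forall w, exists z, f z != w.

Lemma noncst_sub f w : noncst f -> exists z, f z - w != 0.
Proof. by move=> /(_ w)[z h]; exists z; rewrite subr_eq0. Qed.

Lemma isolated_value f c w : holo f -> noncst f -> exists2 e, 0 < e &
  forall z, nm (z - c) <= e -> z != c -> f z != w.
Proof.
move=> hf nf.
have [m [g [hg gc fg]]] := vanish_order c (holo_sub hf (holo_cst w)) (noncst_sub w nf).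
have n0 : 0 < nm (g c) by rewrite nm_gt0.
have /continuous_epsP/(_ _ n0)[d d0 hd] := @holo_cont R g hg c.
exists (d / 2); first by rewrite divr_gt0.
move=> z zc zc0; rewrite -subr_eq0 fg mulf_neq0// ?expf_neq0 ?subr_eq0//.
have := hd z ltac:(lra); apply: contraTneq => ->; rewrite sub0r nmN ltxx//.
Qed.

Lemma decrease_near f c w e : holo f -> noncst f -> f c != w -> 0 < e ->
  exists2 z, nm (z - c) < e & nm (f z - w) < nm (f c - w).
Proof.
move=> hf nf fw e0.
have [m [g [hg gc fg]]] := vanish_order c (holo_sub hf (holo_cst (f c))) (noncst_sub (f c) nf).
have m0 : (0 < m)%N.
  rewrite lt0n; apply/negP => /eqP m0; move: (fg c); rewrite m0 expr0 mul1r subrr.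
  by move/esym/eqP; rewrite (negbTE gc).
pose u0 := w - f c.
have u00 : u0 != 0 by rewrite subr_eq0 eq_sym.
pose l := m.-root (u0 / g c).
have lm : l ^+ m = u0 / g c by exact: rootCK.
have lm0 : 0 < nm (l ^+ m) + 1 by have := nm_ge0 (l ^+ m); lra.
have U0 : 0 < nm u0 by rewrite nm_gt0.
have /continuous_epsP/(_ _ (divr_gt0 U0 lm0))[d d0 hd] := @holo_cont R g hg c.
have nl0 : 0 < nm l + 1 by have := nm_ge0 l; lra.
pose s := Num.min (1 / 2) (Num.min e d / 2 / (nm l + 1)).
have med : 0 < Num.min e d by rewrite lt_min e0.
have s0 : 0 < s by rewrite lt_min !divr_gt0.
have s1 : s <= 1 / 2 by rewrite ge_min lexx.
have sd : s * (nm l + 1) <= Num.min e d / 2.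
  by rewrite -ler_pdivlMr// ge_min lexx orbT.
pose z := c + s%:C * l.
have zc : z - c = s%:C * l by rewrite /z; ring.
have nz : nm (z - c) < Num.min e d.
  by rewrite zc nmM nmC gtr0_norm//; have := nm_ge0 l; lra.
move: (nz); rewrite lt_min => /andP[ze zd].
exists z => //.
have E : f z - w = - ((1 - s ^+ m)%:C * u0) + s%:C ^+ m * (l ^+ m * (g z - g c)).
  have -> : f z - w = (f z - f c) - u0 by rewrite /u0; ring.
  have -> : l ^+ m * (g z - g c) = l ^+ m * g z - u0 by rewrite mulrBr [in X in _ - X]lm divfK.
  by rewrite fg zc exprMn rmorphB rmorph1 rmorphXn /=; ring.
have sm0 : 0 < s ^+ m by rewrite exprn_gt0.
have sm1 : s ^+ m <= 1 by rewrite exprn_ile1// ltW//; clear - s1; lra.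
have -> : nm (f c - w) = nm u0 by rewrite nmB.
rewrite E; apply: (le_lt_trans (nmD _ _)); rewrite nmN nmM nmC ger0_norm ?subr_ge0//.
rewrite -rmorphXn /= nmM nmC (gtr0_norm sm0).
have hg1 := hd z zd.
have hlt : nm (l ^+ m * (g z - g c)) < nm u0.
  rewrite nmM; move: hg1; rewrite ltr_pdivlMr//; have := nm_ge0 (g z - g c); nra.
clear - sm0 hlt; nra.
Qed.

Lemma increase_near f c e : holo f -> noncst f -> 0 < e ->
  exists2 z, nm (z - c) < e & nm (f c) < nm (f z).
Proof.
move=> hf nf e0; have [f0|f0] := eqVneq (f c) 0.
  have [|z ze h] := @decrease_near f c 1 e hf nf _ e0.
    by rewrite f0 eq_sym oner_eq0.
  exists z => //; rewrite f0 nm0 nm_gt0; apply: contraTneq h => ->.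
  by rewrite f0 ltxx.
have [|z ze h] := @decrease_near f c (2 * f c) e hf nf _ e0.
  by rewrite mulr_natl mulr2n -subr_eq0 opprD addrA subrr add0r oppr_eq0.
exists z => //.
have := nmDB (2 * f c) (f z); rewrite (nmB (2 * f c)).
have n2 : nm (2 * f c) = 2 * nm (f c).
  by rewrite nmM -(rmorph_nat (real_complex R)) nmC ger0_norm.
have n3 : nm (f c - 2 * f c) = nm (f c) by rewrite -nmN; congr nm; ring.
by rewrite n2; rewrite n3 in h; lra.
Qed.

Lemma max_principle f (A : set R[i]) M0 M : holo f -> noncst f -> open A ->
  (forall z, A z -> nm z <= M0) ->
  (forall z, closure A z -> ~ A z -> nm (f z) <= M) ->
  forall z, A z -> nm (f z) <= M.
Proof.
move=> hf nf oA bA hb z Az.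
have cA : compact (closure A).
  apply: (@compact_closed_bounded R _ M0); first exact: closed_closure.
  move=> u cu; rewrite leNgt; apply/negP => h.
  have [|v [Av]] := cu [set v | nm (v - u) < nm u - M0].
    by apply/nbhs_nm; exists (nm u - M0) => //; lra.
  by have := bA v Av; have := nmDB u v; rewrite (nmB u) /=; lra.
have [c cc hc] := @compact_attains_max R (closure A) (fun u => nm (f u))
  (ex_intro _ z (subset_closure Az)) cA (cont_comp (holo_cont hf) (@continuous_nm R)).
apply: (le_trans (hc z (subset_closure Az))).
apply: hb => // Ac.
have /nbhs_nm[e e0 he] : nbhs c A by exact: open_nbhs_nbhs.
have [u uc hu] := @increase_near f c e hf nf e0.
by have := hc u (subset_closure (he u uc)); lra.
Qed.

Lemma value_in_ball f c w r : holo f -> noncst f -> 0 < r ->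
  (forall z, nm (z - c) = r -> nm (f c - w) < nm (f z - w)) ->
  exists2 z, nm (z - c) < r & f z = w.
Proof.
move=> hf nf r0 h.
have cc : continuous (fun u => nm (f u - w)).
  exact: (cont_comp (cont_sub (holo_cont hf) (@cont_cst _ _ w)) (@continuous_nm R)).
have c0 : nm (c - c) <= r by rewrite subrr nm0 ltW.
have [z zr hz] := ball_attains_min c (ltW r0) cc.
have zlt : nm (z - c) < r.
  rewrite lt_neqAle zr andbT; apply/negP => /eqP zr'.
  by have := h z zr'; have := hz c c0; lra.
exists z => //; apply/eqP; apply/negPn/negP => fz.
have [u uz hu] := @decrease_near f z w (r - nm (z - c)) hf nf fz ltac:(lra).
have : nm (u - c) <= r by have := nm_sub_trans z u c; lra.
by move=> /hz; lra.
Qed.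

Definition good f c r M :=
  [/\ 0 < r, 0 < M, forall z, nm (z - c) < r -> dz f z != 0 &
   forall z w, nm (z - c) < r -> nm (w - c) < r -> nm (z - w) <= M * nm (f z - f w)].

Lemma good_exists f c : holo f -> dz f c != 0 -> exists r M, good f c r M.
Proof.
move=> hf d0; have n0 : 0 < nm (dz f c) by rewrite nm_gt0.
have n2 : 0 < nm (dz f c) / 2 by rewrite divr_gt0.
have /continuous_epsP/(_ _ n2)[r r0 hr] := @dz_cont R f hf c.
exists r, (2 / nm (dz f c)); split => //.
- by rewrite divr_gt0.
- move=> z zr; rewrite -nm_gt0; have := hr z zr; have := nmDB (dz f c) (dz f z).
  by rewrite (nmB (dz f c)); lra.
move=> z w zr wr.
have : nm ((f z - dz f c * z) - (f w - dz f c * w)) <= nm (dz f c) / 2 * nm (z - w).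
  apply: (@mean_value_all R (fun q => f q - dz f c * q) (fun q => dz f q - dz f c)) => [q|t /andP[t0 t1]].
    by apply: (cder_eqd (cder_sub (holo_dz q hf) (cder_scale (dz f c) (cder_id q)))); rewrite mulr1.
  apply/ltW/hr.
  have -> : w + t%:C * (z - w) - c = t%:C * (z - c) + (1 - t)%:C * (w - c).
    by rewrite rmorphB rmorph1; ring.
  apply: (le_lt_trans (nmD _ _)); rewrite !nmM !nmC !ger0_norm ?subr_ge0//.
  have mr : Num.max (nm (z - c)) (nm (w - c)) < r by rewrite gt_max zr.
  have k1 : t * nm (z - c) <= t * Num.max (nm (z - c)) (nm (w - c)).
    by rewrite ler_wpM2l// le_max lexx.
  have k2 : (1 - t) * nm (w - c) <= (1 - t) * Num.max (nm (z - c)) (nm (w - c)).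
    by rewrite ler_wpM2l ?subr_ge0// le_max lexx orbT.
  by lra.
have -> : f z - dz f c * z - (f w - dz f c * w) = (f z - f w) - dz f c * (z - w) by ring.
move=> h; have := nmDB (dz f c * (z - w)) (f z - f w).
rewrite (nmB (dz f c * (z - w))) nmM => h2.
rewrite mulrAC ler_pdivlMr//; lra.
Qed.

Lemma goodS f c c' r M r' : good f c r M -> 0 < r' -> nm (c' - c) + r' <= r -> good f c' r' M.
Proof.
case=> r0 M0 h1 h2 r'0 h; split => //.
  by move=> z zc; apply: h1; have := nm_sub_trans c' z c; lra.
move=> z w zc wc; apply: h2.
  by have := nm_sub_trans c' z c; lra.
by have := nm_sub_trans c' w c; lra.
Qed.

Lemma good_onto f c r M r' w : holo f -> noncst f -> good f c r M -> 0 < r' -> r' < r ->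
  nm (w - f c) < r' / (2 * M) -> exists2 z, nm (z - c) < r' & f z = w.
Proof.
move=> hf nf [r0 M0 h1 h2] r'0 r'r hw.
apply: value_in_ball => // z zr.
have := h2 z c ltac:(lra) ltac:(by rewrite subrr nm0); rewrite zr => h3.
move: hw; rewrite ltr_pdivlMr; last by rewrite mulr_gt0.
rewrite (nmB (f c)) => h4.
have := nm_sub_trans w (f z) (f c).
by nra.
Qed.

Lemma factor_zeros f M : holo f -> (exists z, f z != 0) ->
  exists (s : seq R[i]) (g : R[i] -> R[i]), [/\ holo g,
    forall z, f z = (\prod_(a <- s) (z - a)) * g z,
    forall a, a \in s -> nm a <= M & forall z, nm z <= M -> g z != 0].
Proof.
move=> hf [z0 fz0]; apply: contrapT => hn.
have hall m : exists (s : seq R[i]) (g : R[i] -> R[i]), [/\ size s = m, holo g,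
    forall z, f z = (\prod_(a <- s) (z - a)) * g z & forall a, a \in s -> nm a <= M].
  elim: m => [|m [s [g [sm hg fg sM]]]].
    by exists [::], f; split => // z; rewrite big_nil mul1r.
  have [[a aM ga]|hno] := pselect (exists2 a, nm a <= M & g a = 0); last first.
    case: hn; exists s, g; split => // z zM; apply/negP => /eqP gz.
    by apply: hno; exists z.
  exists (a :: s), (quo g a); split => //=; first by rewrite sm.
  - exact: holo_quo.
  - by move=> z; rewrite fg (quoE g a z) ga add0r big_cons mulrCA mulrA.
  - by move=> b; rewrite inE => /orP[/eqP->|/sM].
pose N0 := nm z0 + `|M|.
have N00 : 0 <= N0 by rewrite addr_ge0 ?nm_ge0.
pose rho := 3 * N0 + 1.
have rho0 : 0 < rho by rewrite /rho; lra.
have [p _ hp] := @ball_attains_max z0 rho _ (ltW rho0)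
  (cont_comp (holo_cont hf) (@continuous_nm R)).
move/negP : fz0; apply; apply/eqP; apply: nm_small0 => e e0.
have M1 : 0 < nm (f p) + 1 by have := nm_ge0 (f p); lra.
have [n hn'] := expn2_small (divr_gt0 e0 M1).
have [s [g [sn hg fg sM]]] := hall n.
pose q := rho - N0.
have q0 : 0 < q by rewrite /q /rho; lra.
have prod_le u B : 0 <= B -> (forall a, a \in s -> nm (u - a) <= B) ->
    nm (\prod_(a <- s) (u - a)) <= B ^+ n.
  move=> B0; rewrite nm_prod -sn; elim: (s) => [|b l IH] h; first by rewrite big_nil.
  rewrite big_cons exprS ler_pM ?nm_ge0 ?h ?mem_head//.
    by rewrite prodr_ge0// => i _; exact: nm_ge0.
  by apply: IH => a al; apply: h; rewrite inE al orbT.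
have prod_ge u B : 0 <= B -> (forall a, a \in s -> B <= nm (u - a)) ->
    B ^+ n <= nm (\prod_(a <- s) (u - a)).
  move=> B0; rewrite nm_prod -sn; elim: (s) => [|b l IH] h; first by rewrite big_nil.
  rewrite big_cons exprS ler_pM ?exprn_ge0 ?h ?mem_head//.
  by apply: IH => a al; apply: h; rewrite inE al orbT.
have aM a : a \in s -> nm a <= `|M| by move=> /sM h; exact: (le_trans h (ler_norm M)).
have gb : nm (g z0) <= (nm (f p) + 1) / q ^+ n.
  apply: (@weak_mean R g z0 rho) => // u ur.
  have h := hp u; rewrite ur lexx in h; have {}h := h isT.
  rewrite ler_pdivlMr ?exprn_gt0// mulrC.
  apply: (@le_trans _ _ (nm (\prod_(a <- s) (u - a)) * nm (g u))).
    rewrite ler_wpM2r ?nm_ge0//; apply: prod_ge => [|a /aM h']; first exact: ltW.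
    by have := nmDB (u - z0) (a - z0); have := nmD a (- z0);
      rewrite nmN ur (_ : u - z0 - (a - z0) = u - a) /q /N0; [lra|ring].
  by rewrite -nmM -fg; lra.
rewrite fg nmM; apply: (@le_trans _ _ (N0 ^+ n * ((nm (f p) + 1) / q ^+ n))).
  apply: ler_pM; rewrite ?nm_ge0//; apply: prod_le => // a /aM h'.
  by have := nmD z0 (- a); rewrite nmN /N0; lra.
have h2 : N0 ^+ n / q ^+ n <= 1 / 2 ^+ n.
  have h3 : N0 / q <= 2^-1 by rewrite ler_pdivrMr// /q /rho; lra.
  by rewrite mul1r -expr_div_n -exprVn lerXn2r ?nnegrE ?invr_ge0 ?divr_ge0// ltW.
rewrite mulrCA mulrC.
move: hn'; rewrite ltr_pdivlMr// => hn'.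
apply: (le_trans (ler_wpM2r (ltW M1) h2)); exact: ltW.
Qed.

End Local.

(** * Variation of the logarithm along paths *)

Section Winding.
Variable R : realType.
Implicit Types (z w u a b c d : R[i]) (x y t s r e M : R) (f g : R[i] -> R[i]).
Implicit Types (F G L Z l : R -> R[i]).

Lemma contR_add (T : topologicalType) (p q : T -> R) :
  continuous p -> continuous q -> continuous (fun t : T => p t + q t).
Proof. by move=> cp cq t; apply: cvgD; [exact: cp|exact: cq]. Qed.

Lemma contR_mul (T : topologicalType) (p q : T -> R) :
  continuous p -> continuous q -> continuous (fun t : T => p t * q t).
Proof. by move=> cp cq t; apply: cvgM; [exact: cp|exact: cq]. Qed.

Lemma contR_min (T : topologicalType) (p q : T -> R) :
  continuous p -> continuous q -> continuous (fun t : T => Num.min (p t) (q t)).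
Proof. by move=> cp cq t; exact: (@continuous_min R T p q t (cp t) (cq t)). Qed.

Lemma contR_max (T : topologicalType) (p q : T -> R) :
  continuous p -> continuous q -> continuous (fun t : T => Num.max (p t) (q t)).
Proof. by move=> cp cq t; exact: (@continuous_max R T p q t (cp t) (cq t)). Qed.

Lemma contR_affine x y : continuous (fun t : R => x * t + y).
Proof.
apply: contR_add; last exact: cont_cst.
by apply: contR_mul; [exact: cont_cst|exact: cont_id].
Qed.

Definition clamp x y t := Num.max x (Num.min y t).

Lemma clamp_in x y t : x <= y -> x <= clamp x y t <= y.
Proof. by move=> xy; rewrite /clamp le_max lexx ge_max xy ge_min lexx. Qed.

Lemma clamp_id x y t : x <= t <= y -> clamp x y t = t.
Proof. by case/andP=> xt ty; rewrite /clamp (min_idPr ty) (max_idPr xt). Qed.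

Lemma cont_clamp x y : continuous (clamp x y).
Proof.
apply: contR_max; first exact: cont_cst.
by apply: contR_min; [exact: cont_cst|exact: cont_id].
Qed.

Lemma Log_comp_cont (T : topologicalType) (h : T -> R[i]) :
  continuous h -> (forall t : T, slit (h t)) -> continuous (fun t : T => Log (h t)).
Proof.
by move=> ch sh t; apply: (continuous_comp (ch t)); apply: Log_cont; exact: sh.
Qed.

(* Juxtaposes two paths, the second one being translated to start where the
   first one stops. *)
Definition glue s F G t := F (Num.min t s) + (G (Num.max t s) - G s).

Lemma glue_cont s F G : continuous F -> continuous G -> continuous (glue s F G).
Proof.
move=> cF cG; apply: cont_add.
  by apply: cont_comp cF; apply: contR_min; [exact: cont_id|exact: cont_cst].
apply: cont_sub; last exact: cont_cst.
by apply: cont_comp cG; apply: contR_max; [exact: cont_id|exact: cont_cst].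
Qed.

Lemma glue_le s F G t : t <= s -> glue s F G t = F t.
Proof. by move=> ts; rewrite /glue (min_idPl ts) (max_idPr ts) subrr addr0. Qed.

Lemma glue_ge s F G t : F s = G s -> s <= t -> glue s F G t = G t.
Proof.
by move=> E ts; rewrite /glue (min_idPr ts) (max_idPl ts) E addrC subrK.
Qed.

Lemma log_exists F : continuous F -> (forall t, 0 <= t <= 1 -> F t != 0) ->
  exists2 l, continuous l & forall t, 0 <= t <= 1 -> cexp (l t) = F t.
Proof.
move=> cF F0.
pose Q x y := exists2 l, continuous l & forall t, x <= t <= y -> cexp (l t) = F t.
apply: (@interval_cousin R 0 1 Q ler01) => [x y z _ xy yz _ [l cl hl] [k ck hk]|t0 t01].
  exists (glue y l k); first exact: glue_cont.
  move=> t /andP[xt tz]; have [ty|yt] := leP t y.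
    by rewrite glue_le// hl// xt.
  rewrite /glue (min_idPr (ltW yt)) (max_idPl (ltW yt)) cexpD cexpB.
  rewrite (hl y) ?xy ?lexx// (hk y) ?yz ?lexx// hk ?tz ?(ltW yt)//.
  have [y01|] := boolP (0 <= y <= 1); first by rewrite mulrC divfK// F0.
  by move=> _; rewrite -hk ?lexx//; rewrite mulrC divfK// cexp_neq0.
have n0 : 0 < nm (F t0) by rewrite nm_gt0 F0.
have /continuous_realP/(_ _ n0)[d d0 hd] := cF t0.
exists d => // x y _ xt ty _ dx dy.
have [c hc] := cexp_surj (F0 _ t01).
have xy : x <= y by lra.
have sl t : slit (F (clamp x y t) / F t0).
  apply: slit_near1; have /andP[h1 h2] := clamp_in t xy.
  have -> : F (clamp x y t) / F t0 - 1 = (F (clamp x y t) - F t0) / F t0.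
    by field; exact: F0.
  rewrite nmM nmV ltr_pdivrMr// mul1r; apply: hd; rewrite ltr_norml; lra.
exists (fun t => Log (F (clamp x y t) / F t0) + c).
  have ch := cont_mul (cont_comp (@cont_clamp x y) cF) (@cont_cst R R[i] (F t0)^-1).
  exact: cont_add (Log_comp_cont ch sl) (@cont_cst R R[i] c).
by move=> t xty; rewrite cexpD cexp_Log// hc clamp_id// divfK ?F0.
Qed.

Lemma per_small k : nm (per R k) < 1 -> k = 0.
Proof.
move=> h; have := le_lt_trans (Im_le_nm _) h; rewrite /= normrM.
have p2 : 1 <= `|2 * pi : R|.
  by rewrite ger0_norm; have := pi_ge2 R; lra.
move=> h2; have : `|k%:~R : R| < 1 by have := normr_ge0 (k%:~R : R); nra.
by rewrite -intr_norm -[X in _ < X]/(1%:~R) ltr_int -[X in _ < X]add0r ltzD1 normr_le0 => /eqP.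
Qed.

Lemma log_uniq l l' : continuous l -> continuous l' ->
  (forall t, 0 <= t <= 1 -> cexp (l t) = cexp (l' t)) -> l 1 - l 0 = l' 1 - l' 0.
Proof.
move=> cl cl' h; pose D t := l t - l' t.
have cD : continuous D := cont_sub cl cl'.
suff : D 1 = D 0 by rewrite /D => E; rewrite -(subrK (l' 1) (l 1)) E; ring.
pose Q x y := D y = D x.
apply: (@interval_cousin R 0 1 Q ler01) => [x y z _ _ _ _ E1 E2|t0 t01]; first by rewrite /Q E2.
have Dk t : 0 <= t <= 1 -> exists k, D t = per R k.
  by move=> /h/cexp_inj_mod[k hk]; exists k; rewrite /D hk addrC addKr.
have /continuous_realP/(_ _ ltr01)[d d0 hd] := cD t0.
have loc t : 0 <= t <= 1 -> `|t - t0| < d -> D t = D t0.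
  move=> t01' /hd; have [k ->] := Dk t t01'; have [k' ->] := Dk t0 t01.
  rewrite -perN -perD => /per_small/eqP; rewrite subr_eq0 => /eqP ->//.
exists d => // x y x0 xt ty y1 dx dy.
by rewrite /Q !loc//; [lra|rewrite ltr_norml; lra|lra|rewrite ltr_norml; lra].
Qed.

Definition var F d := exists l, [/\ continuous l,
  forall t, 0 <= t <= 1 -> cexp (l t) = F t & d = l 1 - l 0].

Lemma var_uniq F c d : var F c -> var F d -> c = d.
Proof.
move=> [l [cl hl ->]] [k [ck hk ->]]; apply: log_uniq => // t t01.
by rewrite hl ?hk.
Qed.

Lemma var_exists F : continuous F -> (forall t, 0 <= t <= 1 -> F t != 0) ->
  exists d, var F d.
Proof. by move=> cF F0; have [l cl hl] := log_exists cF F0; exists (l 1 - l 0), l. Qed.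

Lemma var_ext F G d : (forall t, 0 <= t <= 1 -> F t = G t) -> var F d -> var G d.
Proof. by move=> E [l [cl hl ->]]; exists l; split => // t t01; rewrite -E// hl. Qed.

Lemma var_mul F G c d : var F c -> var G d -> var (fun t => F t * G t) (c + d).
Proof.
move=> [l [cl hl ->]] [k [ck hk ->]]; exists (fun t => l t + k t); split.
- exact: (cont_add cl ck).
- by move=> t t01; rewrite cexpD hl ?hk.
- by ring.
Qed.

Lemma var_neq0 F d t : var F d -> 0 <= t <= 1 -> F t != 0.
Proof. by move=> [l [_ hl _]] t01; rewrite -hl// cexp_neq0. Qed.

Lemma var_cst c : c != 0 -> var (fun=> c) 0.
Proof.
by move=> /cexp_surj[z hz]; exists (fun=> z); split => //; [exact: cont_cst|rewrite subrr].
Qed.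

Lemma var_slit F : continuous F -> (forall t, 0 <= t <= 1 -> slit (F t)) ->
  var F (Log (F 1) - Log (F 0)).
Proof.
move=> cF sF; exists (fun t => Log (F (clamp 0 1 t))); split.
- apply: (Log_comp_cont (cont_comp (@cont_clamp 0 1) cF)) => t; apply: sF.
  exact: clamp_in.
- by move=> t t01; rewrite cexp_Log clamp_id// sF.
- by rewrite !clamp_id // ?lexx ?ler01 // lexx ler01.
Qed.

(* The dog-on-a-leash principle. *)
Lemma var_close F G d : continuous F -> continuous G -> F 0 = F 1 -> G 0 = G 1 ->
  (forall t, 0 <= t <= 1 -> nm (G t - F t) < nm (F t)) -> var F d -> var G d.
Proof.
move=> cF cG F01 G01 h vF.
have F0 t := @var_neq0 _ _ t vF.
pose H t := G (clamp 0 1 t) / F (clamp 0 1 t).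
have ci t := @clamp_in 0 1 t ler01.
have cc := @cont_clamp 0 1.
have cH : continuous H.
  apply: (cont_mul (cont_comp cc cG)).
  by apply: (cont_inv (cont_comp cc cF)) => t; apply: F0; exact: ci.
have sH t : 0 <= t <= 1 -> slit (H t).
  move=> _; apply: slit_near1; have Fn := F0 _ (ci t).
  have -> : H t - 1 = (G (clamp 0 1 t) - F (clamp 0 1 t)) / F (clamp 0 1 t).
    by rewrite /H; field.
  by rewrite nmM nmV ltr_pdivrMr ?nm_gt0// mul1r h// ci.
have := var_mul vF (var_slit cH sH).
have -> : H 1 = H 0 by rewrite /H !clamp_id ?lexx ?ler01// F01 G01.
rewrite subrr addr0; apply: var_ext => t t01.
by rewrite /H clamp_id// mulrC divfK// F0.
Qed.

Definition wnd L z d := var (fun t => L t - z) d.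

Definition inner L z := (forall t, 0 <= t <= 1 -> L t != z) /\ ~ wnd L z 0.

Lemma path_dist_pos L z : continuous L -> (forall t, 0 <= t <= 1 -> L t != z) ->
  exists2 r, 0 < r & forall t, 0 <= t <= 1 -> r <= nm (L t - z).
Proof.
move=> cL Lz.
have [t0 t01 h] := @EVT_min R (fun t => nm (L t - z)) 0 1 ler01 (continuous_subspaceT
  (cont_comp (cont_sub cL (@cont_cst R R[i] z)) (@continuous_nm R))).
exists (nm (L t0 - z)); first by rewrite nm_gt0 subr_eq0 Lz.
by move=> t t01'; apply: h; rewrite in_itv.
Qed.

Lemma path_bounded L : continuous L -> exists M, forall t, 0 <= t <= 1 -> nm (L t) <= M.
Proof.
move=> cL.
have [t0 t01 h] := @EVT_max R (fun t => nm (L t)) 0 1 ler01 (continuous_subspaceT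
  (cont_comp cL (@continuous_nm R))).
by exists (nm (L t0)) => t t01'; apply: h; rewrite in_itv.
Qed.

Variable L : R -> R[i].
Hypotheses (cL : continuous L) (L01 : L 0 = L 1).

Lemma wnd_near z z' r d : (forall t, 0 <= t <= 1 -> r <= nm (L t - z)) ->
  nm (z' - z) < r -> wnd L z d -> wnd L z' d.
Proof.
move=> hr zz; apply: var_close.
- exact: (cont_sub cL (@cont_cst R R[i] z)).
- exact: (cont_sub cL (@cont_cst R R[i] z')).
- by rewrite L01.
- by rewrite L01.
move=> t t01; have -> : L t - z' - (L t - z) = - (z' - z) by ring.
by rewrite nmN (lt_le_trans zz)// hr.
Qed.

Lemma status_near z : (forall t, 0 <= t <= 1 -> L t != z) ->
  exists2 r, 0 < r & forall z', nm (z' - z) < r -> inner L z' <-> inner L z.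
Proof.
move=> Lz; have [r r0 hr] := path_dist_pos cL Lz.
exists r => // z' zz.
have Lz' t : 0 <= t <= 1 -> L t != z'.
  by move=> /hr h; apply: contraTneq h => ->; rewrite -ltNge.
have [d hd] : exists d, wnd L z d.
  apply: var_exists; first exact: (cont_sub cL (@cont_cst R R[i] z)).
  by move=> t /Lz; rewrite subr_eq0.
have hd' := wnd_near hr zz hd.
split=> -[_ h]; split => // h0; apply: h.
  by rewrite (var_uniq h0 hd).
by rewrite (var_uniq h0 hd').
Qed.

Lemma inner_open z : inner L z -> exists2 r, 0 < r & forall z', nm (z' - z) < r -> inner L z'.
Proof.
by move=> iz; have [r r0 h] := status_near iz.1; exists r => // z' /h[_]; apply.
Qed.

Lemma wnd_far z : (forall t, 0 <= t <= 1 -> nm (L t) < nm z) -> wnd L z 0.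
Proof.
move=> h; have z0 : z != 0.
  by rewrite -nm_gt0; apply: le_lt_trans (h 0 _); rewrite ?nm_ge0// lexx ler01.
have nz0 : - z != 0 by rewrite oppr_eq0.
apply: (var_close (F := fun=> - z)); [exact: cont_cst| |by []|by rewrite L01| |exact: var_cst].
  exact: (cont_sub cL (@cont_cst R R[i] z)).
by move=> t t01; rewrite opprK subrK nmN h.
Qed.

Lemma inner_bounded : exists M, forall z, inner L z -> nm z <= M.
Proof.
have [M hM] := path_bounded cL; exists M => z [_ iz]; rewrite leNgt; apply/negP => h.
by apply: iz; apply: wnd_far => t t01; exact: le_lt_trans (hM t t01) h.
Qed.

Lemma inner_boundary z : closure (inner L) z -> ~ inner L z ->
  exists2 t, 0 <= t <= 1 & L t = z.
Proof.
move=> cz nz; apply: contrapT => hn.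
have Lz t : 0 <= t <= 1 -> L t != z by move=> t01; apply/negP => /eqP E; apply: hn; exists t.
have [r r0 h] := status_near Lz; apply: nz.
have [|v [iv vr]] := cz [set v | nm (v - z) < r]; first by apply/nbhs_nm; exists r.
exact: (h v vr).1.
Qed.

Lemma inner_max f M z : holo f -> noncst f ->
  (forall t, 0 <= t <= 1 -> nm (f (L t)) <= M) -> inner L z -> nm (f z) <= M.
Proof.
move=> hf nf hM; have [M0 hM0] := inner_bounded.
apply: (max_principle hf nf _ hM0) => [|u cu nu].
  rewrite openE => v /inner_open[r r0 h]; apply/nbhs_nm; by exists r.
by have [t t01 <-] := inner_boundary cu nu; exact: hM.
Qed.

Lemma inner_path Z : continuous Z ->
  (forall s t, 0 <= s <= 1 -> 0 <= t <= 1 -> L t != Z s) ->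
  inner L (Z 0) -> inner L (Z 1).
Proof.
move=> cZ ZL; pose Q x y := inner L (Z x) -> inner L (Z y).
apply: (@interval_cousin R 0 1 Q ler01) => [x y z _ _ _ _ h1 h2 /h1/h2//|s s01].
have [r r0 h] := status_near (fun t => ZL s t s01).
have /continuous_realP/(_ _ r0)[d d0 hd] := cZ s.
exists d => // x y _ xs sy _ dx dy; rewrite /Q => /(h _ (hd x _)).1 i.
apply: (h _ (hd y _)).2; first by rewrite ltr_norml; lra.
by apply: i; rewrite ltr_norml; lra.
Qed.

Lemma var_zero_free g M : holo g -> (forall t, 0 <= t <= 1 -> nm (L t) <= M) ->
  (forall z, nm z <= M -> g z != 0) -> var (fun t => g (L t)) 0.
Proof.
move=> hg LM g0; have cg := holo_cont hg.
have M0 : 0 <= M by apply: le_trans (LM 0 _); rewrite ?nm_ge0// lexx ler01.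
have [p pM hp] := @ball_attains_min R 0 M _ M0 (cont_comp cg (@continuous_nm R)).
rewrite subr0 in pM.
have m0 : 0 < nm (g p) by rewrite nm_gt0 g0.
have [d d0 hd] := @unif_cont R g M _ cg m0.
pose G s t := g (s%:C * L t).
have cG s : continuous (G s).
  exact: (cont_comp (cont_mul (@cont_cst R R[i] s%:C) cL) cg).
pose Q x y := var (G x) 0 -> var (G y) 0.
have : Q 0 1.
  apply: (@interval_cousin R 0 1 Q ler01) => [x y z _ _ _ _ h1 h2 /h1/h2//|s s01].
  exists (d / (2 * (M + 1))); first by rewrite divr_gt0// mulr_gt0//; lra.
  move=> x y x0 xs sy y1 dx dy; apply: (@var_close (G x) (G y) 0 (cG x) (cG y)); rewrite /G ?L01// => t t01.
  have xM : nm (x%:C * L t) <= M.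
    rewrite nmM nmC ger0_norm//; apply: le_trans (LM t t01).
    by have := nm_ge0 (L t); have : x <= 1 by [clear - xs sy y1; lra]; clear; nra.
  apply: (@lt_le_trans _ _ (nm (g p))); last by apply: hp; rewrite subr0.
  apply: hd => //; rewrite -mulrBl -rmorphB /= nmM nmC ger0_norm ?subr_ge0; last by lra.
  have yx : y - x < d / (M + 1).
    have -> : d / (M + 1) = d / (2 * (M + 1)) + d / (2 * (M + 1)) by field; rewrite gt_eqF//; lra.
    by lra.
  move: yx; rewrite ltr_pdivlMr; last by lra.
  have := LM t t01; have := nm_ge0 (L t); have : 0 <= y - x by [clear - xs sy; lra]; clear; nra.
rewrite /Q /G => h; have {}h : var (fun t => g (1%:C * L t)) 0.
  apply: h; apply: (var_ext (F := fun=> g 0)) => [t _|]; first by rewrite rmorph0 mul0r.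
  by apply: var_cst; apply: g0; rewrite nm0.
by apply: var_ext h => t _; rewrite rmorph1 mul1r.
Qed.

Lemma arg_principle f w d : holo f -> noncst f ->
  var (fun t => f (L t) - w) d -> d <> 0 -> exists2 z, inner L z & f z = w.
Proof.
move=> hf nf vd d0; apply: contrapT => hn.
have [M hM] := path_bounded cL.
have [s [g [hg fg sM g0]]] := factor_zeros M (holo_sub hf (holo_cst w)) (noncst_sub w nf).
have key (s' : seq R[i]) : {subset s' <= s} -> var (fun t => \prod_(a <- s') (L t - a)) 0.
  elim: s' => [|a s' IH] ss.
    apply: (var_ext (F := fun=> 1)) => [t _|]; first by rewrite big_nil.
    by apply: var_cst; exact: oner_neq0.
  have as_ : a \in s by apply: ss; rewrite mem_head.
  have fa : f a = w.
    apply/eqP; rewrite -subr_eq0 fg (big_rem a as_) /= subrr mul0r mul0r//.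
  have La : wnd L a 0.
    apply: contrapT => h; apply: hn; exists a => //; split => // t t01.
    apply/negP => /eqP E; move: (var_neq0 vd t01).
    by rewrite E fa subrr eqxx.
  have := var_mul La (IH (fun b bs => ss b ltac:(by rewrite inE bs orbT))).
  by rewrite addr0; apply: var_ext => t _; rewrite big_cons.
have := var_mul (key s (fun _ h => h)) (var_zero_free hg hM g0); rewrite addr0 => v0.
apply: d0; apply: (var_uniq vd); apply: var_ext v0 => t _.
by rewrite -fg.
Qed.

End Winding.

(** * Lifting paths through an entire function *)

Section Lifts.
Variable R : realType.
Implicit Types (z w u a b c d : R[i]) (x y t s r e M S T B : R).
Implicit Types (W Z : R -> R[i]).
Variable f : R[i] -> R[i].
Hypotheses (hf : holo f) (nf : noncst f).

Lemma contR_opp (U : topologicalType) (p : U -> R) :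
  continuous p -> continuous (fun t : U => - p t).
Proof. by move=> cp t; apply: cvgN; exact: cp. Qed.

Let cf : continuous f := holo_cont hf.

Lemma circle_attains_min c r (v : R[i] -> R) : 0 <= r -> continuous v ->
  exists2 p, nm (p - c) = r & forall z, nm (z - c) = r -> v p <= v z.
Proof.
move=> r0 cv; pose K := [set z | nm (z - c) <= r] `&` [set z | - nm (z - c) <= - r].
have cn : continuous (fun z => nm (z - c)).
  exact: (cont_comp (cont_sub (@cont_id _) (@cont_cst _ _ c)) (@continuous_nm R)).
have cK : compact K.
  apply: (subclosed_compact _ (@compact_ball_le R c r)); last by move=> z [].
  apply: closedI; first exact: closed_nm_le.
  exact: (closed_le_fun (contR_opp cn)).
have [|p [/= p1 p2] hp] := compact_attains_min _ cK cv.
  by exists (c + r%:C); rewrite /K /= (addrC c) addrK nmC ger0_norm.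
exists p; first by lra.
by move=> z zr; apply: hp; rewrite /K /= zr.
Qed.

Lemma two_preimages c e : dz f c = 0 -> 0 < e -> exists2 d, 0 < d &
  forall w, w != f c -> nm (w - f c) < d -> exists z1 z2,
   [/\ z1 != z2, nm (z1 - c) < e, nm (z2 - c) < e, f z1 = w & f z2 = w].
Proof.
move=> dc e0.
have [z1 fz1] : exists z, dz f z != 0.
  apply: contrapT => hn.
  have h0 z : cder f z 0.
    rewrite -(_ : dz f z = 0); first exact: holo_dz.
    by apply/eqP; apply: contrapT => /negP h; apply: hn; exists z.
  have [z] := nf (f c); rewrite (der0_cst h0 z c) eqxx//.
have [m [g [hg gc fg]]] := vanish_order c (holo_dz_holo hf) (ex_intro _ z1 fz1).
have n0 : 0 < nm (g c) by rewrite nm_gt0.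
have /continuous_epsP/(_ _ n0)[d1 d10 hd1] := @holo_cont R g hg c.
have reg z : nm (z - c) < d1 -> z != c -> dz f z != 0.
  move=> zd zc; rewrite fg mulf_neq0 ?expf_neq0 ?subr_eq0//.
  by have := hd1 z zd; apply: contraTneq => ->; rewrite sub0r nmN ltxx.
have [e1 e10 iso] := isolated_value c (f c) hf nf.
pose rho := Num.min (e / 2) (Num.min (d1 / 2) e1).
have rho0 : 0 < rho by rewrite !lt_min !divr_gt0.
have [re rd r1] : [/\ rho <= e / 2, rho <= d1 / 2 & rho <= e1].
  by rewrite !ge_min !lexx !orbT.
have cv : continuous (fun z => nm (f z - f c)).
  exact: (cont_comp (cont_sub cf (@cont_cst _ _ (f c))) (@continuous_nm R)).
have [p pr hp] := circle_attains_min c (ltW rho0) cv.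
set mu := nm (f p - f c) in hp.
have mu0 : 0 < mu.
  rewrite nm_gt0 subr_eq0 iso//; first by rewrite pr.
  by rewrite -subr_eq0 -nm_eq0 pr gt_eqF.
have eps0 : 0 < mu / (8 * rho) by rewrite divr_gt0// mulr_gt0.
have hd0 := holo_dz c hf; rewrite dc in hd0.
have [s s0 hs] := hd0 _ eps0.
pose rho1 := Num.min (s / 2) (rho / 2).
have rho10 : 0 < rho1 by rewrite lt_min !divr_gt0.
have [rs rr] : rho1 <= s / 2 /\ rho1 <= rho / 2 by rewrite !ge_min !lexx orbT.
have [q qr hq] := circle_attains_min c (ltW rho10) cv.
set nu := nm (f q - f c) in hq.
have nu0 : 0 < nu.
  rewrite nm_gt0 subr_eq0 iso//; first by rewrite qr; clear - r1 rho10 rr; lra.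
  by rewrite -subr_eq0 -nm_eq0 qr gt_eqF.
exists (Num.min (mu / 2) (nu / 2)); first by rewrite lt_min !divr_gt0.
move=> w wc; rewrite lt_min => /andP[wm wn].
have [|z2 z2r fz2] := @value_in_ball R f c w rho1 hf nf rho10.
  by move=> z zr; have := hq z zr; have := nm_sub_trans w (f z) (f c); rewrite (nmB (f c)); clear - wn; lra.
have hz2 := hs z2 ltac:(clear - rho10 rs z2r; lra); rewrite mul0r subr0 in hz2.
have z2c : z2 != c by apply: contraNneq wc => E; rewrite -fz2 E.
have z2c0 : 0 < nm (z2 - c) by rewrite nm_gt0 subr_eq0.
have nq : noncst (quo f z2).
  move=> k; apply: contrapT => hk.
  have hk' z : quo f z2 z = k by apply/eqP; apply: contrapT => /negP h; apply: hk; exists z.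
  have E z : f z = f z2 + (z - z2) * k by rewrite {1}(quoE f z2 z) hk'.
  have dk z : dz f z = k.
    apply: dz_eq; apply: (cder_ext (f := fun z => f z2 + k * (z - z2))) => [u|].
      by rewrite [RHS]E mulrC.
    apply: (cder_eqd (cder_add (cder_cst (f z2) z) (cder_scale k (cder_sub (cder_id z) (cder_cst z2 z))))).
    by rewrite subr0 mulr1 add0r.
  by move: (reg z2 ltac:(clear - rd rho10 rr z2r; lra) z2c); rewrite dk -(dk c) dc eqxx.
have [|z3 z3r fz3] := @value_in_ball R (quo f z2) c 0 rho (holo_quo z2 hf) nq rho0.
  move=> z zr; rewrite !subr0.
  have zz2 : z != z2.
    by apply/negP => /eqP E; move: z2r; rewrite -E zr; lra.
  have k1 : nm (quo f z2 c) <= mu / (8 * rho).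
    rewrite /quo eq_sym (negbTE z2c) nmM nmV (nmB (f c)) (nmB c) ler_pdivrMr//.
  have k2 : mu / (4 * rho) <= nm (quo f z2 z).
    rewrite /quo (negbTE zz2) nmM nmV.
    have z2z : nm (z - z2) <= 2 * rho.
      by have := nm_sub_trans c z z2; rewrite (nmB c); clear - rr z2r z2c0 zr; lra.
    have z2z0 : 0 < nm (z - z2) by rewrite nm_gt0 subr_eq0.
    have fm : mu / 2 <= nm (f z - f z2).
      by have := hp z zr; have := nm_sub_trans w (f z) (f c); rewrite fz2; clear - wm; lra.
    rewrite ler_pdivlMr//; apply: le_trans fm.
    rewrite mulrAC ler_pdivrMr; last by rewrite mulr_gt0.
    by clear - mu0 z2z; nra.
  have : mu / (4 * rho) = mu / (8 * rho) + mu / (8 * rho) by field; rewrite gt_eqF.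
  by clear - eps0 k1 k2; lra.
exists z2, z3; split => //; [|clear - rho0 re rr z2r; lra|clear - rho0 re z3r; lra|].
  have dz2 := reg z2 ltac:(clear - rho0 rd rr z2r; lra) z2c; apply: contraTneq dz2 => E.
  by rewrite -{1}E in fz3; rewrite /quo eqxx in fz3; rewrite fz3 eqxx.
by rewrite (quoE f z2 z3) fz3 mulr0 addr0.
Qed.

Definition lift W T Z := continuous Z /\
  forall t, 0 <= t <= T -> f (Z t) = W t /\ dz f (Z t) != 0.

Definition reach W T z u := exists Z, [/\ lift W T Z, Z 0 = z & Z T = u].

Lemma lift_uniq W T Z Z' : 0 <= T -> lift W T Z -> lift W T Z' -> Z 0 = Z' 0 ->
  forall t, 0 <= t <= T -> Z t = Z' t.
Proof.
move=> T0 [cZ hZ] [cZ' hZ'] E0.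
pose Q x y := (exists2 t, x <= t <= y & Z t = Z' t) -> forall t, x <= t <= y -> Z t = Z' t.
have : Q 0 T; last by apply; exists 0; rewrite // lexx.
apply: (interval_cousin T0) => [x y z _ xy yz _ h1 h2 [t0 t0xz E]|t0 t0T].
  have Ey : Z y = Z' y.
    have [t0y|yt0] := leP t0 y.
      by apply: h1; [exists t0; rewrite // t0y andbT; lra|rewrite xy lexx].
    by apply: h2; [exists t0; rewrite // ltW//=; lra|rewrite lexx yz].
  move=> t txz; have [ty|yt] := leP t y.
    by apply: h1; [exists y; rewrite // xy lexx|rewrite ty andbT; lra].
  by apply: h2; [exists y; rewrite // lexx yz|rewrite (ltW yt) /=; lra].
have [E|E] := eqVneq (Z t0) (Z' t0).
  have [r [M [r0 M0 _ inj]]] := good_exists hf (hZ t0 t0T).2.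
  have /continuous_realP/(_ _ r0)[d1 d10 h1] := cZ t0.
  have /continuous_realP/(_ _ r0)[d2 d20 h2] := cZ' t0.
  exists (Num.min d1 d2); first by rewrite lt_min d10.
  have [m1 m2] : Num.min d1 d2 <= d1 /\ Num.min d1 d2 <= d2 by rewrite !ge_min !lexx orbT.
  move=> x y x0 xt ty yT dx dy _ t /andP[xt' ty'].
  rewrite -E in h2.
  have := inj (Z t) (Z' t) (h1 t ltac:(rewrite ltr_norml; lra)) (h2 t ltac:(rewrite ltr_norml; lra)).
  rewrite (hZ t ltac:(lra)).1 (hZ' t ltac:(lra)).1 subrr nm0 mulr0 => h.
  by apply/eqP; rewrite -subr_eq0 -nm_eq0 eq_le nm_ge0 andbT.
have n0 : 0 < nm (Z t0 - Z' t0) / 2 by rewrite divr_gt0// nm_gt0 subr_eq0.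
have /continuous_realP/(_ _ n0)[d1 d10 h1] := cZ t0.
have /continuous_realP/(_ _ n0)[d2 d20 h2] := cZ' t0.
exists (Num.min d1 d2); first by rewrite lt_min d10.
have [m1 m2] : Num.min d1 d2 <= d1 /\ Num.min d1 d2 <= d2 by rewrite !ge_min !lexx orbT.
move=> x y x0 xt ty yT dx dy [t /andP[xt' ty'] E2].
have := h1 t ltac:(rewrite ltr_norml; clear - m1 dx dy xt' ty'; lra); have := h2 t ltac:(rewrite ltr_norml; clear - m2 dx dy xt' ty'; lra).
have := nm_sub_trans (Z t) (Z t0) (Z' t0); rewrite (nmB (Z t0) (Z t)) E2; clear; lra.
Qed.

Lemma good_mono c r M r' M' : good f c r M -> 0 < r' -> r' <= r -> M <= M' -> good f c r' M'.
Proof.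
case=> r0 M0 h1 h2 r'0 rr MM; split => //; first by lra.
  by move=> z zc; apply: h1; lra.
move=> z w zc wc; apply: (le_trans (h2 z w _ _)); [lra|lra|].
by rewrite ler_wpM2r ?nm_ge0.
Qed.

Lemma lift_good W T Z : 0 <= T -> lift W T Z ->
  exists r M, forall t, 0 <= t <= T -> good f (Z t) r M.
Proof.
move=> T0 [cZ hZ]; pose Q x y := exists r M, forall t, x <= t <= y -> good f (Z t) r M.
apply: (@interval_cousin R 0 T Q T0) => [x y z _ xy yz _ [r1 [M1 h1]] [r2 [M2 h2]]|t0 t0T].
  have [r10 _ _ _] := h1 x ltac:(by rewrite lexx xy).
  have [r20 _ _ _] := h2 y ltac:(by rewrite lexx yz).
  exists (Num.min r1 r2), (Num.max M1 M2) => t /andP[xt tz].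
  have [ty|yt] := leP t y.
    apply: (good_mono (h1 t _)); first by rewrite xt ty.
    - by rewrite lt_min r10.
    - by rewrite ge_min lexx.
    - by rewrite le_max lexx.
  apply: (good_mono (h2 t _)); first by rewrite (ltW yt) tz.
  - by rewrite lt_min r10.
  - by rewrite ge_min lexx orbT.
  - by rewrite le_max lexx orbT.
have [r [M g]] := good_exists hf (hZ t0 t0T).2.
have [r0 _ _ _] := g.
have r2 : 0 < r / 2 by rewrite divr_gt0.
have /continuous_realP/(_ _ r2)[d d0 hd] := cZ t0.
exists d => // x y _ xt ty _ dx dy; exists (r / 2), M => t /andP[xt' ty'].
apply: (goodS g) => //; have := hd t ltac:(rewrite ltr_norml; lra); lra.
Qed.

Lemma lift_perturb W Z T r M : continuous Z -> 0 <= T ->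
  (forall t, 0 <= t <= T -> good f (Z t) r M) -> continuous W ->
  (forall t, 0 <= t <= T -> nm (W t - f (Z t)) < r / (4 * M)) ->
  exists2 Z1, lift W T Z1 & forall t, 0 <= t <= T -> nm (Z1 t - Z t) < r / 2.
Proof.
move=> cZ T0 gZ cW hW.
have [r0 M0 _ _] := gZ 0 ltac:(by rewrite lexx).
have r2 : 0 < r / 2 by rewrite divr_gt0.
have ct t := @clamp_in R 0 T t T0.
have ex t : exists z, nm (z - Z (clamp 0 T t)) < r / 2 /\ f z = W (clamp 0 T t).
  have [|//|z h1 h2] := good_onto (r' := r / 2) (w := W (clamp 0 T t)) hf nf (gZ _ (ct t)) r2; last by exists z.
    by lra.
  by rewrite (_ : r / 2 / (2 * M) = r / (4 * M)) ?hW// ; field; rewrite gt_eqF.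
have [Z1 hZ1] := choice ex.
exists Z1; last by move=> t tT; have := (hZ1 t).1; rewrite clamp_id.
split; last first.
  move=> t tT; have [h1 h2] := hZ1 t; rewrite clamp_id// in h1 h2; split => //.
  by have [_ _ h _] := gZ t tT; apply: h; lra.
have cc := @cont_clamp R 0 T.
move=> t0; apply/continuous_realP => e e0.
have eM : 0 < e / M by rewrite divr_gt0.
have c1 : continuous (fun t => Z (clamp 0 T t)) := cont_comp cc cZ.
have c2 : continuous (fun t => W (clamp 0 T t)) := cont_comp cc cW.
have /continuous_realP/(_ _ r2)[d1 d10 h1] := c1 t0.
have /continuous_realP/(_ _ eM)[d2 d20 h2] := c2 t0.
exists (Num.min d1 d2); first by rewrite lt_min d10.
move=> t; rewrite lt_min => /andP[/h1 k1 /h2 k2].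
have [a1 b1] := hZ1 t; have [a2 b2] := hZ1 t0.
have [_ _ _ inj] := gZ _ (ct t0).
have := inj (Z1 t) (Z1 t0) ltac:(have := nm_sub_trans (Z (clamp 0 T t)) (Z1 t) (Z (clamp 0 T t0)); clear - k1 a1; lra) ltac:(clear - r2 a2; lra).
rewrite b1 b2 => h; apply: (le_lt_trans h).
by rewrite mulrC -ltr_pdivlMr.
Qed.

Lemma lift_sub W T Z T' : lift W T Z -> T' <= T -> lift W T' Z.
Proof. by move=> [cZ h] TT; split => // t /andP[t0 tT]; apply: h; rewrite t0 (le_trans tT). Qed.

Lemma reach_uniq W T z u u' : 0 <= T -> reach W T z u -> reach W T z u' -> u = u'.
Proof.
move=> T0 [Z [lZ Z0 <-]] [Z' [lZ' Z0' <-]].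
by apply: (lift_uniq T0 lZ lZ'); rewrite ?Z0 ?Z0'// T0 lexx.
Qed.

Lemma reach_val W T z u : 0 <= T -> reach W T z u -> f u = W T /\ dz f u != 0.
Proof. by move=> T0 [Z [[_ h] _ <-]]; apply: h; rewrite T0 lexx. Qed.

Lemma reach0 W z : f z = W 0 -> dz f z != 0 -> reach W 0 z z.
Proof.
move=> E d0; exists (fun=> z); split => //; split; first exact: cont_cst.
by move=> t t0; have -> : t = 0 by lra.
Qed.

Lemma reach_trans W T S z u v : 0 <= T -> 0 <= S -> reach W T z u ->
  reach (fun t => W (T + t)) S u v -> reach W (T + S) z v.
Proof.
move=> T0 S0 [Z [[cZ hZ] Z0 ZT]] [Y [[cY hY] Y0 YS]].
have cY' : continuous (fun t => Y (1 * t + - T)) := cont_comp (@contR_affine R 1 (- T)) cY.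
have E : Z T = Y (1 * T + - T) by rewrite mul1r subrr ZT Y0.
exists (glue T Z (fun t => Y (1 * t + - T))); split.
- split; first exact: glue_cont.
  move=> t /andP[t0 tTS]; have [tT|Tt] := leP t T.
    by rewrite glue_le//; apply: hZ; rewrite t0.
  rewrite glue_ge ?(ltW Tt)// mul1r.
  have := hY (t - T) ltac:(lra); rewrite (_ : T + (t - T) = t) //; ring.
- by rewrite glue_le.
- by rewrite glue_ge// ?lerDl// mul1r addrAC subrr add0r.
Qed.

Lemma reach_sub W T S z u : 0 <= S -> S <= T -> reach W T z u ->
  exists u', reach W S z u' /\ reach (fun t => W (S + t)) (T - S) u' u.
Proof.
move=> S0 ST [Z [lZ Z0 ZT]]; exists (Z S); split.
  by exists Z; split => //; exact: lift_sub ST.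
have [cZ hZ] := lZ.
exists (fun t => Z (1 * t + S)); split.
- split; first exact: (cont_comp (@contR_affine R 1 S) cZ).
  move=> t /andP[t0 tT]; rewrite mul1r (addrC t); apply: hZ; lra.
- by rewrite mulr0 add0r.
- by rewrite mul1r subrK.
Qed.

Lemma reach_scale W e T z u : 0 < e -> reach W (e * T) z u -> reach (fun t => W (e * t)) T z u.
Proof.
move=> c0 [Z [[cZ hZ] Z0 ZT]]; exists (fun t => Z (e * t + 0)); split.
- split; first exact: (cont_comp (@contR_affine R e 0) cZ).
  move=> t /andP[t0 tT]; rewrite addr0; apply: hZ.
  by rewrite mulr_ge0 ?(ltW c0)//= ler_pM2l.
- by rewrite mulr0 addr0.
- by rewrite addr0.
Qed.

Lemma reach_rev W T z u : reach W T z u -> reach (fun t => W (T - t)) T u z.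
Proof.
move=> [Z [[cZ hZ] Z0 ZT]]; exists (fun t => Z (-1 * t + T)); split.
- split; first exact: (cont_comp (@contR_affine R (-1) T) cZ).
  move=> t /andP[t0 tT]; rewrite mulN1r (addrC _ T); apply: hZ; lra.
- by rewrite mulr0 add0r.
- by rewrite mulN1r addNr.
Qed.

Lemma reach_ext W W' T z u : (forall t, 0 <= t <= T -> W t = W' t) ->
  reach W T z u -> reach W' T z u.
Proof.
move=> E [Z [[cZ hZ] Z0 ZT]]; exists Z; split => //; split => // t tT.
by rewrite -E//; exact: hZ.
Qed.

Lemma local_lift c : dz f c != 0 -> exists r e, [/\ 0 < r, 0 < e &
  forall z W T, 0 <= T -> nm (z - c) < r -> f z = W 0 -> continuous W ->
   (forall t, 0 <= t <= T -> nm (W t - f c) < e) ->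
   exists2 u, reach W T z u & nm (u - c) < r].
Proof.
move=> dc; have [r [M g]] := good_exists hf dc; have [r0 M0 h1 inj] := g.
exists r, (r / (4 * M)); split => //; first by rewrite divr_gt0// mulr_gt0.
move=> z W T T0 zc fz cW hW.
have [Z1 lZ1 nZ] := lift_perturb (@cont_cst R R[i] c) T0 (fun t _ => g) cW hW.
exists (Z1 T); last by have := nZ T ltac:(by rewrite T0 lexx); lra.
exists Z1; split => //.
have h00 : (0 : R) <= 0 <= T by rewrite lexx T0.
apply/eqP; rewrite -subr_eq0 -nm_eq0 eq_le nm_ge0 andbT.
have := inj (Z1 0) z ltac:(have := nZ 0 h00; lra) zc.
by rewrite (lZ1.2 0 h00).1 fz subrr nm0 mulr0.
Qed.

Definition escapes W S z := forall B, exists t u, [/\ 0 <= t, t < S, reach W t z u & B < nm u].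

Definition hits_critical W S z := exists c, [/\ dz f c = 0, f c = W S &
  forall e, 0 < e -> exists2 d, 0 < d & forall t u, 0 <= t -> t < S -> S - d < t ->
    reach W t z u -> nm (u - c) < e].

Lemma lift_or_blocked W T z : continuous W -> 0 <= T -> f z = W 0 -> dz f z != 0 ->
  (exists u, reach W T z u) \/
  exists S, [/\ 0 < S, S <= T, forall t, 0 <= t -> t < S -> exists u, reach W t z u,
    ~ exists u, reach W S z u & escapes W S z \/ hits_critical W S z].
Proof.
move=> cW T0 fz dz0.
have [hT|hT] := pselect (exists u, reach W T z u); [by left|right].
pose A := [set t | 0 <= t <= T /\ exists u, reach W t z u].
have A0 : A 0 by split; [rewrite lexx|exists z; exact: reach0].
have sA : has_sup A by split; [exists 0|exists T => t [/andP[]]].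
pose S := sup A.
have ubS t : A t -> t <= S by move=> At; apply: sup_ubound => //; exact: sA.2.
have S0 : 0 <= S := ubS 0 A0.
have ST : S <= T by apply: sup_le_ub; [exists 0|move=> t [/andP[]]].
have dn t t' u : 0 <= t' -> t' <= t -> reach W t z u -> exists u, reach W t' z u.
  by move=> h1 h2 h3; have [u' [h _]] := reach_sub h1 h2 h3; exists u'.
have below t : 0 <= t -> t < S -> exists u, reach W t z u.
  move=> t0 tS; have [s [_ [u hu]] ts] := sup_adherent (ltac:(by rewrite subr_gt0) : 0 < S - t) sA.
  by apply: (dn s t u) => //; move: ts; rewrite -/S; lra.
have ext t u : 0 <= t -> t < T -> reach W t z u -> exists2 t', t < t' & A t'.
  move=> t0 tT hu; have [fu du] := reach_val t0 hu.
  have [r [e [r0 e0 h]]] := local_lift du.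
  have /continuous_realP/(_ _ e0)[d d0 hd] := cW t.
  pose q := Num.min (d / 2) (T - t).
  have q0 : 0 < q by rewrite lt_min divr_gt0// subr_gt0.
  have [qd qT] : q <= d / 2 /\ q <= T - t by rewrite !ge_min !lexx orbT.
  have cW' : continuous (fun x => W (t + x)).
    by apply: cont_comp cW; apply: contR_add; [exact: cont_cst|exact: cont_id].
  have [|||u' hu' _] := h u (fun x => W (t + x)) q (ltW q0) _ _ cW' _.
  - by rewrite subrr nm0.
  - by rewrite addr0 fu.
  - move=> x /andP[x0 xq]; rewrite fu; apply: hd.
    by rewrite (addrC t) addrK ger0_norm//; lra.
  exists (t + q); first by lra.
  split; first by lra.
  by exists u'; apply: reach_trans hu'; rewrite ?(ltW q0).
have nS : ~ exists u, reach W S z u.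
  move=> [u hu]; have [E|SltT] := eqVneq S T; first by apply: hT; rewrite -E; exists u.
  have [|t' St' At'] := ext S u S0 _ hu; first by rewrite lt_neqAle SltT.
  by have := ubS t' At'; lra.
have Spos : 0 < S.
  rewrite lt_neqAle S0 andbT; apply/negP => /eqP E; apply: nS; rewrite -E.
  by exists z; exact: reach0.
exists S; split => //.
have [he|he] := pselect (escapes W S z); [by left|right].
have [B hB] : exists B, forall t u, 0 <= t -> t < S -> reach W t z u -> nm u <= B.
  apply: contrapT => hn; apply: he => B; apply: contrapT => hn'; apply: hn.
  exists B => t u t0 tS hu; rewrite leNgt; apply/negP => Bu; apply: hn'.
  by exists t, u.
pose tn n := S - S / 2 ^+ n.
have q1 n : 0 < S / 2 ^+ n /\ S / 2 ^+ n <= S.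
  split; first by rewrite divr_gt0 ?exprn_gt0.
  by rewrite ler_pdivrMr ?exprn_gt0// ler_peMr// exprn_ege1// ler1n.
have ex n : exists u, reach W (tn n) z u by apply: below; rewrite /tn; have := q1 n; lra.
have [un hun] := choice ex.
have [|c hc] := @bounded_cluster R un B.
  by move=> n; apply: (hB (tn n)) (hun n); rewrite /tn; have := q1 n; lra.
have tnS e : 0 < e -> exists N, forall m, (N <= m)%N -> S - e < tn m.
  move=> d0; have [N hN] := expn2_small (divr_gt0 d0 Spos); exists N => m Nm.
  have : 1 / 2 ^+ m <= 1 / 2 ^+ N :> R.
    by rewrite !mul1r lef_pV2 ?posrE ?exprn_gt0// ler_eXn2l// ltr1n.
  move: hN; rewrite ltr_pdivlMr// => hN h; rewrite /tn.
  have : S / 2 ^+ m = 1 / 2 ^+ m * S by rewrite mul1r mulrC.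
  by nra.
have fc : f c = W S.
  apply/eqP; rewrite -subr_eq0; apply/eqP; apply: nm_small0 => e e0.
  have e2 : 0 < e / 2 by rewrite divr_gt0.
  have /continuous_epsP/(_ _ e2)[d1 d10 h1] := @holo_cont R f hf c.
  have /continuous_realP/(_ _ e2)[d2 d20 h2] := cW S.
  have [N hN] := tnS d2 d20.
  have [m Nm hm] := hc _ d10 N.
  have := h1 _ hm; rewrite (reach_val _ (hun m)).1; last by rewrite /tn; have := q1 m; lra.
  have := h2 (tn m) ltac:(rewrite distrC ger0_norm; [have := hN m Nm; clear; lra|rewrite /tn; have := q1 m; clear; lra]).
  by have := nm_sub_trans (W (tn m)) (f c) (W S); rewrite (nmB (f c) (W (tn m))); clear; lra.
have conv e : 0 < e -> exists2 d, 0 < d & forall t u, 0 <= t -> t < S -> S - d < t ->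
    reach W t z u -> nm (u - c) < e.
  move=> e0; have [e1 e10 iso] := isolated_value c (W S) hf nf.
  pose rho := Num.min (e / 2) e1.
  have rho0 : 0 < rho by rewrite lt_min divr_gt0.
  have [re r1] : rho <= e / 2 /\ rho <= e1 by rewrite !ge_min !lexx orbT.
  have cv : continuous (fun z => nm (f z - W S)).
    exact: (cont_comp (cont_sub cf (@cont_cst _ _ (W S))) (@continuous_nm R)).
  have [p pr hp] := circle_attains_min c (ltW rho0) cv.
  have mu0 : 0 < nm (f p - W S).
    rewrite nm_gt0 subr_eq0 iso ?pr//.
    by rewrite -subr_eq0 -nm_eq0 pr gt_eqF.
  have /continuous_realP/(_ _ mu0)[d d0 hd] := cW S.
  exists d => // t u t0 tS dt hu.
  have [N hN] := tnS d d0.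
  have [m Nm hm] := hc _ rho0 N.
  have tm := hN m Nm.
  have tmS : 0 <= tn m /\ tn m < S by rewrite /tn; have := q1 m; clear; lra.
  pose mx := Num.max t (tn m).
  have mxS : mx < S by rewrite gt_max tS tmS.2.
  have mx0 : 0 <= mx by rewrite le_max t0.
  have [v [Z [lZ Z0 _]]] := below mx mx0 mxS.
  have Zt : Z t = u.
    have rt : reach W t z (Z t).
      exists Z; split; [|exact: Z0|reflexivity].
      by apply: (lift_sub lZ); rewrite le_max lexx.
    exact: (reach_uniq t0 rt hu).
  have Ztm : Z (tn m) = un m.
    have rt : reach W (tn m) z (Z (tn m)).
      exists Z; split; [|exact: Z0|reflexivity].
      by apply: (lift_sub lZ); rewrite le_max lexx orbT.
    exact: (reach_uniq tmS.1 rt (hun m)).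
  suff h : nm (u - c) < rho by lra.
  rewrite ltNge; apply/negP => rhou.
  have cg : continuous (fun s => nm (Z s - c)).
    exact: (cont_comp (cont_sub lZ.1 (@cont_cst R R[i] c)) (@continuous_nm R)).
  have [s sI sr] : exists2 s, Num.min t (tn m) <= s <= mx & nm (Z s - c) = rho.
    have hle : Num.min t (tn m) <= mx by rewrite ge_min le_max lexx.
    have [|s] := @IVT R _ _ _ rho hle (continuous_subspaceT cg).
      have h1 : nm (Z (tn m) - c) <= rho by rewrite Ztm ltW.
      have h2 : rho <= nm (Z t - c) by rewrite Zt.
      rewrite /mx; case: (leP t (tn m)) => _; rewrite ge_min le_max ?h1 ?h2 ?orbT//.
    by rewrite in_itv /= => sI h; exists s.
  have mn0 : 0 <= Num.min t (tn m) by rewrite le_min t0 tmS.1.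
  have mnd : S - d < Num.min t (tn m) by rewrite lt_min dt tm.
  case/andP: sI => s1 s2.
  have := hd s ltac:(rewrite distrC ger0_norm; clear - s1 s2 mnd mxS; lra).
  have := hp _ sr; rewrite (lZ.2 s ltac:(clear - s1 s2 mn0; lra)).1; clear; lra.
exists c; split => //; apply/eqP; apply: contrapT => /negP dc; apply: nS.
have [r [e [r0 e0 h]]] := local_lift dc.
have [d1 d10 h1] := conv r r0.
have /continuous_realP/(_ _ e0)[d2 d20 h2] := cW S.
pose q := Num.min (S / 2) (Num.min (d1 / 2) (d2 / 2)).
have q0 : 0 < q by rewrite !lt_min !divr_gt0.
have [qS qd1 qd2] : [/\ q <= S / 2, q <= d1 / 2 & q <= d2 / 2].
  by rewrite !ge_min !lexx !orbT.
have [u hu] := below (S - q) ltac:(clear - q0 qS; lra) ltac:(clear - q0; lra).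
have cW' : continuous (fun x => W (S - q + x)).
  by apply: cont_comp cW; apply: contR_add; [exact: cont_cst|exact: cont_id].
have [|||u' hu' _] := h u (fun x => W (S - q + x)) q (ltW q0) _ _ cW' _.
- by apply: h1 hu; clear - q0 qS qd1; lra.
- by rewrite addr0 (reach_val _ hu).1//; clear - q0 qS; lra.
- by move=> x /andP[x0 xq]; rewrite fc; apply: h2; rewrite ltr_norml; lra.
exists u'; rewrite -(subrK q S); apply: reach_trans hu' => //; first by lra.
exact: ltW.
Qed.

End Lifts.

Section Rays.
Variable R : realType.
Implicit Types (z w u a c d v : R[i]) (x y t s r e M S T B b h : R).
Implicit Types (W Z : R -> R[i]).

Definition ray w v t : R[i] := w * cexp (t%:C * v).

Lemma ray_cont w v : continuous (ray w v).
Proof.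
apply: (cont_mul (@cont_cst R R[i] w)).
exact: (cont_comp (cont_mul (@continuous_RtoC R) (@cont_cst R R[i] v)) (@cexp_cont R)).
Qed.

Lemma ray0 w v : ray w v 0 = w.
Proof. by rewrite /ray rmorph0 mul0r cexp0 mulr1. Qed.

Lemma ray_add w v T t : ray w v (T + t) = ray (ray w v T) v t.
Proof. by rewrite /ray rmorphD mulrDl cexpD mulrA. Qed.

Lemma ray_neq0 w v t : w != 0 -> ray w v t != 0.
Proof. by move=> w0; rewrite mulf_neq0// cexp_neq0. Qed.

Lemma nm_ray w v t : nm (ray w v t) = nm w * expR (t * complex.Re v).
Proof. by rewrite nmM nm_cexp; case: v => [p q] /=; rewrite mul0r subr0. Qed.

Lemma ray_scale w v e t : ray w v (e * t) = ray w (e%:C * v) t.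
Proof. by rewrite /ray rmorphM /=; congr (_ * cexp _); ring. Qed.

Lemma ray_opp w v T t : ray w v (T - t) = ray (ray w v T) (- v) t.
Proof. by rewrite /ray -mulrA -cexpD rmorphB /=; congr (_ * cexp _); ring. Qed.

Definition turn v h : R[i] := v + (0 +i* h)%C.

Lemma Re_turn v h : complex.Re (turn v h) = complex.Re v.
Proof. by case: v => p q; rewrite /turn /= addr0. Qed.

Lemma Im_turn v h : complex.Im (turn v h) = complex.Im v + h.
Proof. by case: v => p q. Qed.

Lemma turn0 v : turn v 0 = v.
Proof. by case: v => p q; rewrite /turn; apply/eqP; rewrite eq_complex /= !addr0 !eqxx. Qed.

Lemma mulc_turn t v h : t%:C * turn v h = ((t * complex.Re v) +i* (t * (complex.Im v + h)))%C.
Proof.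
by case: v => p q; apply/eqP; rewrite eq_complex /=; apply/andP; split; apply/eqP; ring.
Qed.

Lemma bad_angles w0 v b wc : w0 != 0 -> complex.Re v != 0 ->
  exists E : seq R, forall h t, `|h| <= b -> 0 < t -> ray w0 (turn v h) t = wc -> h \in E.
Proof.
move=> w00 v0; have [wc0|wc0] := eqVneq wc 0.
  by exists [::] => h t _ _ E; have := ray_neq0 (turn v h) t w00; rewrite E wc0 eqxx.
have [be hbe] : exists be, cexp be = wc / w0 by apply: cexp_surj; rewrite mulf_neq0 ?invr_eq0.
pose t0 := complex.Re be / complex.Re v.
pose m := `|t0| * (b + `|complex.Im v|) + `|complex.Im be|.
pose K := Num.bound m.
have [E0 hE0] : exists E : seq R, E =
    [seq (complex.Im be + 2 * pi * (Posz k - Posz K)%:~R) / t0 - complex.Im v | k <- iota 0 (2 * K).+1].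
  by eexists.
exists E0; move=> h t hb tpos E.
have b0 : 0 <= b := le_trans (normr_ge0 h) hb.
have [k hk] : exists k, t%:C * turn v h = be + per R k.
  by apply: cexp_inj_mod; rewrite hbe -E /ray mulrAC divff// mul1r.
move/eqP: hk; rewrite mulc_turn eq_complex.
rewrite (raddfD (@complex.Re R)) (raddfD (@complex.Im R)) /= addr0 => /andP[/eqP h1 /eqP h2].
have tt : t = t0 by rewrite /t0 -h1 mulfK.
have t00 : t0 != 0 by rewrite -tt gt_eqF.
have p2 := pi_ge2 R.
have kK : `|k%:~R : R| <= m.
  have -> : k%:~R = (t * (complex.Im v + h) - complex.Im be) / (2 * pi) :> R.
    by rewrite h2 (addrC (complex.Im be)) addrK mulrAC divff ?mul1r// gt_eqF//; lra.
  rewrite normrM normrV ?unitfE; last by rewrite gt_eqF// mulr_gt0// pi_gt0.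
  rewrite ler_pdivrMr; last by rewrite normr_gt0 gt_eqF// mulr_gt0// pi_gt0.
  rewrite (ger0_norm (_ : 0 <= 2 * pi)); last by rewrite mulr_ge0// ltW// pi_gt0.
  apply: (@le_trans _ _ m); last first.
    have : 0 <= m by rewrite /m addr_ge0// mulr_ge0// addr_ge0.
    by move=> m0; nra.
  apply: (le_trans (ler_normB _ _)); rewrite /m lerD2r normrM -tt ler_wpM2l//.
  by apply: (le_trans (ler_normD _ _)); rewrite addrC lerD2r.
have m0 : 0 <= m := le_trans (normr_ge0 _) kK.
have kK' : - Posz K < k /\ k < Posz K.
  have := le_lt_trans kK (archi_boundP m0); rewrite ltr_norml -/K => /andP[k1 k2].
  by split; rewrite -(ltr_int R)// rmorphN.
rewrite hE0; apply/mapP; exists (absz (k + Posz K)).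
  rewrite mem_iota /= add0n ltnS -lez_nat.
  have kp : 0 <= k + Posz K by rewrite -lerBlDr sub0r ltW// kK'.1.
  by rewrite gez0_abs// mul2n -addnn PoszD lerD2r ltW// kK'.2.
have -> : Posz (absz (k + Posz K)) = k + Posz K by rewrite gez0_abs// -lerBlDr sub0r ltW// kK'.1.
rewrite addrK -h2 tt; field; exact: t00.
Qed.

Variable f : R[i] -> R[i].
Hypotheses (hf : holo f) (nf : noncst f).

Definition go z v T u := reach f (ray (f z) v) T z u.

Lemma go_val z v T u : 0 <= T -> go z v T u -> f u = ray (f z) v T /\ dz f u != 0.
Proof. exact: reach_val. Qed.

Lemma go0 z v : dz f z != 0 -> go z v 0 z.
Proof. by move=> d; apply: reach0 => //; rewrite ray0. Qed.

Lemma go_uniq z v T u u' : 0 <= T -> go z v T u -> go z v T u' -> u = u'.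
Proof. exact: reach_uniq. Qed.

Lemma go_trans z v T S u w : 0 <= T -> 0 <= S -> go z v T u -> go u v S w -> go z v (T + S) w.
Proof.
move=> T0 S0 g1 g2; apply: (reach_trans T0 S0 g1).
by apply: reach_ext g2 => t _; rewrite ray_add (go_val T0 g1).1.
Qed.

Lemma go_sub z v T S u : 0 <= S -> S <= T -> go z v T u ->
  exists2 u', go z v S u' & go u' v (T - S) u.
Proof.
move=> S0 ST g; have [u' [g1 g2]] := reach_sub S0 ST g; exists u' => //.
by apply: reach_ext g2 => t _; rewrite ray_add (go_val S0 g1).1.
Qed.

Lemma go_scale z v e T u : 0 < e -> go z v (e * T) u -> go z (e%:C * v) T u.
Proof.
by move=> e0 g; apply: reach_ext (reach_scale e0 g) => t _; rewrite ray_scale.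
Qed.

Lemma go_scale1 z v e u : 0 < e -> go z v e u <-> go z (e%:C * v) 1 u.
Proof.
move=> e0; split=> g; first by apply: go_scale; rewrite ?mulr1.
have ei : 0 < e^-1 by rewrite invr_gt0.
have := @go_scale z (e%:C * v) e^-1 e u ei; rewrite mulVf ?gt_eqF// => /(_ g).
by rewrite mulrA -rmorphM mulVf ?gt_eqF// rmorph1 mul1r.
Qed.

Lemma go_rev z v T u : 0 <= T -> go z v T u -> go u (- v) T z.
Proof.
move=> T0 g; apply: reach_ext (reach_rev g) => t _.
by rewrite ray_opp (go_val T0 g).1.
Qed.

Lemma dz_not0 : exists z, dz f z != 0.
Proof.
apply: contrapT => hn.
have h0 z : cder f z 0.
  rewrite -(_ : dz f z = 0); first exact: holo_dz.
  by apply/eqP; apply: contrapT => /negP h; apply: hn; exists z.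
by have [z] := nf (f 0); rewrite (der0_cst h0 z 0) eqxx.
Qed.

Lemma critical_list M : exists s : seq R[i], forall c, dz f c = 0 -> nm c <= M -> c \in s.
Proof.
have [s [g [_ fg _ g0]]] := factor_zeros M (holo_dz_holo hf) dz_not0.
exists s => c dc cM; move: (fg c); rewrite dc => /esym/eqP; rewrite mulf_eq0 (negbTE (g0 c cM)) orbF.
by rewrite prodf_seq_eq0 => /hasP[a as_]; rewrite /= subr_eq0 => /eqP ->.
Qed.

Lemma bad_angles_ball z0 v b M : f z0 != 0 -> complex.Re v != 0 ->
  exists E : seq R, forall h t c, `|h| <= b -> 0 < t -> dz f c = 0 -> nm c <= M ->
    ray (f z0) (turn v h) t = f c -> h \in E.
Proof.
move=> fz v0; have [s hs] := critical_list M.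
have [E hE] : exists E : seq R, forall h t c, `|h| <= b -> 0 < t -> c \in s ->
    ray (f z0) (turn v h) t = f c -> h \in E.
  elim: (s) => [|c s' [E hE]]; first by exists [::].
  have [E' hE'] := @bad_angles (f z0) v b (f c) fz v0.
  exists (E' ++ E) => h t c' hb t0; rewrite inE mem_cat => /orP[/eqP->|cs] hr.
    by rewrite (hE' h t).
  by rewrite (hE h t c') ?orbT.
by exists E => h t c hb t0 dc cM; apply: (hE h t c) => //; exact: hs.
Qed.

Lemma ray_dichotomy z0 v b M : f z0 != 0 -> dz f z0 != 0 -> complex.Re v != 0 ->
  exists E : seq R, forall h, `|h| <= b -> h \notin E -> forall T, 0 <= T ->
    (exists u, go z0 (turn v h) T u) \/
    exists t u, [/\ 0 <= t, t < T, go z0 (turn v h) t u & M < nm u].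
Proof.
move=> fz dz0 v0; have [E hE] := bad_angles_ball b M fz v0.
exists E => h hb hnE T T0.
have [|//|[S [S0 ST below _ [esc|[c [dc fc conv]]]]]] :=
    @lift_or_blocked R f hf nf (ray (f z0) (turn v h)) T z0 (@ray_cont _ _) T0 _ dz0.
- by rewrite ray0.
- by left.
- right; have [t [u [t0 tS g Mu]]] := esc M; exists t, u; split => //; lra.
have [cM|Mc] := leP (nm c) M.
  by have := hE h S c hb S0 dc cM (esym fc); rewrite (negbTE hnE).
right; have [d d0 hd] := conv (nm c - M) ltac:(lra).
pose t := Num.max 0 (S - d / 2).
have t0 : 0 <= t by rewrite le_max lexx.
have tS : t < S by rewrite gt_max S0; lra.
have [u hu] := below t t0 tS.
exists t, u; split => //; first by lra.
have := hd t u t0 tS; rewrite lt_max => /(_ ltac:(apply/orP; right; lra) hu).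
by have := nmDB c u; rewrite (nmB c); clear; lra.
Qed.

(* In small discs around [c] the map is close to its differential at [c], with
   constants that do not depend on the size of the derivative. *)
Definition tame c r := [/\ 0 < r, dz f c != 0 & forall z z', nm (z - c) < r -> nm (z' - c) < r ->
  nm (f z - f z' - dz f c * (z - z')) <= nm (dz f c) / 2 * nm (z - z')].

Lemma tame_lower c r z z' : tame c r -> nm (z - c) < r -> nm (z' - c) < r ->
  nm (dz f c) * nm (z - z') <= 2 * nm (f z - f z').
Proof.
move=> [_ _ h] zc zc'; have := h z z' zc zc'; have := nmDB (dz f c * (z - z')) (f z - f z').
by rewrite (nmB (dz f c * _)) nmM; lra.
Qed.

Lemma tame_upper c r z z' : tame c r -> nm (z - c) < r -> nm (z' - c) < r ->
  nm (f z - f z') <= 3 / 2 * (nm (dz f c) * nm (z - z')).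
Proof.
move=> [_ _ h] zc zc'; have := h z z' zc zc'.
have := nmD (f z - f z' - dz f c * (z - z')) (dz f c * (z - z')).
by rewrite subrK nmM; lra.
Qed.

Lemma tame_inj c r z z' : tame c r -> nm (z - c) < r -> nm (z' - c) < r -> f z = f z' -> z = z'.
Proof.
move=> tc zc zc' E; have := tame_lower tc zc zc'; rewrite E subrr nm0 mulr0.
have [_ d0 _] := tc; have n0 : 0 < nm (dz f c) by rewrite nm_gt0.
rewrite pmulr_rle0// => h; apply/eqP; rewrite -subr_eq0 -nm_eq0 eq_le h.
exact: nm_ge0.
Qed.

Lemma tame_near c : dz f c != 0 -> exists r D, [/\ 0 < r, 0 < D &
  forall c' r', nm (c' - c) < r -> 0 < r' -> r' <= r -> tame c' r' /\ D <= nm (dz f c')].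
Proof.
move=> dc; have n0 : 0 < nm (dz f c) by rewrite nm_gt0.
have n8 : 0 < nm (dz f c) / 8 by rewrite divr_gt0.
have /continuous_epsP/(_ _ n8)[r r0 hr] := @dz_cont R f hf c.
have r2 : 0 < r / 2 by rewrite divr_gt0.
exists (r / 2), (nm (dz f c) / 2); split => //; first by rewrite divr_gt0.
move=> c' r' cc r'0 r'r.
have hc' := hr c' ltac:(lra).
have dlow : nm (dz f c) * 7 / 8 <= nm (dz f c').
  by have := nmDB (dz f c) (dz f c'); rewrite (nmB (dz f c)); lra.
split; last by lra.
split => //; first by rewrite -nm_gt0; lra.
move=> z z' zc zc'.
have -> : f z - f z' - dz f c' * (z - z') = (f z - dz f c' * z) - (f z' - dz f c' * z') by ring.
apply: (@mean_value_all R (fun q => f q - dz f c' * q) (fun q => dz f q - dz f c')) => [q|t /andP[t0 t1]].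
  by apply: (cder_eqd (cder_sub (holo_dz q hf) (cder_scale (dz f c') (cder_id q)))); rewrite mulr1.
have hq : nm (z' + t%:C * (z - z') - c) < r.
  have -> : z' + t%:C * (z - z') - c = (t%:C * (z - c') + (1 - t)%:C * (z' - c')) + (c' - c).
    by rewrite rmorphB rmorph1; ring.
  apply: (le_lt_trans (nmD _ _)).
  have : nm (t%:C * (z - c') + (1 - t)%:C * (z' - c')) <= r'.
    apply: (le_trans (nmD _ _)); rewrite !nmM !nmC !ger0_norm ?subr_ge0//.
    by nra.
  lra.
have := hr _ hq; have := nm_sub_trans (dz f c) (dz f (z' + t%:C * (z - z'))) (dz f c').
by rewrite (nmB (dz f c) (dz f c')); clear - n8 hc' dlow; lra.
Qed.

Lemma lift_tame W T Z : 0 <= T -> lift f W T Z -> exists r D, [/\ 0 < r, 0 < D &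
  forall t c' r', 0 <= t <= T -> nm (c' - Z t) < r -> 0 < r' -> r' <= r ->
    tame c' r' /\ D <= nm (dz f c')].
Proof.
move=> T0 [cZ hZ].
pose Q x y := exists r D, [/\ 0 < r, 0 < D & forall t c' r', x <= t <= y -> nm (c' - Z t) < r ->
  0 < r' -> r' <= r -> tame c' r' /\ D <= nm (dz f c')].
apply: (@interval_cousin R 0 T Q T0) => [x y z _ xy yz _ [r1 [D1 [r10 D10 h1]]] [r2 [D2 [r20 D20 h2]]]|t0 t0T].
  exists (Num.min r1 r2), (Num.min D1 D2); split; rewrite ?lt_min ?r10 ?D10// => t c' r' /andP[xt tz].
  rewrite lt_min le_min => /andP[c1 c2] r'0 /andP[r'1 r'2].
  have [ty|yt] := leP t y.
    have [|ta Da] := h1 t c' r' _ c1 r'0 r'1; first by rewrite xt ty.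
    by split => //; rewrite ge_min Da.
  have [|ta Da] := h2 t c' r' _ c2 r'0 r'2; first by rewrite (ltW yt) tz.
  by split => //; rewrite ge_min Da orbT.
have [r [D [r0 D0 h]]] := tame_near (hZ t0 t0T).2.
have r2 : 0 < r / 2 by rewrite divr_gt0.
have /continuous_realP/(_ _ r2)[d d0 hd] := cZ t0.
exists d => // x y _ xt ty _ dx dy; exists (r / 2), D; split => // t c' r' /andP[xt' ty'] cc r'0 r'r.
apply: h => //; last by lra.
have := hd t ltac:(rewrite ltr_norml; clear - dx dy xt' ty'; lra); have := nm_sub_trans (Z t) c' (Z t0); clear - cc; lra.
Qed.

End Rays.

(** * The length-area estimate *)

Section Packing.
Variable R : realType.
Implicit Types (z w u : R[i]) (x y t r B V : R) (d e : R[i] * R) (s : seq (R[i] * R)).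

Definition in_disc d u := nm (u - d.1) < d.2.

Definition apart d e := forall u, in_disc d u -> in_disc e u -> False.

Fixpoint pdisj s : Prop := if s is d :: s' then (forall e, e \in s' -> apart d e) /\ pdisj s' else True.

Lemma pdisj_filter (P : pred (R[i] * R)) s : pdisj s -> pdisj (seq.filter P s).
Proof.
elim: s => //= d s IH [h1 h2]; case: (P d) => /=; last exact: IH.
by split; [move=> e; rewrite mem_filter => /andP[_]; exact: h1 | exact: IH].
Qed.

Lemma pdisj_cat s s' : pdisj s -> pdisj s' ->
  (forall d e, d \in s -> e \in s' -> apart d e) -> pdisj (s ++ s').
Proof.
elim: s => //= d s IH [h1 h2] h3 h; split.
  move=> e; rewrite mem_cat => /orP[es|es]; first exact: h1.
  by apply: h => //; rewrite inE eqxx.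
by apply: IH => // d' e ds; apply: h; rewrite inE ds orbT.
Qed.

Definition sq d : set (R * R) :=
  `[complex.Re d.1 - d.2 / 2, complex.Re d.1 + d.2 / 2] `*`
  `[complex.Im d.1 - d.2 / 2, complex.Im d.1 + d.2 / 2].

Definition area := (@lebesgue_measure R \x @lebesgue_measure R)%E.

Lemma sq_measurable d : measurable (sq d).
Proof. by apply: measurableX; exact: measurable_itv. Qed.

Lemma box_area x1 x2 y1 y2 : x1 <= x2 -> y1 <= y2 ->
  area (`[x1, x2]%classic `*` `[y1, y2]%classic) = ((x2 - x1) * (y2 - y1))%:E.
Proof.
have itv t r : t <= r -> @lebesgue_measure R `[t, r]%classic = (r - t)%:E.
  move=> tr; rewrite lebesgue_measure_itv /= lte_fin; case: ltP => [_|rt]; first by rewrite EFinB.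
  by have -> : r = t; [lra|rewrite subrr].
move=> x12 y12.
rewrite /area product_measure1E// EFinM; congr (_ * _)%E; exact: itv.
Qed.

Lemma sq_area d : 0 <= d.2 -> area (sq d) = (d.2 ^+ 2)%:E.
Proof. by move=> d0; rewrite /sq box_area; [congr (_%:E); field|lra|lra]. Qed.

Lemma sq_in_disc d p : 0 < d.2 -> sq d p -> in_disc d (p.1 +i* p.2)%C.
Proof.
case: d p => [[a b] r] [x y] /= r0 [] /=; rewrite !in_itv /= => /andP[h1 h2] /andP[h3 h4].
rewrite /in_disc /= -(ltr_pXn2r (n := 2)) ?nnegrE ?nm_ge0 ?(ltW r0)// nm_sqr /=; nra.
Qed.

Fixpoint squares s : set (R * R) := if s is d :: s' then sq d `|` squares s' else set0.

Lemma squares_area s : pdisj s -> (forall d, d \in s -> 0 < d.2) ->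
  measurable (squares s) /\ area (squares s) = (\sum_(d <- s) d.2 ^+ 2)%:E.
Proof.
elim: s => [|d s IH] /=; first by rewrite big_nil /area measure0.
move=> [h1 h2] h; have [|m1 m2] := IH h2; first by move=> e es; apply: h; rewrite inE es orbT.
have d0 : 0 < d.2 by apply: h; rewrite inE eqxx.
split; first by apply: measurableU => //; exact: sq_measurable.
rewrite /area measureU//; [|exact: sq_measurable|].
  by rewrite big_cons EFinD -m2 -(sq_area (ltW d0)).
apply/seteqP; split => // p [/(sq_in_disc d0) pd].
have {m1 m2 IH h2} hp : forall e, e \in s -> ~ sq e p.
  move=> e es /sq_in_disc pe; apply: (h1 e es _ pd); apply: pe.
  by apply: h; rewrite inE es orbT.
elim: (s) hp => //= e s' IH hp [|]; first by apply: hp; rewrite inE eqxx.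
by apply: IH => e' es; apply: hp; rewrite inE es orbT.
Qed.

Lemma flat_packing s B : pdisj s -> (forall d, d \in s -> 0 < d.2 /\ nm d.1 + d.2 <= B) ->
  \sum_(d <- s) d.2 ^+ 2 <= (2 * B) ^+ 2.
Proof.
move=> pd h; have [|m1 m2] := squares_area pd; first by move=> d /h[].
have [->|[d0 d0s]] : s = [::] \/ exists d, d \in s.
    by case: (s) => [|d s']; [left|right; exists d; rewrite inE eqxx].
  by rewrite big_nil sqr_ge0.
have B0 : 0 <= B by have [p1 p2] := h _ d0s; have := nm_ge0 d0.1; lra.
rewrite -lee_fin -m2.
have -> : (2 * B) ^+ 2 = (B - - B) * (B - - B) by ring.
have b2 : - B <= B by lra.
rewrite -(box_area b2 b2).
rewrite /area; apply: le_measure; rewrite ?inE//; first by apply: measurableX; exact: measurable_itv.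
move: h; clear => h p.
elim: s h => [|d s IH] h //= [|]; last by apply: IH => e es; apply: h; rewrite inE es orbT.
have [|d0 dB] := h d; first by rewrite inE eqxx.
move=> [] /=; rewrite !in_itv /= => /andP[h1 h2] /andP[h3 h4].
have := Re_le_nm d.1; have := Im_le_nm d.1; rewrite !ler_norml => /andP[i1 i2] /andP[r1 r2].
by split; rewrite /= ?in_itv /=; apply/andP; split; clear - dB h1 h2 h3 h4 i1 i2 r1 r2; lra.
Qed.

Definition weight d := (d.2 / (1 + nm d.1)) ^+ 2.

Lemma dyadic_packing K s : pdisj s ->
  (forall d, d \in s -> [/\ 0 < d.2, 4 * d.2 <= 1 + nm d.1 & 1 + nm d.1 < 2 ^+ K]) ->
  \sum_(d <- s) weight d <= 64 * K%:R.
Proof.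
elim: K s => [|K IH] s pd h.
  rewrite mulr0; case: s pd h => [|d s] pd h; first by rewrite big_nil.
  by have [|_ _] := h d; rewrite ?inE ?eqxx// expr0; have := nm_ge0 d.1; lra.
rewrite (bigID (fun d => 1 + nm d.1 < 2 ^+ K)) /= -(natr1 K) mulrDr mulr1.
have p0 : 0 < 2 ^+ K :> R by rewrite exprn_gt0.
apply: lerD.
  rewrite -big_filter; apply: IH; first exact: pdisj_filter.
  by move=> d; rewrite mem_filter => /andP[dK ds]; have [h1 h2 _] := h d ds.
rewrite -big_filter.
set s' := seq.filter _ _.
have ps' : pdisj s' := pdisj_filter _ pd.
have hs' d : d \in s' -> [/\ 0 < d.2, 4 * d.2 <= 1 + nm d.1, 2 ^+ K <= 1 + nm d.1 & 1 + nm d.1 < 2 * 2 ^+ K].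
  by rewrite mem_filter -leNgt => /andP[dK ds]; have [h1 h2] := h d ds; rewrite exprS.
have hd d : d \in s' -> 0 < d.2 /\ nm d.1 + d.2 <= 5 / 2 * 2 ^+ K.
  by move=> ds; have [h1 h2 h3 h4] := hs' d ds; split => //; lra.
have := flat_packing ps' hd.
have -> : (2 * (5 / 2 * 2 ^+ K)) ^+ 2 = 25 * (2 ^+ K) ^+ 2 :> R by field.
move=> hf; apply: (@le_trans _ _ (\sum_(d <- s') d.2 ^+ 2 / (2 ^+ K) ^+ 2)).
  rewrite !big_seq; apply: ler_sum => d /hs'[d0 _ dK _].
  rewrite /weight expr_div_n ler_wpM2l ?sqr_ge0// lef_pV2 ?posrE ?exprn_gt0//; last by lra.
  by rewrite lerXn2r// nnegrE; lra.
rewrite -mulr_suml ler_pdivrMr ?exprn_gt0//; apply: (le_trans hf).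
by rewrite ler_pM2r ?exprn_gt0//; lra.
Qed.

Lemma packing_bound s B : 1 <= B -> pdisj s ->
  (forall d, d \in s -> [/\ 0 < d.2, 4 * d.2 <= 1 + nm d.1 & 1 + nm d.1 <= B]) ->
  \sum_(d <- s) weight d <= 128 * ln (4 * B).
Proof.
move=> B1 pd h.
have l2 : 1 / 2 <= ln 2 :> R.
  have eh : 1 / 2 <= expR (- (1 / 2)) :> R by have := @expR_ge1Dx R (- (1 / 2)); lra.
  have e0 := expR_gt0 (1 / 2 : R); have e1 := expRxMexpNx_1 (1 / 2 : R).
  by rewrite -[leLHS]expRK ler_ln ?posrE//; nra.
have l0 : 0 < ln 2 :> R by lra.
have lB : 0 <= ln B by rewrite ln_ge0.
have q0 : 0 <= ln B / ln 2 by rewrite divr_ge0// ltW.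
have [m /andP[m1 m2]] : exists m : nat, m%:R <= ln B / ln 2 < m.+1%:R.
  by exists (Num.trunc (ln B / ln 2)); exact: truncn_itv.
have -> : ln (4 * B) = 2 * ln 2 + ln B.
  rewrite lnM ?posrE//; last lra.
  have -> : 4 = 2 * 2 :> R by lra.
  by rewrite lnM ?posrE//; lra.
have hB : B < 2 ^+ m.+1.
  rewrite -ltr_ln ?posrE ?exprn_gt0//; last lra.
  by rewrite lnXn// -(mulr_natl (ln 2) m.+1) -ltr_pdivrMr.
apply: (le_trans (@dyadic_packing m.+1 s pd _)).
  by move=> d /h[h1 h2 h3]; split; [exact: h1|exact: h2|exact: le_lt_trans h3 hB].
have m1' : m%:R * ln 2 <= ln B by rewrite -ler_pdivlMr.
have m0 : 0 <= m%:R :> R by [].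
rewrite -(natr1 m); nra.
Qed.

Definition pack (S : set R[i]) B V := exists s, [/\ pdisj s,
  forall d, d \in s -> [/\ 0 < d.2, 4 * d.2 <= 1 + nm d.1, 1 + nm d.1 <= B & forall u, in_disc d u -> S u]
  & V <= \sum_(d <- s) weight d].

Lemma pack0 S B V : V <= 0 -> pack S B V.
Proof. by move=> V0; exists [::]; split => //; rewrite big_nil. Qed.

Lemma pack_le S S' B V V' : (forall u, S u -> S' u) -> V' <= V -> pack S B V -> pack S' B V'.
Proof.
move=> SS VV [s [h1 h2 h3]]; exists s; split => //; last exact: le_trans h3.
by move=> d /h2[p1 p2 p3 p4]; split => // u /p4; exact: SS.
Qed.

Lemma pack_disc (S : set R[i]) B z r : 0 < r -> 4 * r <= 1 + nm z -> 1 + nm z <= B ->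
  (forall u, nm (u - z) < r -> S u) -> pack S B ((r / (1 + nm z)) ^+ 2).
Proof.
move=> r0 h1 h2 h3; exists [:: (z, r)]; split; first by split.
  by move=> d; rewrite inE => /eqP ->.
by rewrite big_seq1.
Qed.

Lemma pack_union (S S1 S2 : set R[i]) B V1 V2 : (forall u, S1 u -> S2 u -> False) ->
  (forall u, S1 u -> S u) -> (forall u, S2 u -> S u) ->
  pack S1 B V1 -> pack S2 B V2 -> pack S B (V1 + V2).
Proof.
move=> dis i1 i2 [s1 [h1 h2 h3]] [s2 [k1 k2 k3]]; exists (s1 ++ s2); split.
- apply: pdisj_cat => // d e /h2[_ _ _ hd] /k2[_ _ _ he] u /hd u1 /he u2.
  exact: dis u1 u2.
- move=> d; rewrite mem_cat => /orP[/h2|/k2] [p1 p2 p3 p4]; split => // u /p4; [exact: i1|exact: i2].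
- by rewrite big_cat lerD.
Qed.

Lemma pack_bound (S : set R[i]) B V : 1 <= B -> pack S B V -> V <= 128 * ln (4 * B).
Proof.
move=> B1 [s [h1 h2 h3]]; apply: (le_trans h3); apply: packing_bound => // d /h2[p1 p2 p3 _].
by split.
Qed.

End Packing.

Section LengthArea.
Variable R : realType.
Implicit Types (z w u a c d v q : R[i]) (x y t s r e M S T B b h : R).
Implicit Types (W Z : R -> R[i]).

Lemma cexp_near0 : exists2 e : R, 0 < e & forall d, nm d < e ->
  nm (cexp d - 1) <= 2 * nm d /\ nm d <= 2 * nm (cexp d - 1).
Proof.
have [e e0 he] := @cexp_der0 R (1 / 2) ltac:(lra).
exists e => // d de; have := he d; rewrite subr0 cexp0 mul1r => /(_ de) h.
have := nmD (cexp d - 1 - d) d; rewrite subrK; have := nmDB d (cexp d - 1).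
by rewrite (nmB d); lra.
Qed.

Lemma cexp_onto1 : exists2 e : R, 0 < e & forall w, nm (w - 1) < e ->
  exists2 d, cexp d = w & nm d <= 2 * nm (w - 1).
Proof.
have [e e0 he] := cexp_near0.
have /continuous_epsP/(_ _ e0)[r r0 hr] : {for 1, continuous (@Log R)}.
  by apply: Log_cont; apply: slit_near1; rewrite subrr nm0.
exists (Num.min r 1); first by rewrite lt_min r0 ltr01.
move=> w; rewrite lt_min => /andP[wr w1].
have sw := slit_near1 w1.
exists (Log w); first exact: cexp_Log.
have := hr w wr; rewrite Log1 subr0 => /he[_]; rewrite cexp_Log//.
Qed.

Variable f : R[i] -> R[i].
Hypotheses (hf : holo f) (nf : noncst f).

Lemma ray_lift_near q v T Z e : 0 <= T -> lift f (ray (f q) v) T Z -> Z 0 = q ->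
  0 < e -> exists2 b, 0 < b & forall w, nm (w - v) < b ->
  exists2 Z', lift f (ray (f q) w) T Z' &
    Z' 0 = q /\ forall t, 0 <= t <= T -> nm (Z' t - Z t) < e.
Proof.
move=> T0 lZ Z0 e0; have [r [M gZ]] := lift_good hf T0 lZ.
have [r0 M0 _ _] := gZ 0 ltac:(by rewrite lexx).
have [r' [r'0 r'r r'e]] : exists r', [/\ 0 < r', r' <= r & r' <= e].
  by exists (Num.min r e); rewrite lt_min r0 e0 !ge_min !lexx orbT.
have gZ' t : 0 <= t <= T -> good f (Z t) r' M by move=> /gZ g; exact: (good_mono g).
have [cZ hZ] := lZ.
have [N hN] : exists N, forall t, 0 <= t <= T -> nm (f (Z t)) <= N.
  have cfz : continuous (fun t => f (Z (T * t + 0))).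
    exact: (cont_comp (cont_comp (@contR_affine R T 0) cZ) (holo_cont hf)).
  have [N hN] := path_bounded cfz; exists N => t /andP[t0 tT].
  have [T00|Tn] := eqVneq T 0.
    have -> : t = T * 0 + 0 by rewrite mulr0 addr0; lra.
    by apply: hN; rewrite lexx ler01.
  have Tp : 0 < T by rewrite lt_neqAle eq_sym Tn.
  have -> : t = T * (t / T) + 0 by rewrite addr0 mulrCA divff ?mulr1.
  by apply: hN; rewrite divr_ge0//= ler_pdivrMr// mul1r.
have N0 : 0 <= N by apply: le_trans (hN 0 _); rewrite ?nm_ge0 ?lexx.
have [e1 e10 he1] := cexp_near0.
pose k := r' / (4 * M).
have k0 : 0 < k by rewrite divr_gt0// mulr_gt0.
pose b1 := e1 / (T + 1); pose b2 := k / (2 * (N + 1) * (T + 1)).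
have T1 : 0 < T + 1 by lra.
have b10 : 0 < b1 by rewrite divr_gt0.
have N2 : 0 < 2 * (N + 1) * (T + 1) by nra.
have b20 : 0 < b2 by rewrite divr_gt0.
exists (Num.min b1 b2); first by rewrite lt_min b10 b20.
move=> w; rewrite lt_min => /andP[hb1 hb2].
have [|Z' lZ' hZ'] := lift_perturb hf nf cZ T0 gZ' (@ray_cont R (f q) w).
  move=> t /andP[t0 tT].
  have tI : 0 <= t <= T by rewrite t0 tT.
  pose d : R[i] := t%:C * (w - v).
  have -> : ray (f q) w t = f (Z t) * cexp d.
    rewrite (hZ t tI).1 /ray -mulrA -cexpD; congr (_ * cexp _).
    by rewrite /d; ring.
  have nd : nm d = t * nm (w - v) by rewrite nmM nmC ger0_norm.
  have h00 := nm_ge0 (w - v).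
  have nd1 : nm d <= (T + 1) * nm (w - v) by rewrite nd; clear - tI h00; nra.
  have d1 : nm d < e1.
    by apply: (le_lt_trans nd1); rewrite mulrC -ltr_pdivlMr.
  have [h1 _] := he1 d d1.
  have -> : f (Z t) * cexp d - f (Z t) = f (Z t) * (cexp d - 1) by ring.
  rewrite nmM; have hNt := hN t tI; have := nm_ge0 (f (Z t)); have := nm_ge0 d => g1 g2.
  have : (N + 1) * (2 * ((T + 1) * nm (w - v))) < k.
    by move: hb2; rewrite ltr_pdivlMr// => g3; lra.
  apply: le_lt_trans; apply: ler_pM; rewrite ?nm_ge0//; clear - nd1 h1 hNt; lra.
exists Z' => //; split; last by move=> t tI; have := hZ' t tI; clear - r'0 r'e; lra.
have I0 : (0:R) <= 0 <= T by rewrite lexx.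
have [_ _ _ inj] := gZ' 0 I0.
have := inj (Z' 0) (Z 0); rewrite subrr nm0 => /(_ _ r'0).
have := hZ' 0 I0 => g1 /(_ ltac:(lra)).
have [_ /(_ 0 I0)[-> _]] := lZ'; rewrite ray0 Z0 subrr nm0 mulr0 => g2.
by apply/eqP; rewrite -subr_eq0 -nm_eq0 eq_le g2 nm_ge0.
Qed.

Lemma fan_lift q v (h0 : R) T Z e : 0 <= T -> lift f (ray (f q) (turn v h0)) T Z -> Z 0 = q ->
  0 < e -> exists2 b, 0 < b & forall h, `|h - h0| < b ->
  exists2 Z', lift f (ray (f q) (turn v h)) T Z' &
    Z' 0 = q /\ forall t, 0 <= t <= T -> nm (Z' t - Z t) < e.
Proof.
move=> T0 lZ Z0 e0; have [b b0 hb] := ray_lift_near T0 lZ Z0 e0; exists b => // h hh.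
apply: hb; rewrite (_ : turn v h - turn v h0 = (0 +i* (h - h0))%C).
  by rewrite nmE /= expr0n /= add0r sqrtr_sqr.
by case: v {lZ} => x y; apply/eqP; rewrite eq_complex /=; apply/andP; split; apply/eqP; ring.
Qed.

Definition fan q v x y S : set R[i] :=
  [set u | exists h t, [/\ x < h < y, 0 < t, t < S & go f q (turn v h) t u]].

Definition block q v h0 t0 b u := exists h t,
  [/\ `|h - h0| <= b / 4, `|t - t0| <= b * t0 / 8 & go f q (turn v h) t u].

Lemma sheet_disc : exists2 e : R, 0 < e & forall q v h0 t0 z r r' b A (c : R),
  f z = ray (f q) (turn v h0) t0 -> f q != 0 -> complex.Re v != 0 ->
  nm v + `|h0| <= A -> 1 <= A -> c = `|complex.Re v| / (24 * (`|complex.Re v| + A)) ->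
  tame f z r -> 0 < t0 -> 0 < b -> b <= 1 -> b * t0 <= e ->
  (forall h t, `|h - h0| <= b / 4 -> `|t - t0| <= b * t0 / 8 ->
     exists2 u, go f q (turn v h) t u & nm (u - z) < r) ->
  r' = c * (b * t0) * nm (f z) / nm (dz f z) -> r' <= r ->
  forall u, nm (u - z) < r' -> block q v h0 t0 b u.
Proof.
have [e e0 he] := cexp_onto1.
exists e => // q v h0 t0 z r r' b A c fz fq v0 hA A1 cE tz t0p b0 b1 bte loc r'E r'r u uz.
have [r0 dz0 _] := tz.
have D0 : 0 < nm (dz f z) by rewrite nm_gt0.
have fz0 : f z != 0 by rewrite fz ray_neq0.
have F0 : 0 < nm (f z) by rewrite nm_gt0.
pose p := `|complex.Re v|.
have p0 : 0 < p by rewrite normr_gt0.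
have pA : 0 < p + A by clear - A1 p0; lra.
have c0 : 0 < c by rewrite cE divr_gt0// mulr_gt0.
have cp : 24 * c * (p + A) = p by rewrite cE -/p; field; lra.
have c24 : c <= 1 / 24 by clear - A1 pA cp; nra.
have bt0 : 0 < b * t0 by rewrite mulr_gt0.
have w1 : nm (f u / f z - 1) <= 3 / 2 * (c * (b * t0)).
  have -> : f u / f z - 1 = (f u - f z) / f z by field.
  rewrite nmM nmV ler_pdivrMr//.
  apply: (le_trans (tame_upper tz _ _)); rewrite ?subrr ?nm0//; first by clear - r'r uz; lra.
  have : nm (dz f z) * nm (u - z) <= c * (b * t0) * nm (f z).
    by rewrite mulrC -ler_pdivlMr// -r'E ltW.
  clear; lra.
have [|d dE dn] := he (f u / f z); first by apply: (le_lt_trans w1); nra.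
have d1 : nm d <= 3 * (c * (b * t0)) by clear - dn w1; lra.
have d2 : 8 * (p + A) * nm d <= p * (b * t0).
  have : 8 * (p + A) * nm d <= 8 * (p + A) * (3 * (c * (b * t0))).
    by rewrite ler_pM2l// mulr_gt0.
  have -> : 8 * (p + A) * (3 * (c * (b * t0))) = (24 * c * (p + A)) * (b * t0) by ring.
  by rewrite cp.
pose s := complex.Re d / complex.Re v.
have sn : p * `|s| <= nm d.
  by rewrite -normrM /s mulrCA divff// mulr1; exact: Re_le_nm.
have s1 : 8 * (p + A) * `|s| <= b * t0.
  rewrite -(ler_pM2l p0); apply: le_trans d2.
  have -> : p * (8 * (p + A) * `|s|) = 8 * (p + A) * (p * `|s|) by ring.
  by rewrite ler_pM2l// mulr_gt0.
have s0 := normr_ge0 s.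
have s2 : 8 * `|s| <= b * t0 by clear - s1 s0 p0 A1; nra.
have st : t0 / 2 <= t0 + s by move: (ler_norm (- s)); rewrite normrN; clear - s2 b1 t0p; nra.
have st0 : 0 < t0 + s by clear - st t0p; lra.
pose k := (complex.Im d - s * (complex.Im v + h0)) / (t0 + s).
have kn : `|k| <= b / 4.
  rewrite normrM normrV ?unitfE ?gt_eqF// (gtr0_norm st0) ler_pdivrMr//.
  apply: (le_trans (ler_normB _ _)); rewrite normrM.
  have i1 : `|complex.Im v + h0| <= A.
    by apply: (le_trans (ler_normD _ _)); apply: le_trans hA; rewrite lerD2r Im_le_nm.
  have i2 := Im_le_nm d.
  have i3 : `|s| * `|complex.Im v + h0| <= `|s| * A by rewrite ler_wpM2l.
  have i4 : p * (8 * (nm d + `|s| * A)) <= p * (b * t0).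
    have : A * (p * `|s|) <= A * nm d by apply: ler_wpM2l => //; clear - A1; lra.
    by clear - d2 ; lra.
  move: i4; rewrite ler_pM2l// => i4.
  have : b / 4 * (t0 / 2) <= b / 4 * (t0 + s) by apply: ler_wpM2l => //; clear - b0; lra.
  by clear - i2 i3 i4; lra.
clear - v0 fq r0 tz kn s2 uz r'r loc b0 t0p dE fz s1 fz0 st0 k.
have [||u' gu' u'z] := loc (h0 + k) (t0 + s).
- by rewrite addrC addKr.
- by rewrite addrC addKr; lra.
suff -> : u = u'.
  by exists (h0 + k), (t0 + s); split; [rewrite addrC addKr|rewrite addrC addKr; lra|].
apply: (tame_inj tz) => //; first by clear - r'r uz; lra.
rewrite (go_val (ltW st0) gu').1.
have -> : f u = f z * cexp d by rewrite dE mulrC divfK.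
rewrite fz /ray -mulrA -cexpD; congr (_ * cexp _).
rewrite !mulc_turn; apply/eqP; rewrite eq_complex.
rewrite (raddfD (@complex.Re R)) (raddfD (@complex.Im R)) /=.
apply/andP; split; apply/eqP; first by rewrite mulrDl /s divfK.
rewrite addrA [RHS]mulrDr /k mulrCA divff ?gt_eqF// mulr1; ring.
Qed.

Lemma sheet_step : exists2 e : R, 0 < e & forall q v h0 t0 z z1 r r' b A (c : R),
  f z = ray (f q) (turn v h0) t0 -> f z1 = ray (f q) (turn v h0) (t0 * (1 + b)) ->
  f q != 0 -> nm v + `|h0| <= A -> 0 < c -> tame f z r -> nm (z1 - z) < r ->
  0 < t0 -> 0 < b -> b * t0 * A < e ->
  r' = c * (b * t0) * nm (f z) / nm (dz f z) -> nm (z1 - z) <= 4 * A / c * r'.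
Proof.
have [e e0 he] := cexp_near0.
exists e => // q v h0 t0 z z1 r r' b A c fz fz1 fq hA c0 tz z1z t0p b0 bte r'E.
have [r0 dz0 _] := tz.
have D0 : 0 < nm (dz f z) by rewrite nm_gt0.
have F0 : 0 < nm (f z) by rewrite nm_gt0 fz ray_neq0.
have bt0 : 0 < b * t0 by rewrite mulr_gt0.
pose d := (b * t0)%:C * turn v h0.
have dn : nm d <= b * t0 * A.
  rewrite nmM nmC gtr0_norm// ler_pM2l//; apply: (le_trans (nmD _ _)); apply: le_trans hA.
  by rewrite lerD2l nmE /= expr0n /= add0r sqrtr_sqr.
have [h1 _] := he d (le_lt_trans dn bte).
have E : f z1 - f z = f z * (cexp d - 1).
  rewrite fz1 mulrBr mulr1 fz; congr (_ - _); rewrite /ray -mulrA -cexpD; congr (_ * cexp _).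
  by rewrite /d -mulrDl -rmorphD /=; congr (_%:C * _); ring.
have zz : nm (z - z) < r by rewrite subrr nm0.
have := tame_lower tz z1z zz; rewrite E nmM => h2.
rewrite r'E -(ler_pM2l D0).
have -> : nm (dz f z) * (4 * A / c * (c * (b * t0) * nm (f z) / nm (dz f z))) =
    2 * (nm (f z) * (2 * (b * t0 * A))).
  by field; rewrite !gt_eqF.
apply: (le_trans h2); rewrite ler_pM2l// ler_pM2l//; clear - dn h1; lra.
Qed.

Lemma ln1_half b : 0 < b -> b <= 1 -> b / 2 <= ln (1 + b).
Proof.
move=> b0 b1.
have e0 := expR_gt0 (b / 2); have e1 := expRxMexpNx_1 (b / 2).
have e2 := @expR_ge1Dx R (- (b / 2)).
by rewrite -[leLHS]expRK ler_ln ?posrE//; nra.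
Qed.

Lemma ln_diff x y : 0 < x -> 0 < y -> ln y - ln x <= (y - x) / x.
Proof.
move=> x0 y0; have := @expR_ge1Dx R (ln y - ln x).
rewrite expRB !lnK ?posrE// => h.
have -> : (y - x) / x = y / x - 1 by field; rewrite gt_eqF.
lra.
Qed.

Lemma fan_chain q v h0 b t0 T tau K R0 R1 Z (rr : R -> R) :
  0 < b -> b <= 1 -> 0 < t0 -> t0 <= T -> T <= tau -> t0 < tau -> 0 < K -> 1 <= R0 -> 2 * R0 <= R1 ->
  1 + nm (Z t0) <= R0 ->
  (forall t, T < t * (1 + b) -> t <= T -> R1 / 2 <= 1 + nm (Z t)) ->
  (forall t, t0 <= t -> t * (1 + b) <= T ->
     [/\ 0 < rr t, 4 * rr t <= 1, forall u, nm (u - Z t) < rr t -> block q v h0 t b u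
       & nm (Z (t * (1 + b)) - Z t) <= K * rr t]) ->
  (forall h t h' t' u, `|h - h0| <= b / 2 -> `|h' - h0| <= b / 2 -> 0 < t <= tau -> 0 < t' <= tau ->
     go f q (turn v h) t u -> go f q (turn v h') t' u -> t = t') ->
  pack (fan q v (h0 - b / 2) (h0 + b / 2) tau) R1
    (ln (R1 / (2 * R0)) ^+ 2 * b / (2 * K ^+ 2 * ln (tau / t0))).
Proof.
move=> b0 b1 t00 T1 Ttau tau1 K0 R01 R1R0 start top hdisc inj.
have b10 : 0 < 1 + b by lra.
pose tm j := t0 * (1 + b) ^+ j.
have tmS j : tm j.+1 = tm j * (1 + b) by rewrite /tm exprSr mulrA.
have tmge j : t0 <= tm j by rewrite /tm ler_peMr// ?(ltW t00)// exprn_ege1//; clear - b0; lra.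
have tm1 j : 0 < tm j := lt_le_trans t00 (tmge j).
have tmle j k : (j <= k)%N -> tm j <= tm k by move=> jk; rewrite /tm ler_pM2l// ler_weXn2l//; lra.
have lb := ln1_half b0 b1.
have ltau : 0 < ln (tau / t0) by rewrite ln_gt0// ltr_pdivlMr// mul1r.
have tml j : tm j <= tau -> j%:R * b <= 2 * ln (tau / t0).
  move=> h; have tau0 : 0 < tau / t0 by rewrite divr_gt0//; clear - t00 tau1; lra.
  have : ln ((1 + b) ^+ j) <= ln (tau / t0).
    by rewrite ler_ln ?posrE ?exprn_gt0// ler_pdivlMr// mulrC.
  have j0 : 0 <= j%:R :> R by [].
  by rewrite lnXn// -mulr_natl; clear - j0 lb; nra.
have [N [hN NT top_ N_]] : exists N, [/\ tm N <= T, True, R1 / 2 <= 1 + nm (Z (tm N)) &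
    forall j, (j < N)%N -> 1 + nm (Z (tm j)) < R1 / 2].
  have [n [n1 n2]] : exists n, tm n <= T /\ T < tm n.+1.
    have ex : exists n, tm n <= T by exists 0%N; rewrite /tm expr0 mulr1.
    have bd n : tm n <= T -> (n <= Num.bound (2 * ln (tau / t0) / b))%N.
      move=> h; have h1 := tml n (le_trans h Ttau).
      rewrite -(ler_nat R); apply/ltW; apply: le_lt_trans (archi_boundP _).
        by rewrite ler_pdivlMr.
      by apply: divr_ge0; [apply: mulr_ge0; rewrite ?(ltW ltau)|exact: ltW].
    have [n hn mx] := ex_maxnP ex bd; exists n; split => //.
    by rewrite ltNge; apply/negP => /mx; rewrite ltnn.
  have ex : exists n, (tm n <= T) && (R1 / 2 <= 1 + nm (Z (tm n))).
    by exists n; rewrite n1 top// -tmS.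
  have [N /andP[h1 h2] mn] := ex_minnP ex; exists N; split => // j jN.
  rewrite ltNge; apply/negP => h3.
  have /mn : (tm j <= T) && (R1 / 2 <= 1 + nm (Z (tm j))).
    by rewrite h3 andbT; apply: le_trans h1; apply: tmle; exact: ltnW.
  by rewrite leqNgt jN.
have l0 z : 0 < 1 + nm z by have := nm_ge0 z; clear - top_; lra.
pose G := ln (R1 / (2 * R0)).
have G0 : 0 <= G by rewrite ln_ge0// ler_pdivlMr; clear - R01 R1R0; lra.
pose la := G * b / (2 * K * ln (tau / t0)).
have la0 : 0 <= la by apply: divr_ge0; apply: mulr_ge0; clear - G0 b0 K0 ltau; lra.
have main k : (k <= N)%N -> pack (fan q v (h0 - b / 2) (h0 + b / 2) (tm k * (1 - b / 8))) R1
    (2 * la / K * (ln (1 + nm (Z (tm k))) - ln (1 + nm (Z t0))) - k%:R * la ^+ 2).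
  elim: k => [|k IH] kN; first by apply: pack0; rewrite /tm expr0 mulr1 subrr mulr0 mul0r subr0.
  have tk1 := tm1 k.
  have tkT : tm k * (1 + b) <= T.
    by rewrite -tmS; apply: le_trans hN; exact: tmle.
  have [rr0 rr1 rd rs] := hdisc _ (tmge k) tkT.
  have tkk : tm k <= T by clear - tkT tk1 b0; nra.
  set z := Z (tm k) in rd rs *.
  have wk : 2 * la / K * (ln (1 + nm (Z (tm k.+1))) - ln (1 + nm z)) - la ^+ 2 <=
      (rr (tm k) / (1 + nm z)) ^+ 2.
    have dl := ln_diff (l0 z) (l0 (Z (tm k.+1))).
    have dl' : ln (1 + nm (Z (tm k.+1))) - ln (1 + nm z) <= K * (rr (tm k) / (1 + nm z)).
      apply: (le_trans dl); rewrite mulrA ler_pM2r ?invr_gt0//.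
      have -> : 1 + nm (Z (tm k.+1)) - (1 + nm z) = nm (Z (tm k.+1)) - nm z by ring.
      by apply: (le_trans (nmDB _ _)); rewrite tmS.
    have c0 : 0 <= 2 * la / K by rewrite divr_ge0 ?(ltW K0)// mulr_ge0.
    have := ler_wpM2l c0 dl'; set a := rr (tm k) / (1 + nm z).
    have -> : 2 * la / K * (K * a) = 2 * la * a by field; rewrite gt_eqF.
    by have := sqr_ge0 (a - la); clear; nra.
  have rz : 1 + nm z < R1 / 2 by apply: N_.
  have z0 := nm_ge0 z.
  have pd : pack [set u | block q v h0 (tm k) b u] R1 ((rr (tm k) / (1 + nm z)) ^+ 2).
    by apply: pack_disc rd; clear - rr0 rr1 rz z0 R01 R1R0; lra.
  have tk8 : tm k * (1 + b / 8) < tm k.+1 * (1 - b / 8) by rewrite tmS -mulrA ltr_pM2l//; clear - b0 b1; nra.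
  have tk9 : tm k.+1 * (1 - b / 8) <= tau.
    by rewrite tmS; apply: le_trans Ttau; apply: le_trans tkT; clear - tk1 b0; nra.
  have e1 h : `|h - h0| <= b / 4 -> h0 - b / 2 < h < h0 + b / 2.
    by clear - b0; rewrite ler_norml => /andP[? ?]; apply/andP; split; lra.
  have e2 t : `|t - tm k| <= b * tm k / 8 -> tm k * (1 - b / 8) <= t <= tm k * (1 + b / 8).
    by clear; rewrite ler_norml => /andP[? ?]; apply/andP; split; lra.
  have tb : 0 < tm k * b by exact: mulr_gt0.
  have tk7 : 0 < tm k * (1 - b / 8) by clear - tk1 b1; nra.
  clear - inj b0 b1 IH pd wk tk8 tk9 tk1 e1 e2 tk7 tb kN.
  apply: (pack_le _ _ (pack_union (S := fan q v (h0 - b / 2) (h0 + b / 2) (tm k.+1 * (1 - b / 8)))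
    _ _ _ (IH (ltnW kN)) pd)) => //.
  - by rewrite -natr1 -/z; lra.
  - move=> u [h [t [hI t_0 tk g]]] [h' [t' [hh ht g']]].
    have /andP[t'1 t'2] := e2 t' ht.
    suff : t = t' by clear - tk t'1; lra.
    apply: (inj h t h' t' u) => //; clear - hI hh t_0 tk t'1 t'2 b0 tk7 tk8 tk9 tb.
    - by rewrite ler_norml; move: hI => /andP[? ?]; apply/andP; split; lra.
    - by move: hh; lra.
    - by apply/andP; split; lra.
    - by apply/andP; split; lra.
  - by move=> u [h [t [hI t_0 tk g]]]; exists h, t; split => //; lra.
  - move=> u [h [t [hh ht g]]]; exists h, t; have /andP[t1 t2] := e2 t ht.
    by split; [exact: e1|clear - t1 tk7; lra|clear - t2 tk8; lra|].
have tN := tm1 N.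
apply: (pack_le _ _ (main N (leqnn N))) => [u [h [t [hI t_0 tk g]]]|].
  by exists h, t; split => //; nra.
have Nb := tml N (le_trans hN Ttau).
have GG : G <= ln (1 + nm (Z (tm N))) - ln (1 + nm (Z t0)).
  have -> : G = ln (R1 / 2) - ln R0.
    by clear - R01 R1R0; rewrite /G -ln_div ?posrE; [congr ln; field; lra|lra|lra].
  by clear - start l0 R01 R1R0 top_; apply: lerB; rewrite ler_ln ?posrE//; lra.
have c0 : 0 <= 2 * la / K by rewrite divr_ge0 ?(ltW K0)// mulr_ge0.
have i1 := ler_wpM2l c0 GG.
have i2 : N%:R * la ^+ 2 <= la / K * G.
  have -> : la / K * G = 2 * ln (tau / t0) / b * la ^+ 2 by rewrite /la; field; rewrite !gt_eqF.
  by rewrite ler_wpM2r ?sqr_ge0// ler_pdivlMr.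
have -> : ln (R1 / (2 * R0)) ^+ 2 * b / (2 * K ^+ 2 * ln (tau / t0)) = la / K * G.
  by rewrite /la -/G; field; rewrite !gt_eqF.
have : 2 * la / K * G = la / K * G + la / K * G by ring.
lra.
Qed.

End LengthArea.

Section Sheets.
Variable R : realType.
Implicit Types (z w u a c d v : R[i]) (x y t s r e M S T B b h tau : R).
Implicit Types (W Z : R -> R[i]).
Variable f : R[i] -> R[i].
Hypotheses (hf : holo f) (nf : noncst f).

Lemma lift_go q v T Z t : dz f q != 0 -> lift f (ray (f q) v) T Z -> Z 0 = q -> t <= T ->
  go f q v t (Z t).
Proof. by move=> dq lZ Z0 tT; exists Z; split => //; exact: lift_sub lZ tT. Qed.

Lemma unif_cont_path Z T e : continuous Z -> 0 < e -> exists2 d, 0 < d &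
  forall s t, 0 <= s <= T -> `|t - s| < d -> nm (Z t - Z s) < e.
Proof.
move=> cZ e0.
have [d d0 h] := unif_cont T (cont_comp (@continuous_Re R) cZ) e0.
exists d => // s t /andP[s0 sT] st; have := h s%:C t%:C; rewrite /= nmC ger0_norm//.
by rewrite -rmorphB nmC => /(_ sT st).
Qed.

Definition slope v : R := `|complex.Re v|.

Definition spread v b : R := nm v + b + 1.

(* The ratio between the steps along a sheet and the radii of the discs packed around it. *)
Definition gap v b : R := 96 * spread v b * (slope v + spread v b) / slope v.

Record sheet q v b t0 tau R0 R1 : Prop := Sheet {
  sheet_base : f q != 0;
  sheet_dir : complex.Re v != 0;
  sheet_width : 0 <= b;
  sheet_early : 0 < t0;
  sheet_time : t0 < tau;
  sheet_inner : 1 <= R0;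
  sheet_outer : 2 * R0 <= R1;
  sheet_start : forall h u, `|h| <= b -> go f q (turn v h) t0 u -> 1 + nm u <= R0;
  sheet_inj : forall h t h' t' u, `|h| <= b -> `|h'| <= b -> 0 < t <= tau -> 0 < t' <= tau ->
    go f q (turn v h) t u -> go f q (turn v h') t' u -> h = h' /\ t = t' }.

Definition density v b t0 tau R0 R1 : R := ln (R1 / (2 * R0)) ^+ 2 / (2 * gap v b ^+ 2 * ln (tau / t0)).

Lemma strip q v b t0 tau R0 R1 h0 T u : sheet q v b t0 tau R0 R1 ->
  - b <= h0 <= b -> t0 <= T -> T <= tau -> go f q (turn v h0) T u ->
  R1 <= 1 + nm u -> exists2 d, 0 < d & forall x y, - b <= x -> x <= h0 -> h0 <= y -> y <= b ->
    h0 - d < x -> y < h0 + d -> pack (fan f q v x y tau) R1 ((density v b t0 tau R0 R1) * (y - x)).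
Proof.
move=> [fq v0 b0 t00 tau1 R01 R1R0 start inj] /andP[h0b bh0] T1 Ttau [Z [lZ Z0 ZT]] uR.
have T0 : 0 <= T by lra.
have tau0 : 0 < tau by lra.
have p0 : 0 < slope v by rewrite normr_gt0.
have A1 : 1 <= spread v b by rewrite /spread; have := nm_ge0 v; lra.
set A := spread v b in A1.
pose c := slope v / (24 * (slope v + A)).
have c0 : 0 < c by rewrite divr_gt0//; lra.
have gE : gap v b = 4 * A / c by rewrite /gap /c -/A; field; rewrite !gt_eqF//; clear - p0 A1; lra.
have c1 : c <= 1 by rewrite /c ler_pdivrMr ?mul1r; clear - p0 A1; lra.
have [r0 [D [r00 D0 ht0]]] := lift_tame hf T0 lZ.
have [r [rp r1 rr0]] : exists r, [/\ 0 < r, r <= 1 & r <= r0].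
  by exists (Num.min 1 r0); rewrite lt_min r00 ltr01 !ge_min !lexx orbT.
have r8 : 0 < r / 8 by clear - rp; lra.
have dq : dz f q != 0 by have [_ /(_ 0)[]] := lZ; rewrite ?lexx ?T0// Z0.
have [b1 b10 hl] := fan_lift hf nf T0 lZ Z0 r8.
have [d1 d10 hu] := unif_cont_path T lZ.1 r8.
have [e1 e10 he1] := @sheet_disc R f.
have [e2 e20 he2] := sheet_step f.
pose N := nm (f q) * expR (tau * slope v) + 1.
have N1 : 0 < N by rewrite ltr_wpDl// mulr_ge0 ?nm_ge0// expR_ge0.
have [m [m0 me1 me2 md1 mN]] : exists m, [/\ 0 < m, m <= e1, m * A <= e2, m <= d1 & m * N <= r / 4 * D].
  exists (Num.min (Num.min e1 (e2 / A)) (Num.min d1 (r / 4 * D / N))).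
  rewrite !lt_min e10 d10 !divr_gt0 ?mulr_gt0//=; [|clear - A1; lra..].
  have A0 : 0 < A by clear - A1; lra.
  by split => //; rewrite -?ler_pdivlMr// ?ge_min ?lexx ?orbT//.
pose d := Num.min (b1 / 2) (Num.min (1 / 2) (m / (2 * tau))).
have d0 : 0 < d by rewrite !lt_min !divr_gt0//; clear - tau0; lra.
have [db1 d12 dm] : [/\ d <= b1 / 2, d <= 1 / 2 & d <= m / (2 * tau)].
  by split; rewrite !ge_min lexx ?orbT.
clearbody d; exists d => // x y bx xh hy yb dx dy.
have [xy|xy] := eqVneq x y; first by apply: pack0; rewrite xy subrr mulr0.
have xy' : x < y by rewrite lt_neqAle xy (le_trans xh).
have [l [hc [xE yE]]] : exists l hc, x = hc - l / 2 /\ y = hc + l / 2.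
  by exists (y - x), ((x + y) / 2); split; field.
subst x y.
have l0 : 0 < l by clear - xy'; lra.
have l2 : l < 2 * d by clear - dx dy; lra.
have l1 : l <= 1 by clear - l2 d12; lra.
have lm : l * tau < m.
  have dm' : d * (2 * tau) <= m by rewrite -ler_pdivlMr//; clear - tau0; lra.
  by clear - l2 dm' tau0; nra.
have hcd h : `|h - hc| <= l / 2 -> `|h - h0| < b1 /\ `|h| <= b.
  rewrite !ler_norml ltr_norml; clear - bx xh hy yb dx dy db1.
  by move=> /andP[i1 i2]; split; apply/andP; split; lra.
have hcc : `|hc - hc| <= l / 2 by rewrite subrr normr0; clear - l0; lra.
have [Z1 lZ1 [Z10 hZ1]] := hl hc (hcd hc hcc).1.
have vA : nm v + `|hc| <= A.
  have : `|hc| <= b := (hcd hc hcc).2.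
  by rewrite /A /spread; clear; lra.
pose rr t := c * (l * t) * nm (f (Z1 t)) / nm (dz f (Z1 t)).
have tI t : t0 <= t -> t * (1 + l) <= T -> [/\ 0 <= t <= T, 0 <= t * (1 + l) <= T, l * t < m & t <= tau].
  clear - l0 T1 Ttau lm t00; move=> t1 tl; have lt : 0 < l * t by apply: mulr_gt0; lra.
  have tT : t <= tau by lra.
  have : l * t <= l * tau by rewrite ler_pM2l.
  by move=> i; split; rewrite ?(lt_le_trans _ tT)//; try (apply/andP; split); lra.
have tam t : 0 <= t <= T -> tame f (Z1 t) (r / 2) /\ D <= nm (dz f (Z1 t)).
  move=> tT; apply: (ht0 t); [by []|apply: lt_le_trans (hZ1 t tT) _|..]; clear - rp rr0; lra.
have -> : hc + l / 2 - (hc - l / 2) = l by field.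
have -> : density v b t0 tau R0 R1 * l = ln (R1 / (2 * R0)) ^+ 2 * l / (2 * gap v b ^+ 2 * ln (tau / t0)).
  by rewrite /density mulrAC.
apply: (@fan_chain R f q v hc l t0 T tau (gap v b) R0 R1 Z1 rr) => //.
- by rewrite gE; apply: divr_gt0 => //; apply: mulr_gt0 => //; clear - A1; lra.
- apply: (start hc (Z1 t0) (hcd hc hcc).2).
  exact: (lift_go dq lZ1).
- move=> t Tt tT.
  have t_0 : 0 < t by clear - Tt T1 l0 t00; nra.
  have tI0 : 0 <= t <= T by rewrite ltW.
  have i1 := hZ1 t tI0.
  have i2 : nm (Z T - Z t) < r / 8.
    by apply: hu => //; rewrite ger0_norm; clear - Tt tT lm md1 t_0 l0 Ttau; nra.
  have := nmDB (Z T) (Z1 t); have := nm_sub_trans (Z t) (Z T) (Z1 t).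
  rewrite (nmB (Z t)) ZT in i2 *; clear - i1 i2 r1 uR R01 R1R0.
  by lra.
- move=> t t1 tl; have [tT tlT ltm ttau] := tI t t1 tl.
  have t_0 : 0 < t by clear - t1 t00; lra.
  have [tz Dz] := tam t tT.
  have fZ : f (Z1 t) = ray (f q) (turn v hc) t := (lZ1.2 t tT).1.
  have fZN : nm (f (Z1 t)) <= N.
    rewrite fZ nm_ray Re_turn; apply: (le_trans (ler_wpM2l (nm_ge0 _) (_ : _ <= expR (tau * slope v)))).
      rewrite ler_expR; apply: (le_trans (ler_wpM2l (ltW t_0) (ler_norm _))).
      by apply: ler_wpM2r => //; exact: normr_ge0.
    by rewrite /N; clear; lra.
  have Dz0 : 0 < nm (dz f (Z1 t)) by clear - D0 Dz; lra.
  have fZ0 : 0 < nm (f (Z1 t)) by rewrite nm_gt0 fZ ray_neq0.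
  have lt0 : 0 < l * t by rewrite mulr_gt0.
  have rr4 : rr t <= r / 4.
    rewrite /rr ler_pdivrMr//; apply: (@le_trans _ _ (l * t * N)).
      have : c * (l * t) <= l * t by clear - c1 lt0; nra.
      by move=> i; apply: ler_pM => //; [rewrite mulr_ge0// ltW|exact: ltW].
    apply: (@le_trans _ _ (m * N)); first by rewrite ler_pM2r// ltW.
    by apply: (le_trans mN); rewrite ler_pM2l//; clear - rp; lra.
  have loc h t' : `|h - hc| <= l / 4 -> `|t' - t| <= l * t / 8 ->
      exists2 u', go f q (turn v h) t' u' & nm (u' - Z1 t) < r / 2.
    move=> hh ht'.
    have [|hb _] := hcd h; first by clear - hh l0; lra.
    have [Z' lZ' [Z'0 hZ']] := hl h hb.
    have t'T : 0 <= t' <= T.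
      move: ht'; rewrite ler_norml; clear - tlT lt0 l1 t_0 tl => /andP[i1 i2].
      by apply/andP; split; nra.
    exists (Z' t'); first by apply: (lift_go dq lZ'); case/andP: t'T.
    have i1 := hZ' t' t'T; have i2 := hZ1 t tT.
    have i3 : nm (Z t' - Z t) < r / 8.
      by apply: hu => //; clear - ht' ltm md1 lt0; lra.
    have := nm_sub_trans (Z t') (Z' t') (Z1 t); have := nm_sub_trans (Z t) (Z t') (Z1 t).
    by rewrite (nmB (Z t)); clear - i1 i2 i3 rp; lra.
  split.
  + by rewrite /rr divr_gt0// mulr_gt0// mulr_gt0.
  + by clear - rr4 r1; lra.
  + apply: (he1 q v hc t (Z1 t) (r / 2) (rr t) l A c) => //; first by clear - ltm me1; lra.
    by clear - rr4 rp; lra.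
  rewrite gE; apply: (he2 q v hc t (Z1 t) (Z1 (t * (1 + l))) (r / 2) (rr t) l A c) => //.
  + exact: (lZ1.2 _ tlT).1.
  + have i1 := hZ1 _ tlT; have i2 := hZ1 t tT.
    have i3 : nm (Z (t * (1 + l)) - Z t) < r / 8.
      apply: hu => //; have -> : t * (1 + l) - t = l * t by ring.
      by rewrite gtr0_norm//; clear - ltm md1; lra.
    have := nm_sub_trans (Z (t * (1 + l))) (Z1 (t * (1 + l))) (Z1 t).
    have := nm_sub_trans (Z t) (Z (t * (1 + l))) (Z1 t).
    by rewrite (nmB (Z t)); clear - i1 i2 i3 rp; lra.
  + by apply: lt_le_trans me2; rewrite ltr_pM2r//; clear - A1; lra.
move=> h t h' t' u' hh hh' tT t'T g g'.
by apply: (inj h t h' t' u' (hcd h hh).2 (hcd h' hh').2 tT t'T g g').2.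
Qed.

Lemma density_ge0 q v b t0 tau R0 R1 : sheet q v b t0 tau R0 R1 -> 0 <= density v b t0 tau R0 R1.
Proof.
move=> [fq v0 b0 t00 tau1 R01 R1R0 start inj]; apply: divr_ge0; first exact: sqr_ge0.
by apply: mulr_ge0; [rewrite mulr_ge0 ?sqr_ge0|rewrite ln_ge0// ler_pdivlMr// mul1r ltW].
Qed.

Lemma fan_union q v b t0 tau R0 R1 x y r V1 V2 : sheet q v b t0 tau R0 R1 ->
  - b <= x -> x <= y -> y <= r -> r <= b ->
  pack (fan f q v x y tau) R1 V1 -> pack (fan f q v y r tau) R1 V2 ->
  pack (fan f q v x r tau) R1 (V1 + V2).
Proof.
move=> [_ _ _ _ _ _ _ _ inj] bx xy yz zb; apply: pack_union => u; [|move=> [h [t [/andP[h1 h2] t1 t2 g]]]..].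
- move=> [h [t [/andP[h1 h2] t1 t2 g]]] [h' [t' [/andP[h3 h4] t3 t4 g']]].
  suff [E _] : h = h' /\ t = t' by move: h2 h3 E; clear; lra.
  have [hI hI'] : `|h| <= b /\ `|h'| <= b.
    by rewrite !ler_norml; clear - h1 h2 h3 h4 xy yz bx zb; split; apply/andP; split; lra.
  by apply: (inj h t h' t' u hI hI' _ _ g g'); rewrite ?t1 ?t3 /= ltW.
- by exists h, t; split => //; rewrite h1 (lt_le_trans h2).
- by exists h, t; split => //; rewrite h2 andbT (le_lt_trans xy).
Qed.

Lemma sheet_pack q v b t0 tau R0 R1 (E : seq R) x y e : sheet q v b t0 tau R0 R1 ->
  - b <= x -> x <= y -> y <= b -> 0 < e ->
  (forall h, x <= h <= y -> h \notin E -> exists T u,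
     [/\ t0 <= T, T <= tau, go f q (turn v h) T u & R1 <= 1 + nm u]) ->
  pack (fan f q v x y tau) R1 ((density v b t0 tau R0 R1) * (y - x) - e).
Proof.
move=> H; have k0 := density_ge0 H.
elim: E x y e => [|h0 E IH] x y e bx xy yb e0 esc.
  have : pack (fan f q v x y tau) R1 ((density v b t0 tau R0 R1) * (y - x)).
    pose Q x y := pack (fan f q v x y tau) R1 ((density v b t0 tau R0 R1) * (y - x)).
    apply: (@interval_cousin R x y Q xy) => [x' y' z' h1 h2 h3 h4 p1 p2|h hI].
      rewrite /Q (_ : (density v b t0 tau R0 R1) * (z' - x') = (density v b t0 tau R0 R1) * (y' - x') + (density v b t0 tau R0 R1) * (z' - y')); last by ring.
      by apply: (fan_union H _ h2 h3 _ p1 p2); clear - bx yb h1 h4; lra.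
    have [T [u [T1 T2 g uR]]] := esc h hI isT.
    have [|d d0 hd] := strip H _ T1 T2 g uR.
      by move: hI => /andP[i1 i2]; rewrite (le_trans bx i1) (le_trans i2 yb).
    exists d => // x' y' i1 i2 i3 i4 i5 i6; apply: hd => //; first exact: le_trans i1.
    exact: le_trans yb.
  by apply: pack_le => //; clear - e0; lra.
have [hin|hout] := boolP (x <= h0 <= y); last first.
  apply: IH => // h hI hE; apply: esc => //; rewrite inE negb_or hE andbT.
  by apply: contraNneq hout => <-.
have [d d0 dk] : exists2 d, 0 < d & (density v b t0 tau R0 R1) * d <= e / 8.
  exists (e / 8 / ((density v b t0 tau R0 R1) + 1)); first by rewrite divr_gt0//; clear - e0 k0; lra.
  have k1 : 0 < (density v b t0 tau R0 R1) + 1 by clear - k0; lra.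
  by rewrite mulrA ler_pdivrMr//; clear - e0 k0; nra.
case/andP: hin => h1 h2.
have p1 : pack (fan f q v x h0 tau) R1 ((density v b t0 tau R0 R1) * (h0 - x) - e / 2).
  have [hx|hx] := leP (h0 - x) d.
    apply: pack0; have := ler_wpM2l k0 hx; clear - dk e0; lra.
  have := IH x (h0 - d) (e / 8) bx _ _ _ _.
  move=> /(_ ltac:(clear - hx; lra) ltac:(clear - d0 h2 yb; lra) ltac:(clear - e0; lra)) pk.
  apply: pack_le (pk _) => [u [h [t [/andP[i1 i2] i3 i4 i5]]]||h /andP[i1 i2] hE].
  - by exists h, t; split => //; apply/andP; split => //; clear - i2 d0; lra.
  - clear - dk e0; lra.
  - apply: esc; first by apply/andP; split => //; clear - i2 d0 h2; lra.
    by rewrite inE negb_or hE andbT lt_eqF//; clear - i2 d0; lra.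
have p2 : pack (fan f q v h0 y tau) R1 ((density v b t0 tau R0 R1) * (y - h0) - e / 2).
  have [hx|hx] := leP (y - h0) d.
    apply: pack0; have := ler_wpM2l k0 hx; clear - dk e0; lra.
  have := IH (h0 + d) y (e / 8) _ _ yb _ _.
  move=> /(_ ltac:(clear - d0 h1 bx; lra) ltac:(clear - hx; lra) ltac:(clear - e0; lra)) pk.
  apply: pack_le (pk _) => [u [h [t [/andP[i1 i2] i3 i4 i5]]]||h /andP[i1 i2] hE].
  - by exists h, t; split => //; apply/andP; split => //; clear - i1 d0; lra.
  - clear - dk e0; lra.
  - apply: esc; first by apply/andP; split => //; clear - i1 d0 h1; lra.
    by rewrite inE negb_or hE andbT gt_eqF//; clear - i1 d0; lra.
have -> : (density v b t0 tau R0 R1) * (y - x) - e = ((density v b t0 tau R0 R1) * (h0 - x) - e / 2) + ((density v b t0 tau R0 R1) * (y - h0) - e / 2).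
  by field.
exact: (fan_union H bx h1 h2 yb p1 p2).
Qed.

End Sheets.

Section LengthAreaBound.
Variable R : realType.
Implicit Types (z w u a c d v : R[i]) (x y t s r e M S T B b h tau : R).
Variable f : R[i] -> R[i].
Hypotheses (hf : holo f) (nf : noncst f).

Theorem length_area n (q : nat -> R[i]) v b t0 tau R0 R1 :
  (forall i, (i < n)%N -> f (q i) != 0) -> complex.Re v != 0 -> 0 <= b -> 0 < t0 -> t0 < tau ->
  1 <= R0 -> 2 * R0 <= R1 ->
  (forall i h u, (i < n)%N -> `|h| <= b -> go f (q i) (turn v h) t0 u -> 1 + nm u <= R0) ->
  (forall i h t i' h' t' u, (i < n)%N -> (i' < n)%N -> `|h| <= b -> `|h'| <= b ->
     0 < t <= tau -> 0 < t' <= tau ->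
     go f (q i) (turn v h) t u -> go f (q i') (turn v h') t' u -> [/\ i = i', h = h' & t = t']) ->
  (forall i, (i < n)%N -> exists E : seq R, forall h, `|h| <= b -> h \notin E -> exists T u,
     [/\ t0 <= T, T <= tau, go f (q i) (turn v h) T u & R1 <= 1 + nm u]) ->
  n%:R * b * ln (R1 / (2 * R0)) ^+ 2 <= 128 * gap v b ^+ 2 * ln (tau / t0) * ln (4 * R1).
Proof.
move=> fq v0 b0 t00 tau1 R01 R10 start inj esc.
pose k := density v b t0 tau R0 R1.
have pk e m : 0 < e -> (m <= n)%N ->
    pack [set u | exists i, (i < m)%N /\ fan f (q i) v (- b) b tau u] R1 (m%:R * (k * (2 * b) - e)).
  move=> e0; elim: m => [|m IH] mn; first by apply: pack0; rewrite mul0r.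
  have [E hE] := esc m mn.
  have p2 : pack (fan f (q m) v (- b) b tau) R1 (k * (b - - b) - e).
    apply: (sheet_pack hf nf (E := E)) => //; last 2 first.
    - by clear - b0; lra.
    - by move=> h hI; apply: hE; rewrite ler_norml.
    split => //; first exact: fq.
      by move=> h u; exact: start.
    by move=> h t h' t' u hb hb' tt tt' g g'; have [] := inj m h t m h' t' u mn mn hb hb' tt tt' g g'.
  rewrite -natr1 mulrDl mul1r (_ : 2 * b = b - - b); last by ring.
  rewrite (_ : 2 * b = b - - b) in IH; last by ring.
  apply: (pack_union _ _ _ (IH (ltnW mn)) p2) => [u [i [im [h [t [h1 t_0 tt g]]]]] [h' [t' [h2 t0' tt' g']]]|u [i [im F]]|u F].
  - have [E1 _ _] : [/\ i = m, h = h' & t = t'].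
      apply: (inj i h t m h' t' u) => //; first exact: ltn_trans mn.
      + by move: h1; rewrite ler_norml; clear; lra.
      + by move: h2; rewrite ler_norml; clear; lra.
      + by rewrite t_0 ltW.
      + by rewrite t0' ltW.
    by move: im; rewrite E1 ltnn.
  - by exists i; split => //; exact: ltnW.
  - by exists m.
have hk : n%:R * (k * (2 * b)) <= 128 * ln (4 * R1).
  apply/ler_addgt0Pr => e e0.
  have n1 : 0 < n%:R + 1 :> R by rewrite ltr_wpDl.
  have e1 : 0 < e / (n%:R + 1) by rewrite divr_gt0.
  have := pack_bound _ (pk _ n e1 (leqnn n)); rewrite mulrBr => /(_ ltac:(lra)) h.
  have : n%:R * (e / (n%:R + 1)) <= e by rewrite mulrCA ger_pMr// ler_pdivrMr//; clear - h; lra.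
  clear - h; lra.
have lt : 0 < ln (tau / t0) by rewrite ln_gt0// ltr_pdivlMr// mul1r.
have g0 : 0 < gap v b.
  have p0 : 0 < slope v by rewrite normr_gt0.
  have A1 : 0 < spread v b by rewrite /spread; have := nm_ge0 v; clear - b0; lra.
  by rewrite divr_gt0// !mulr_gt0//; clear - p0 A1; lra.
have kE : k * (gap v b ^+ 2 * ln (tau / t0)) * 2 = ln (R1 / (2 * R0)) ^+ 2.
  by rewrite /k /density; field; rewrite !gt_eqF.
rewrite -kE.
have g2 : 0 <= gap v b ^+ 2 * ln (tau / t0) by apply: mulr_ge0; [exact: sqr_ge0|exact: ltW].
have := ler_wpM2r g2 hk.
rewrite (_ : n%:R * b * (k * (gap v b ^+ 2 * ln (tau / t0)) * 2) = n%:R * (k * (2 * b)) * (gap v b ^+ 2 * ln (tau / t0))); last by ring.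
by rewrite (_ : 128 * gap v b ^+ 2 * ln (tau / t0) * ln (4 * R1) = 128 * ln (4 * R1) * (gap v b ^+ 2 * ln (tau / t0))); last by ring.
Qed.

End LengthAreaBound.

(** * Gross's theorem *)

Section Gross.
Variable R : realType.
Implicit Types (z w u a c d v q : R[i]) (x y t s r e M S T B b h tau : R).
Variable f : R[i] -> R[i].
Hypotheses (hf : holo f) (nf : noncst f).

Lemma turnD v x y : turn (turn v x) y = turn v (x + y).
Proof. by rewrite /turn -addrA; congr (_ + _); apply/eqP; rewrite eq_complex /= addr0 !eqxx. Qed.

Lemma turn_scale v s h : turn (s%:C * v) (s * h) = s%:C * turn v h.
Proof.
case: v => a b; rewrite /turn; apply/eqP; rewrite eq_complex /=.
by apply/andP; split; apply/eqP; ring.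
Qed.

Lemma go_near q A e : dz f q != 0 -> 0 < e -> exists2 s, 0 < s &
  forall w t, nm w <= A -> 0 <= t <= s -> exists2 u, go f q w t u & nm (u - q) < e.
Proof.
move=> dq e0; have [r0 [M g0]] := good_exists hf dq; have [r00 M0 _ _] := g0.
have [r [rp re rr]] : exists r, [/\ 0 < r, r <= e & r <= r0].
  by exists (Num.min e r0); rewrite lt_min r00 e0 !ge_min !lexx orbT.
have g := good_mono g0 rp rr (lexx M).
have [e1 e10 he1] := @cexp_near0 R.
pose k := r / (4 * M).
have k0 : 0 < k by rewrite divr_gt0// mulr_gt0.
pose A' := `|A| + 1; pose N := nm (f q) + 1.
have A'0 : 0 < A' by rewrite ltr_wpDl.
have N0 : 0 < N by rewrite ltr_wpDl ?nm_ge0.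
pose s := Num.min (e1 / (2 * A')) (k / (4 * N * A')).
have s0 : 0 < s by rewrite lt_min !divr_gt0 ?mulr_gt0.
have [s1 s2] : s * (2 * A') <= e1 /\ s * (4 * N * A') <= k.
  by rewrite -!ler_pdivlMr ?mulr_gt0// !ge_min !lexx orbT.
clearbody s; exists s => // w t wA /andP[t0 ts].
have [|Z lZ hZ] := lift_perturb hf nf (@cont_cst R R[i] q) (ltW s0) (fun _ _ => g) (@ray_cont R (f q) w).
  move=> t' /andP[t'0 t's].
  have tw : nm (t'%:C * w) <= s * A'.
    rewrite nmM nmC ger0_norm//; apply: ler_pM; rewrite ?nm_ge0//.
    by apply: (le_trans wA); rewrite /A'; have := ler_norm A; clear - t's; lra.
  have [|h1 _] := he1 (t'%:C * w).
    by apply: (le_lt_trans tw); apply: lt_le_trans s1; have := mulr_gt0 s0 A'0; lra.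
  have -> : ray (f q) w t' - f q = f q * (cexp (t'%:C * w) - 1) by rewrite /ray; ring.
  rewrite nmM; apply: (@le_lt_trans _ _ (N * (2 * (s * A')))).
    apply: ler_pM; rewrite ?nm_ge0//; last by clear - tw h1; lra.
    by rewrite /N; clear; lra.
  have : 0 < s * N * A' by rewrite !mulr_gt0.
  by rewrite -/k; clear - s2; lra.
have I0 : (0:R) <= 0 <= s by rewrite lexx ltW.
have Z0 : Z 0 = q.
  have [_ _ _ inj] := g.
  have h0 := hZ 0 I0.
  have := inj (Z 0) q; rewrite subrr nm0 => /(_ ltac:(clear - rp h0; lra) rp).
  have [_ /(_ 0 I0)[-> _]] := lZ; rewrite ray0 subrr nm0 mulr0 => g2.
  by apply/eqP; rewrite -subr_eq0 -nm_eq0 eq_le g2 nm_ge0.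
have tI : 0 <= t <= s by rewrite t0.
exists (Z t); first exact: (lift_go dq lZ Z0 ts).
by have := hZ t tI; clear - rp re; lra.
Qed.

Lemma ray_inj w v t h t' h' : w != 0 -> complex.Re v != 0 -> 0 < t -> `|t * (h - h')| < 2 * pi ->
  ray w (turn v h) t = ray w (turn v h') t' -> h = h' /\ t = t'.
Proof.
move=> w0 v0 t0 hh /(mulfI w0)/cexp_inj_mod[k].
rewrite !mulc_turn => /eqP; rewrite eq_complex (raddfD (@complex.Re R)) (raddfD (@complex.Im R)) /=.
rewrite addr0 => /andP[/eqP/(mulIf v0) E /eqP E2].
suff k0 : k = 0.
  split => //; move: E2; rewrite k0 -E mulr0 addr0 => /(mulfI (lt0r_neq0 t0)).
  exact: addrI.
have p2 := pi2_gt0 R.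
have E3 : t * (h - h') = 2 * pi * k%:~R by move: E2; rewrite -E; lra.
move: hh; rewrite E3 normrM (gtr0_norm p2) gtr_pMr// -intr_norm.
by rewrite -[1]/(1%:~R) ltr_int; lia.
Qed.

Theorem gross q v x y : f q != 0 -> dz f q != 0 -> complex.Re v != 0 -> x < y ->
  exists h u, x < h < y /\ go f q (turn v h) 1 u.
Proof.
move=> fq dq v0 xy; apply: contrapT => hn.
pose v1 := turn v ((x + y) / 2).
have v10 : complex.Re v1 != 0 by rewrite Re_turn.
pose b := Num.min 1 ((y - x) / 4).
have b0 : 0 < b by rewrite lt_min ltr01 divr_gt0// subr_gt0.
have [b1 bxy] : b <= 1 /\ b <= (y - x) / 4 by rewrite !ge_min !lexx orbT.
clearbody b.
have {}hn h u : `|h| <= b -> ~ go f q (turn v1 h) 1 u.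
  rewrite ler_norml turnD => /andP[h1 h2] g; apply: hn; exists ((x + y) / 2 + h), u; split => //.
  by apply/andP; split; lra.
have [s0 s00 near] := @go_near q (nm v1 + b) 1 dq ltr01.
pose s := Num.min s0 (1 / 2).
have s_0 : 0 < s by rewrite lt_min s00 divr_gt0.
have [ss0 s12] : s <= s0 /\ s <= 1 / 2 by rewrite !ge_min !lexx orbT.
clearbody s.
pose v2 := s%:C * v1; pose b2 := s * b; pose tau := s^-1.
have v20 : complex.Re v2 != 0.
  by rewrite /v2; case: (v1) v10 => p r /= p0; rewrite mul0r subr0 mulf_neq0// gt_eqF.
have b20 : 0 < b2 by rewrite mulr_gt0.
have tau1 : 1 < tau by rewrite /tau invf_gt1//; clear - s12; lra.
have conv h t u : 0 < t -> go f q (turn v2 (s * h)) t u -> go f q (turn v1 h) (s * t) u.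
  move=> t0; rewrite turn_scale => g; have {g} := (@go_scale1 _ f q (s%:C * turn v1 h) t u t0).1 g.
  have -> : t%:C * (s%:C * turn v1 h) = (s * t)%:C * turn v1 h by rewrite rmorphM /=; ring.
  by move=> g; exact: ((@go_scale1 _ f q (turn v1 h) (s * t) u (mulr_gt0 s_0 t0)).2 g).
have split_h h : `|h| <= b2 -> exists2 h', h = s * h' & `|h'| <= b.
  move=> hb; exists (h / s); first by rewrite mulrC divfK// gt_eqF.
  by rewrite normrM normrV ?unitfE ?gt_eqF// (gtr0_norm s_0) ler_pdivrMr// mulrC.
have wn h : `|h| <= b -> nm (turn v1 h) <= nm v1 + b.
  move=> hb; apply: (le_trans (nmD _ _)); rewrite lerD2l nmE /= expr0n /= add0r sqrtr_sqr.
  exact: hb.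
pose R0 := 2 + nm q.
have R01 : 1 <= R0 by rewrite /R0; have := nm_ge0 q; clear - b20; lra.
have loc h t u : `|h| <= b2 -> 0 < t -> t <= 1 -> go f q (turn v2 h) t u -> 1 + nm u <= R0.
  move=> /split_h[h' -> hb'] t0 t1 /(conv h' t u t0) g.
  have [|u' g' uq] := near (turn v1 h') (s * t) (wn h' hb').
    by apply/andP; split; [by rewrite mulr_ge0 ?ltW|clear - s_0 ss0 t1; nra].
  have st0 : 0 <= s * t by rewrite mulr_ge0 ?ltW.
  rewrite (go_uniq hf st0 g g') /R0; have := nmDB u' q; clear - uq; lra.
have main X : 0 <= X -> b2 * X ^+ 2 <= 128 * gap v2 b2 ^+ 2 * ln tau * (X + ln (8 * R0)).
  move=> X0; pose R1 := 2 * R0 * expR X.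
  have eX : 1 <= expR X by have := @expR_ge1Dx R X; clear - X0; lra.
  have R1R0 : 2 * R0 <= R1 by rewrite /R1; nra.
  have := @length_area R f hf nf 1 (fun=> q) v2 b2 1 tau R0 R1 (fun _ _ => fq) v20 (ltW b20) ltr01 tau1 R01 R1R0.
  have -> : R1 / (2 * R0) = expR X by rewrite /R1 mulrAC divff ?mul1r// gt_eqF//; lra.
  have -> : 4 * R1 = expR X * (8 * R0) by rewrite /R1; ring.
  rewrite divr1 lnM ?posrE ?expR_gt0//; last by lra.
  rewrite !expRK mul1r; apply.
  - by move=> _ h u _ hb; apply: loc => //; exact: ltr01.
  - move=> i h t i' h' t' u; rewrite !ltnS !leqn0 => /eqP -> /eqP -> hb hb' /andP[t0 tt] /andP[t'0 tt'] g g'.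
    have [] // := @ray_inj (f q) v2 t h t' h' fq v20 t0.
      rewrite normrM (gtr0_norm t0).
      have h2 : `|h - h'| <= 2 * b2.
        by apply: (le_trans (ler_normB _ _)); clear - hb hb'; lra.
      have : t * `|h - h'| <= tau * (2 * b2) by apply: ler_pM => //; exact: ltW.
      have -> : tau * (2 * b2) = 2 * b by rewrite /tau /b2; field; rewrite gt_eqF.
      by have := pi_ge2 R; clear - b1; lra.
    by rewrite -(go_val (ltW t0) g).1 -(go_val (ltW t'0) g').1.
  - move=> i _; have [E hE] := @ray_dichotomy R f hf nf q v2 b2 R1 fq dq v20.
    exists E => h hb hnE.
    have tau0 : 0 <= tau by clear - tau1; lra.
    have [[u g]|[t [u [t0 tt g uR]]]] := hE h hb hnE tau tau0.
      have [h' hh hb'] := split_h h hb.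
      rewrite hh in g; have tp : 0 < tau by lra.
      by have := conv h' tau u tp g; rewrite /tau divff ?gt_eqF// => /(hn h' u hb').
    have [t1|t1] := leP 1 t; first by exists t, u; split => //; clear - tt uR; lra.
    have [tz|tn] := eqVneq t 0.
      move: g; rewrite tz => g; have := go_uniq hf (lexx 0) g (go0 _ dq) => uq.
      by move: uR; rewrite uq /R1 /R0; have := nm_ge0 q; nra.
    have tp : 0 < t by rewrite lt_neqAle eq_sym tn.
    by have := loc h t u hb tp (ltW t1) g; lra.
pose K := 128 * gap v2 b2 ^+ 2 * ln tau; pose L := ln (8 * R0).
have L0 : 0 <= L by rewrite ln_ge0//; lra.
have K0 : 0 <= K by apply: mulr_ge0; [rewrite mulr_ge0 ?sqr_ge0|rewrite ln_ge0// ltW].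
have q0 : 0 <= K * (1 + L) / b2.
  by apply: divr_ge0; [apply: mulr_ge0 => //; clear - L0; lra|exact: ltW].
have := main (K * (1 + L) / b2 + 1) ltac:(clear - q0; lra); rewrite -/K -/L.
set X := K * (1 + L) / b2 + 1.
have X1 : 1 <= X by rewrite /X; clear - q0; lra.
have bX : b2 * X = K * (1 + L) + b2 by rewrite /X; field; rewrite gt_eqF.
rewrite expr2 mulrA bX => h.
have : K * (X + L) <= K * (1 + L) * X by rewrite -mulrA; apply: ler_wpM2l => //; clear - L0 X1; nra.
have : 0 < b2 * X by rewrite mulr_gt0//; clear - X1; lra.
clear - h; lra.
Qed.

End Gross.

(** * Minimum modulus of functions of finite order *)

Section MinimumModulus.
Variable R : realType.
Implicit Types (z w u a c d : R[i]) (x y t s r e M S T B b h : R) (f g k : R[i] -> R[i]).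

Lemma holo_sum (I : Type) (s : seq I) (F : I -> R[i] -> R[i]) :
  (forall i, holo (F i)) -> holo (fun z => \sum_(i <- s) F i z).
Proof.
move=> hF; elim: s => [|i s IH].
  by under eq_fun => z do rewrite big_nil; exact: holo_cst.
by under eq_fun => z do rewrite big_cons; exact: holo_add.
Qed.

Lemma holo_prod (I : Type) (s : seq I) (P : pred I) (F : I -> R[i] -> R[i]) :
  (forall i, holo (F i)) -> holo (fun z => \prod_(i <- s | P i) F i z).
Proof.
move=> hF; elim: s => [|i s IH].
  by under eq_fun => z do rewrite big_nil; exact: holo_cst.
under eq_fun => z do rewrite big_cons.
by case: (P i) => //; exact: holo_mul.
Qed.

Lemma factor_roots (s : seq R[i]) g : holo g -> uniq s -> (forall c, c \in s -> g c = 0) ->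
  exists2 k, holo k & forall z, g z = \prod_(c <- s) (z - c) * k z.
Proof.
elim: s g => [|a s IH] g hg; first by exists g => // z; rewrite big_nil mul1r.
move=> /= /andP[as_ us] h; have ga : g a = 0 by apply: h; rewrite inE eqxx.
have [|k hk E] := IH (quo g a) (holo_quo a hg) us.
  move=> c cs; rewrite /quo; case: eqVneq cs as_ => [->->//|_ cs _].
  by rewrite ga h ?subrr ?mul0r// inE cs orbT.
by exists k => // z; rewrite (quoE g a z) ga add0r E big_cons mulrA.
Qed.

Definition gapfac (n i : nat) : R := \prod_(j < n.+1 | j != i :> nat) `|i%:R - j%:R|.

Lemma gapfacE n i : (i <= n)%N -> gapfac n i = (i`! * (n - i)`!)%:R.
Proof.
elim: n => [|n IH].
  rewrite leqn0 => /eqP ->; rewrite /gapfac big_mkcond big_ord_recl big_ord0 /=.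
  by rewrite mulr1 subn0.
rewrite leq_eqVlt => /orP[/eqP ->{i IH}|].
  rewrite subnn muln1 /gapfac.
  have -> : \prod_(j < n.+2 | j != n.+1 :> nat) `|n.+1%:R - j%:R| = \prod_(j < n.+1) (n.+1 - j)%:R :> R.
    rewrite big_mkcond big_ord_recr /= eqxx mulr1; apply: eq_bigr => j _.
    by rewrite neq_ltn ltn_ord /= natrB ?(ltnW (ltn_ord j))// ger0_norm// subr_ge0 ler_nat ltnW.
  rewrite -natr_prod; congr (_%:R).
  elim: n => [|n IH]; first by rewrite big_ord_recl big_ord0.
  by rewrite big_ord_recl /= subn0 [in RHS]factS -IH.
rewrite ltnS => ni; rewrite /gapfac big_mkcond big_ord_recr -big_mkcond /= -/(gapfac n i) IH//.
rewrite gtn_eqF ?ltnS//= subSn// factS distrC.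
by rewrite ger0_norm ?subr_ge0 ?ler_nat 1?ltnW// -natrB 1?ltnW// -natrM subSn// mulnCA mulnC mulnA mulnAC.
Qed.

Lemma sum_gapfac n : \sum_(i < n.+1) (gapfac n i)^-1 = 2 ^+ n / n`!%:R :> R.
Proof.
have <- : \sum_(i < n.+1) 'C(n, i)%:R = 2 ^+ n :> R.
  have := @exprD1n R 1 n; rewrite -[1 + 1]/(2%:R) => ->.
  by apply: eq_bigr => i _; rewrite expr1n.
rewrite mulr_suml; apply: eq_bigr => i _.
rewrite gapfacE -1?ltnS//.
have i0 : 0 < (i`! * (n - i)`!)%:R :> R by rewrite ltr0n muln_gt0 !fact_gt0.
have n0 : 0 < n`!%:R :> R by rewrite ltr0n fact_gt0.
by apply: (mulIf (lt0r_neq0 i0)); rewrite mulVf ?gt_eqF// mulrAC -natrM bin_fact -1?ltnS// divff// gt_eqF.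
Qed.

Lemma expn_fact n : n%:R ^+ n <= expR n%:R * n`!%:R :> R.
Proof.
elim: n => [|n IH]; first by rewrite !expr0 expR0 mul1r.
have [->|n0] := posnP n; first by rewrite expr1 mulr1; have := @expR_ge1Dx R 1; lra.
rewrite exprS factS natrM mulrCA ler_pM2l ?ltr0n//.
have np : 0 < n%:R :> R by rewrite ltr0n.
have -> : n.+1%:R = n%:R * (1 + n%:R^-1) :> R by rewrite mulrDr mulr1 divff ?gt_eqF// natr1.
rewrite exprMn.
have e1 : (1 + n%:R^-1) ^+ n <= expR 1 :> R.
  apply: (le_trans (lerXn2r n _ _ (expR_ge1Dx n%:R^-1))); rewrite ?nnegrE ?expR_ge0 ?addr_ge0 ?invr_ge0//.
  by rewrite -expRM_natl mulrV// unitfE gt_eqF.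
rewrite mulrDr mulr1 divff ?gt_eqF// expRD -mulrA (mulrC (expR 1)) mulrA.
by apply: ler_pM => //; rewrite ?exprn_ge0 ?addr_ge0 ?invr_ge0.
Qed.

Lemma nm_prod_cond (I : Type) (s : seq I) (P : pred I) (F : I -> R[i]) :
  nm (\prod_(i <- s | P i) F i) = \prod_(i <- s | P i) nm (F i).
Proof.
rewrite big_mkcond nm_prod [RHS]big_mkcond; apply: eq_bigr => i _.
by case: ifP; rewrite ?nm1.
Qed.

Definition lag (p : nat -> R[i]) N i z := \prod_(j < N.+1 | j != i :> nat) ((z - p j) / (p i - p j)).

Lemma lag_node p N i (k : nat) : (k <= N)%N -> (forall i j, (i <= N)%N -> (j <= N)%N -> i != j -> p i != p j) ->
  (i <= N)%N -> lag p N i (p k) = (k == i)%:R.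
Proof.
move=> kN inj iN; rewrite /lag; case: eqVneq => [->|ki].
  apply: big1 => j ji; rewrite divff// subr_eq0 inj//; first by rewrite -ltnS.
  by rewrite eq_sym.
by rewrite (bigD1 (Ordinal (kN : k < N.+1)%N)) //= subrr mul0r mul0r.
Qed.

Lemma lag_bound p N r i z : (0 < N)%N -> 0 < r -> (i <= N)%N ->
  (forall j, (j <= N)%N -> nm (p j) = r * (1 + j%:R / N%:R)) -> nm z <= 8 * r ->
  nm (lag p N i z) <= (10 * N%:R) ^+ N / gapfac N i.
Proof.
move=> N0 r0 iN pE zr; have Np : 0 < N%:R :> R by rewrite ltr0n.
rewrite /lag nm_prod_cond /gapfac.
have c : #|[pred j : 'I_N.+1 | j != i :> nat]| = N.
  transitivity #|predC1 (Ordinal (iN : i < N.+1)%N)|; last by rewrite cardC1 card_ord.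
  by apply: eq_card => j; rewrite !inE.
have -> : (10 * N%:R) ^+ N = \prod_(j < N.+1 | j != i :> nat) (10 * N%:R) :> R.
  by rewrite prodr_const c.
rewrite -prodf_div; apply: ler_prod => j ji; rewrite nm_ge0 /= nmM nmV.
have ij : 0 < `|i%:R - j%:R| :> R by rewrite normr_gt0 subr_eq0 eqr_nat eq_sym.
have jN : (j <= N)%N by rewrite -ltnS.
have jN1 : j%:R / N%:R <= 1 :> R by rewrite ler_pdivrMr// mul1r ler_nat.
have h1 : nm (z - p j) <= 10 * r.
  by apply: (le_trans (nmD _ _)); rewrite nmN pE//; nra.
have h2 : r * `|i%:R - j%:R| / N%:R <= nm (p i - p j).
  have -> : r * `|i%:R - j%:R| / N%:R = `|nm (p i) - nm (p j)|.
    rewrite !pE// -mulrBr normrM (gtr0_norm r0) -mulrA; congr (_ * _).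
    by rewrite opprD addrACA subrr add0r -mulrBl normrM normrV ?unitfE ?gt_eqF// (gtr0_norm Np).
  by rewrite ler_norml nmDB; have := nmDB (p j) (p i); rewrite nmB; lra.
have q0 : 0 < r * `|i%:R - j%:R| / N%:R by rewrite divr_gt0// mulr_gt0.
have d0 : 0 < nm (p i - p j) := lt_le_trans q0 h2.
rewrite ler_pdivrMr//; apply: (le_trans h1).
have -> : 10 * r = 10 * N%:R / `|i%:R - j%:R| * (r * `|i%:R - j%:R| / N%:R).
  by field; rewrite !gt_eqF.
by rewrite ler_pM2l// divr_gt0// mulr_gt0.
Qed.

Lemma interp_sum p N r z : (0 < N)%N -> 0 < r ->
  (forall j, (j <= N)%N -> nm (p j) = r * (1 + j%:R / N%:R)) -> nm z <= 8 * r ->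
  \sum_(i < N.+1) nm (lag p N i z) <= expR (6 * N%:R).
Proof.
move=> N0 r0 pE zr.
apply: (@le_trans _ _ (\sum_(i < N.+1) (10 * N%:R) ^+ N / gapfac N i)).
  by apply: ler_sum => i _; apply: (@lag_bound p N r) => //; rewrite -ltnS.
have n0 : 0 < N`!%:R :> R by rewrite ltr0n fact_gt0.
rewrite -mulr_sumr sum_gapfac exprMn mulrA ler_pdivrMr//.
have -> : 10 ^+ N * N%:R ^+ N * 2 ^+ N = 20 ^+ N * N%:R ^+ N :> R.
  by rewrite mulrAC -exprMn; congr (_ ^+ _ * _); ring.
have -> : 6 * N%:R = 5 * N%:R + N%:R :> R by ring.
rewrite expRD -mulrA; apply: ler_pM; rewrite ?exprn_ge0//; last exact: expn_fact.
rewrite expRM_natr lerXn2r ?nnegrE ?expR_ge0//.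
rewrite -[in leRHS](mulr1 5) expRM_natl.
have e2 : 2 <= expR 1 :> R by have := @expR_ge1Dx R 1; lra.
apply: (@le_trans _ _ (2 ^+ 5)); first by lra.
by rewrite lerXn2r ?nnegrE ?expR_ge0.
Qed.

Lemma interp_bound g N (p : nat -> R[i]) r M e : holo g -> (0 < N)%N -> 0 < r ->
  (forall j, (j <= N)%N -> nm (p j) = r * (1 + j%:R / N%:R)) ->
  (forall j, (j <= N)%N -> nm (g (p j)) <= e) ->
  (forall z, nm z = 8 * r -> nm (g z) <= M) ->
  nm (g 0) <= (M + e * expR (6 * N%:R)) / 3 ^+ N.+1 + e * expR (6 * N%:R).
Proof.
move=> hg N0 r0 pE ge gM; set E := expR _.
have Np : 0 < N%:R :> R by rewrite ltr0n.
have inj i j : (i <= N)%N -> (j <= N)%N -> i != j -> p i != p j.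
  move=> iN jN ij; apply: contraNneq ij => pij; have := pE i iN; rewrite pij pE// => /(mulfI (lt0r_neq0 r0)).
  by move=> /addrI/(mulIf (invr_neq0 (lt0r_neq0 Np)))/eqP; rewrite eqr_nat eq_sym.
pose L z := \sum_(i < N.+1) g (p i) * lag p N i z.
have Lb z : nm z <= 8 * r -> nm (L z) <= e * E.
  move=> zr; apply: (le_trans (nm_sum _ _)).
  apply: (@le_trans _ _ (\sum_(i < N.+1) e * nm (lag p N i z))).
    by apply: ler_sum => i _; rewrite nmM ler_wpM2r ?nm_ge0// ge// -ltnS.
  rewrite -mulr_sumr ler_wpM2l//; first by apply: le_trans (ge 0%N _); rewrite ?nm_ge0.
  exact: (interp_sum N0 r0 pE zr).
have hL : holo L.
  apply: holo_sum => i; apply: holo_mul; first exact: holo_cst.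
  apply: holo_prod => j; apply: holo_mul; last exact: holo_cst.
  exact: holo_shift.
pose s := [seq p i | i <- iota 0 N.+1].
have us : uniq s.
  rewrite map_inj_in_uniq ?iota_uniq// => i j; rewrite !mem_iota !add0n !ltnS /= => iN jN E1.
  by apply/eqP; apply: contraT => ij; have := inj i j iN jN ij; rewrite E1 eqxx.
have [|k hk kE] := factor_roots (holo_sub hg hL) us.
  move=> c /mapP[k]; rewrite mem_iota add0n ltnS /= => kN ->.
  rewrite /L (bigD1 (Ordinal (kN : k < N.+1)%N)) //= lag_node// eqxx mulr1 big1 ?addr0 ?subrr// => i ik.
  by rewrite lag_node// -1?ltnS// eq_sym (negbTE (ik : i != k :> nat)) mulr0.
have sz : size s = N.+1 by rewrite size_map size_iota.
have sr c : c \in s -> r <= nm c <= 2 * r.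
  move=> /mapP[j]; rewrite mem_iota add0n ltnS /= => jN ->; rewrite pE//.
  have j0 : 0 <= j%:R / N%:R :> R by rewrite divr_ge0.
  have j1 : j%:R / N%:R <= 1 :> R by rewrite ler_pdivrMr// mul1r ler_nat.
  by apply/andP; split; nra.
have low z : nm z = 8 * r -> (6 * r) ^+ N.+1 <= nm (\prod_(c <- s) (z - c)).
  move=> zr; rewrite nm_prod -sz.
  elim: (s) sr => [|c s' IH] sr; first by rewrite big_nil expr0.
  rewrite big_cons /= exprS; apply: ler_pM; rewrite ?exprn_ge0 ?mulr_ge0 ?(ltW r0)//.
    have /andP[_ c2] := sr c (mem_head c s'); have := nmDB z c; lra.
  by apply: IH => c' cs; apply: sr; rewrite inE cs orbT.
have up : nm (\prod_(c <- s) (0 - c)) <= (2 * r) ^+ N.+1.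
  rewrite nm_prod -sz.
  elim: (s) sr => [|c s' IH] sr; first by rewrite big_nil expr0.
  rewrite big_cons /= exprS; apply: ler_pM; rewrite ?prodr_ge0 ?nm_ge0//.
  - by move=> *; exact: nm_ge0.
  - by have /andP[_ c2] := sr c (mem_head c s'); rewrite sub0r nmN.
  by apply: IH => c' cs; apply: sr; rewrite inE cs orbT.
have k0 : nm (k 0) <= (M + e * E) / (6 * r) ^+ N.+1.
  apply: (weak_mean (r := 8 * r) hk); first by rewrite mulr_gt0.
  move=> u; rewrite subr0 => ur; have l := low u ur.
  have p0 : 0 < (6 * r) ^+ N.+1 by rewrite exprn_gt0// mulr_gt0.
  rewrite ler_pdivlMr//; apply: (@le_trans _ _ (nm (g u - L u))).
    by rewrite kE nmM mulrC ler_wpM2r ?nm_ge0.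
  by apply: (le_trans (nmD _ _)); rewrite nmN lerD ?gM ?Lb// ur.
have h0 : nm (g 0 - L 0) <= (M + e * E) / 3 ^+ N.+1.
  rewrite kE nmM; apply: (le_trans (ler_pM (nm_ge0 _) (nm_ge0 _) up k0)).
  have -> : (6 * r) ^+ N.+1 = 3 ^+ N.+1 * (2 * r) ^+ N.+1 by rewrite -exprMn; congr (_ ^+ _); ring.
  have p1 : (2 * r) ^+ N.+1 != 0 by rewrite expf_neq0// gt_eqF// mulr_gt0.
  have p2 : 3 ^+ N.+1 != 0 :> R by rewrite expf_neq0.
  by rewrite mulrCA (invfM (3 ^+ N.+1)) (mulrCA _ (3 ^+ _)^-1) divff ?mulr1.
have := nmD (g 0 - L 0) (L 0); rewrite subrK.
have := Lb 0; rewrite nm0 => /(_ ltac:(lra)).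
lra.
Qed.

Definition growth f B n := forall z, nm (f z) <= expR (B * (1 + nm z) ^+ n).

Lemma growth_shift f B n c : 0 <= B -> growth f B n ->
  growth (fun z => f (z + c)) (B * (1 + nm c) ^+ n) n.
Proof.
move=> B0 h z; apply: (le_trans (h _)); rewrite ler_expR -mulrA ler_wpM2l// -exprMn.
have := nm_ge0 z; have := nm_ge0 c => c0 z0.
rewrite lerXn2r ?nnegrE ?addr_ge0 ?mulr_ge0 ?nm_ge0//; have := nmD z c; nra.
Qed.

Theorem min_modulus f B n : holo f -> noncst f -> 0 <= B -> growth f B n ->
  exists c C, 0 <= C /\ forall r, 1 <= r -> exists r', r <= r' <= 2 * r /\
    forall z, nm (z - c) = r' -> expR (- (C * r ^+ n)) <= nm (f z).
Proof.
move=> hf nf B0 gf; have [c fc] := nf 0.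
have g0 : 0 < nm (f c) by rewrite nm_gt0.
have := growth_shift c B0 gf; set B1 := B * _; set g := fun z => f (z + c) => gg.
have hg : holo g := holo_translate c hf.
have B10 : 0 <= B1 by rewrite mulr_ge0 ?exprn_ge0// addr_ge0// nm_ge0.
have gE : g 0 = f c by rewrite /g add0r.
pose B2 := B1 * 9 ^+ n.
have B20 : 0 <= B2 by rewrite mulr_ge0 ?exprn_ge0.
pose l := `|ln (4 / nm (f c))|.
pose C := 6 * (2 * B2 + 2 * l + 1) + l.
have l0 : 0 <= l := normr_ge0 _.
have C0 : 0 <= C by rewrite /C; lra.
exists c, C; split => // r r1; apply: contrapT => hn.
have rn : 1 <= r ^+ n by rewrite exprn_ege1.
set e := expR (- (C * r ^+ n)).
have e0 : 0 < e by rewrite expR_gt0.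
pose X := B2 * r ^+ n + l.
have X0 : 0 <= X by apply: addr_ge0 => //; apply: mulr_ge0 => //; exact: le_trans rn.
have X2 : 0 <= 2 * X by lra.
have [N [N0 XN NX]] : exists N : nat, [/\ (0 < N)%N, 2 * X <= N%:R & N%:R <= 2 * X + 1].
  exists (Num.trunc (2 * X)).+1; have /andP[t1 t2] := truncn_itv X2; split => //; first exact: ltW.
  by rewrite -natr1; lra.
have pts (j : nat) : exists p, (j <= N)%N -> nm p = r * (1 + j%:R / N%:R) /\ nm (g p) <= e.
  have [jN|jN] := leqP j N; last by exists 0.
  apply: contrapT => hp; apply: hn; exists (r * (1 + j%:R / N%:R)); split.
    have j0 : 0 <= j%:R / N%:R :> R by rewrite divr_ge0.
    have j1 : j%:R / N%:R <= 1 :> R by rewrite ler_pdivrMr ?ltr0n// mul1r ler_nat.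
    by apply/andP; split; clear - r1 j0 j1; nra.
  move=> z zE; rewrite leNgt; apply/negP => fz; apply: hp; exists (z - c) => _.
  by split => //; rewrite /g subrK ltW.
pose p j := projT1 (cid (pts j)).
have pP j : (j <= N)%N -> nm (p j) = r * (1 + j%:R / N%:R) /\ nm (g (p j)) <= e.
  by move=> jN; rewrite /p; case: cid => /= x; apply.
have r0 : 0 < r by lra.
have := @interp_bound g N p r (expR (B2 * r ^+ n)) e hg N0 r0 (fun j jN => (pP j jN).1)
  (fun j jN => (pP j jN).2).
have gM z : nm z = 8 * r -> nm (g z) <= expR (B2 * r ^+ n).
  move=> zr; apply: (le_trans (gg z)); rewrite ler_expR /B2 -mulrA ler_wpM2l// -exprMn.
  by rewrite lerXn2r ?nnegrE ?addr_ge0 ?nm_ge0//; lra.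
move=> /(_ gM); rewrite gE; set E := expR (6 * N%:R).
have E0 : 0 < E by rewrite expR_gt0.
have lE : expR (- l) <= nm (f c) / 4.
  have -> : nm (f c) / 4 = expR (- ln (4 / nm (f c))).
    by rewrite expRN lnK ?posrE ?divr_gt0// invf_div.
  by rewrite ler_expR lerN2 ler_norm.
have eE : e * E <= nm (f c) / 4.
  apply: le_trans lE; rewrite -expRD ler_expR.
  have l1 : l * 1 <= l * r ^+ n by apply: ler_wpM2l.
  have C1 : C * r ^+ n = 12 * (B2 * r ^+ n) + 12 * (l * r ^+ n) + 6 * r ^+ n + l * r ^+ n.
    by rewrite /C; ring.
  by rewrite C1; move: NX; rewrite /X; clear - rn l1; lra.
have e2 : expR (1 / 2) <= 2 :> R.
  have := expRxMexpNx_1 (1 / 2 : R); have := @expR_ge1Dx R (- (1 / 2)); have := expR_gt0 (1 / 2 : R).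
  by clear; nra.
have h3 : expR (B2 * r ^+ n) <= 3 ^+ N * (nm (f c) / 4).
  apply: (@le_trans _ _ (expR (N%:R * (1 / 2)) * expR (- l))).
    by rewrite -expRD ler_expR; move: XN; rewrite /X; clear; lra.
  apply: ler_pM; rewrite ?expR_ge0// expRM_natl lerXn2r ?nnegrE ?expR_ge0//.
  by move: e2; clear; lra.
have t0 : 1 <= 3 ^+ N :> R by rewrite exprn_ege1//; clear; lra.
have h4 : (expR (B2 * r ^+ n) + e * E) / 3 ^+ N.+1 <= nm (f c) / 4.
  rewrite ler_pdivrMr ?exprn_gt0// exprS.
  have : nm (f c) / 4 * 1 <= nm (f c) / 4 * 3 ^+ N by rewrite ler_wpM2l// divr_ge0// ltW.
  by move: h3 eE g0; clear; lra.
by move: h4 eE g0; clear; lra.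
Qed.

End MinimumModulus.

(** * Lost points *)

Section Unreachable.
Variable R : realType.
Implicit Types (z w u a c d v q p : R[i]) (x y t s r e M S T B b h tau : R).
Implicit Types (W Z L : R -> R[i]).
Variable f : R[i] -> R[i].
Hypotheses (hf : holo f) (nf : noncst f).

Lemma clamp_lip s t : `|clamp 0 1 s - clamp 0 1 t| <= `|s - t|.
Proof.
have [h1 h2] := ler_normlP _ _ (lexx `|s - t|).
rewrite /clamp; case: (leP s 1) => i1; case: (leP t 1) => i2;
  rewrite ?(max_idPr ler01); try case: (leP 0 s) => i3; try case: (leP 0 t) => i4;
  by rewrite ler_norml; apply/andP; split; lra.
Qed.

Definition seg q w u := go f q w 1 u.

Lemma seg_val q w u : seg q w u -> f u = f q * cexp w /\ dz f u != 0.
Proof. by move=> g; have [-> ?] := go_val ler01 g; rewrite /ray mul1r. Qed.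

Lemma seg_uniq q w u u' : seg q w u -> seg q w u' -> u = u'.
Proof. exact: (go_uniq hf ler01). Qed.

Lemma seg_go q w t u : 0 < t -> go f q w t u -> seg q (t%:C * w) u.
Proof. by move=> t0; exact: (@go_scale1 R f q w t u t0).1. Qed.

Lemma go_seg q w t u : 0 < t -> seg q (t%:C * w) u -> go f q w t u.
Proof. by move=> t0; exact: (@go_scale1 R f q w t u t0).2. Qed.

Lemma seg_lift q w u : seg q w u -> exists Z, [/\ continuous Z, Z 0 = q, Z 1 = u &
  forall t, 0 <= t <= 1 -> go f q w t (Z t)].
Proof.
move=> [Z [lZ Z0 Z1]]; exists Z; split => //; first exact: lZ.1.
by move=> t /andP[t0 t1]; exists Z; split => //; exact: lift_sub lZ t1.
Qed.

Lemma endpoints q (w : R -> R[i]) : continuous w -> (forall s, 0 <= s <= 1 -> exists u, seg q (w s) u) ->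
  exists2 Z, continuous Z & forall s, 0 <= s <= 1 -> seg q (w s) (Z s).
Proof.
move=> cw h.
have h' s : exists u, 0 <= s <= 1 -> seg q (w s) u.
  by have [/h[u hu]|ns] := boolP (0 <= s <= 1); [exists u|exists 0].
pose Z s := projT1 (cid (h' s)).
have hZ s : 0 <= s <= 1 -> seg q (w s) (Z s).
  by move=> sI; rewrite /Z; case: cid => u /= ; apply.
have Zc s0 : 0 <= s0 <= 1 -> forall e, 0 < e -> exists2 d, 0 < d &
    forall s, 0 <= s <= 1 -> `|s - s0| < d -> nm (Z s - Z s0) < e.
  move=> s0I e e0; have [Y [lY Y0 Y1]] := hZ s0 s0I.
  have [b b0 hb] := ray_lift_near hf nf ler01 lY Y0 e0.
  have /continuous_realP/(_ _ b0)[d d0 hd] := cw s0.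
  exists d => // s sI ss; have [Y' lY' [Y'0 hY']] := hb (w s) (hd s ss).
  have I1 : 0 <= (1:R) <= (1:R) by rewrite ler01 lexx.
  have -> : Z s = Y' 1 by apply: seg_uniq (hZ s sI) _; exists Y'.
  by rewrite -Y1; exact: hY' I1.
exists (fun t => Z (clamp 0 1 t)); last by move=> s sI; rewrite clamp_id//; exact: hZ.
move=> t; apply/continuous_realP => e e0.
have [d d0 hd] := Zc (clamp 0 1 t) (clamp_in t ler01) e e0.
exists d => // y yt; apply: hd; first exact: clamp_in.
exact: le_lt_trans (clamp_lip _ _) yt.
Qed.

Lemma triangle q w0 w1 u0 u1 : seg q w0 u0 -> seg q w1 u1 ->
  (forall s, 0 <= s <= 1 -> exists u, seg q (w0 + s%:C * (w1 - w0)) u) -> seg u0 (w1 - w0) u1.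
Proof.
move=> g0 g1 h.
have cw : continuous (fun s => w0 + s%:C * (w1 - w0)).
  exact: (cont_add (@cont_cst R R[i] w0) (cont_mul (@continuous_RtoC R) (@cont_cst R R[i] (w1 - w0)))).
have [Z cZ hZ] := endpoints cw h.
have I0 : 0 <= (0:R) <= (1:R) by rewrite lexx ler01.
have I1 : 0 <= (1:R) <= (1:R) by rewrite ler01 lexx.
exists Z; split.
- split => // t tI; have [-> ?] := seg_val (hZ t tI); split => //.
  by rewrite (seg_val g0).1 /ray cexpD mulrA.
- by apply: seg_uniq (hZ 0 I0) _; rewrite rmorph0 mul0r addr0.
- by apply: seg_uniq (hZ 1 I1) _; rewrite rmorph1 mul1r addrC subrK.
Qed.

Definition basin u := exists z0 r M, [/\ good f z0 r M, f z0 = 0, nm (u - z0) < r &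
  nm (f u) < r / (4 * M)].

Inductive reaches : R[i] -> Prop :=
| reaches_basin u of basin u : reaches u
| reaches_seg z v u of complex.Re v < 0 & seg z v u & reaches u : reaches z.

Definition lost z := [/\ dz f z != 0, f z != 0 & ~ reaches z].

Lemma lost_seg z v u : complex.Re v < 0 -> seg z v u -> lost z -> lost u.
Proof.
move=> v0 g [dz0 fz nz]; have [fu du] := seg_val g.
split => //; first by rewrite fu mulf_neq0// cexp_neq0.
by move=> ru; apply: nz; exact: reaches_seg g ru.
Qed.

Lemma near_zero_basin z0 : f z0 = 0 -> dz f z0 != 0 ->
  exists2 e, 0 < e & forall u, nm (u - z0) < e -> basin u.
Proof.
move=> fz dz0; have [r [M g]] := good_exists hf dz0; have [r0 M0 _ _] := g.
have k0 : 0 < r / (4 * M) by rewrite divr_gt0// mulr_gt0.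
have /continuous_epsP/(_ _ k0)[d d0 hd] := @holo_cont R f hf z0.
exists (Num.min r d); first by rewrite lt_min r0.
move=> u; rewrite lt_min => /andP[ur ud]; exists z0, r, M; split => //.
by have := hd u ud; rewrite fz subr0.
Qed.

Hypothesis simple0 : forall z, f z = 0 -> dz f z != 0.

Lemma nm_descend q w t : complex.Re w <= 0 -> 0 <= t -> nm (ray (f q) w t) <= nm (f q).
Proof.
move=> w0 t0; rewrite nm_ray ler_piMr ?nm_ge0// -expR0 ler_expR.
by rewrite mulr_ge0_le0.
Qed.

Lemma trapped Z T c r m : 0 <= T -> continuous Z -> nm (Z 0 - c) < r ->
  (forall z, nm (z - c) = r -> m <= nm (f z)) ->
  (forall t, 0 <= t <= T -> nm (f (Z t)) < m) -> nm (Z T - c) < r.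
Proof.
move=> T0 cZ Z0 hc hm; rewrite ltNge; apply/negP => hT.
have cg : continuous (fun t => nm (Z t - c)).
  exact: (cont_comp (cont_sub cZ (@cont_cst R R[i] c)) (@continuous_nm R)).
have [|t tI E] := @IVT R (fun t => nm (Z t - c)) 0 T r T0 (continuous_subspaceT cg).
  by rewrite ge_min le_max (ltW Z0) hT orbT.
have /hm : 0 <= t <= T by move: tI; rewrite in_itv.
by rewrite ltNge (hc _ E).
Qed.

Lemma fresh_angle (E : seq R) b : 0 < b -> exists2 h : R, `|h| <= b & h \notin E.
Proof.
move=> b0; pose s := [seq b / k.+1%:R | k <- iota 0 (size E).+1] : seq R.
have us : uniq s.
  rewrite map_inj_uniq ?iota_uniq// => x y /(mulfI (lt0r_neq0 b0))/invr_inj/eqP.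
  by rewrite eqr_nat => /eqP[].
have [/hasP[h hs hE]|] := boolP (has (fun h => h \notin E) s).
  exists h => //; case/mapP: hs => k _ ->.
  by rewrite ger0_norm ?divr_ge0 ?(ltW b0)// ler_pdivrMr ?ltr0n// ler_peMr ?(ltW b0)// ler1n.
rewrite -all_predC => /allP sE.
have : (size s <= size E)%N.
  by apply: uniq_leq_size => // h /sE /=; rewrite negbK.
by rewrite size_map size_iota ltnn.
Qed.

Lemma lost_lower B n : 0 <= B -> growth f B n -> exists c C, 0 <= C /\
  forall z, lost z -> expR (- (C * (1 + nm (z - c)) ^+ n)) <= nm (f z).
Proof.
move=> B0 gB; have [c [C [C0 hC]]] := min_modulus hf nf B0 gB.
exists c, C; split => // z [dz0 fz nz]; rewrite leNgt; apply/negP => small.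
have [|r' [/andP[r1 r2] hr]] := hC (1 + nm (z - c)); first by rewrite lerDl nm_ge0.
have zr : nm (z - c) < r' by lra.
have v0 : complex.Re (-1 : R[i]) != 0 by rewrite /= oppr_eq0 oner_eq0.
have [E hE] := ray_dichotomy hf nf 1 (r' + nm c) fz dz0 v0.
have [h hb hnE] := fresh_angle E (@ltr01 R).
pose w := turn (-1 : R[i]) h.
have w0 : complex.Re w = -1 by rewrite Re_turn /=.
have low t : 0 <= t -> nm (ray (f z) w t) < expR (- (C * (1 + nm (z - c)) ^+ n)).
  by move=> t0; apply: le_lt_trans small; apply: nm_descend => //; rewrite w0; lra.
have inside t u : 0 <= t -> go f z w t u -> nm (u - c) < r'.
  move=> t0 [Z [[cZ hZ] Z0 <-]].
  apply: (trapped t0 cZ _ hr); first by rewrite Z0.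
  by move=> s sI; rewrite (hZ s sI).1; apply: low; case/andP: sI.
have full T : 0 <= T -> exists u, go f z w T u.
  move=> T0; have [//|[t [u [t0 tT g ur]]]] := hE h hb hnE T T0.
  by have := inside t u t0 g; have := nmDB u c; clear - ur; lra.
have ex (k : nat) : exists u, go f z w k%:R u by apply: full.
pose a k := projT1 (cid (ex k)).
have ha (k : nat) : go f z w k%:R (a k) by rewrite /a; case: cid.
have [k|z0 hz0] := @bounded_cluster R a (r' + nm c).
  by have := inside _ _ (ler0n R k) (ha k); have := nmDB (a k) c; clear; lra.
have fa (k : nat) : nm (f (a k)) = nm (f z) * expR (- k%:R).
  by rewrite (go_val (ler0n R k) (ha k)).1 nm_ray w0 mulrN1.
have fz0 : f z0 = 0.
  apply/eqP; rewrite -nm_eq0 eq_le nm_ge0 andbT; apply/ler_addgt0Pr => e e0; rewrite add0r.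
  have e2 : 0 < e / 2 by clear - hb e0; lra.
  have /continuous_epsP/(_ _ e2)[d d0 hd] := @holo_cont R f hf z0.
  have [k km] : exists k : nat, nm (f z) * expR (- k%:R) < e / 2.
    have F0 : 0 < nm (f z) by rewrite nm_gt0.
    have q0 : 0 <= nm (f z) * 2 / e by rewrite divr_ge0 ?mulr_ge0 ?nm_ge0// ltW.
    exists (Num.bound (nm (f z) * 2 / e)); have := archi_boundP q0; set k := Num.bound _.
    rewrite ltr_pdivrMr// expRN => hk; have h1 := @expR_ge1Dx R k%:R.
    have ek : 0 < expR k%:R :> R by rewrite expR_gt0.
    by rewrite ltr_pdivrMr//; clear - e2 hk h1; nra.
  have [m mk mz] := hz0 d d0 k.
  have := hd _ mz; have := nmDB (f z0) (f (a m)); rewrite (nmB (f z0)) fa.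
  have : nm (f z) * expR (- m%:R) <= nm (f z) * expR (- k%:R).
    by rewrite ler_wpM2l ?nm_ge0// ler_expR lerN2 ler_nat.
  clear - km; lra.
have [e e0 he] := near_zero_basin fz0 (simple0 fz0).
have [m m1 mz] := hz0 e e0 1%N.
apply: nz; apply: (@reaches_seg z (m%:R%:C * w) (a m)).
- by case: (w) w0 => x y /= ->; rewrite mul0r subr0 mulrN1 oppr_lt0 ltr0n.
- by apply: seg_go (ha m); rewrite ltr0n.
- by apply: reaches_basin; exact: he.
Qed.

End Unreachable.

Section Joins.
Variable R : realType.
Implicit Types (x y t s : R) (P Q : R -> R[i]) (d : R[i]) (g : R[i] -> R[i]).

Definition join P Q := glue (1 / 2) (fun t : R => P (2 * t + 0)) (fun t : R => Q (2 * t + -1)).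

Definition rev P := fun t : R => P (-1 * t + 1).

Lemma join_cont P Q : continuous P -> continuous Q -> continuous (join P Q).
Proof.
move=> cP cQ; apply: glue_cont.
  exact: (cont_comp (@contR_affine R 2 0) cP).
exact: (cont_comp (@contR_affine R 2 (-1)) cQ).
Qed.

Lemma rev_cont P : continuous P -> continuous (rev P).
Proof. exact: (cont_comp (@contR_affine R (-1) 1)). Qed.

Lemma join_le P Q t : t <= 1 / 2 -> join P Q t = P (2 * t).
Proof. by move=> h; rewrite /join glue_le// addr0. Qed.

Lemma join_ge P Q t : P 1 = Q 0 -> 1 / 2 <= t -> join P Q t = Q (2 * t - 1).
Proof.
move=> E h; rewrite /join glue_ge//.
have [-> ->] // : 2 * (1 / 2) + 0 = 1 :> R /\ 2 * (1 / 2) + -1 = 0 :> R by split; field.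
Qed.

Lemma join0 P Q : join P Q 0 = P 0.
Proof. by rewrite join_le ?mulr0//; lra. Qed.

Lemma join1 P Q : P 1 = Q 0 -> join P Q 1 = Q 1.
Proof. by move=> E; rewrite join_ge//; [congr Q|]; lra. Qed.

Lemma joinP P Q t : P 1 = Q 0 -> 0 <= t <= 1 ->
  exists2 s, 0 <= s <= 1 & join P Q t = P s \/ join P Q t = Q s.
Proof.
move=> E /andP[t0 t1]; have [h|h] := leP t (1 / 2).
  by exists (2 * t); [apply/andP; split; lra|left; exact: join_le].
by exists (2 * t - 1); [apply/andP; split; lra|right; apply: join_ge => //; lra].
Qed.

Lemma revP P t : 0 <= t <= 1 -> exists2 s, 0 <= s <= 1 & rev P t = P s.
Proof. by move=> /andP[t0 t1]; exists (-1 * t + 1) => //; apply/andP; split; lra. Qed.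

Lemma rev0 P : rev P 0 = P 1.
Proof. by rewrite /rev mulr0 add0r. Qed.

Lemma rev1 P : rev P 1 = P 0.
Proof. by rewrite /rev mulr1 addNr. Qed.

Lemma var_join g P Q c d : P 1 = Q 0 ->
  var (fun t => g (P t)) c -> var (fun t => g (Q t)) d -> var (fun t => g (join P Q t)) (c + d).
Proof.
move=> E [l [cl hl ->]] [k [ck hk ->]].
pose k' t := k t + (l 1 - k 0).
have ck' : continuous k' := cont_add ck (@cont_cst R R[i] (l 1 - k 0)).
have E' : l 1 = k' 0 by rewrite /k' addrC subrK.
have kk : cexp (l 1 - k 0) = 1.
  rewrite cexpB hl ?ler01 ?lexx// hk ?ler01 ?lexx// E divff//.
  by rewrite -hk ?cexp_neq0// lexx ler01.
exists (join l k'); split; first exact: join_cont.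
  move=> t /andP[t0 t1]; have [h|h] := leP t (1 / 2).
    by rewrite !join_le//; apply: hl; apply/andP; split; lra.
  have h' := ltW h; rewrite !join_ge// /k' cexpD kk mulr1; apply: hk.
  by apply/andP; split; lra.
by rewrite join0 join1// /k'; ring.
Qed.

Lemma var_rev g P d : var (fun t => g (P t)) d -> var (fun t => g (rev P t)) (- d).
Proof.
move=> [l [cl hl ->]]; exists (rev l); split; first exact: rev_cont.
  by move=> t /andP[t0 t1]; apply: hl; apply/andP; split; lra.
by rewrite rev0 rev1 opprB.
Qed.

End Joins.

Section Blocked.
Variable R : realType.
Implicit Types (z w u a c d v q p : R[i]) (x y t s r e M S T B b h tau : R).
Implicit Types (W Z L : R -> R[i]).
Variable f : R[i] -> R[i].
Hypotheses (hf : holo f) (nf : noncst f).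
Hypothesis simple0 : forall z, f z = 0 -> dz f z != 0.

Lemma seg_var q w u : seg f q w u -> exists Z, [/\ continuous Z, Z 0 = q, Z 1 = u,
  forall t, 0 <= t <= 1 -> go f q w t (Z t) & f q != 0 -> var (fun t => f (Z t)) w].
Proof.
move=> /seg_lift[Z [cZ Z0 Z1 hZ]]; exists Z; split => // fq.
have [l hl] := cexp_surj fq.
exists (fun t => l + t%:C * w); split.
- exact: (cont_add (@cont_cst R R[i] l) (cont_mul (@continuous_RtoC R) (@cont_cst R R[i] w))).
- move=> t /andP[t0 t1]; rewrite cexpD hl.
  by have [-> _] := go_val t0 (hZ t ltac:(by rewrite t0 t1)).
- by rewrite rmorph1 rmorph0; ring.
Qed.

Lemma climb L u v b : continuous L -> L 0 = L 1 -> inner L u -> dz f u != 0 -> f u != 0 ->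
  0 < complex.Re v -> 0 < b -> exists h s t,
  [/\ `|h| <= b, 0 < s, 0 <= t <= 1 & go f u (turn v h) s (L t)].
Proof.
move=> cL L01 iu du fu v0 b0.
have [M1 hM1] := inner_bounded cL L01.
have [E hE] := ray_dichotomy hf nf b M1 fu du (lt0r_neq0 v0).
have [h hb hnE] := fresh_angle E b0.
pose w := turn v h; have w1 : complex.Re w = complex.Re v by rewrite Re_turn.
have F0 : 0 < nm (f u) by rewrite nm_gt0.
have [m hm] : exists m, forall t, 0 <= t <= 1 -> nm (f (L t)) <= m.
  exact: path_bounded (cont_comp cL (holo_cont hf)).
have m0 : 0 <= m by apply: le_trans (hm 0 _); rewrite ?nm_ge0// lexx ler01.
have T0 : 0 <= m / nm (f u) / complex.Re v by rewrite !divr_ge0 ?(ltW v0)// nm_ge0.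
have [T [p [Tp g np]]] : exists T p, [/\ 0 <= T, go f u w T p & ~ inner L p].
  have [[p g]|[t [p [t0 tT g pM]]]] := hE h hb hnE _ T0.
    exists (m / nm (f u) / complex.Re v), p; split => // /(inner_max cL L01 hf nf hm).
    rewrite (go_val T0 g).1 nm_ray w1 divfK ?gt_eqF//.
    have h3 := @expR_ge1Dx R (m / nm (f u)).
    have : nm (f u) * (1 + m / nm (f u)) = nm (f u) + m by field; rewrite gt_eqF.
    have := ler_wpM2l (ltW F0) h3; clear - F0; lra.
  by exists t, p; split => // /hM1; clear - pM; lra.
have [Y [lY Y0 YT]] := g.
have [s [t [sI tI E1]]] : exists s t, [/\ 0 <= s <= T, 0 <= t <= 1 & L t = Y s].
  apply: contrapT => hn; apply: np; rewrite -YT.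
  have cY : continuous (fun s => Y (T * s + 0)) := cont_comp (@contR_affine R T 0) lY.1.
  have := inner_path cL L01 cY; rewrite mulr0 mulr1 !addr0 Y0; apply=> // s t /andP[s0 s1] tI.
  apply/eqP => E1; apply: hn; exists (T * s + 0), t; split => //.
  by rewrite addr0; apply/andP; split; clear - s0 s1 Tp; nra.
exists h, s, t; split => //.
  case/andP: sI => s0 _; rewrite lt_neqAle s0 andbT; apply/eqP => s00.
  by have [/(_ t tI)] := iu; rewrite E1 -s00 Y0 eqxx.
rewrite E1; exists Y; split; [|exact: Y0|reflexivity].
by apply: lift_sub lY _; case/andP: sI.
Qed.

Lemma zero_inside z L z0 : continuous L -> L 0 = L 1 ->
  (forall t, 0 <= t <= 1 -> L t = z \/ exists v, complex.Re v < 0 /\ seg f z v (L t)) ->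
  inner L z0 -> f z0 = 0 -> reaches f z.
Proof.
move=> cL L01 Ltree iz fz0; have dz0 := simple0 fz0.
have [e1 e10 h1] := near_zero_basin hf fz0 dz0.
have [r1 r10 h2] := inner_open cL L01 iz.
have [r [M [r0 M0 g1 g2]]] := good_exists hf dz0.
pose k := Num.min (e1 / 2) (Num.min (r1 / 2) (r / 2)).
have k0 : 0 < k by rewrite !lt_min !divr_gt0.
have [ke kr kr'] : [/\ k <= e1 / 2, k <= r1 / 2 & k <= r / 2] by split; rewrite !ge_min lexx ?orbT.
clearbody k; pose u := z0 + k%:C.
have uz : nm (u - z0) = k by rewrite /u addrC addKr nmC gtr0_norm.
have bu : basin f u by apply: h1; lra.
have iu : inner L u by apply: h2; lra.
have du : dz f u != 0 by apply: g1; lra.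
have fu : f u != 0.
  apply/eqP => fu; have := g2 u z0; rewrite fu fz0 !subrr nm0 mulr0 uz => h.
  by have := h ltac:(clear - k0 kr'; lra) r0; clear - k0 kr; lra.
have v0 : 0 < complex.Re (1 : R[i]) by rewrite /= ltr01.
have [h [s [t [_ s0 tI gs]]]] := climb cL L01 iu du fu v0 ltr01.
have w1 : complex.Re (turn (1 : R[i]) h) = 1 by rewrite Re_turn.
have rL : reaches f (L t).
  apply: (@reaches_seg _ f (L t) (s%:C * - turn (1 : R[i]) h) u); last exact: reaches_basin.
    by case: (turn _ _) w1 => x y /= ->; rewrite mul0r subr0 mulrN1 oppr_lt0.
  by apply: seg_go => //; apply: go_rev gs; exact: ltW.
have [<-//|[v [v1 gv]]] := Ltree t tI.
exact: reaches_seg v1 gv rL.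
Qed.

Lemma lost_inj z v1 v2 u : lost f z -> complex.Re v1 < 0 -> complex.Re v2 < 0 ->
  seg f z v1 u -> seg f z v2 u -> v1 = v2.
Proof.
move=> [dz0 fz nz] h1 h2 /seg_var[Z1 [cZ1 Z10 Z11 g1 /(_ fz) V1]] /seg_var[Z2 [cZ2 Z20 Z21 g2 /(_ fz) V2]].
apply: contrapT => nv; apply: nz.
pose L := join Z1 (rev Z2).
have E : Z1 1 = rev Z2 0 by rewrite rev0 Z11 Z21.
have cL : continuous L := join_cont cZ1 (rev_cont cZ2).
have L01 : L 0 = L 1 by rewrite /L join0 join1// rev1 Z10 Z20.
have VL := var_join E V1 (var_rev V2).
have LP t : 0 <= t <= 1 -> exists s v, [/\ 0 <= s <= 1, complex.Re v < 0 & go f z v s (L t)].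
  move=> tI; rewrite /L; have [s sI [->|->]] := joinP E tI.
    by exists s, v1; split => //; exact: g1.
  by have [s' s'I ->] := revP Z2 sI; exists s', v2; split => //; exact: g2.
have [||z0 iz fz0] := arg_principle cL L01 (w := 0) hf nf (d := v1 + - v2).
- by apply: var_ext VL => t _; rewrite subr0.
- by move/subr0_eq.
apply: (zero_inside cL L01 _ iz fz0) => t /LP[s [v [/andP[s0 s1] v0 g]]].
have [s00|sn] := eqVneq s 0.
  left; move: g; rewrite s00 => g; exact: (go_uniq hf (lexx 0) g (go0 _ dz0)).
have sp : 0 < s by rewrite lt_neqAle eq_sym sn.
right; exists (s%:C * v); split; last exact: seg_go.
by case: (v) v0 => x y /= x0; rewrite mul0r subr0; nra.
Qed.

Hypothesis unomitted : forall r (G : set R[i]) z0, 0 < r -> G z0 ->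
  (forall z, G z -> nm (f z) < r) ->
  (forall z, G z -> exists2 e, 0 < e & forall u, nm (u - z) < e -> G u) ->
  (forall z, nm (f z) < r -> (forall e, 0 < e -> exists2 u, G u & nm (u - z) < e) -> G z) ->
  exists2 z, G z & f z = 0.

Lemma lost_blocked q : lost f q -> exists2 v, complex.Re v < 0 & ~ exists u, seg f q v u.
Proof.
move=> lq; have [dq fq nq] := lq; apply: contrapT => hn.
have full v : complex.Re v < 0 -> exists u, seg f q v u.
  by move=> v0; apply: contrapT => h; apply: hn; exists v.
have q0 : 0 < nm (f q) by rewrite nm_gt0.
pose G := [set u | exists2 v, complex.Re v < 0 & seg f q v u].
have [u0 gu0] := full (-1) ltac:(by rewrite /= ltrN10).
have [e1 e10 he1] := @cexp_onto1 R.
have [e2 e20 he2] := @cexp_near0 R.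
have [z [v v0 g] fz] : exists2 z, G z & f z = 0.
  apply: (unomitted q0 (z0 := u0)).
  - by exists (-1); rewrite //= ltrN10.
  - move=> z [v v0 /seg_val[-> _]]; rewrite nmM nm_cexp gtr_pMr// -[ltRHS]expR0 ltr_expR//.
  - move=> u [v v0 gu]; have [fu du] := seg_val gu.
    have fu0 : f u != 0 by rewrite fu mulf_neq0// cexp_neq0.
    have F0 : 0 < nm (f u) by rewrite nm_gt0.
    have [r [M [r0 M0 g1 g2]]] := good_exists hf du.
    have [Y [lY Y0 Y1]] := gu.
    have [b b0 hb] := ray_lift_near hf nf ler01 lY Y0 r0.
    pose k := Num.min e1 (Num.min (b / 2) (- complex.Re v / 2)).
    have k0 : 0 < k by rewrite !lt_min e10 !divr_gt0//=; clear - v0 fu; lra.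
    have kF : 0 < k / 2 * nm (f u) by rewrite mulr_gt0// divr_gt0.
    have [ke kb kv] : [/\ k <= e1, k <= b / 2 & k <= - complex.Re v / 2] by split; rewrite !ge_min lexx ?orbT.
    clearbody k.
    have /continuous_epsP/(_ _ kF)[d d0 hd] := @holo_cont R f hf u.
    exists (Num.min d r); first by rewrite lt_min d0.
    move=> u'; rewrite lt_min => /andP[ud ur].
    have ratio : nm (f u' / f u - 1) < k / 2.
      have -> : f u' / f u - 1 = (f u' - f u) / f u by field.
      by rewrite nmM nmV ltr_pdivrMr//; exact: hd.
    have [|d' dE dn] := he1 (f u' / f u); first by clear - k0 ke ratio; lra.
    have Rd := le_trans (Re_le_nm d') dn.
    have v'0 : complex.Re (v + d') < 0.
      by rewrite raddfD /=; move: Rd; rewrite ler_norml; clear - ratio kv k0; lra.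
    exists (v + d') => //.
    have [|Y' lY' [Y'0 hY']] := hb (v + d'); first by rewrite addrC addKr; clear - dn ratio kb b0; lra.
    have gu' : seg f q (v + d') (Y' 1) by exists Y'.
    suff -> : u' = Y' 1 by [].
    have I1 : 0 <= (1:R) <= (1:R) by rewrite ler01 lexx.
    have := g2 u' (Y' 1) ur; rewrite (seg_val gu').1 -Y1 => /(_ (hY' 1 I1)).
    rewrite cexpD mulrA -fu dE mulrCA divff// mulr1 subrr nm0 mulr0 => h.
    by apply/eqP; rewrite -subr_eq0 -nm_eq0 eq_le h nm_ge0.
  - move=> z zq lim; have [fz|fz] := eqVneq (f z) 0.
      have [e e0 he] := near_zero_basin hf fz (simple0 fz).
      have [u [v v0 gu] uz] := lim e e0.
      by case: nq; apply: reaches_seg gu (reaches_basin (he u uz)).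
    have F0 : 0 < nm (f z) by rewrite nm_gt0.
    have [e e0 he] := isolated_value z (f z) hf nf.
    have [p pe hp] := @circle_attains_min R z e (fun u => nm (f u - f z)) (ltW e0)
      (cont_comp (cont_sub (holo_cont hf) (@cont_cst _ _ (f z))) (@continuous_nm R)).
    set m := nm (f p - f z) in hp.
    have m0 : 0 < m.
      rewrite nm_gt0 subr_eq0; apply: he; first by rewrite pe.
      by apply/eqP => pz; move: pe e0; rewrite pz subrr nm0 => <-; rewrite ltxx.
    pose k := Num.min (Num.min (e1 / 4) (e2 / 8)) (Num.min (1 / 2) (m / (20 * nm (f z)))).
    have k0 : 0 < k by rewrite !lt_min !divr_gt0 ?mulr_gt0.
    have [ke1 ke2 k1 km] : [/\ k <= e1 / 4, k <= e2 / 8, k <= 1 / 2 & k * (20 * nm (f z)) <= m].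
      by split; rewrite -?ler_pdivlMr ?mulr_gt0// !ge_min lexx ?orbT.
    clearbody k.
    have kF : 0 < k * nm (f z) by rewrite mulr_gt0.
    have /continuous_epsP/(_ _ kF)[d d0 hd] := @holo_cont R f hf z.
    have [u [v v0 gu]] := lim (Num.min d e) ltac:(by rewrite lt_min d0).
    rewrite lt_min => /andP[ud ue]; have fuz := hd u ud.
    have [fu du] := seg_val gu.
    have Fu : nm (f z) / 2 <= nm (f u).
      by have := nmDB (f z) (f u); rewrite (nmB (f z)); clear - fuz k1 F0; nra.
    have Fu2 : nm (f u) <= 2 * nm (f z).
      by have := nmDB (f u) (f z); clear - fuz k1 F0; nra.
    have Fu0 : 0 < nm (f u) by clear - Fu F0; lra.
    have fu0 : f u != 0 by rewrite -nm_gt0.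
    have ratio : nm (f z / f u - 1) < 2 * k.
      have -> : f z / f u - 1 = (f z - f u) / f u by field.
      by rewrite nmM nmV ltr_pdivrMr// nmB; clear - fuz Fu k0; nra.
    have [|d' dE dn] := he1 (f z / f u); first by clear - ratio ke1 e10; lra.
    have vE : f q * cexp (v + d') = f z by rewrite cexpD mulrA -fu dE mulrCA divff// mulr1.
    have v'0 : complex.Re (v + d') < 0.
      by move: zq; rewrite -vE nmM nm_cexp gtr_pMr// -[ltRHS]expR0 ltr_expR.
    have [u' gu'] := full _ v'0.
    have gd : seg f u d' u'.
      have -> : d' = v + d' - v by rewrite addrC addKr.
      apply: (triangle hf nf gu gu') => s /andP[s0 s1]; apply: full.
      have -> : v + s%:C * (v + d' - v) = (1 - s)%:C * v + s%:C * (v + d').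
        by rewrite rmorphB rmorph1; ring.
      case: (v) v0 (v + d') v'0 => x y /= x0 [x' y'] /= x'0; rewrite !mul0r !subr0.
      by clear - s0 s1 x0 x'0; have [->|sn] := eqVneq s 0; nra.
    have [Y [cY Y0 Y1 hY]] := seg_lift gd.
    suff E : u' = z by exists (v + d') => //; rewrite -E.
    have [fu' _] := seg_val gu'.
    have inb : nm (Y 1 - z) < e.
      apply: (@trapped R (fun u => f u - f z) Y 1 z e m ler01 cY _ hp); first by rewrite Y0.
      move=> s sI; have /andP[s0 s1] := sI; rewrite (go_val s0 (hY s sI)).1.
      have -> : ray (f u) d' s - f z = f u * (cexp (s%:C * d') - 1) + (f u - f z) by rewrite /ray; ring.
      have sd : nm (s%:C * d') <= nm d' by rewrite nmM nmC ger0_norm// ler_piMl ?nm_ge0.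
      have [|h3 _] := he2 (s%:C * d'); first by clear - sd dn ratio ke2 e20; lra.
      apply: (le_lt_trans (nmD _ _)); rewrite nmM.
      have : nm (f u) * nm (cexp (s%:C * d') - 1) <= 2 * nm (f z) * (8 * k).
        by apply: ler_pM; rewrite ?nm_ge0//; clear - h3 sd dn ratio; lra.
      by move: km fuz kF; clear; lra.
    apply: contrapT => nE; move: (he (Y 1) (ltW inb)); rewrite Y1 fu' vE.
    by move=> /(_ ltac:(exact/eqP)); rewrite eqxx.
move: (seg_val g).1; rewrite fz => /esym/eqP; rewrite mulf_eq0 (negbTE fq).
by rewrite (negbTE (cexp_neq0 v)).
Qed.

End Blocked.

Section Branching.
Variable R : realType.
Implicit Types (z w u a c d v q p : R[i]) (x y t s r e M S T B b h l : R).
Implicit Types (W Z L : R -> R[i]).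

Lemma Im_Log_gt0 u : 0 < complex.Im u -> 0 < complex.Im (Log u).
Proof.
move=> u0; have s : slit u by apply: slit_im; rewrite gt_eqF.
by rewrite /= mulr_gt0// -atan0; apply: lt_atan; exact: divr_gt0.
Qed.

Lemma Im_Log_lt0 u : complex.Im u < 0 -> complex.Im (Log u) < 0.
Proof.
move=> u0; have s : slit u by apply: slit_im; rewrite lt_eqF.
by rewrite /= pmulr_rlt0// -atan0; apply: lt_atan; rewrite pmulr_llt0// invr_gt0.
Qed.

Lemma Im_cexp a : complex.Im (cexp a) = expR (complex.Re a) * sin (complex.Im a).
Proof. by []. Qed.

Lemma sin_neg t : - pi < t -> t < 0 -> sin t < 0.
Proof. by move=> t1 t2; rewrite -oppr_gt0 -sinN sin_gt0_pi//; lra. Qed.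

Lemma slit_cexpm1 a : 0 < complex.Re a -> `|complex.Im a| < pi -> slit (cexp a - 1).
Proof.
move=> a0; rewrite ltr_norml => /andP[a1 a2].
have [E|aN] := eqVneq (complex.Im a) 0.
  apply: slit_re; rewrite raddfB /= E cos0 mulr1 subr_gt0 -expR0 ltr_expR//.
apply: slit_im; rewrite raddfB /= subr0; apply: mulf_neq0; first by rewrite gt_eqF// expR_gt0.
have [lt|gt|E] := ltgtP (complex.Im a) 0; [|by rewrite gt_eqF// sin_gt0_pi// gt a2|by rewrite E eqxx in aN].
by rewrite lt_eqF// sin_neg.
Qed.

Lemma slit_1mcexp a : complex.Re a < 0 \/ complex.Im a != 0 /\ `|complex.Im a| < pi ->
  slit (1 - cexp a).
Proof.
move=> [a0|[aN]].
  apply: slit_re; rewrite raddfB subr_gt0 /=; apply: le_lt_trans (ler_norm _) _.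
  rewrite normrM (ger0_norm (expR_ge0 _)).
  have h : `|cos (complex.Im a)| <= 1 by rewrite ler_norml cos_geN1 cos_le1.
  apply: (@le_lt_trans _ _ (expR (complex.Re a) * 1)); first by rewrite ler_wpM2l ?expR_ge0.
  by rewrite mulr1 -expR0 ltr_expR.
rewrite ltr_norml => /andP[a1 a2]; apply: slit_im.
rewrite raddfB /= sub0r oppr_eq0; apply: mulf_neq0; first by rewrite gt_eqF// expR_gt0.
have [lt|gt|E] := ltgtP (complex.Im a) 0; [|by rewrite gt_eqF// sin_gt0_pi// gt a2|by rewrite E eqxx in aN].
by rewrite lt_eqF// sin_neg.
Qed.

(* [Log (- g)] along [A] and [Log g] along [B] differ by [pi i] at one junction and by [- pi i] at the other. *)
Lemma crossing (A B : R -> R[i]) (g : R[i] -> R[i]) : continuous (fun t => g (A t)) ->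
  continuous (fun t => g (B t)) -> A 1 = B 0 -> B 1 = A 0 ->
  (forall t, 0 <= t <= 1 -> slit (- g (A t))) -> (forall t, 0 <= t <= 1 -> slit (g (B t))) ->
  0 < complex.Im (g (A 0)) -> complex.Im (g (A 1)) < 0 ->
  exists2 d, d <> 0 & var (fun t => g (join A B t)) d.
Proof.
move=> cA cB AB BA sA sB i0 i1.
have cN : continuous (fun t => - g (A t)).
  have -> : (fun t => - g (A t)) = (fun t => (-1) * g (A t)) by apply/funext => t; rewrite mulN1r.
  exact: (cont_mul (@cont_cst R R[i] (-1)) cA).
have V1 := var_slit cN sA.
have V2 := var_mul (@var_cst R (-1) ltac:(by rewrite oppr_eq0 oner_eq0)) V1.
have V3 : var (fun t => g (A t)) (0 + (Log (- g (A 1)) - Log (- g (A 0)))).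
  by apply: var_ext V2 => t _; rewrite mulN1r opprK.
exists (0 + (Log (- g (A 1)) - Log (- g (A 0))) + (Log (g (B 1)) - Log (g (B 0)))).
  move/(congr1 (@complex.Im R)); rewrite BA -AB.
  rewrite !(raddfD (@complex.Im R)) !(raddfN (@complex.Im R)) -!/(complex.Im (Log _)).
  have j0 := Im_Log_gt0 i0; have j1 := Im_Log_lt0 i1.
  have k0 : complex.Im (Log (- g (A 0))) < 0 by apply: Im_Log_lt0; rewrite raddfN oppr_lt0.
  have k1 : 0 < complex.Im (Log (- g (A 1))) by apply: Im_Log_gt0; rewrite raddfN oppr_gt0.
  move: j0 j1 k0 k1; set l1 := complex.Im (Log _); set l2 := complex.Im (Log _).
  set l3 := complex.Im (Log _); set l4 := complex.Im (Log _).
  by rewrite (_ : complex.Im 0 = 0 :> R)//; clear; lra.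
exact: (var_join AB V3 (var_slit cB sB)).
Qed.

Definition dirn v t h : R[i] := t%:C * turn v h.

Definition in_cone v x y T S w :=
  [/\ T < complex.Re w / complex.Re v, complex.Re w / complex.Re v < S,
      complex.Re w / complex.Re v * (complex.Im v + x) < complex.Im w &
      complex.Im w < complex.Re w / complex.Re v * (complex.Im v + y)].

Lemma Re_dirn v t h : complex.Re v != 0 -> complex.Re (dirn v t h) / complex.Re v = t.
Proof. by move=> v0; rewrite /dirn mulc_turn /= mulfK. Qed.

Lemma Im_dirn v t h : complex.Im (dirn v t h) = t * (complex.Im v + h).
Proof. by rewrite /dirn mulc_turn. Qed.

Lemma cone_dirn v x y T S t h : complex.Re v != 0 -> 0 <= T -> T < t -> t < S -> x < h -> h < y ->
  in_cone v x y T S (dirn v t h).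
Proof.
move=> v0 T0 Tt tS xh hy; have t0 : 0 < t by lra.
by rewrite /in_cone !Re_dirn// Im_dirn !ltr_pM2l// !ltrD2l.
Qed.

Lemma cone_dirnE v x y T S w : complex.Re v != 0 -> 0 <= T -> in_cone v x y T S w ->
  exists t h, [/\ T < t, t < S, x < h, h < y & w = dirn v t h].
Proof.
move=> v0 T0 []; set t := _ / _ => h1 h2 h3 h4; have t0 : 0 < t by lra.
exists t, (complex.Im w / t - complex.Im v); split => //.
- by rewrite ltrBrDr addrC ltr_pdivlMr// mulrC.
- by rewrite ltrBlDr addrC ltr_pdivrMr// mulrC.
rewrite /dirn mulc_turn; apply/eqP; rewrite eq_complex /=; apply/andP; split; apply/eqP.
  by rewrite /t divfK.
by rewrite addrC subrK mulrCA divff ?mulr1// gt_eqF.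
Qed.

Lemma cone_open v x y T S w : complex.Re v != 0 -> in_cone v x y T S w ->
  exists2 e, 0 < e & forall d, nm d < e -> in_cone v x y T S (w + d).
Proof.
move=> v0 []; set t := _ / _ => h1 h2 h3 h4.
pose k := `|complex.Re v|^-1.
have k0 : 0 <= k by rewrite invr_ge0.
pose X := `|complex.Im v + x|; pose Y := `|complex.Im v + y|.
have X0 : 0 <= X by exact: normr_ge0.
have Y0 : 0 <= Y by exact: normr_ge0.
pose K := k + k * X + k * Y + 1.
have kX : 0 <= k * X by rewrite mulr_ge0.
have kY : 0 <= k * Y by rewrite mulr_ge0.
have K0 : 0 < K by rewrite /K; lra.
pose m := Num.min (Num.min (t - T) (S - t))
  (Num.min (complex.Im w - t * (complex.Im v + x)) (t * (complex.Im v + y) - complex.Im w)).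
have m0 : 0 < m by rewrite !lt_min !subr_gt0 h1 h2 h3 h4.
have [m1 m2 m3 m4] : [/\ m <= t - T, m <= S - t, m <= complex.Im w - t * (complex.Im v + x) &
    m <= t * (complex.Im v + y) - complex.Im w] by split; rewrite !ge_min lexx ?orbT.
clearbody m; exists (m / K); first by rewrite divr_gt0.
move=> d; rewrite ltr_pdivlMr// => dK.
have d0 := nm_ge0 d.
rewrite /in_cone !raddfD /= mulrDl -/t.
set s := complex.Re d / complex.Re v.
have sk : `|s| <= k * nm d.
  by rewrite /s normrM normrV ?unitfE// mulrC ler_wpM2l// Re_le_nm.
have sX : `|s * (complex.Im v + x)| <= k * nm d * X by rewrite normrM ler_wpM2r.
have sY : `|s * (complex.Im v + y)| <= k * nm d * Y by rewrite normrM ler_wpM2r.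
have di := Im_le_nm d.
have e1 : 0 <= k * nm d by rewrite mulr_ge0.
have e2 : 0 <= k * nm d * X by rewrite mulr_ge0.
have e3 : 0 <= k * nm d * Y by rewrite mulr_ge0.
have dK' : k * nm d + k * nm d * X + k * nm d * Y + nm d < m.
  by move: dK; rewrite /K; clear; lra.
move: sk sX sY di; rewrite !ler_norml !mulrDl => /andP[? ?] /andP[? ?] /andP[? ?] /andP[? ?].
by clear k0 X0 Y0 kX kY K0 dK; split; lra.
Qed.

Lemma cone_mix v x y t0 h0 t1 h1 s : complex.Re v != 0 -> 0 < t0 -> 0 < t1 ->
  x <= h0 <= y -> x <= h1 <= y -> 0 <= s <= 1 -> exists2 h, x <= h <= y &
  dirn v t0 h0 + s%:C * (dirn v t1 h1 - dirn v t0 h0) = dirn v (t0 + s * (t1 - t0)) h.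
Proof.
move=> v0 t00 t10 /andP[x0 y0] /andP[x1 y1] /andP[s0 s1].
pose t := t0 + s * (t1 - t0); have t_0 : 0 < t by rewrite /t; nra.
exists (((1 - s) * t0 * h0 + s * t1 * h1) / t).
  have a0 : 0 <= (1 - s) * t0 by rewrite mulr_ge0 ?subr_ge0// ltW.
  have a1 : 0 <= s * t1 by rewrite mulr_ge0// ltW.
  by rewrite ler_pdivlMr// ler_pdivrMr// /t; apply/andP; split; nra.
rewrite -/t /dirn !mulc_turn; apply/eqP; rewrite eq_complex /=.
apply/andP; split; apply/eqP; first by rewrite /t; ring.
by rewrite [RHS]mulrDr (mulrCA t) divff ?gt_eqF// mulr1 /t; ring.
Qed.

Variable f : R[i] -> R[i].
Hypotheses (hf : holo f) (nf : noncst f).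

Definition on_loop q v x y T l p := [\/ exists2 h, x <= h <= y & go f q (turn v h) T p,
  exists2 t, T <= t <= 1 & go f q (turn v x) t p \/ go f q (turn v y) t p | nm (f p) < l].

(* The loop runs along the arc at time [T], down one side of the fan, through [k], and up the other side. *)
Lemma fan_loop q v x y T l q1 q2 (k : R -> R[i]) : f q != 0 -> complex.Re v < 0 -> x < y ->
  y - x <= 1 -> 0 < T -> T < 1 -> go f q (turn v x) 1 q1 -> go f q (turn v y) 1 q2 ->
  (forall h, x <= h <= y -> exists u, go f q (turn v h) T u) ->
  continuous k -> k 0 = q2 -> k 1 = q1 -> (forall t, 0 <= t <= 1 -> nm (f (k t)) < l) ->
  exists L, [/\ continuous L, L 0 = L 1, forall t, 0 <= t <= 1 -> on_loop q v x y T l (L t) &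
    forall w, in_cone v x y T 1 w -> T * (complex.Im v + x) < complex.Im w ->
      complex.Im w < T * (complex.Im v + y) -> l <= nm (f q) * expR (complex.Re w) ->
      exists2 d, d <> 0 & var (fun t => f (L t) - f q * cexp w) d].
Proof.
move=> fq v0 xy xy1 T0 T1 gx gy arc ck k0 k1 kl.
have vn : complex.Re v != 0 by rewrite lt_eqF.
pose hs s := x + s * (y - x).
have hsI s : 0 <= s <= 1 -> x <= hs s <= y.
  by move=> /andP[s0 s1]; rewrite /hs; apply/andP; split; nra.
have cw : continuous (fun s => dirn v T (hs s)).
  have -> : (fun s => dirn v T (hs s)) = (fun s => dirn v T x + s%:C * (0 +i* (T * (y - x)))%C).
    apply/funext => s; rewrite /dirn !mulc_turn /hs; apply/eqP; rewrite eq_complex /=.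
    by apply/andP; split; apply/eqP; ring.
  exact: (cont_add (@cont_cst R R[i] _) (cont_mul (@continuous_RtoC R) (@cont_cst R R[i] _))).
have [s sI|A cA hA0] := endpoints hf nf cw (q := q).
  by have [u g] := arc _ (hsI s sI); exists u; apply: seg_go.
have hA s : 0 <= s <= 1 -> go f q (turn v (hs s)) T (A s) by move=> sI; apply: go_seg => //; exact: hA0.
have [X [cX X0 X1 hX]] := seg_lift gx.
have [Y [cY Y0 Y1 hY]] := seg_lift gy.
pose ta s := (1 - T) * s + T.
have taI s : 0 <= s <= 1 -> T <= ta s <= 1 /\ 0 <= ta s <= 1.
  by move=> /andP[s0 s1]; rewrite /ta; split; apply/andP; split; nra.
have cX' : continuous (fun s => X (ta s)) := cont_comp (@contR_affine R (1 - T) T) cX.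
have cY' : continuous (fun s => Y (ta s)) := cont_comp (@contR_affine R (1 - T) T) cY.
pose S1 := fun s => X (ta s); pose S2 := fun s => Y (ta s).
have I0 : 0 <= (0:R) <= (1:R) by rewrite lexx ler01.
have I1 : 0 <= (1:R) <= (1:R) by rewrite ler01 lexx.
have ta0 : ta 0 = T by rewrite /ta mulr0 add0r.
have ta1 : ta 1 = 1 by rewrite /ta mulr1 subrK.
have TI : 0 <= T <= 1 by rewrite !ltW.
have A0 : A 0 = S1 0.
  rewrite /S1 ta0; apply: (go_uniq hf (ltW T0) (hA 0 I0)); rewrite /hs mul0r addr0; exact: hX.
have A1 : A 1 = S2 0.
  rewrite /S2 ta0; apply: (go_uniq hf (ltW T0) (hA 1 I1)); rewrite /hs mul1r addrC subrK; exact: hY.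
have kS : k 1 = rev S1 0 by rewrite rev0 k1 /S1 ta1.
have Sk : S2 1 = join k (rev S1) 0 by rewrite join0 k0 /S2 ta1.
pose B := join S2 (join k (rev S1)).
have cB : continuous B := join_cont cY' (join_cont ck (rev_cont cX')).
have AB : A 1 = B 0 by rewrite /B join0.
have BA : B 1 = A 0 by rewrite /B join1// join1// rev1.
have BP t : 0 <= t <= 1 -> (exists2 s, T <= s <= 1 &
    go f q (turn v x) s (B t) \/ go f q (turn v y) s (B t)) \/ nm (f (B t)) < l.
  move=> tI; rewrite /B; have [t' t'I [->|->]] := joinP Sk tI.
    by have [i1 i2] := taI t' t'I; left; exists (ta t') => //; right; exact: (hY (ta t') i2).
  have [t2 t2I [->|->]] := joinP kS t'I; first by right; exact: kl.
  have [t3 t3I ->] := revP S1 t2I.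
  by have [i1 i2] := taI t3 t3I; left; exists (ta t3) => //; left; exact: (hX (ta t3) i2).
exists (join A B); split.
- exact: join_cont.
- by rewrite join0 join1.
- move=> t tI; have [t' t'I [->|->]] := joinP AB tI.
    by constructor 1; exists (hs t'); [exact: hsI|exact: hA].
  by have [h|h] := BP t' t'I; [constructor 2|constructor 3].
move=> w [c1 c2 c3 c4] wx wy lw.
set t1 := _ / _ in c1 c2 c3 c4.
have wE : complex.Re w = t1 * complex.Re v by rewrite /t1 divfK.
clearbody t1; set p := f q * cexp w.
have p0 : p != 0 by rewrite mulf_neq0// cexp_neq0.
pose G := fun z => 1 - f z / p.
have cG : continuous G.
  exact: (cont_sub (@cont_cst _ R[i] 1) (cont_mul (holo_cont hf) (@cont_cst _ R[i] p^-1))).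
have GE z t h : 0 <= t -> go f q (turn v h) t z -> G z = 1 - cexp (dirn v t h - w).
  move=> t0 g; rewrite /G (go_val t0 g).1 /ray /p cexpB invfM mulrACA divff// mul1r.
  by [].
have ReD t h : complex.Re (dirn v t h - w) = (t - t1) * complex.Re v.
  by rewrite raddfB /= {1}/dirn mulc_turn /= wE; ring.
have ImD t h : complex.Im (dirn v t h - w) = t * (complex.Im v + h) - complex.Im w.
  by rewrite raddfB /= Im_dirn.
have pi2 := pi_ge2 R.
have sA t : 0 <= t <= 1 -> slit (- G (A t)).
  move=> tI; rewrite (GE _ _ _ (ltW T0) (hA t tI)) opprB; have /andP[i1 i2] := hsI t tI.
  apply: slit_cexpm1; rewrite ?ReD ?ImD; first by clear - c1 v0; nra.
  rewrite ltr_norml; clear - wx wy i1 i2 T0 T1 xy1 pi2 xy; apply/andP; split; nra.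
have side t z h : T <= t <= 1 -> h = x \/ h = y -> go f q (turn v h) t z -> slit (G z).
  move=> /andP[Tt t11] hh g; rewrite (GE _ _ _ _ g); last by rewrite (le_trans (ltW T0)).
  apply: slit_1mcexp; rewrite ReD ImD.
  have [tt|tt] := ltP t1 t; [left; clear - tt v0; nra|right].
  set P := complex.Im v in c3 c4 wx wy *.
  clear - hh wx wy c1 c2 c3 c4 T0 xy1 pi2 xy Tt tt t11.
  have [e1 e2] : - 1 <= t * (P + h) - complex.Im w <= 1 /\ t * (P + h) - complex.Im w != 0.
    case: hh => ->.
      suff : t * (P + x) < complex.Im w /\ complex.Im w - t * (P + x) <= 1.
        by move=> [? ?]; split; [apply/andP; split; lra|rewrite lt_eqF//; lra].
      have [P0|P0] := leP 0 (P + x).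
        have k1 : t * (P + x) <= t1 * (P + x) by rewrite ler_wpM2r.
        have k2 : T * (P + x) <= t * (P + x) by rewrite ler_wpM2r.
        by split; clear - xy xy1 Tt t11 tt c3 wy P0; nra.
      have k1 : t * (P + x) <= T * (P + x) by rewrite ler_wnM2r// ltW.
      have k2 : t1 * (P + x) <= t * (P + x) by rewrite ler_wnM2r// ltW.
      by split; clear - xy xy1 c2 c4 wx k1 k2; nra.
    suff : complex.Im w < t * (P + y) /\ t * (P + y) - complex.Im w <= 1.
      by move=> [? ?]; split; [apply/andP; split; lra|rewrite gt_eqF//; lra].
    have [P0|P0] := leP 0 (P + y).
      have k1 : t * (P + y) <= t1 * (P + y) by rewrite ler_wpM2r.
      have k2 : T * (P + y) <= t * (P + y) by rewrite ler_wpM2r.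
      by split; clear - xy xy1 c2 c3 wy k1 k2; nra.
    have k1 : t * (P + y) <= T * (P + y) by rewrite ler_wnM2r// ltW.
    have k2 : t1 * (P + y) <= t * (P + y) by rewrite ler_wnM2r// ltW.
    by split; clear - xy xy1 Tt t11 c4 wx k1 k2; nra.
  by split => //; move: e1; rewrite ltr_norml => /andP[? ?]; apply/andP; split; lra.
have sB t : 0 <= t <= 1 -> slit (G (B t)).
  move=> /BP[[t' t'I [g|g]]|h].
  - by apply: (side t' _ x t'I _ g); left.
  - by apply: (side t' _ y t'I _ g); right.
  apply: slit_near1; rewrite /G addrAC subrr add0r nmN nmM nmV ltr_pdivrMr ?nm_gt0// mul1r.
  by rewrite /p nmM nm_cexp; exact: lt_le_trans lw.
have ImG t h : complex.Im (1 - cexp (dirn v t h - w)) =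
    - (expR ((t - t1) * complex.Re v) * sin (t * (complex.Im v + h) - complex.Im w)).
  have E a : complex.Im (1 - a) = - complex.Im a by case: a => p1 p2 /=; rewrite sub0r.
  by rewrite E Im_cexp ReD ImD.
have iA0 : 0 < complex.Im (G (A 0)).
  have := hA 0 I0; rewrite (_ : hs 0 = x); last by rewrite /hs mul0r addr0.
  move=> /(GE _ _ _ (ltW T0)) ->; rewrite ImG oppr_gt0 pmulr_rlt0 ?expR_gt0//.
  by apply: sin_neg; clear - wx wy T0 T1 xy1 pi2 xy; nra.
have iA1 : complex.Im (G (A 1)) < 0.
  have := hA 1 I1; rewrite (_ : hs 1 = y); last by rewrite /hs mul1r addrC subrK.
  move=> /(GE _ _ _ (ltW T0)) ->; rewrite ImG oppr_lt0 mulr_gt0 ?expR_gt0//.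
  by apply: sin_gt0_pi; clear - wx wy T0 T1 xy1 pi2 xy; apply/andP; split; nra.
have [d d0 Vd] := crossing (cont_comp cA cG) (cont_comp cB cG) AB BA sA sB iA0 iA1.
exists (0 + d); first by rewrite add0r.
have pN : - p != 0 by rewrite oppr_eq0.
apply: var_ext (var_mul (var_cst pN) Vd) => t _.
by rewrite /G mulrBr mulr1 mulNr opprK mulrCA divff// mulr1 addrC.
Qed.

End Branching.

Section Branch.
Variable R : realType.
Implicit Types (z w u a c d v q p : R[i]) (x y t s r e M S T B b h l : R).
Implicit Types (W Z L : R -> R[i]).
Variable f : R[i] -> R[i].
Hypotheses (hf : holo f) (nf : noncst f).

Definition fan_lifts q v x y S := forall t h, 0 < t -> t < S -> x <= h <= y ->
  exists u, go f q (turn v h) t u.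

Lemma ReN a : complex.Re (- a) = - complex.Re a.
Proof. by case: a. Qed.

Lemma ReB a c : complex.Re (a - c) = complex.Re a - complex.Re c.
Proof. by case: a; case: c. Qed.

Lemma fan_inner_regular q v x y T S l L z w : f q != 0 -> complex.Re v < 0 ->
  y - x <= 1 -> 0 < T -> S <= 1 -> fan_lifts q v x y S ->
  l <= nm (f q) * expR (S * complex.Re v) ->
  continuous L -> L 0 = L 1 -> (forall t, 0 <= t <= 1 -> on_loop f q v x y T l (L t)) ->
  in_cone v x y T S w -> inner L z -> dz f z != 0 -> f z = f q * cexp w -> seg f q w z.
Proof.
move=> fq v0 xy1 T0 S1 fan lS cL L01 hL cw iz dz0 fz.
have vn : complex.Re v != 0 by rewrite lt_eqF.
have [t1 [h1 [Tt1 t1S xh1 h1y wE]]] := cone_dirnE vn (ltW T0) cw.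
have F0 : 0 < nm (f q) by rewrite nm_gt0.
have fz0 : f z != 0 by rewrite fz mulf_neq0// cexp_neq0.
pose b := T * (Num.min (h1 - x) (y - h1) / 2).
have m0 : 0 < Num.min (h1 - x) (y - h1) by rewrite lt_min !subr_gt0 xh1.
have b0 : 0 < b by rewrite mulr_gt0// divr_gt0.
have v'0 : 0 < complex.Re (- turn v h1) by rewrite ReN Re_turn oppr_gt0.
have [h [s [t [hb s0 tI g]]]] := climb hf nf cL L01 iz dz0 fz0 v'0 b0.
pose h2 := h1 - h.
have dE : turn (- turn v h1) h = - turn v h2.
  rewrite /h2; case: (v) => v1 v2; rewrite /turn; apply/eqP; rewrite eq_complex /=.
  by apply/andP; split; apply/eqP; ring.
rewrite dE in g; set p := L t in g.
have fp : f p = f q * cexp (w - s%:C * turn v h2).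
  by rewrite (go_val (ltW s0) g).1 fz /ray -mulrA -cexpD; congr (_ * cexp _); ring.
have wRe : complex.Re (w - s%:C * turn v h2) = (t1 - s) * complex.Re v.
  by rewrite ReB wE /dirn !mulc_turn /=; ring.
have np : nm (f p) = nm (f q) * expR ((t1 - s) * complex.Re v) by rewrite fp nmM nm_cexp wRe.
have lev t' h' : 0 <= t' -> go f q (turn v h') t' p -> t1 - s = t'.
  move=> t'0 g'; have : nm (f p) = nm (f q) * expR (t' * complex.Re v).
    by rewrite (go_val t'0 g').1 nm_ray Re_turn.
  by rewrite np => /(mulfI (lt0r_neq0 F0))/expR_inj/(mulIf vn).
pose th := h1 + s * h / (t1 - s).
have wth : 0 < t1 - s -> w - s%:C * turn v h2 = dirn v (t1 - s) th.
  move=> ts; rewrite wE /dirn !mulc_turn; apply/eqP; rewrite eq_complex.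
  rewrite !(raddfB (@complex.Re R)) !(raddfB (@complex.Im R)) /=; apply/andP; split; apply/eqP; first by ring.
  have k : (t1 - s) * (s * h / (t1 - s)) = s * h by rewrite mulrCA divff ?mulr1// gt_eqF.
  by rewrite /th /h2 !mulrDr k; ring.
have thI : T <= t1 - s -> x < th < y.
  move=> ts; have ts0 : 0 < t1 - s := lt_le_trans T0 ts.
  have : `|s * h / (t1 - s)| <= Num.min (h1 - x) (y - h1) / 2.
    rewrite normrM normrV ?unitfE ?gt_eqF// (gtr0_norm ts0) ler_pdivrMr// normrM (gtr0_norm s0).
    apply: (@le_trans _ _ (1 * b)).
      by apply: ler_pM => //; [exact: ltW|clear - ts S1 t1S T0; lra].
    by rewrite mul1r /b mulrC ler_pM2l// divr_gt0.
  have mx : Num.min (h1 - x) (y - h1) <= h1 - x by rewrite ge_min lexx.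
  have my : Num.min (h1 - x) (y - h1) <= y - h1 by rewrite ge_min lexx orbT.
  rewrite ler_norml /th; clear - m0 mx my => /andP[? ?]; apply/andP; split; lra.
have same t' h' : T <= t' -> t' <= 1 -> x <= h' <= y -> go f q (turn v h') t' p -> t1 - s = t' /\ h' = th.
  move=> Tt' t'1 /andP[xh' h'y] g'; have t'0 : 0 < t' := lt_le_trans T0 Tt'.
  have ts := lev t' h' (ltW t'0) g'; split => //.
  have /andP[x1 y1] : x < th < y by apply: thI; rewrite ts.
  have [] // := @ray_inj R (f q) v t' h' t' th fq vn t'0.
    rewrite normrM (gtr0_norm t'0).
    have : `|h' - th| <= 1 by rewrite ler_norml; clear - xh' h'y x1 y1 xy1; apply/andP; split; lra.
    have := pi_ge2 R; have := normr_ge0 (h' - th); clear - t'0 t'1; nra.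
  by rewrite -(go_val (ltW t'0) g').1 fp wth ts// /ray /dirn.
have [[h' h'I g']|[t' /andP[Tt' t'1] [g'|g']]|lo] := hL t tI.
- have T1 : T <= 1 by clear - Tt1 t1S S1; lra.
  have [ts hth] := same T h' (lexx T) T1 h'I g'.
  rewrite hth in g'.
  have ts0 : 0 < t1 - s by rewrite ts.
  have [u gu] := fan t1 h1 (lt_trans T0 Tt1) t1S ltac:(by rewrite !ltW).
  have gu' : seg f q w u by rewrite wE; apply: seg_go gu; exact: lt_trans Tt1.
  have thI' : x <= th <= y by have /andP[? ?] := thI ltac:(by rewrite ts); rewrite !ltW.
  have tri : seg f p (w - dirn v T th) u.
    apply: (triangle hf nf (seg_go T0 g') gu') => s' s'I.
    rewrite wE; have [hh hhI ->] := @cone_mix R v x y T th t1 h1 s' vn T0 (lt_trans T0 Tt1) thI'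
      ltac:(by rewrite !ltW) s'I.
    have /andP[s'0 s'1] := s'I.
    have tt0 : 0 < T + s' * (t1 - T) by clear - T0 Tt1 s'0; nra.
    have ttS : T + s' * (t1 - T) < S by clear - t1S Tt1 s'1; nra.
    by have [u' g''] := fan _ hh tt0 ttS hhI; exists u'; apply: seg_go.
  have -> : z = u; last by [].
  apply: (seg_uniq hf _ tri).
  have -> : w - dirn v T th = s%:C * turn v h2.
    by have := wth ts0; rewrite ts => <-; ring.
  by apply: seg_go => //; rewrite -(opprK (turn v h2)); apply: go_rev (ltW s0) g.
- have [ts hx] := same t' x Tt' t'1 ltac:(by rewrite lexx ltW// (lt_trans xh1)) g'.
  by have /andP[] := thI ltac:(by rewrite ts); rewrite -hx ltxx.
- have [ts hy] := same t' y Tt' t'1 ltac:(by rewrite lexx andbT ltW// (lt_trans xh1)) g'.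
  by have /andP[_] := thI ltac:(by rewrite ts); rewrite -hy ltxx.
have : nm (f p) < nm (f p).
  apply: lt_le_trans lo (le_trans lS _); rewrite np ler_pM2l// ler_expR.
  by clear - v0 t1S s0; nra.
by rewrite ltxx.
Qed.

Lemma fan_inner q v x y T S l L z w : f q != 0 -> complex.Re v < 0 ->
  y - x <= 1 -> 0 < T -> S <= 1 -> fan_lifts q v x y S ->
  l <= nm (f q) * expR (S * complex.Re v) ->
  continuous L -> L 0 = L 1 -> (forall t, 0 <= t <= 1 -> on_loop f q v x y T l (L t)) ->
  in_cone v x y T S w -> inner L z -> f z = f q * cexp w -> seg f q w z.
Proof.
move=> fq v0 xy1 T0 S1 fan lS cL L01 hL cw iz fz.
have vn : complex.Re v != 0 by rewrite lt_eqF.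
have [t1 [h1 [Tt1 t1S xh1 h1y wE]]] := cone_dirnE vn (ltW T0) cw.
have t10 : 0 < t1 := lt_trans T0 Tt1.
have [u gu] : exists u, seg f q w u.
  have [u gu] := fan t1 h1 t10 t1S ltac:(by rewrite !ltW).
  by exists u; rewrite wE; exact: seg_go gu.
have [->//|zu] := eqVneq z u; exfalso.
have D0 : 0 < nm (z - u) / 2 by rewrite divr_gt0// nm_gt0 subr_eq0.
have [e1 e10 he1] := cone_open vn cw.
have [e2 e20 he2] := inner_open cL L01 iz.
have [Y [lY Y0 Y1]] := gu.
have [e3 e30 he3] := ray_lift_near hf nf ler01 lY Y0 D0.
have [e4 e40 he4] := @cexp_onto1 R.
have fz0 : f z != 0 by rewrite fz mulf_neq0// cexp_neq0.
have F0 : 0 < nm (f z) by rewrite nm_gt0.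
pose m := Num.min e4 (Num.min (e1 / 2) (e3 / 2)).
have m0 : 0 < m by rewrite !lt_min e40 !divr_gt0.
have [m4 m1 m3] : [/\ m <= e4, m <= e1 / 2 & m <= e3 / 2] by split; rewrite !ge_min lexx ?orbT.
clearbody m; have mF : 0 < m * nm (f z) by rewrite mulr_gt0.
have /continuous_epsP/(_ _ mF)[e5 e50 he5] := @holo_cont R f hf z.
have [s hs] := critical_list hf nf (nm z + 1).
pose b := Num.min 1 (Num.min (e2 / 2) (Num.min (nm (z - u) / 2) (e5 / 2))).
have b0 : 0 < b by rewrite !lt_min ltr01 D0 !divr_gt0.
have [b1 b2 bD b5] : [/\ b <= 1, b <= e2 / 2, b <= nm (z - u) / 2 & b <= e5 / 2].
  by split; rewrite !ge_min lexx ?orbT.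
clearbody b.
have [h hb hnE] := fresh_angle [seq complex.Re (c - z) | c <- s] b0.
pose z' := z + h%:C.
have z'z : nm (z' - z) <= b by rewrite /z' addrC addKr nmC.
have dz' : dz f z' != 0.
  apply: contra hnE => /eqP dz0; apply/mapP; exists z'.
    by apply: hs => //; have := nmDB z' z; clear - z'z b1; lra.
  by rewrite /z' addrC addKr.
have iz' : inner L z' by apply: he2; clear - z'z b2 e20; lra.
have ratio : nm (f z' / f z - 1) < m.
  have -> : f z' / f z - 1 = (f z' - f z) / f z by field.
  rewrite nmM nmV ltr_pdivrMr//; apply: he5; clear - z'z b5 e50; lra.
have [|d dE dn] := he4 (f z' / f z); first by clear - ratio m4; lra.
have cw' : in_cone v x y T S (w + d) by apply: he1; clear - dn ratio m1; lra.
have fz' : f z' = f q * cexp (w + d) by rewrite cexpD mulrA -fz dE mulrCA divff// mulr1.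
have g' := fan_inner_regular fq v0 xy1 T0 S1 fan lS cL L01 hL cw' iz' dz' fz'.
have [|Y' lY' [Y'0 hY']] := he3 (w + d); first by rewrite addrC addKr; clear - dn ratio m3; lra.
have E : z' = Y' 1 by apply: (seg_uniq hf g'); exists Y'.
have I1 : 0 <= (1:R) <= (1:R) by rewrite ler01 lexx.
have := hY' 1 I1; rewrite -E Y1; have := nm_sub_trans z' z u; rewrite (nmB z z').
by clear - z'z bD; lra.
Qed.

(* The first time at which some direction of the fan is blocked. *)
Lemma fan_tip q v x y S h0 : dz f q != 0 -> 0 <= S -> x <= h0 <= y ->
  (~ exists u, go f q (turn v h0) S u) -> exists T h, [/\ 0 < T, T <= S, x <= h <= y,
    fan_lifts q v x y T & ~ exists u, go f q (turn v h) T u].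
Proof.
move=> dq S0 h0I nS.
pose P := [set T : R | 0 <= T /\ forall h, x <= h <= y -> exists u, go f q (turn v h) T u].
have P0 : P 0 by split => // h _; exists q; exact: go0.
have PS T : P T -> T <= S.
  move=> [T0 hT]; rewrite leNgt; apply/negP => ST; apply: nS.
  have [u g] := hT h0 h0I; have [u' g' _] := go_sub S0 (ltW ST) g; by exists u'.
have hs : has_sup P by split; [exists 0|exists S => T /PS].
pose T := sup P.
have T0 : 0 <= T := ub_le_sup hs.2 P0.
have TS : T <= S by apply: ge_sup; [exists 0|move=> t /PS].
have fan : fan_lifts q v x y T.
  move=> t h t0 tT hI.
  have tT' : 0 < T - t by rewrite subr_gt0.
  have [T' [T'0 hT'] tT1] := sup_adherent tT' hs.
  have tT2 : t <= T' by move: tT1; rewrite -/T; clear; lra.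
  by have [u g] := hT' h hI; have [u' g' _] := go_sub (ltW t0) tT2 g; exists u'.
have [h [hI nh]] : exists h, x <= h <= y /\ ~ exists u, go f q (turn v h) T u.
  apply: contrapT => hn.
  have hT h : x <= h <= y -> exists u, go f q (turn v h) T u.
    by move=> hI; apply: contrapT => nh; apply: hn; exists h.
  have xy : x <= y by case/andP: h0I => h1 h2; exact: le_trans h2.
  pose Q x1 y1 := exists2 d, 0 < d & forall h, x1 <= h <= y1 -> exists u, go f q (turn v h) (T + d) u.
  have [d d0 hd] : Q x y.
    apply: (@interval_cousin R x y Q xy) => [x1 y1 r1 _ xy1 yr1 _ [d1 d10 H1] [d2 d20 H2]|h1 h1I].
      exists (Num.min d1 d2); first by rewrite lt_min d10.
      have short (d : R) h : Num.min d1 d2 <= d -> (exists u, go f q (turn v h) (T + d) u) ->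
          exists u, go f q (turn v h) (T + Num.min d1 d2) u.
        move=> le [u g]; have mn : 0 < Num.min d1 d2 by rewrite lt_min d10.
        have Tm : 0 <= T + Num.min d1 d2 by rewrite addr_ge0// ltW.
        have le' : T + Num.min d1 d2 <= T + d by rewrite lerD2l.
        by have [u' g' _] := go_sub Tm le' g; exists u'.
      move=> h /andP[xh hr]; have [hy|yh] := leP h y1.
        by apply: (short d1); [rewrite ge_min lexx|apply: H1; rewrite xh].
      by apply: (short d2); [rewrite ge_min lexx orbT|apply: H2; rewrite (ltW yh)].
    have [u g] := hT h1 h1I; have du := (go_val T0 g).2.
    have [s s0 hs'] := go_near hf nf (nm (turn v h1)) du (@ltr01 R).
    have [u' g' _] := hs' (turn v h1) s (lexx _) ltac:(by rewrite lexx ltW).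
    have gT := go_trans T0 (ltW s0) g g'.
    have [Z [lZ Z0 Z1]] := gT.
    have Ts0 : 0 <= T + s by rewrite addr_ge0// ltW.
    have [b b0 hb] := fan_lift hf nf Ts0 lZ Z0 ltr01.
    exists b => // x1 y1 _ xh hy _ h1x h1y; exists s => // h /andP[xh' hy'].
    have [|Z' lZ' [Z'0 _]] := hb h; first by rewrite ltr_norml; clear - xh hy h1x h1y xh' hy'; apply/andP; split; lra.
    by exists (Z' (T + s)), Z'.
  have : T + d <= T by apply: (ub_le_sup hs.2); split; [rewrite addr_ge0// ltW|exact: hd].
  clear - d0; lra.
exists T, h; split => //; rewrite lt_neqAle T0 andbT; apply/eqP => T00; apply: nh.
by rewrite -T00; exists q; exact: go0.
Qed.

Definition joined l p q := exists k : R -> R[i],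
  [/\ continuous k, k 0 = p, k 1 = q & forall t, 0 <= t <= 1 -> nm (f (k t)) < l].

Definition simple_zeros := forall z, f z = 0 -> dz f z != 0.

Definition unomitted := forall r (G : set R[i]) z0, 0 < r -> G z0 ->
  (forall z, G z -> nm (f z) < r) ->
  (forall z, G z -> exists2 e, 0 < e & forall u, nm (u - z) < e -> G u) ->
  (forall z, nm (f z) < r -> (forall e, 0 < e -> exists2 u, G u & nm (u - z) < e) -> G z) ->
  exists2 z, G z & f z = 0.

(* A blocked direction ends at infinity or at a critical point; neither can lie inside the
   loop that would exist if the two sides of the blocked direction could be joined below. *)
Lemma branch q : simple_zeros -> unomitted -> lost f q -> exists q1 q2 v1 v2 l,
  [/\ complex.Re v1 < 0, complex.Re v2 < 0, seg f q v1 q1, seg f q v2 q2 &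
   [/\ nm (f q1) < l, nm (f q2) < l & ~ joined l q2 q1]].
Proof.
move=> simple0 unom lq; have [dq fq nq] := lq; have F0 : 0 < nm (f q) by rewrite nm_gt0.
have [v' v'0 nv'] := lost_blocked hf nf simple0 unom lq.
pose v := 2%:C * v'.
have ReS (s : R) a : complex.Re (s%:C * a) = s * complex.Re a by case: a => p1 p2 /=; rewrite mul0r subr0.
have v0 : complex.Re v < 0 by rewrite /v ReS; clear - v'0; lra.
have vn : complex.Re v != 0 by rewrite lt_eqF.
have h2 : 0 < 1 / 2 :> R by lra.
have half0 := ltW h2.
have nS : ~ exists u, go f q (turn v 0) (1 / 2) u.
  move=> [u g]; apply: nv'; exists u.
  have := seg_go h2 g; rewrite turn0.
  have -> : (1 / 2)%:C * v = v'.
    rewrite /v mulrA -rmorphM /=; have -> : 1 / 2 * 2 = 1 :> R by field.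
    by rewrite rmorph1 mul1r.
  by [].
have n2 : - (1 / 2) < 0 :> R by lra.
have [x [q1 [/andP[x1 x0] g1]]] := gross hf nf fq dq vn n2.
have [y [q2 [/andP[y0 y1] g2]]] := gross hf nf fq dq vn h2.
have xy : x < y by lra.
have xy1 : y - x <= 1 by lra.
have zI : x <= 0 <= y by rewrite !ltW.
have [S [h [S0 S2 hI fan nh]]] := fan_tip dq half0 zI nS.
pose l := nm (f q) * expR (3 / 4 * complex.Re v).
exists q1, q2, (turn v x), (turn v y), l; split; rewrite ?Re_turn//.
have low p h1 : go f q (turn v h1) 1 p -> nm (f p) < l.
  by move=> g; rewrite (go_val ler01 g).1 nm_ray Re_turn ltr_pM2l// ltr_expR; clear - v0; lra.
split; [exact: low g1|exact: low g2|move=> [k [ck k0 k1 kl]]].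
have S1 : S < 1 by clear - S2; lra.
have xh : x < h.
  rewrite lt_neqAle; case/andP: hI => -> _; rewrite andbT; apply/eqP => E; apply: nh.
  rewrite -E; have [u gu _] := go_sub (ltW S0) (ltW S1) g1; exact: (ex_intro _ u gu).
have hy : h < y.
  rewrite lt_neqAle; case/andP: hI => _ ->; rewrite andbT; apply/eqP => E; apply: nh.
  rewrite E; have [u gu _] := go_sub (ltW S0) (ltW S1) g2; exact: (ex_intro _ u gu).
pose T := S / 2; have T0 : 0 < T by rewrite divr_gt0.
have TS : T < S by rewrite /T; clear - S0; lra.
have T1 : T < 1 by clear - S1 TS; lra.
have arc h' : x <= h' <= y -> exists u, go f q (turn v h') T u by exact: fan.
have [L [cL L01 hL vL]] := fan_loop hf nf fq v0 xy xy1 T0 T1 g1 g2 arc ck k0 k1 kl.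
have lev t : t <= S -> l <= nm (f q) * expR (t * complex.Re v).
  by move=> tS; rewrite ler_pM2l// ler_expR; clear - tS S2 v0; nra.
have uniq := fan_inner fq v0 xy1 T0 (ltW S1) fan (lev S (lexx S)) cL L01 hL.
pose P := complex.Im v + h.
have wdir t : T < t -> t < S -> in_cone v x y T S (dirn v t h).
  by move=> Tt tS; apply: cone_dirn => //; exact: ltW.
have off t p : T < t -> t <= S -> f p = f q * cexp (dirn v t h) ->
    forall s, 0 <= s <= 1 -> L s != p.
  move=> Tt tS fp s sI; apply/eqP => E.
  have t0 : 0 < t := lt_trans T0 Tt.
  have np : nm (f p) = nm (f q) * expR (t * complex.Re v).
    by rewrite fp nmM nm_cexp /dirn mulc_turn.
  have clash t' h' : 0 <= t' -> t' <= 1 -> x <= h' <= y -> go f q (turn v h') t' p -> h' = h /\ t' = t.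
    move=> t'0 t'1 /andP[xh' h'y] g'.
    have [] // := @ray_inj R (f q) v t h t' h' fq vn t0.
      rewrite normrM (gtr0_norm t0).
      have : `|h - h'| <= 1.
        by rewrite ler_norml; clear - xh' h'y xh hy xy1; apply/andP; split; lra.
      have := pi_ge2 R; have := normr_ge0 (h - h'); clear - t0 tS S1; nra.
    by rewrite -(go_val t'0 g').1 fp.
  have := hL s sI; rewrite E => -[[h' h'I g']|[t' /andP[Tt' t'1] [g'|g']]|].
  - have [_ E1] := clash T h' (ltW T0) (ltW T1) h'I g'; move: Tt; rewrite E1 ltxx => //.
  - have [E1 _] := clash t' x (le_trans (ltW T0) Tt') t'1 ltac:(by rewrite lexx ltW) g'.
    by move: xh; rewrite E1 ltxx.
  - have [E1 _] := clash t' y (le_trans (ltW T0) Tt') t'1 ltac:(by rewrite lexx andbT ltW) g'.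
    by move: hy; rewrite E1 ltxx.
  by rewrite np ltNge lev.
(* The front point just below the arc lies inside the loop. *)
have [t1 [Tt1 t1S w1 w2]] : exists t1, [/\ T < t1, t1 < S, T * (complex.Im v + x) < t1 * P &
    t1 * P < T * (complex.Im v + y)].
  pose m := T * Num.min (h - x) (y - h); pose e := Num.min ((S - T) / 2) (m / (2 * (`|P| + 1))).
  have m0 : 0 < m by apply: mulr_gt0 => //; rewrite lt_min !subr_gt0 xh hy.
  have P1 : 0 < `|P| + 1 by rewrite ltr_wpDl.
  have e0 : 0 < e by rewrite lt_min; apply/andP; split; apply: divr_gt0 => //; rewrite ?subr_gt0// mulr_gt0.
  have [e1 e2] : e <= (S - T) / 2 /\ e * (2 * (`|P| + 1)) <= m.
    by rewrite -ler_pdivlMr ?mulr_gt0// !ge_min !lexx orbT.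
  have [mx my] : m <= T * (h - x) /\ m <= T * (y - h) by rewrite /m !ler_pM2l// !ge_min !lexx orbT.
  clearbody e m; exists (T + e).
  have eP : `|e * P| < m.
    by rewrite normrM (gtr0_norm e0); have := normr_ge0 P; clear - e2 e0; nra.
  move: eP; rewrite ltr_norml /P => /andP[i1 i2].
  by split; clear - e0 e1 TS mx my i1 i2; lra.
have t10 : 0 < t1 := lt_trans T0 Tt1.
have [z1 iz1 fz1] : exists2 z, inner L z & f z = f q * cexp (dirn v t1 h).
  have c1 : in_cone v x y T 1 (dirn v t1 h) by apply: cone_dirn => //; [exact: ltW|clear - S1 t1S; lra].
  have [d d0 Vd] := vL (dirn v t1 h) c1 ltac:(by rewrite Im_dirn) ltac:(by rewrite Im_dirn)
    ltac:(by rewrite /dirn mulc_turn /=; apply: lev; exact: ltW).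
  exact: (arg_principle cL L01 hf nf Vd d0).
have gz1 : go f q (turn v h) t1 z1 by apply: go_seg => //; exact: (uniq _ _ (wdir _ Tt1 t1S) iz1 fz1).
have front t p : t1 <= t -> t < S -> go f q (turn v h) t p -> inner L p.
  move=> t1t tS [Z [lZ Z0 ZT]].
  have cY : continuous (fun s => Z ((t - t1) * s + t1)) := cont_comp (@contR_affine R (t - t1) t1) lZ.1.
  have := inner_path cL L01 cY; rewrite mulr0 add0r mulr1 subrK ZT; apply.
    move=> s s' /andP[s0 s1] s'I.
    have j1 : t1 <= (t - t1) * s + t1 by clear - s0 t1t; nra.
    have j2 : (t - t1) * s + t1 <= t by clear - s1 t1t; nra.
    apply: (off ((t - t1) * s + t1)) => //; first exact: lt_le_trans j1.
      by apply: le_trans j2 _; exact: ltW.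
    by have [-> _] := lZ.2 ((t - t1) * s + t1) ltac:(by rewrite j2 (le_trans (ltW t10))).
  have -> : Z t1 = z1; last by [].
  apply: (go_uniq hf (ltW t10) _ gz1).
  by exists Z; split; [exact: lift_sub lZ t1t|exact: Z0|reflexivity].
have cR : continuous (ray (f q) (turn v h)) := @ray_cont _ _ _.
have [//|[S' [S'0 S'S below nS' bad]]] := lift_or_blocked hf nf cR (ltW S0) (esym (ray0 (f q) (turn v h))) dq.
have SE : S' = S.
  apply/eqP; rewrite eq_le S'S leNgt; apply/negP => lt; apply: nS'.
  by have [u g] := fan S' h S'0 lt ltac:(by rewrite !ltW); exists u.
rewrite {}SE {S' S'0 S'S} in below nS' bad.
case: bad => [esc|[c [dc fc conv]]].
  have [M1 hM1] := inner_bounded cL L01.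
  have [Z [lZ Z0 ZT]] := gz1.
  have [M2 hM2] := path_bounded (cont_comp (@contR_affine R t1 0) lZ.1).
  have [t [u [t0 tS gu]]] := esc (Num.max M1 M2); rewrite gt_max => /andP[uM1 uM2].
  have [tt|tt] := leP t1 t; first by have := hM1 u (front t u tt tS gu); clear - uM1; lra.
  have uE : u = Z t.
    apply: (go_uniq hf t0 gu).
    by exists Z; split; [exact: lift_sub lZ (ltW tt)|exact: Z0|reflexivity].
  have := hM2 (t / t1); rewrite addr0 mulrCA divff ?gt_eqF// mulr1 -uE.
  rewrite divr_ge0 ?(ltW t10)//= ler_pdivrMr// mul1r (ltW tt) => /(_ isT).
  by clear - uM2; lra.
have fc' : f c = f q * cexp (dirn v S h) by rewrite fc.
have near e : 0 < e -> exists t u, [/\ t1 <= t, t < S, go f q (turn v h) t u, inner L u & nm (u - c) < e].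
  move=> e0; have [d d0 hd] := conv e e0.
  pose t := Num.max t1 (S - d / 2).
  have t1t : t1 <= t by rewrite le_max lexx.
  have tS : t < S by rewrite gt_max t1S; clear - d0; lra.
  have td : S - d < t by rewrite lt_max; apply/orP; right; clear - d0; lra.
  have t0 : 0 <= t := le_trans (ltW t10) t1t.
  have [u gu] := below t t0 tS; exists t, u; split => //; first exact: front gu.
  exact: hd t u t0 tS td gu.
have ic : inner L c.
  apply: contrapT => nc.
  have [|s sI E] := inner_boundary cL L01 _ nc.
    move=> A /nbhs_nm[e e0 he]; have [t [u [_ _ _ iu uc]]] := near e e0.
    by exists u; split => //; exact: he.
  by have := off S c TS (lexx S) fc' s sI; rewrite E eqxx.
have [e e0 he] := inner_open cL L01 ic.
have [d d0 hd] := two_preimages hf nf dc e0.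
have /continuous_epsP/(_ _ d0)[e1 e10 he1] := @holo_cont R f hf c.
have [t [u [t1t tS gu iu uc]]] := near e1 e10.
have t0 : 0 < t := lt_le_trans t10 t1t.
have fu : f u = f q * cexp (dirn v t h) by have [-> _] := seg_val (seg_go t0 gu).
have fuc : f u != f c.
  apply/eqP => E; have := congr1 (@nm R) E; rewrite fu fc' !nmM !nm_cexp /dirn !mulc_turn /=.
  by move/(mulfI (lt0r_neq0 F0))/expR_inj/(mulIf vn) => tE; move: tS; rewrite tE ltxx.
have [z1' [z2 [zz z1c z2c fz1' fz2]]] := hd (f u) fuc (he1 u uc).
have Tt : T < t := lt_le_trans Tt1 t1t.
have u1 := uniq _ _ (wdir t Tt tS) (he _ z1c) (etrans fz1' fu).
have u2 := uniq _ _ (wdir t Tt tS) (he _ z2c) (etrans fz2 fu).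
by move: zz; rewrite (seg_uniq hf u1 u2) eqxx.
Qed.

End Branch.

Section Counting.
Variable R : realType.
Implicit Types (z w u a c d v q p : R[i]) (x y t s r e M S T B b h l : R).
Variable f : R[i] -> R[i].
Hypotheses (hf : holo f) (nf : noncst f).

Lemma joined_sym l p q : joined f l p q -> joined f l q p.
Proof.
move=> [k [ck k0 k1 kl]]; exists (rev k); split; [exact: rev_cont|by rewrite rev0|by rewrite rev1|].
by move=> t tI; have [s sI ->] := revP k tI; exact: kl.
Qed.

Lemma joined_trans l p q u : joined f l p q -> joined f l q u -> joined f l p u.
Proof.
move=> [k [ck k0 k1 kl]] [k' [ck' k'0 k'1 k'l]].
have E : k 1 = k' 0 by rewrite k1 k'0.
exists (join k k'); split; [exact: join_cont|by rewrite join0|by rewrite join1|].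
by move=> t tI; have [s sI [->|->]] := joinP E tI; [exact: kl|exact: k'l].
Qed.

Lemma joined_seg l q v u : complex.Re v <= 0 -> nm (f q) < l -> seg f q v u -> joined f l q u.
Proof.
move=> v0 ql /seg_lift[Z [cZ Z0 Z1 hZ]]; exists Z; split; [exact: cZ|exact: Z0|exact: Z1|move=> t tI].
have /andP[t0 _] := tI; rewrite (go_val t0 (hZ t tI)).1.
by apply: le_lt_trans ql; exact: nm_descend.
Qed.

Definition apart_below p q := exists l, [/\ nm (f p) < l, nm (f q) < l & ~ joined f l p q].

Lemma apart_below_sym p q : apart_below p q -> apart_below q p.
Proof. by move=> [l [h1 h2 h3]]; exists l; split => // /joined_sym. Qed.

Lemma seg_below q v u : complex.Re v <= 0 -> seg f q v u -> nm (f u) <= nm (f q).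
Proof.
by move=> v0 g; rewrite (go_val ler01 g).1; exact: nm_descend.
Qed.

Lemma apart_below_seg p q v u : complex.Re v < 0 -> seg f p v u -> apart_below p q -> apart_below u q.
Proof.
move=> v0 g [l [h1 h2 h3]]; exists l; split => //.
  by apply: le_lt_trans h1; apply: seg_below g; exact: ltW.
move=> h; apply: h3; apply: joined_trans h; exact: joined_seg (ltW v0) h1 g.
Qed.

Fixpoint family (s : seq R[i]) : Prop := if s is a :: s' then
  [/\ lost f a, forall c, c \in s' -> apart_below a c & family s'] else True.

Lemma family_lost (s : seq R[i]) q : family s -> q \in s -> lost f q.
Proof.
elim: s => //= a s IH [la _ fs]; rewrite inE => /orP[/eqP->//|]; exact: IH.
Qed.

Lemma family_apart (s : seq R[i]) i j : family s -> (i < size s)%N -> (j < size s)%N -> i <> j ->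
  apart_below (nth 0 s i) (nth 0 s j).
Proof.
elim: s i j => //= a s IH [|i] [|j] [_ h fs] //= i1 j1 ij.
- by apply: h; exact: mem_nth.
- by apply: apart_below_sym; apply: h; exact: mem_nth.
- by apply: IH => //; move=> E; apply: ij; rewrite E.
Qed.

Lemma large_family n q : simple_zeros f -> unomitted f -> lost f q ->
  exists2 s : seq R[i], family s & size s = n.+1.
Proof.
move=> sz un lq; elim: n => [|n [[|p s] //= [lp hs fs] sE]]; first by exists [:: q].
have [q1 [q2 [v1 [v2 [l [v10 v20 g1 g2 [l1 l2 nj]]]]]]] := branch hf nf sz un lp.
exists [:: q1, q2 & s]; last by rewrite /= sE.
split; [exact: lost_seg g1 lp| |split => //].
- move=> c; rewrite inE => /orP[/eqP->|cs]; last exact: apart_below_seg v10 g1 (hs c cs).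
  by exists l; split => // /joined_sym.
- exact: lost_seg g2 lp.
- move=> c cs; exact: apart_below_seg v20 g2 (hs c cs).
Qed.

Lemma common_start (s : seq R[i]) A : (forall q, q \in s -> dz f q != 0) -> exists t0 R0 F : R,
  [/\ 0 < t0, t0 <= 1, 1 <= R0, 1 <= F & forall q, q \in s -> [/\ nm q + 2 <= R0, nm (f q) <= F &
    forall w t, nm w <= A -> 0 <= t <= t0 -> exists2 u, go f q w t u & nm (u - q) < 1]].
Proof.
elim: s => [|a s IH] h; first by exists 1, 1, 1; split.
have [|t0 [R0 [F [t00 t01 R01 F1 hs]]]] := IH; first by move=> q qs; apply: h; rewrite inE qs orbT.
have [t1 t10 ht1] := @go_near R f hf nf a A 1 (h a (mem_head a s)) ltr01.
exists (Num.min t0 t1), (Num.max R0 (nm a + 2)), (Num.max F (nm (f a))).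
rewrite lt_min t00 t10 !ge_min t01 !le_max R01 F1; split => // q.
rewrite inE => /orP[/eqP->|qs]; rewrite !le_max ?lexx ?orbT.
  split => // w t wA /andP[t_0 tt]; apply: ht1 => //; rewrite t_0.
  by move: tt; rewrite le_min => /andP[].
have [h1 h2 h3] := hs q qs; rewrite h1 h2; split => // w t wA /andP[t_0 tt]; apply: h3 => //.
by rewrite t_0; move: tt; rewrite le_min => /andP[].
Qed.

Theorem no_lost B n q : 0 <= B -> growth f B n -> simple_zeros f -> unomitted f -> ~ lost f q.
Proof.
move=> B0 gB sz un lq.
have [c [C [C0 low]]] := lost_lower hf nf sz B0 gB.
pose K := 128 * gap (-1 : R[i]) 1 ^+ 2.
have K0 : 0 <= K by rewrite mulr_ge0 ?sqr_ge0.
pose N := (Num.bound (2 * K * (n%:R + 1))).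
have hN : 2 * K * (n%:R + 1) < N%:R.
  by apply: archi_boundP; apply: mulr_ge0; [exact: mulr_ge0|exact: addr_ge0].
have [s fs sN] := large_family N sz un lq.
have ns i : (i < N)%N -> (i < size s)%N by rewrite sN => /ltnW; rewrite ltnS.
have ds p : p \in s -> dz f p != 0 by move=> /(family_lost fs)[].
have [t0 [R0 [F [t00 t01 R01 F1 hs]]]] := common_start 2 ds.
have v0 : complex.Re (-1 : R[i]) != 0 by rewrite /= oppr_eq0 oner_eq0.
have wn h : `|h| <= 1 -> nm (turn (-1 : R[i]) h) <= 2.
  move=> h1; apply: (le_trans (nmD _ _)); rewrite nmN nm1.
  by rewrite nmE /= expr0n /= add0r sqrtr_sqr; lra.
have Rew h : complex.Re (turn (-1 : R[i]) h) = -1 by rewrite Re_turn.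
have sc (r : R) h : complex.Re (r%:C * turn (-1 : R[i]) h) = - r.
  by rewrite mulc_turn /= mulrN1.
pose qq i := nth 0 s i.
have qs i : (i < N)%N -> qq i \in s by move=> /ns; exact: mem_nth.
have nearq i h t u : (i < N)%N -> `|h| <= 1 -> 0 <= t -> t <= t0 ->
    go f (qq i) (turn (-1) h) t u -> 1 + nm u <= R0.
  move=> iN h1 t_0 tt g; have [i1 i2 i3] := hs _ (qs i iN).
  have [|u' g' uq] := i3 (turn (-1) h) t (wn h h1); first by rewrite t_0.
  by rewrite (go_uniq hf t_0 g g'); have := nmDB u' (qq i); clear - i1 uq; lra.
have main X : 0 <= X -> exists a, 0 <= a /\ True by exists 0.
pose A0 := C * (1 + nm c + 2 * R0) ^+ n + F + 1.
have A01 : 1 <= A0.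
  have : 0 <= C * (1 + nm c + 2 * R0) ^+ n.
    by rewrite mulr_ge0// exprn_ge0//; have := nm_ge0 c; clear - R01; lra.
  by rewrite /A0; clear - F1; lra.
pose a := ln (A0 / t0); pose b := ln (8 * R0).
have a0 : 0 <= a.
  by apply: ln_ge0; rewrite ler_pdivlMr// mul1r; exact: le_trans A01.
have b0 : 0 <= b by apply: ln_ge0; clear - R01; lra.
have {}main X : 0 <= X -> N%:R * X ^+ 2 <= K * (n%:R * X + a) * (X + b).
  move=> X0; pose R1 := 2 * R0 * expR X.
  have eX : 1 <= expR X by have := @expR_ge1Dx R X; clear - X0; lra.
  have R1R0 : 2 * R0 <= R1 by rewrite /R1; clear - eX R01; nra.
  pose tau := C * (1 + nm c + R1) ^+ n + F + 1.
  have c0 := nm_ge0 c.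
  have tauF : F + 1 <= tau.
    have : 0 <= C * (1 + nm c + R1) ^+ n.
      by rewrite mulr_ge0// exprn_ge0//; clear - R01 R1R0 c0; lra.
    by rewrite /tau; clear; lra.
  have tau0 : t0 < tau by clear - tauF t01 F1; lra.
  have tau00 : 0 <= tau by clear - tau0 t00; lra.
  have := @length_area R f hf nf N qq (-1) 1 t0 tau R0 R1 _ v0 ler01 t00 tau0 R01 R1R0 _ _ _.
  have -> : R1 / (2 * R0) = expR X by rewrite /R1 mulrAC divff ?mul1r// gt_eqF//; clear - R01; lra.
  have -> : 4 * R1 = expR X * (8 * R0) by rewrite /R1; ring.
  have r8 : 0 < 8 * R0 by clear - R01; lra.
  have -> : ln (expR X * (8 * R0)) = X + b by rewrite lnM ?posrE ?expR_gt0// expRK.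
  rewrite expRK mulr1 -/K => LA.
  have tb : ln (tau / t0) <= n%:R * X + a.
    have A00 : 0 < A0 / t0 by apply: divr_gt0 => //; exact: lt_le_trans A01.
    have tt0 : 0 < tau / t0 by apply: divr_gt0 => //; exact: lt_trans tau0.
    rewrite -(expRK (n%:R * X)) /a -lnM ?posrE ?expR_gt0//.
    rewrite ler_ln ?posrE//; last by rewrite mulr_gt0 ?expR_gt0.
    rewrite mulrA ler_pM2r ?invr_gt0// /tau /A0 expRM_natl !mulrDr mulr1.
    have en : 1 <= expR X ^+ n by rewrite exprn_ege1.
    apply: lerD; last by [].
    apply: lerD; last by rewrite ler_peMl//; clear - F1; lra.
    rewrite mulrCA ler_wpM2l// -exprMn lerXn2r ?nnegrE//; [clear - R01 R1R0 c0; lra| |].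
      by rewrite mulr_ge0 ?expR_ge0//; clear - R01 c0; lra.
    by rewrite /R1; clear - eX c0; nra.
  apply: (le_trans (LA _ _ _ _)) => {LA}.
  - by move=> i iN; have [_ ? _] := family_lost fs (qs i iN).
  - by move=> i h u iN h1 g; apply: nearq h1 _ _ g => //; exact: ltW.
  - move=> i h t i' h' t' u iN i'N h1 h1' /andP[t_0 tt] /andP[t'0 tt'] g g'.
    have s1 := seg_go t_0 g; have s2 := seg_go t'0 g'.
    have r1 : complex.Re (t%:C * turn (-1 : R[i]) h) < 0 by rewrite sc oppr_lt0.
    have r2 : complex.Re (t'%:C * turn (-1 : R[i]) h') < 0 by rewrite sc oppr_lt0.
    have [ii|ii] := eqVneq i i'; last first.
      exfalso; have [l [l1 l2 nj]] := family_apart fs (ns i iN) (ns i' i'N) (elimN eqP ii).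
      apply: nj; apply: joined_trans (joined_seg (ltW r1) l1 s1) _.
      exact: joined_sym (joined_seg (ltW r2) l2 s2).
    rewrite -ii in s2; have E := lost_inj hf nf sz (family_lost fs (qs i iN)) r1 r2 s1 s2.
    move: E; rewrite !mulc_turn => /eqP; rewrite eq_complex /= => /andP[/eqP E1 /eqP E2].
    have tt0 : t = t' by clear - E1; lra.
    split => //; move: E2; rewrite -tt0 => /(mulfI (lt0r_neq0 t_0)); exact: addrI.
  - move=> i iN; have [di fi ni] := family_lost fs (qs i iN).
    have [E hE] := ray_dichotomy hf nf 1 R1 fi di v0.
    exists E => h h1 hnE; have [[u g]|[t [u [t_0 tt g uR]]]] := hE h h1 hnE tau tau00.
      exists tau, u; split => //; first exact: ltW.
      rewrite leNgt; apply/negP => uR.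
      have tp : 0 < tau by clear - tau0 t00; lra.
      have rv : complex.Re (tau%:C * turn (-1 : R[i]) h) < 0 by rewrite sc oppr_lt0.
      have lu := lost_seg rv (seg_go tp g) (family_lost fs (qs i iN)).
      have := low u lu; rewrite (go_val tau00 g).1 nm_ray Rew mulrN1.
      have [_ hF _] := hs _ (qs i iN).
      rewrite leNgt => /negP; apply.
      apply: (@le_lt_trans _ _ (F * expR (- tau))); first by rewrite ler_wpM2r ?expR_ge0.
      apply: (@lt_le_trans _ _ (expR (F + 1) * expR (- tau))).
        by rewrite ltr_pM2r ?expR_gt0//; have := @expR_ge1Dx R (F + 1); clear - hF; lra.
      rewrite -expRD ler_expR /tau.
      have : C * (1 + nm (u - c)) ^+ n <= C * (1 + nm c + R1) ^+ n.
        have e1 : nm (u - c) <= nm u + nm c by rewrite -(nmN c); exact: nmD.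
        have e2 := nm_ge0 (u - c).
        have e3 : 0 <= 1 + nm (u - c) by clear - e2; lra.
        have e4 : 1 + nm (u - c) <= 1 + nm c + R1 by clear - e1 uR; lra.
        by apply: ler_wpM2l => //; apply: lerXn2r; rewrite ?nnegrE//; exact: le_trans e4.
      by clear; lra.
    exists t, u; split => //; last 1 first.
    - by clear - uR; lra.
    - rewrite leNgt; apply/negP => lt; have := nearq i h t u iN h1 t_0 (ltW lt) g.
      by clear - uR R1R0 R01; lra.
    - exact: ltW.
  rewrite -mulrA -[leRHS]mulrA ler_wpM2l// ler_wpM2r//; clear - X0 b0; lra.
have n0 : 0 <= n%:R :> R by [].
pose X := a + b + 1.
have X1 : 1 <= X by rewrite /X; clear - a0 b0; lra.
have := main X ltac:(clear - X1; lra).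
have h1 : (n%:R * X + a) * (X + b) <= (n%:R + 1) * X * (2 * X).
  apply: ler_pM; rewrite ?addr_ge0 ?mulr_ge0//; try (clear - X1; lra).
    by rewrite mulrDl mul1r lerD2l /X; clear - b0; lra.
  by rewrite /X; clear - a0; lra.
have := ler_wpM2l K0 h1.
have : 2 * K * (n%:R + 1) * X ^+ 2 < N%:R * X ^+ 2.
  by rewrite ltr_pM2r// exprn_gt0//; clear - X1; lra.
rewrite mulrA expr2; clear; lra.
Qed.

End Counting.

(** * A curve along which all lifts descend *)

Section Descents.
Variable R : realType.
Implicit Types (z w u a c d v q p : R[i]) (x y t s r e M S T B b h l : R).
Implicit Types (g k : R -> R).

Definition crv g x : R[i] := cexp (x +i* g x)%C.

Lemma crv_cont g : continuous g -> continuous (crv g).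
Proof.
move=> cg; have -> : crv g = (fun x => cexp (x%:C + (g x)%:C * (0 +i* 1)%C)).
  apply/funext => x; rewrite /crv; congr cexp; apply/eqP; rewrite eq_complex /=.
  by apply/andP; split; apply/eqP; ring.
apply: (fun H => cont_comp H (@cexp_cont R)).
exact: (cont_add (@continuous_RtoC R) (cont_mul (cont_comp cg (@continuous_RtoC R)) (@cont_cst R R[i] _))).
Qed.

Lemma crv_neq0 g x : crv g x != 0.
Proof. exact: cexp_neq0. Qed.

Definition bend g x v t : R := complex.Im v / complex.Re v * (clamp (x + complex.Re v) x t - x) +
  g (Num.max t x) + (g (Num.min t (x + complex.Re v)) - g (x + complex.Re v)).

Lemma bend_cont g x v : continuous g -> continuous (bend g x v).
Proof.
move=> cg; set x1 := x + complex.Re v.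
have c1 : continuous (fun t => complex.Im v / complex.Re v * (clamp x1 x t - x)).
  apply: (contR_mul (@cont_cst R R (complex.Im v / complex.Re v))).
  exact: (contR_add (@cont_clamp R x1 x) (@cont_cst R R (- x))).
have c2 : continuous (fun t => g (Num.max t x)).
  exact: (cont_comp (contR_max (@cont_id R) (@cont_cst R R x)) cg).
have c3 : continuous (fun t => g (Num.min t x1) - g x1).
  exact: (contR_add (cont_comp (contR_min (@cont_id R) (@cont_cst R R x1)) cg) (@cont_cst R R (- g x1))).
exact: (contR_add (contR_add c1 c2) c3).
Qed.

Lemma bend_ge g x v t : complex.Re v < 0 -> x <= t -> bend g x v t = g t.
Proof.
move=> v0 xt; rewrite /bend /clamp.
have xt1 : x + complex.Re v <= x by lra.
have xt2 : x + complex.Re v <= t by lra.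
rewrite (min_idPl xt) (max_idPr xt1) (max_idPl xt) (min_idPr xt2) !subrr mulr0; ring.
Qed.

Lemma bend_le g x v t : complex.Re v < 0 -> t <= x + complex.Re v ->
  bend g x v t = g t + (g x + complex.Im v - g (x + complex.Re v)).
Proof.
move=> v0 xt; rewrite /bend /clamp.
have tx : t <= x by lra.
rewrite (min_idPr tx) (max_idPl xt) (max_idPr tx) (min_idPl xt) addrC.
have -> : x + complex.Re v - x = complex.Re v by ring.
rewrite divfK ?lt_eqF//; ring.
Qed.

Lemma bend_mid g x v t : complex.Re v < 0 -> x + complex.Re v <= t -> t <= x ->
  bend g x v t = g x + (t - x) * (complex.Im v / complex.Re v).
Proof.
move=> v0 xt tx; rewrite /bend /clamp.
by rewrite (min_idPr tx) (max_idPr xt) (max_idPr tx) (min_idPr xt) subrr addr0 addrC mulrC.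
Qed.

Variable f : R[i] -> R[i].
Hypotheses (hf : holo f) (nf : noncst f).

Definition desc g S x z u := reach f (fun t => crv g (S - t)) (S - x) z u.

Lemma desc_trans g S y x z w u : x <= y -> y <= S -> desc g S y z w -> desc g y x w u -> desc g S x z u.
Proof.
move=> xy yS d1 d2; have y0 : 0 <= S - y by lra.
have x0 : 0 <= y - x by lra.
rewrite /desc (_ : S - x = (S - y) + (y - x)); last by ring.
apply: (reach_trans y0 x0 d1); apply: reach_ext d2 => t _; congr crv; ring.
Qed.

Lemma desc_ext g k S x z u : (forall t, x <= t -> t <= S -> g t = k t) -> desc g S x z u -> desc k S x z u.
Proof.
move=> E; apply: reach_ext => t /andP[t0 tS]; rewrite /crv E//; lra.
Qed.

Lemma desc_refl g x z : f z = crv g x -> dz f z != 0 -> desc g x x z z.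
Proof. by move=> fz d0; rewrite /desc subrr; apply: reach0 => //; rewrite subr0. Qed.

Lemma desc_val g S x z u : x <= S -> desc g S x z u -> f u = crv g x /\ dz f u != 0.
Proof.
move=> xS d1; have x0 : 0 <= S - x by lra.
have [-> ?] := reach_val x0 d1; split => //; congr crv; ring.
Qed.

Lemma desc_seg g x z v u : complex.Re v < 0 -> f z = crv g x -> seg f z v u ->
  desc (bend g x v) x (x + complex.Re v) z u.
Proof.
move=> v0 fz gu; pose T := - complex.Re v.
have T0 : 0 < T by rewrite oppr_gt0.
have Ti : 0 < T^-1 by rewrite invr_gt0.
have := @reach_scale R f (ray (f z) v) T^-1 T z u Ti; rewrite mulVf ?gt_eqF// => /(_ gu) rg.
rewrite /desc (_ : x - (x + complex.Re v) = T); last by rewrite /T; ring.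
apply: reach_ext rg => t /andP[t0 tT].
rewrite /ray fz /crv -cexpD; congr cexp.
rewrite bend_mid//; [|by move: tT; rewrite /T; lra|lra].
have vn : complex.Re v != 0 by rewrite lt_eqF.
rewrite /T; case: (v) vn => p q /= pn; apply/eqP; rewrite eq_complex /=.
by apply/andP; split; apply/eqP; field; rewrite ?oppr_eq0.
Qed.

(* Any curve can be followed approximately, by Gross's theorem. *)
Lemma follow g0 S x0 e0 : continuous g0 -> 0 < e0 -> x0 <= S ->
  forall g z e, continuous g -> (exists r, forall t, t <= S -> g t = g0 t + r) ->
  f z = crv g S -> dz f z != 0 -> 0 < e -> exists g' u, [/\ continuous g',
    forall t, S <= t -> g' t = g t, desc g' S x0 z u,
    forall t, `|g' t - g t| <= e0 + e &
    exists2 r, `|r| <= e & forall t, t <= x0 -> g' t = g t + r].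
Proof.
move=> cg0 e00 xS.
pose Q x y := forall g z e, continuous g -> (exists r, forall t, t <= y -> g t = g0 t + r) ->
  f z = crv g y -> dz f z != 0 -> 0 < e -> exists g' u, [/\ continuous g',
    forall t, y <= t -> g' t = g t, desc g' y x z u,
    forall t, `|g' t - g t| <= e0 + e &
    exists2 r, `|r| <= e & forall t, t <= x -> g' t = g t + r].
apply: (@interval_cousin R x0 S Q xS) => [x y s _ xy ys _ Q1 Q2|t0 t0I].
  move=> g z e cg [r hr] fz dz0 ep.
  have e2 : 0 < e / 2 by lra.
  have [g1 [w [cg1 ge1 d1 dev1 [r1 r1e hr1]]]] := Q2 g z (e / 2) cg (ex_intro _ r hr) fz dz0 e2.
  have [fw dw] := desc_val ys d1.
  have [|g2 [u [cg2 ge2 d2 dev2 [r2 r2e hr2]]]] := Q1 g1 w (e / 2) cg1 _ fw dw e2.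
    by exists (r + r1) => t ty; rewrite hr1// hr ?addrA//; exact: le_trans ys.
  exists g2, u; split => //.
  - by move=> t st; rewrite ge2 ?ge1//; exact: le_trans st.
  - apply: (desc_trans xy ys _ d2); apply: desc_ext d1 => t yt _; by rewrite ge2.
  - move=> t; have [yt|ty] := leP y t.
      by rewrite ge2//; have := dev1 t; lra.
    have := dev2 t; rewrite (hr1 t (ltW ty)) => h1.
    have -> : g2 t - g t = (g2 t - (g t + r1)) + r1 by ring.
    by apply: (le_trans (ler_normD _ _)); clear - r1e h1; lra.
  exists (r1 + r2); first by apply: (le_trans (ler_normD _ _)); lra.
  by move=> t tx; rewrite hr2// hr1 ?addrA//; exact: le_trans xy.
have e3 : 0 < e0 / 4 by lra.
have cgc : continuous (fun t => (g0 t)%:C) := cont_comp cg0 (@continuous_RtoC R).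
have /continuous_realP/(_ _ e3)[d d0 hd] := cgc t0.
exists d => // x y _ xt ty _ dx dy g z e cg [r hr] fz dz0 ep.
have osc s t : x <= s <= y -> x <= t <= y -> `|g s - g t| <= e0 / 2.
  move=> /andP[s1 s2] /andP[t1 t2]; rewrite !hr//.
  have hs := hd s ltac:(rewrite ltr_norml; clear - dx dy s1 s2 xt ty; apply/andP; split; lra).
  have ht := hd t ltac:(rewrite ltr_norml; clear - dx dy t1 t2 xt ty; apply/andP; split; lra).
  move: hs ht; rewrite -!rmorphB !nmC => hs ht.
  have -> : g0 s + r - (g0 t + r) = (g0 s - g0 t0) - (g0 t - g0 t0) by ring.
  by apply: (le_trans (ler_normB _ _)); clear - hs ht; lra.
have [xy|xy] := eqVneq x y.
  exists g, z; split => //; first by rewrite xy; exact: desc_refl.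
    by move=> t; rewrite subrr normr0; lra.
  by exists 0; rewrite ?normr0 ?(ltW ep)// => t _; rewrite addr0.
have xly : x < y by rewrite lt_neqAle xy (le_trans xt).
pose v0 : R[i] := ((x - y) +i* (g x - g y))%C.
have v00 : complex.Re v0 < 0 by rewrite /=; clear - xly; lra.
have fz0 : f z != 0 by rewrite fz crv_neq0.
have vn0 : complex.Re v0 != 0 by rewrite lt_eqF.
have ee : - e < e by clear - ep; lra.
have [h [u [/andP[h1 h2] gu]]] := gross hf nf fz0 dz0 vn0 ee.
pose v := turn v0 h.
have vR : complex.Re v = x - y by rewrite Re_turn.
have vI : complex.Im v = g x - g y + h by rewrite Im_turn.
have vn : complex.Re v < 0 by rewrite vR; clear - xly; lra.
have yx : y + complex.Re v = x by rewrite vR; ring.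
have he : `|h| <= e by rewrite ler_norml; clear - h1 h2; lra.
have low t : t <= x -> bend g y v t = g t + h.
  by move=> tx; rewrite bend_le// yx// vI; ring.
exists (bend g y v), u; split.
- exact: bend_cont.
- by move=> t yt; rewrite bend_ge.
- by have := desc_seg vn fz gu; rewrite -/v yx.
- move=> t; have [tx|xt'] := leP t x.
    by rewrite low// addrC addKr; clear - e3 he; lra.
  have [yt|ty'] := leP y t; first by rewrite bend_ge// subrr normr0; clear - e3 ep; lra.
  rewrite (bend_mid _ vn _ (ltW ty')); last by rewrite yx ltW.
  rewrite vI vR.
  have q0 : 0 <= (t - y) / (x - y) <= 1.
    by rewrite -mulrNN -invrN !opprB divr_ge0 ?ler_pdivrMr ?mul1r/= ?subr_ge0 ?subr_gt0 ?ltW//; clear - xt'; lra.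
  have -> : g y + (t - y) * ((g x - g y + h) / (x - y)) - g t =
      (g y - g t) + ((t - y) / (x - y)) * (g x - g y) + ((t - y) / (x - y)) * h.
    by field; rewrite subr_eq0.
  move: q0; set Qr := (t - y) / (x - y) => /andP[q0 q1].
  have xI : x <= x <= y by rewrite lexx ltW.
  have yI : x <= y <= y by rewrite lexx ltW.
  have tI : x <= t <= y by rewrite !ltW.
  have o1 := osc y t yI tI; have o2 := osc x y xI yI.
  have n1 : `|Qr * (g x - g y)| <= e0 / 2 by rewrite normrM ger0_norm//; have := normr_ge0 (g x - g y); clear - q0 q1 o2; nra.
  have n2 : `|Qr * h| <= e by rewrite normrM ger0_norm//; have := normr_ge0 h; clear - q0 q1 he; nra.
  apply: (le_trans (ler_normD _ _)); have := ler_normD (g y - g t) (Qr * (g x - g y)).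
  by clear - o1 n1 n2; lra.
by exists h.
Qed.

Lemma chain g x u : continuous g -> reaches f u -> f u = crv g x -> dz f u != 0 ->
  exists g' x' u', [/\ continuous g', forall t, x <= t -> g' t = g t, x' <= x, desc g' x x' u u' & basin f u'].
Proof.
move=> cg ru; elim: ru g x cg => [{}u bu|z v {}u v0 gu _ IH] g x cg fz dz0.
  by exists g, x, u; split => //; exact: desc_refl.
have d1 := desc_seg v0 fz gu.
have xx : x + complex.Re v <= x by lra.
have [fu du] := desc_val xx d1.
have [g' [x' [u' [cg' ge' xx' d2 bu']]]] := IH _ _ (bend_cont (x := x) (v := v) cg) fu du.
exists g', x', u'; split => //.
- by move=> t xt; rewrite ge' ?bend_ge//; exact: le_trans xt.
- exact: le_trans xx.
apply: (desc_trans xx' xx _ d2); apply: desc_ext d1 => t xt _; by rewrite ge'.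
Qed.

Lemma basin_open u : basin f u -> exists2 e, 0 < e & forall u', nm (u' - u) < e -> basin f u'.
Proof.
move=> [z0 [r [M [gd fz ur fu]]]].
have k0 : 0 < r / (4 * M) - nm (f u) by rewrite subr_gt0.
have /continuous_epsP/(_ _ k0)[d d0 hd] := @holo_cont R f hf u.
exists (Num.min d (r - nm (u - z0))); first by rewrite lt_min d0 subr_gt0.
move=> u'; rewrite lt_min => /andP[h1 h2]; exists z0, r, M; split => //.
  by have := nm_sub_trans u u' z0; lra.
by have := hd u' h1; have := nmDB (f u') (f u); lra.
Qed.

Lemma crv_close : exists2 e1 : R, 0 < e1 & forall g k x, `|g x - k x| < e1 ->
  nm (crv g x - crv k x) <= 2 * `|g x - k x| * expR x.
Proof.
have [e1 e10 he] := @cexp_near0 R; exists e1 => // g k x gk.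
pose d : R[i] := (0 +i* (g x - k x))%C.
have dn : nm d = `|g x - k x| by rewrite nmE /= expr0n /= add0r sqrtr_sqr.
have -> : crv g x - crv k x = crv k x * (cexp d - 1).
  rewrite mulrBr mulr1 /crv -cexpD; congr (cexp _ - _); apply/eqP; rewrite eq_complex /=.
  by apply/andP; split; apply/eqP; ring.
have [|h1 _] := he d; first by rewrite dn.
by rewrite nmM nm_cexp /= mulrC ler_wpM2r ?expR_ge0// -dn.
Qed.

Lemma stable g S x z u e : continuous g -> x <= S -> desc g S x z u -> basin f u -> 0 < e ->
  exists2 d, 0 < d & forall k, continuous k -> (forall t, x <= t -> t <= S -> `|k t - g t| <= d) ->
    exists z' u', [/\ nm (z' - z) < e, desc k S x z' u' & basin f u'].
Proof.
move=> cg xS [Z [lZ Z0 Z1]] bu e0.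
have [e1 e10 he1] := basin_open bu.
have S0 : 0 <= S - x by lra.
have [r0 [M gd0]] := lift_good hf S0 lZ.
have [r00 M0 _ _] := gd0 0 ltac:(by rewrite lexx).
pose r := Num.min r0 (Num.min e e1).
have rp : 0 < r by rewrite !lt_min r00 e0 e10.
have [rr0 re re1] : [/\ r <= r0, r <= e & r <= e1] by split; rewrite !ge_min lexx ?orbT.
clearbody r.
have gd t : 0 <= t <= S - x -> good f (Z t) r M by move=> /gd0 G; exact: (good_mono G).
have k0 : 0 < r / (4 * M) by rewrite divr_gt0// mulr_gt0.
have [e2 e20 he2] := crv_close.
pose d := Num.min (e2 / 2) (r / (4 * M) / (8 * expR S)).
have d0 : 0 < d by rewrite lt_min; apply/andP; split; apply: divr_gt0 => //; rewrite mulr_gt0 ?expR_gt0.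
have [d1 d2] : d <= e2 / 2 /\ d * (8 * expR S) <= r / (4 * M).
  by rewrite -ler_pdivlMr ?mulr_gt0 ?expR_gt0// !ge_min !lexx orbT.
clearbody d; exists d => // k ck kg.
have cW : continuous (fun t => crv k (S - t)).
  have -> : (fun t => crv k (S - t)) = (fun t => crv k (-1 * t + S)).
    by apply/funext => t; congr crv; ring.
  exact: (cont_comp (@contR_affine R (-1) S) (crv_cont ck)).
have [|Z1' lZ' hZ'] := lift_perturb hf nf lZ.1 S0 gd cW.
  move=> t tI; have [-> _] := lZ.2 t tI; have /andP[t0 tS] := tI.
  have kgt : `|k (S - t) - g (S - t)| <= d by apply: kg; clear - tI; lra.
  apply: (le_lt_trans (he2 _ _ _ _)); first by clear - d0 d1 kgt; lra.
  apply: lt_le_trans d2; have eS : expR (S - t) <= expR S by rewrite ler_expR; lra.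
  have := expR_gt0 (S - t); have := normr_ge0 (k (S - t) - g (S - t)); clear - d0 kgt eS; nra.
have I0 : 0 <= (0:R) <= S - x by rewrite lexx.
have I1 : 0 <= S - x <= S - x by rewrite lexx S0.
exists (Z1' 0), (Z1' (S - x)); split.
- by rewrite -Z0; have := hZ' 0 I0; clear - rp re; lra.
- by exists Z1'.
- by apply: he1; rewrite -Z1; have := hZ' _ I1; clear - rp re1; lra.
Qed.

End Descents.

Section GoodCurve.
Variable R : realType.
Implicit Types (z w u a c d v q p : R[i]) (x y t s r e M S T B b h l : R).
Implicit Types (g k : R -> R).
Variable f : R[i] -> R[i].
Hypotheses (hf : holo f) (nf : noncst f).

Lemma desc_start g S x z u : x <= S -> desc f g S x z u -> f z = crv g S /\ dz f z != 0.
Proof.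
move=> xS [Z [[_ hZ] <- _]]; have [|-> ?] := hZ 0; first by rewrite lexx subr_ge0.
by rewrite subr0.
Qed.

Record stage := Stage { path :> R -> R; low : R; tol : R; path_cont : continuous path; tol_gt0 : 0 < tol }.
Implicit Types P : stage.

Definition serves c r x g := forall M z, good f c r M -> nm (z - c) < r -> f z = crv g x ->
  exists y u, [/\ y <= x, desc f g x y z u & basin f u].

Definition refines P c r x P' := [/\ forall t, low P <= t -> `|P' t - P t| <= tol P / 2,
  low P' <= low P - 1, tol P' <= tol P / 2 &
  forall k, continuous k -> (forall t, low P' <= t -> `|k t - P' t| <= tol P') -> serves c r x k].

Lemma refine (reach : forall z, dz f z != 0 -> f z != 0 -> reaches f z) P c r x :
  exists P', refines P c r x P'.
Proof.
have e0 := tol_gt0 P; set e := tol P in e0.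
have e4 : 0 < e / 4 by lra.
have same t : `|P t - P t| <= e / 2 by rewrite subrr normr0; lra.
have [[M gM]|nM] := pselect (exists M, good f c r M); last first.
  have e2 : 0 < e / 2 by lra.
  exists (Stage (low P - 1) (@path_cont P) e2); split => //=.
  by move=> k _ _ M z gM; case: nM; exists M.
have [[l [z [le zc fz]]]|nz] := pselect (exists l z, [/\ `|l| <= e / 4, nm (z - c) < r &
    f z = crv (fun t => P t + l) x]); last first.
  exists (Stage (Num.min x (low P - 1)) (@path_cont P) e4); split => //=.
  - by rewrite ge_min lexx orbT.
  - by rewrite -/e; lra.
  move=> k ck hk M' z _ zc fz; case: nz; exists (k x - P x), z; split => //.
    by apply: hk; rewrite ge_min lexx.
  by rewrite fz /crv (addrC (P x)) subrK.
have [r0 M0 gd inj] := gM.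
pose g1 t := P t + l; have cg1 : continuous g1 := contR_add (@path_cont P) (@cont_cst R R l).
pose x1 := Num.min (low P) x.
have x1x : x1 <= x by rewrite ge_min lexx orbT.
have x1l : x1 <= low P by rewrite ge_min lexx.
have e16 : 0 < e / 16 by lra.
have dz0 := gd z zc.
have [|g2 [u1 [cg2 ge2 d1 dev _]]] := follow hf nf cg1 e16 x1x cg1 _ fz dz0 e16.
  by exists 0 => t _; rewrite addr0.
have [fu1 du1] := desc_val x1x d1.
have ru1 : reaches f u1 by apply: reach => //; rewrite fu1 crv_neq0.
have [g3 [x2 [u2 [cg3 ge3 x21 d2 bu2]]]] := chain cg2 ru1 fu1 du1.
have d3 : desc f g3 x x2 z u2.
  by apply: (desc_trans x21 x1x _ d2); apply: desc_ext d1 => t xt _; rewrite ge3.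
have rz : 0 < r - nm (z - c) by rewrite subr_gt0.
have x2x := le_trans x21 x1x.
have [d d0 hd] := stable hf nf cg3 x2x d3 bu2 rz.
have m0 : 0 < Num.min d (e / 2) by rewrite lt_min d0; clear - e16; lra.
exists (Stage (Num.min x2 (low P - 1)) cg3 m0); split => /=.
- move=> t tl; rewrite ge3; last exact: le_trans tl.
  have := dev t; rewrite /g1 -/e => h1.
  have -> : g2 t - P t = (g2 t - (P t + l)) + l by ring.
  by apply: (le_trans (ler_normD _ _)); clear - e4 le h1; lra.
- by rewrite ge_min lexx orbT.
- by rewrite ge_min lexx orbT.
move=> k ck hk M' z' gM' z'c fz'.
have [|z3 [u3 [z3z d4 bu3]]] := hd k ck.
  move=> t xt _; apply: (le_trans (hk t _)); last by rewrite ge_min lexx.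
  by rewrite ge_min xt.
suff -> : z' = z3 by exists x2, u3.
have z3c : nm (z3 - c) < r by have := nm_sub_trans z z3 c; clear - z3z; lra.
have := inj z' z3 z'c z3c; rewrite (desc_start x2x d4).1 fz' subrr nm0 mulr0 => h1.
by apply/eqP; rewrite -subr_eq0 -nm_eq0 eq_le h1 nm_ge0.
Qed.

Lemma good_curve (c : nat -> R[i]) (r x : nat -> R) :
  (forall z, dz f z != 0 -> f z != 0 -> reaches f z) ->
  exists2 g, continuous g & forall n, serves (c n) (r n) (x n) g.
Proof.
move=> reach.
pose nxt n P := projT1 (cid (refine reach P (c n) (r n) (x n))).
have hn n P : refines P (c n) (r n) (x n) (nxt n P) by rewrite /nxt; case: cid.
pose P0 := Stage 0 (@cont_cst R R 0) (@ltr01 R).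
pose fix P n := if n is n'.+1 then nxt n' (P n') else P0.
have step n : refines (P n) (c n) (r n) (x n) (P n.+1) := hn n (P n).
clearbody nxt.
have low_n n : low (P n) <= - n%:R.
  elim: n => [|n IH]; first by rewrite /= oppr0.
  by have [_ h _ _] := step n; rewrite -natr1; lra.
have tol_n n : tol (P n) <= 1 / 2 ^+ n.
  elim: n => [|n IH]; first by rewrite /= expr0 divr1.
  have [_ _ h _] := step n; rewrite exprS.
  have -> : 1 / (2 * 2 ^+ n) = 1 / 2 ^+ n / 2 :> R by field.
  lra.
have close n m t : low (P n) <= t -> `|P (n + m)%N t - P n t| <= tol (P n).
  elim: m n => [|m IH] n lt; first by rewrite addn0 subrr normr0 ltW// tol_gt0.
  have [h1 h2 h3 _] := step n.
  have lt' : low (P n.+1) <= t by lra.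
  have := IH n.+1 lt'; rewrite addSnnS => h4; have h5 := h1 t lt.
  have -> : P (n + m.+1)%N t - P n t = (P (n + m.+1)%N t - P n.+1 t) + (P n.+1 t - P n t) by ring.
  by apply: (le_trans (ler_normD _ _)); lra.
have close' n m t : (n <= m)%N -> low (P n) <= t -> `|P m t - P n t| <= tol (P n).
  by move=> nm; rewrite -(subnKC nm); exact: close.
have far t e : 0 < e -> exists n, low (P n) < t /\ tol (P n) < e.
  move=> e0; have [n2 hn2] := expn2_small e0.
  pose n1 := Num.bound `|t|; have hn1 : `|t| < n1%:R := archi_boundP (normr_ge0 t).
  clearbody n1; exists (maxn n1 n2); split.
    apply: (le_lt_trans (low_n _)); have : n1%:R <= (maxn n1 n2)%:R :> R by rewrite ler_nat leq_maxl.
    by move: hn1; rewrite ltr_norml; lra.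
  apply: (le_lt_trans (tol_n _)); apply: le_lt_trans hn2.
  by rewrite ler_pM2l// lef_pV2 ?posrE ?exprn_gt0// ler_weXn2l ?leq_maxr//; lra.
pose A t := [set y | exists2 n, low (P n) <= t & y = P n t - tol (P n)].
pose g t := sup (A t).
have gP n t : low (P n) <= t -> `|g t - P n t| <= tol (P n).
  move=> lt.
  have ub n' : low (P n') <= t -> ubound (A t) (P n' t + tol (P n')).
    move=> lt' _ [m lm ->]; have [h|h] := leqP n' m.
      have := close' n' m t h lt'; have := tol_gt0 (P m); rewrite ler_norml; lra.
    have := close' m n' t (ltnW h) lm; have := tol_gt0 (P n'); rewrite ler_norml; lra.
  have hs : has_sup (A t) by split; [exists (P n t - tol (P n)), n|exists (P n t + tol (P n)); exact: ub].
  have h1 : P n t - tol (P n) <= g t by apply: (ub_le_sup hs.2); exists n.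
  have h2 : g t <= P n t + tol (P n) by apply: ge_sup; [exact: hs.1|exact: ub].
  by rewrite ler_norml; apply/andP; split; lra.
have cg : continuous g.
  have cgc : continuous (fun t => (g t)%:C).
    move=> t0; apply/continuous_realP => e e0.
    have [n [nt ne]] := far t0 (e / 4) ltac:(lra).
    have cPc : continuous (fun t => (P n t)%:C) := cont_comp (@path_cont (P n)) (@continuous_RtoC R).
    have e4 : 0 < e / 4 by lra.
    have /continuous_realP/(_ _ e4)[d d0 hd] := cPc t0.
    exists (Num.min d (t0 - low (P n))); first by rewrite lt_min d0 subr_gt0.
    move=> t; rewrite lt_min => /andP[td tl].
    have lt : low (P n) <= t by move: tl; rewrite ltr_norml; lra.
    have := hd t td; rewrite -!rmorphB !nmC => h1.
    have h2 := gP n t lt; have h3 := gP n t0 (ltW nt).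
    have -> : g t - g t0 = (g t - P n t) + (P n t - P n t0) - (g t0 - P n t0) by ring.
    apply: (le_lt_trans (ler_normB _ _)).
    have := ler_normD (g t - P n t) (P n t - P n t0); clear - ne e4 h1 h2 h3; lra.
  exact: (cont_comp cgc (@continuous_Re R)).
exists g => // n; have [_ _ _] := step n; apply => // t; exact: gP.
Qed.

Lemma rat_near x e : 0 < e -> exists y : rat, x - e < ratr y < x.
Proof.
move=> e0; have lt : x - e < x by lra.
by have [y] := rat_in_itvoo lt; rewrite in_itv /=; exists y.
Qed.

Theorem descending_curve : (forall z, dz f z != 0 -> f z != 0 -> reaches f z) ->
  exists2 g, continuous g & forall z x, f z = crv g x -> dz f z != 0 ->
    exists y u, [/\ y <= x, desc f g x y z u & basin f u].
Proof.
move=> reach.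
pose dec n : rat * rat * nat * rat := odflt (0, 0, 0%N, 0) (unpickle n).
pose cc n : R[i] := (ratr (dec n).1.1.1 +i* ratr (dec n).1.1.2)%C.
pose rr n : R := 1 / 2 ^+ (dec n).1.2.
have [g cg hg] := good_curve cc rr (fun n => ratr (dec n).2) reach.
exists g => // z x fz dz0.
have [r [M gM]] := good_exists hf dz0; have [r0 M0 gd inj] := gM.
have r2 : 0 < r / 2 by lra.
have [m hm] := expn2_small r2.
set rho := 1 / 2 ^+ m in hm; have rho0 : 0 < rho by rewrite divr_gt0// exprn_gt0.
have rho4 : 0 < rho / 4 by lra.
have [a /andP[a1 a2]] := rat_near (complex.Re z) rho4.
have [b /andP[b1 b2]] := rat_near (complex.Im z) rho4.
pose c : R[i] := (ratr a +i* ratr b)%C.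
have zc : nm (z - c) < rho / 2.
  apply: (le_lt_trans (nm_le_ReIm _)); rewrite /c; case: (z) a1 a2 b1 b2 => p q /= a1 a2 b1 b2.
  by rewrite !ger0_norm; clear - a1 a2 b1 b2; lra.
have gc : good f c rho M.
  split => // [w wc|w w' wc w'c]; first by apply: gd; have := nm_sub_trans c w z; rewrite (nmB c); lra.
  by apply: inj; [have := nm_sub_trans c w z|have := nm_sub_trans c w' z]; rewrite (nmB c z); lra.
have rho2 : 0 < rho / 2 by clear - b1 b2; lra.
have gz : good f z (rho / 2) M by apply: (good_mono gM) => //; clear - r2 hm; lra.
have k0 : 0 < rho / 2 / (4 * M) by rewrite divr_gt0// mulr_gt0.
have cc' := crv_cont cg.
have /continuous_realP/(_ _ k0)[d d0 hd] := cc' x.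
have [xi /andP[xi1 xi2]] := rat_near x d0.
have S0 : 0 <= x - ratr xi by clear - xi2; lra.
have cW : continuous (fun t => crv g (x - t)).
  have -> : (fun t => crv g (x - t)) = (fun t => crv g (-1 * t + x)).
    by apply/funext => t; congr crv; ring.
  exact: (cont_comp (@contR_affine R (-1) x) (crv_cont cg)).
have [|Z lZ hZ] := lift_perturb hf nf (@cont_cst R R[i] z) S0 (fun _ _ => gz) cW.
  by move=> t /andP[t0 tx]; rewrite fz; apply: hd; rewrite ltr_norml; lra.
have I0 : 0 <= (0:R) <= x - ratr xi by rewrite lexx.
have I1 : 0 <= x - ratr xi <= x - ratr xi by rewrite lexx S0.
have Z0 : Z 0 = z.
  have [_ _ _ inj'] := gz; have h0 := hZ 0 I0.
  have := inj' (Z 0) z; rewrite subrr nm0 (lZ.2 0 I0).1 subr0 fz subrr nm0 mulr0 => h1.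
  have := h1 ltac:(clear - rho2 h0; lra) rho2 => h2.
  by apply/eqP; rewrite -subr_eq0 -nm_eq0 eq_le h2 nm_ge0.
have d1 : desc f g x (ratr xi) z (Z (x - ratr xi)).
  by exists Z; split; [exact: lZ|exact: Z0|reflexivity].
have [fw dw] := desc_val (ltW xi2) d1.
have wc : nm (Z (x - ratr xi) - c) < rho.
  by have := hZ _ I1; have := nm_sub_trans z (Z (x - ratr xi)) c; clear - zc rho2; lra.
have decE : dec (pickle (a, b, m, xi)) = (a, b, m, xi) by rewrite /dec pickleK.
have := hg (pickle (a, b, m, xi)); rewrite /cc /rr decE /= -/c -/rho => sv.
have [y [u [yx d2 bu]]] := sv M _ gc wc fw.
exists y, u; split => //; first exact: le_trans (ltW xi2).
exact: (desc_trans yx (ltW xi2) d1 d2).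
Qed.

End GoodCurve.

(** * The slit plane and its preimage *)

Section SlitPlane.
Variable R : realType.
Implicit Types (z w u a c d v q p : R[i]) (x y t s r e M S T B b h l th : R).
Variable g : R -> R.
Hypothesis cg : continuous g.

Definition pt x th : R[i] := cexp (x +i* (g x + th))%C.

Definition slit_plane : set R[i] := [set w | exists x th, [/\ 0 < th, th < 2 * pi & w = pt x th]].

Lemma pt0 x : pt x 0 = crv g x.
Proof. by rewrite /pt addr0. Qed.

Lemma nm_pt x th : nm (pt x th) = expR x.
Proof. by rewrite nm_cexp. Qed.

Lemma pt_per x th : pt x (th + 2 * pi) = pt x th.
Proof.
rewrite /pt -[RHS]mulr1 -(@cexp_per1 R) -cexpD; congr cexp; apply/eqP; rewrite eq_complex.
rewrite (raddfD (@complex.Re R)) (raddfD (@complex.Im R)) /= addr0 eqxx /=; apply/eqP.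
by rewrite mulr1; ring.
Qed.

Lemma pt_inj x th x' th' : pt x th = pt x' th' -> x = x' /\ exists k : int, th = th' + 2 * pi * k%:~R.
Proof.
move=> /cexp_inj_mod[k /eqP]; rewrite eq_complex (raddfD (@complex.Re R)) (raddfD (@complex.Im R)) /=.
rewrite addr0 => /andP[/eqP E1 /eqP E2]; split => //; exists k; move: E2; rewrite E1; lra.
Qed.

Lemma crv_notin x : ~ slit_plane (crv g x).
Proof.
move=> [y [th [t0 t1]]]; rewrite -pt0 => /pt_inj[_ [k]]; have p2 := pi2_gt0 R => E.
have k0 : (0:R) < - k%:~R by rewrite -(pmulr_rgt0 _ p2); lra.
have k1 : - k%:~R < (1:R) by rewrite -(ltr_pM2l p2); lra.
move: k0 k1; rewrite -rmorphN -[1]/(1%:~R) -[0]/(0%:~R) !ltr_int; lia.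
Qed.

Lemma pt_slit x th : th != 0 -> `|th| < 2 * pi -> slit_plane (pt x th).
Proof.
move=> t0; rewrite ltr_norml => /andP[t1 t2]; have [lt|gt|E] := ltgtP th 0; last by rewrite E eqxx in t0.
  by exists x, (th + 2 * pi); rewrite pt_per; split => //; lra.
by exists x, th.
Qed.

Lemma slit_plane0 : ~ slit_plane 0.
Proof. by move=> [x [th [_ _ /esym/eqP]]]; rewrite (negbTE (cexp_neq0 _)). Qed.

Lemma slit_plane_cover w : w != 0 -> slit_plane w \/ exists x, w = crv g x.
Proof.
move=> /cexp_surj[l hl]; have p2 := pi2_gt0 R.
pose y := complex.Im l - g (complex.Re l); pose k := Num.floor (y / (2 * pi)).
have /andP[k1 k2] : k%:~R <= y / (2 * pi) < (k + 1)%:~R by apply: floor_itv; exact: num_real.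
pose th := y - 2 * pi * k%:~R.
have wE : w = pt (complex.Re l) th.
  rewrite -hl -[LHS]mulr1 -(cexp_per R (- k)) -cexpD /pt; congr cexp.
  have k' : (- k)%:~R = - k%:~R :> R by rewrite rmorphN.
  apply/eqP; rewrite eq_complex (raddfD (@complex.Re R)) (raddfD (@complex.Im R)) /per /= addr0 eqxx /= k'.
  by apply/eqP; rewrite /th /y; ring.
have t0 : 0 <= th by rewrite subr_ge0 mulrC -ler_pdivlMr.
have t1 : th < 2 * pi.
  move: k2; rewrite ltr_pdivrMr// rmorphD /= mulrDl mul1r /th; lra.
have [E|tn] := eqVneq th 0; first by right; exists (complex.Re l); rewrite wE E pt0.
by left; exists (complex.Re l), th; split => //; rewrite lt_neqAle eq_sym tn.
Qed.

Lemma pt_cont (T : topologicalType) (p q : T -> R) : continuous p -> continuous q -> continuous (fun t : T => pt (p t) (q t)).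
Proof.
move=> cp cq.
have -> : (fun t : T => pt (p t) (q t)) = (fun t : T => cexp ((p t)%:C + (g (p t) + q t)%:C * (0 +i* 1)%C)).
  apply/funext => t; rewrite /pt; congr cexp; apply/eqP; rewrite eq_complex /=.
  by apply/andP; split; apply/eqP; ring.
apply: (fun H => cont_comp H (@cexp_cont R)).
apply: (cont_add (cont_comp cp (@continuous_RtoC R))).
exact: (cont_mul (cont_comp (contR_add (cont_comp cp cg) cq) (@continuous_RtoC R)) (@cont_cst T R[i] _)).
Qed.

Lemma slit_path w w' : slit_plane w -> slit_plane w' -> exists W : R -> R[i],
  [/\ continuous W, W 0 = w, W 1 = w' & forall t, 0 <= t <= 1 -> slit_plane (W t) /\
    nm (W t) <= Num.max (nm w) (nm w')].
Proof.
move=> [x [th [t0 t1 ->]]] [x' [th' [t'0 t'1 ->]]].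
have aff (y s : R) : continuous (fun t : R => y + t * (s - y)).
  exact: (contR_add (@cont_cst R R y) (contR_mul (@cont_id R) (@cont_cst R R (s - y)))).
exists (fun t => pt (x + t * (x' - x)) (th + t * (th' - th))); split.
- exact: pt_cont.
- by rewrite !mul0r !addr0.
- by rewrite !mul1r !(addrC _ (_ - _)) !subrK.
move=> t /andP[t_0 t_1]; split.
  have p2 := pi2_gt0 R; exists (x + t * (x' - x)), (th + t * (th' - th)).
  have co (p q r : R) : p < q -> p < r -> p < q + t * (r - q).
    move=> pq pr; have -> : q + t * (r - q) = p + ((1 - t) * (q - p) + t * (r - p)) by ring.
    have a1 : 0 <= t * (r - p) by rewrite mulr_ge0// subr_ge0 ltW.
    have [->|t1'] := eqVneq t 1; first by rewrite subrr mul0r mul1r; clear - pr; lra.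
    have : 0 < (1 - t) * (q - p) by rewrite mulr_gt0// subr_gt0// lt_neqAle t1'.
    by clear - a1; lra.
  split => //; first exact: co.
  by have := co (- (2 * pi)) (- th) (- th') ltac:(lra) ltac:(lra); lra.
rewrite !nm_pt le_max !ler_expR; have [xx|/ltW xx] := leP x x'; apply/orP; [right|left].
  by clear - xx t_0 t_1; nra.
by clear - xx t_0 t_1; nra.
Qed.

Lemma pt_near x th e : 0 < e -> exists2 b, 0 < b & forall w, nm (w - pt x th) < b ->
  exists s t, [/\ w = pt s t, `|s - x| < e & `|t - th| < e].
Proof.
move=> e0; have [e1 e10 he1] := @cexp_onto1 R.
have cgc : continuous (fun t => (g t)%:C) := cont_comp cg (@continuous_RtoC R).
have e2 : 0 < e / 2 by lra.
have /continuous_realP/(_ _ e2)[d d0 hd] := cgc x.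
pose m := Num.min e1 (Num.min (d / 2) (e / 4)).
have m0 : 0 < m by rewrite !lt_min e10 !divr_gt0.
have [m1 m2 m3] : [/\ m <= e1, m <= d / 2 & m <= e / 4] by split; rewrite !ge_min lexx ?orbT.
clearbody m; have p0 : pt x th != 0 := cexp_neq0 _.
have P0 : 0 < nm (pt x th) by rewrite nm_gt0.
exists (m * nm (pt x th)); first by rewrite mulr_gt0.
move=> w hw.
have ratio : nm (w / pt x th - 1) < m.
  have -> : w / pt x th - 1 = (w - pt x th) / pt x th by field.
  by rewrite nmM nmV ltr_pdivrMr.
have [|a aE an] := he1 (w / pt x th); first by lra.
have aR := le_trans (Re_le_nm a) an; have aI := le_trans (Im_le_nm a) an.
exists (x + complex.Re a), (g x + th + complex.Im a - g (x + complex.Re a)).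
have ga : `|g (x + complex.Re a) - g x| < e / 2.
  by have := hd (x + complex.Re a); rewrite -rmorphB nmC addrC addKr; apply; clear - m2 ratio aR; lra.
split.
- have -> : w = pt x th * cexp a by rewrite aE mulrC divfK.
  rewrite /pt -cexpD; congr cexp; case: (a) => a1 a2; apply/eqP; rewrite eq_complex /=.
  by apply/andP; split; apply/eqP; ring.
- by rewrite addrC addKr; clear - m0 m3 ratio aR; lra.
have -> : g x + th + complex.Im a - g (x + complex.Re a) - th =
  complex.Im a - (g (x + complex.Re a) - g x) by ring.
by apply: (le_lt_trans (ler_normB _ _)); clear - m3 ratio aI ga; lra.
Qed.

Lemma slit_plane_dense w e : 0 < e -> exists2 w', slit_plane w' & nm (w' - w) < e.
Proof.
move=> e0; have p2 := pi_ge2 R.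
have [->|w0] := eqVneq w 0.
  exists (pt (ln (e / 2)) 1); first by apply: pt_slit; rewrite ?oner_eq0// normr1; lra.
  by rewrite subr0 nm_pt lnK ?posrE; lra.
have [h|[x ->]] := slit_plane_cover w0; first by exists w => //; rewrite subrr nm0.
have c1 : continuous (fun t => pt x t) := pt_cont (@cont_cst R R x) (@cont_id R).
have /continuous_realP/(_ _ e0)[d d0 hd] := c1 0.
have [t [t0 td t1]] : exists t, [/\ 0 < t, t < d & t < 1].
  exists (Num.min (d / 2) (1 / 2)); rewrite lt_min !gt_min !divr_gt0//=.
  by split => //; apply/orP; [left|right]; lra.
exists (pt x t); first by exists x, t; split => //; lra.
by rewrite -pt0; apply: hd; rewrite subr0 gtr0_norm.
Qed.

End SlitPlane.

Section Clopen.
Variable R : realType.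
Implicit Types (z w u a c d v q p : R[i]) (x y t s r e M S T b h l th : R).
Implicit Types (A B U : set R[i]).

Definition rel_open A B := forall z, B z -> exists2 e : R, 0 < e & forall u, A u -> nm (u - z) < e -> B u.

Definition rel_closed A B := forall z, A z -> ~ B z -> exists2 e : R, 0 < e &
  forall u, A u -> nm (u - z) < e -> ~ B u.

Lemma connected_eps A : (forall B, (forall z, B z -> A z) -> rel_open A B -> rel_closed A B ->
  forall z0, B z0 -> forall z, A z -> B z) -> connected A.
Proof.
move=> H B [z0 Bz0] [C oC BC] [K cK BK].
have BA z : B z -> A z by rewrite BC => -[].
apply/seteqP; split => // z Az; apply: (H B BA _ _ z0 Bz0 z Az).
  move=> u; rewrite BC => -[_ Cu]; have /nbhs_nm[e e0 he] : nbhs u C by exact: open_nbhs_nbhs.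
  by exists e => // u' Au' uu; split => //; exact: he.
move=> u Au nB; have oK : open (~` K) by exact: closed_openC.
have Ku : (~` K) u by move=> Ku; apply: nB; rewrite BK.
have /nbhs_nm[e e0 he] : nbhs u (~` K) by exact: open_nbhs_nbhs.
by exists e => // u' Au' uu; rewrite BK => -[_]; exact: he.
Qed.

Lemma path_same A B (Z : R -> R[i]) : rel_open A B -> rel_closed A B -> continuous Z ->
  (forall t, 0 <= t <= 1 -> A (Z t)) -> (B (Z 0) <-> B (Z 1)).
Proof.
move=> oB cB cZ AZ; pose Q x y := B (Z x) <-> B (Z y).
apply: (@interval_cousin R 0 1 Q ler01) => [x y z _ _ _ _ h1 h2|t tI]; first exact: iff_trans h1 h2.
have [Bt|nB] := pselect (B (Z t)).
  have [e e0 he] := oB _ Bt; have /continuous_realP/(_ _ e0)[d d0 hd] := cZ t.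
  exists d => // x y x0 xt ty y1 dx dy.
  have nr s : 0 <= s <= 1 -> `|s - t| < d -> B (Z s).
    by move=> sI st; apply: he; [exact: AZ|exact: hd].
  by split => _; apply: nr; rewrite ?ltr_norml; clear - x0 xt ty y1 dx dy; lra.
have [e e0 he] := cB _ (AZ t tI) nB; have /continuous_realP/(_ _ e0)[d d0 hd] := cZ t.
exists d => // x y x0 xt ty y1 dx dy.
have nr s : 0 <= s <= 1 -> `|s - t| < d -> ~ B (Z s).
  by move=> sI st; apply: he; [exact: AZ|exact: hd].
have nx : ~ B (Z x) by apply: nr; rewrite ?ltr_norml; lra.
have ny : ~ B (Z y) by apply: nr; rewrite ?ltr_norml; clear - x0 xt ty y1 dy; lra.
by split.
Qed.

Definition full A B z := exists2 e : R, 0 < e & forall u, A u -> nm (u - z) < e -> B u.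

Definition void A B z := exists2 e : R, 0 < e & forall u, A u -> nm (u - z) < e -> ~ B u.

Definition pure A B z := full A B z \/ void A B z.

Lemma full_open A B z : full A B z -> exists2 e : R, 0 < e & forall u, nm (u - z) < e -> full A B u.
Proof.
move=> [e e0 he]; have e2 : 0 < e / 2 by lra.
exists (e / 2) => // u uz; exists (e / 2) => // u' Au' uu; apply: he => //.
by have := nm_sub_trans u u' z; lra.
Qed.

Lemma void_open A B z : void A B z -> exists2 e : R, 0 < e & forall u, nm (u - z) < e -> void A B u.
Proof.
move=> [e e0 he]; have e2 : 0 < e / 2 by lra.
exists (e / 2) => // u uz; exists (e / 2) => // u' Au' uu; apply: he => //.
by have := nm_sub_trans u u' z; lra.
Qed.

Definition dense_in A := forall z e, 0 < e -> exists2 u, A u & nm (u - z) < e.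

Lemma full_void A B z : dense_in A -> full A B z -> void A B z -> False.
Proof.
move=> dA [e e0 he] [e' e'0 he'].
have m0 : 0 < Num.min e e' by rewrite lt_min e0.
have [u Au] := dA z _ m0; rewrite lt_min => /andP[u1 u2].
exact: he' Au u2 (he u Au u1).
Qed.

Lemma pure_path A B (Z : R -> R[i]) : dense_in A -> continuous Z ->
  (forall t, 0 <= t <= 1 -> pure A B (Z t)) -> (full A B (Z 0) <-> full A B (Z 1)).
Proof.
move=> dA cZ pZ; pose Q x y := full A B (Z x) <-> full A B (Z y).
apply: (@interval_cousin R 0 1 Q ler01) => [x y z _ _ _ _ h1 h2|t tI]; first exact: iff_trans h1 h2.
have [/full_open[e e0 he]|/void_open[e e0 he]] := pZ t tI;
    have /continuous_realP/(_ _ e0)[d d0 hd] := cZ t; exists d => // x y x0 xt ty y1 dx dy.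
  have nr s : `|s - t| < d -> full A B (Z s) by move=> st; apply: he; exact: hd.
  by split => _; apply: nr; rewrite ltr_norml; lra.
have nr s : `|s - t| < d -> ~ full A B (Z s).
  by move=> st F; apply: (full_void dA F); apply: he; exact: hd.
have nx : ~ full A B (Z x) by apply: nr; rewrite ltr_norml; lra.
have ny : ~ full A B (Z y) by apply: nr; rewrite ltr_norml; lra.
by split.
Qed.

Lemma pure_punctured A B z e : dense_in A -> rel_open A B -> 0 < e ->
  (forall u, u != z -> nm (u - z) < e -> pure A B u) ->
  forall u u', A u -> A u' -> u != z -> u' != z -> nm (u - z) < e -> nm (u' - z) < e -> B u -> B u'.
Proof.
move=> dA oB e0 pz u u' Au Au' uz u'z ue u'e Bu.
have [a ha] : exists a, cexp a = u - z by apply: cexp_surj; rewrite subr_eq0.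
have [a' ha'] : exists a', cexp a' = u' - z by apply: cexp_surj; rewrite subr_eq0.
pose Z t := z + cexp (a + t%:C * (a' - a)).
have cZ : continuous Z.
  apply: (cont_add (@cont_cst R R[i] z)); apply: (fun H => cont_comp H (@cexp_cont R)).
  exact: (cont_add (@cont_cst R R[i] a) (cont_mul (@continuous_RtoC R) (@cont_cst R R[i] (a' - a)))).
have Z0 : Z 0 = u by rewrite /Z rmorph0 mul0r addr0 ha addrC subrK.
have Z1 : Z 1 = u' by rewrite /Z rmorph1 mul1r (addrC a) subrK ha' addrC subrK.
have ra : expR (complex.Re a) < e by rewrite -nm_cexp ha.
have ra' : expR (complex.Re a') < e by rewrite -nm_cexp ha'.
have pZ t : 0 <= t <= 1 -> pure A B (Z t).
  move=> /andP[t0 t1]; apply: pz.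
    by rewrite -subr_eq0 /Z addrC addKr cexp_neq0.
  rewrite /Z addrC addKr nm_cexp.
  have -> : complex.Re (a + t%:C * (a' - a)) = complex.Re a + t * (complex.Re a' - complex.Re a).
    by case: (a) (a') => [? ?] [? ?] /=; ring.
  have [aa|aa] := leP (complex.Re a) (complex.Re a').
    by apply: le_lt_trans ra'; rewrite ler_expR; nra.
  by apply: le_lt_trans ra; rewrite ler_expR; nra.
have := pure_path dA cZ pZ; rewrite Z0 Z1 => -[h _].
have [e' e'0 he'] := h (oB u Bu).
by apply: he' => //; rewrite subrr nm0.
Qed.

Lemma pure_everywhere A B z0 z : dense_in A -> rel_open A B -> (forall u, pure A B u) ->
  B z0 -> A z -> B z.
Proof.
move=> dA oB pA Bz0 Az.
have cZ : continuous (fun t => z0 + t%:C * (z - z0)).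
  exact: (cont_add (@cont_cst R R[i] z0) (cont_mul (@continuous_RtoC R) (@cont_cst R R[i] (z - z0)))).
have := pure_path dA cZ (fun t _ => pA _).
rewrite rmorph0 mul0r addr0 rmorph1 mul1r addrC subrK => -[h _].
have [e e0 he] := h (oB _ Bz0); by apply: he => //; rewrite subrr nm0.
Qed.

End Clopen.

Section SlitPreimage.
Variable R : realType.
Implicit Types (z w u a c d v q p : R[i]) (x y t s r e M S T b h l th : R).
Variable f : R[i] -> R[i].
Hypotheses (hf : holo f) (nf : noncst f) (sf : simple_zeros f).
Variable g : R -> R.
Hypothesis cg : continuous g.
Hypothesis descend : forall z x, f z = crv g x -> dz f z != 0 ->
  exists y u, [/\ y <= x, desc f g x y z u & basin f u].
Local Notation U := (f @^-1` slit_plane g).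

Lemma slit_preimage_dense : dense_in U.
Proof.
move=> z e e0; have [s hs] := critical_list hf nf (nm z + e).
have e2 : 0 < e / 2 by lra.
have [h hb hnE] := fresh_angle [seq complex.Re (c - z) | c <- s] e2.
pose z' := z + h%:C.
have z'z : nm (z' - z) <= e / 2 by rewrite /z' addrC addKr nmC.
have dz' : dz f z' != 0.
  apply: contra hnE => /eqP dz0; apply/mapP; exists z'.
    by apply: hs => //; have := nmDB z' z; lra.
  by rewrite /z' addrC addKr.
have [r [M gM]] := good_exists hf dz'; have [r0 M0 _ _] := gM.
pose r' := Num.min (r / 2) (e / 2).
have r'0 : 0 < r' by rewrite lt_min e2 divr_gt0.
have [r'1 r'2] : r' <= r / 2 /\ r' <= e / 2 by split; rewrite ge_min lexx ?orbT.
clearbody r'; have k0 : 0 < r' / (2 * M) by rewrite divr_gt0// mulr_gt0.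
have [w sw wf] := slit_plane_dense cg (f z') k0.
have [u uz fu] := good_onto hf nf gM r'0 (ltac:(clear - M0 r'0 r'1; lra)) wf.
exists u; first by rewrite /= fu.
by have := nm_sub_trans z' u z; clear - z'z r'2 uz; lra.
Qed.

Variable B : set R[i].
Hypotheses (BU : forall z, B z -> U z) (oB : rel_open U B) (cB : rel_closed U B).

Lemma lift_same W T (Z : R -> R[i]) : 0 <= T -> lift f W T Z ->
  (forall t, 0 <= t <= T -> slit_plane g (W t)) -> (B (Z 0) <-> B (Z T)).
Proof.
move=> T0 [cZ hZ] hW.
have aff : continuous (fun t : R => T * t + 0) := @contR_affine R T 0.
have cY : continuous (fun t => Z (T * t + 0)) := cont_comp aff cZ.
have hY t : 0 <= t <= 1 -> U (Z (T * t + 0)).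
  move=> /andP[t0 t1]; have tT : 0 <= T * t + 0 <= T.
    by rewrite addr0 mulr_ge0//= ler_piMr.
  by rewrite /= (hZ _ tT).1; exact: hW.
by have := path_same oB cB cY hY; rewrite mulr0 mulr1 !addr0.
Qed.

Lemma good_eq c r M z w : good f c r M -> nm (z - c) < r -> nm (w - c) < r -> f z = f w -> z = w.
Proof.
move=> [_ _ _ inj] zc wc E; have := inj z w zc wc; rewrite E subrr nm0 mulr0 => h.
by apply/eqP; rewrite -subr_eq0 -nm_eq0 eq_le h nm_ge0.
Qed.

Lemma basin_same z0 r M u u' : good f z0 r M -> f z0 = 0 ->
  U u -> U u' -> nm (u - z0) < r -> nm (u' - z0) < r ->
  nm (f u) < r / (4 * M) -> nm (f u') < r / (4 * M) -> B u -> B u'.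
Proof.
move=> gM fz0 Uu Uu' ur u'r fu fu'; have [r0 M0 _ _] := gM.
have [W [cW W0 W1 hW]] := slit_path cg Uu Uu'.
have [|Z lZ hZ] := lift_perturb hf nf (@cont_cst R R[i] z0) ler01 (fun _ _ => gM) cW.
  move=> t tI; rewrite fz0 subr0; apply: (le_lt_trans (hW t tI).2).
  by rewrite gt_max fu.
have I0 : 0 <= (0:R) <= (1:R) by rewrite lexx ler01.
have I1 : 0 <= (1:R) <= (1:R) by rewrite ler01 lexx.
have Z0 : Z 0 = u.
  apply: (good_eq gM) => //; last by rewrite (lZ.2 0 I0).1.
  by have := hZ 0 I0; lra.
have Z1 : Z 1 = u'.
  apply: (good_eq gM) => //; last by rewrite (lZ.2 1 I1).1.
  by have := hZ 1 I1; lra.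
by have := lift_same ler01 lZ (fun t tI => (hW t tI).1); rewrite Z0 Z1 => -[].
Qed.

Lemma pure_of_same z e : 0 < e -> (forall u u', U u -> U u' -> nm (u - z) < e -> nm (u' - z) < e ->
  B u -> B u') -> pure U B z.
Proof.
move=> e0 h; have [[u [Uu uz Bu]]|nu] := pselect (exists u, [/\ U u, nm (u - z) < e & B u]).
  by left; exists e => // u' Uu' u'z; exact: h Bu.
by right; exists e => // u Uu uz Bu; apply: nu; exists u.
Qed.

Lemma pure_slit z : U z -> pure U B z.
Proof. by move=> Uz; have [Bz|nB] := pselect (B z); [left; exact: oB|right; exact: cB]. Qed.

Lemma pure_zero z : f z = 0 -> pure U B z.
Proof.
move=> fz; have [r [M gM]] := good_exists hf (sf fz); have [r0 M0 _ _] := gM.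
have k0 : 0 < r / (4 * M) by rewrite divr_gt0// mulr_gt0.
have /continuous_epsP/(_ _ k0)[d d0 hd] := @holo_cont R f hf z.
have m0 : 0 < Num.min r d by rewrite lt_min r0.
apply: (pure_of_same m0) => u u' Uu Uu'; rewrite !lt_min => /andP[u1 u2] /andP[u'1 u'2].
by apply: (basin_same gM fz) => //; [have := hd u u2|have := hd u' u'2]; rewrite fz subr0.
Qed.

(* Moving vertically along [crv g], a point next to the lift of [crv g] through [z] flows
   down inside the preimage to the basin at the end of that lift. *)
Lemma pure_regular z x : f z = crv g x -> dz f z != 0 -> pure U B z.
Proof.
move=> fz dzz; have [y [u0 [yx [Z [lZ Z0 ZT]] [z0 [r [M [gM fz0 u0z fu0]]]]]]] := descend fz dzz.
have [r0 M0 _ _] := gM.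
set T := x - y in lZ ZT; have T0 : 0 <= T by rewrite subr_ge0.
have TT : 0 <= T <= T by rewrite T0 lexx.
have O0 : 0 <= (0:R) <= T by rewrite lexx T0.
have [r1 [M1 g1]] := lift_good hf T0 lZ.
have [r10 M10 _ _] := g1 0 O0.
pose r2 := Num.min r1 (r - nm (u0 - z0)).
have r20 : 0 < r2 by rewrite lt_min r10 subr_gt0.
have [r21 r2r] : r2 <= r1 /\ r2 <= r - nm (u0 - z0) by split; rewrite ge_min lexx ?orbT.
clearbody r2.
have g2 t : 0 <= t <= T -> good f (Z t) r2 M1 by move=> tT; exact: (good_mono (g1 t tT)).
pose k := Num.min (r2 / (4 * M1)) (r / (4 * M) - nm (f u0)).
have k0 : 0 < k by rewrite lt_min subr_gt0 fu0 divr_gt0// mulr_gt0.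
have [k1 k2] : k <= r2 / (4 * M1) /\ k <= r / (4 * M) - nm (f u0) by split; rewrite ge_min lexx ?orbT.
clearbody k.
have [e1 e10 he1] := @cexp_near0 R.
have X0 : 0 < expR x := expR_gt0 x.
pose m := Num.min (e1 / 4) (Num.min (k / (8 * expR x)) 1).
have m0 : 0 < m by rewrite !lt_min ltr01 !divr_gt0// mulr_gt0.
have [m1 m2 m3] : [/\ m <= e1 / 4, m <= k / (8 * expR x) & m <= 1] by split; rewrite !ge_min lexx ?orbT.
clearbody m.
have cG : continuous (fun t => (g (x - t))%:C).
  have -> : (fun t => (g (x - t))%:C) = (fun t => (g (-1 * t + x))%:C).
    by apply/funext => t; congr (g _)%:C; ring.
  exact: (cont_comp (cont_comp (@contR_affine R (-1) x) cg) (@continuous_RtoC R)).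
have [d d0 hd] := unif_cont_path T cG m0.
have md0 : 0 < Num.min m d by rewrite lt_min m0.
have [b b0 hb] := pt_near cg x 0 md0.
have /continuous_epsP/(_ _ b0)[b' b'0 hb'] := @holo_cont R f hf z.
have flow u : U u -> nm (u - z) < Num.min r2 b' -> exists u',
    [/\ U u', nm (u' - z0) < r, nm (f u') < r / (4 * M) & B u <-> B u'].
  move=> Uu; rewrite lt_min => /andP[uz1 uz2].
  have [s [th [fu]]] := hb (f u) (ltac:(rewrite pt0 -fz; exact: hb')).
  rewrite subr0 !lt_min => /andP[s1 s2] /andP[th1 _].
  have th0 : th != 0.
    by apply/negP => /eqP E; apply: (@crv_notin R g s); rewrite -pt0 -E -fu; exact: Uu.
  have th2 : `|th| < 2 * pi by have := pi_ge2 R; clear - hf nf sf cg descend oB cB BU th1 m3; lra.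
  pose W t := pt g (s - t) th.
  have cW : continuous W.
    have c1 : continuous (fun t : R => s - t).
      have -> : (fun t => s - t) = (fun t => -1 * t + s) by apply/funext => t; ring.
      exact: contR_affine.
    exact: (pt_cont cg c1 (@cont_cst R R th)).
  have hW t : 0 <= t <= T -> nm (W t - f (Z t)) < k.
    move=> tT; rewrite (lZ.2 t tT).1 /W /pt /crv.
    pose dd : R[i] := ((s - x) +i* (g (s - t) + th - g (x - t)))%C.
    have gg : `|g (s - t) - g (x - t)| < m.
      have := hd t (t - (s - x)) tT; rewrite -rmorphB nmC.
      have -> : x - (t - (s - x)) = s - t by ring.
      by apply; rewrite addrAC subrr add0r normrN.
    have nd : nm dd < 3 * m.
      apply: (le_lt_trans (nm_le_ReIm dd)); rewrite /dd /=.
      have -> : g (s - t) + th - g (x - t) = (g (s - t) - g (x - t)) + th by ring.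
      by have := ler_normD (g (s - t) - g (x - t)) th; clear - hf nf sf cg descend oB cB BU gg s1 th1; lra.
    have [h1 _] := he1 dd (ltac:(clear - hf nf sf cg descend oB cB BU nd m1 e10; lra)).
    have -> : cexp ((s - t) +i* (g (s - t) + th))%C - cexp ((x - t) +i* g (x - t))%C =
        cexp ((x - t) +i* g (x - t))%C * (cexp dd - 1).
      rewrite mulrBr mulr1 -cexpD; congr (cexp _ - _); apply/eqP; rewrite eq_complex /=.
      by apply/andP; split; apply/eqP; ring.
    rewrite nmM nm_cexp /=.
    have Xt : expR (x - t) <= expR x by rewrite ler_expR gerBl; case/andP: tT.
    have Xm : m * (8 * expR x) <= k by rewrite -ler_pdivlMr// mulr_gt0.
    apply: (@le_lt_trans _ _ (expR x * (6 * m))).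
      by apply: ler_pM; rewrite ?expR_ge0 ?nm_ge0//; clear - hf nf sf cg descend oB cB BU h1 nd; lra.
    by have := mulr_gt0 X0 m0; clear - hf nf sf cg descend oB cB BU Xm; lra.
  have [|Y lY hY] := lift_perturb hf nf lZ.1 T0 g2 cW.
    by move=> t tT; apply: (lt_le_trans (hW t tT)).
  have Y0 : Y 0 = u.
    apply: (good_eq (g2 0 O0)).
    - by have := hY 0 O0; clear - hf nf sf cg descend oB cB BU r20; lra.
    - by rewrite Z0.
    - by rewrite (lY.2 0 O0).1 /W subr0.
  have sW t : slit_plane g (W t) by exact: pt_slit.
  exists (Y T); split.
  - by rewrite /= (lY.2 T TT).1.
  - by have := hY T TT; rewrite ZT => h; have := nm_sub_trans u0 (Y T) z0; clear - hf nf sf cg descend oB cB BU h r20 r2r; lra.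
  - rewrite (lY.2 T TT).1; have := hW T TT; rewrite ZT => h.
    by have := nmDB (W T) (f u0); clear - hf nf sf cg descend oB cB BU h k2; lra.
  by have := lift_same T0 lY (fun t _ => sW t); rewrite Y0.
have e0 : 0 < Num.min r2 b' by rewrite lt_min r20.
apply: (pure_of_same e0) => u u' Uu Uu' uz u'z.
have [v [Uv vz fv Bv]] := flow u Uu uz; have [v' [Uv' v'z fv' Bv']] := flow u' Uu' u'z.
by move=> /Bv Bv1; apply/Bv'; exact: (basin_same gM fz0 Uv Uv').
Qed.

Lemma pure_noncritical z : dz f z != 0 -> pure U B z.
Proof.
move=> dzz; have [/pure_zero//|fz] := eqVneq (f z) 0.
by have [/pure_slit//|[x E]] := slit_plane_cover g fz; exact: pure_regular E dzz.
Qed.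

Lemma pure_all z : pure U B z.
Proof.
have [dzz|/pure_noncritical//] := eqVneq (dz f z) 0.
have [/pure_slit//|nU] := pselect (U z).
have ndz : noncst (dz f).
  move=> w; apply: contrapT => h; have [z1] := dz_not0 hf nf; apply/negP; rewrite negbK.
  have E u : dz f u = w by apply/eqP; apply: contrapT => /negP hu; apply: h; exists u.
  by rewrite E -(E z) dzz.
have [e e0 he] := isolated_value z 0 (holo_dz_holo hf) ndz.
apply: (pure_of_same e0) => u u' Uu Uu' uz u'z Bu.
apply: (pure_punctured slit_preimage_dense oB e0 _ Uu Uu' _ _ uz u'z Bu) => [v vz ve||].
- by apply: pure_noncritical; apply: he => //; exact: ltW.
- by apply: contra_notN nU => /eqP <-.
- by apply: contra_notN nU => /eqP <-.
Qed.

End SlitPreimage.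

Lemma slit_preimage_connected (R : realType) (f : R[i] -> R[i]) (g : R -> R) :
  holo f -> noncst f -> simple_zeros f -> continuous g ->
  (forall z x, f z = crv g x -> dz f z != 0 ->
    exists y u, [/\ y <= x, desc f g x y z u & basin f u]) ->
  connected (f @^-1` slit_plane g).
Proof.
move=> hf nf sf cg descend; apply: connected_eps => B BU oB cB z0 Bz0 z Uz.
apply: (pure_everywhere (slit_preimage_dense hf nf cg) oB _ Bz0 Uz) => u.
exact: (pure_all hf nf sf cg descend oB cB).
Qed.

Section SimplyConnected.
Variable R : realType.
Implicit Types (z w u a c d v q p : R[i]) (x y t s r e M S T b h l th : R).
Variable g : R -> R.
Hypothesis cg : continuous g.

Lemma cont_clamp_within (G : R -> R[i]) : {within `[(0 : R), 1], continuous G} ->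
  continuous (fun t => G (clamp 0 1 t)).
Proof.
move=> /subspace_continuousP cG t A nA.
have cI : `[(0 : R), 1]%classic (clamp 0 1 t) by rewrite /= in_itv /=; exact: clamp_in.
have n : \forall s \near t, `[(0 : R), 1]%classic (clamp 0 1 s) -> A (G (clamp 0 1 s)) :=
  @cont_clamp R 0 1 t _ (cG _ cI A nA).
by apply: filterS n => s; apply; rewrite /= in_itv /=; exact: clamp_in.
Qed.

Lemma pt_range x th x' th' : 0 < th < 2 * pi -> 0 < th' < 2 * pi ->
  pt g x th = pt g x' th' -> x = x' /\ th = th'.
Proof.
move=> h1 h2 /pt_inj[-> [k E]]; split => //; have p2 := pi2_gt0 R.
have k0 : -1 < k%:~R :> R by rewrite -(ltr_pM2l p2); lra.
have k1 : k%:~R < 1 :> R by rewrite -(ltr_pM2l p2); lra.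
move: k0 k1 E; rewrite -[1]/(1%:~R) -rmorphN !ltr_int => k0 k1 ->.
by rewrite (_ : k = 0) ?mulr0 ?addr0//; lia.
Qed.

Lemma slit_coordinates (F : R -> R[i]) : continuous F -> (forall t, 0 <= t <= 1 -> slit_plane g (F t)) ->
  exists x th : R -> R, [/\ continuous x, continuous th &
    forall t, 0 <= t <= 1 -> F t = pt g (x t) (th t) /\ 0 < th t < 2 * pi].
Proof.
move=> cF hF; have p2 := pi2_gt0 R.
have F0 t : 0 <= t <= 1 -> F t != 0.
  by move=> /hF sF; apply/eqP => E; apply: (@slit_plane0 R g); rewrite -E.
have [l cl hl] := log_exists cF F0.
have cx : continuous (fun t => complex.Re (l t)) := cont_comp cl (@continuous_Re R).
have cy : continuous (fun t => complex.Im (l t)) := cont_comp cl (@continuous_Im R).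
pose th0 t := complex.Im (l t) - g (complex.Re (l t)).
have ct0 : continuous th0 := contR_add cy (contR_opp (cont_comp cx cg)).
have E0 t : 0 <= t <= 1 -> F t = pt g (complex.Re (l t)) (th0 t).
  move=> tI; rewrite -hl// /pt /th0; congr cexp; case: (l t) => a b /=; apply/eqP; rewrite eq_complex /=.
  by rewrite eqxx addrC subrK eqxx.
have I0 : 0 <= (0:R) <= (1:R) by rewrite lexx ler01.
have [x0 [a0 [a01 a02 aE]]] := hF 0 I0.
have [_ [k kE]] : complex.Re (l 0) = x0 /\ exists k : int, th0 0 = a0 + 2 * pi * k%:~R.
  exact: pt_inj (etrans (esym (E0 0 I0)) aE).
pose th t := th0 t + - (2 * pi * k%:~R).
have cth : continuous th := contR_add ct0 (@cont_cst R R _).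
have ptk (n : nat) x y : pt g x (y + 2 * pi * n%:R) = pt g x y.
  elim: n => [|n IH]; first by rewrite mulr0 addr0.
  by rewrite -[RHS]IH -[RHS]pt_per -natr1; congr (pt g x _); ring.
have Eth t : pt g (complex.Re (l t)) (th t) = pt g (complex.Re (l t)) (th0 t).
  rewrite /th; case: (k) => n; first by rewrite -[LHS](ptk n) subrK.
  by rewrite NegzE rmorphN mulrN opprK ptk.
have E t : 0 <= t <= 1 -> F t = pt g (complex.Re (l t)) (th t) by move=> tI; rewrite Eth E0.
have nz t : 0 <= t <= 1 -> th t != 0 /\ th t != 2 * pi.
  move=> tI; split; apply/eqP => Z; apply: (@crv_notin R g (complex.Re (l t))).
    by rewrite -pt0 -Z -E//; exact: hF.
  by rewrite -pt0 -[pt _ _ 0]pt_per add0r -Z -E//; exact: hF.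
have th_0 : th 0 = a0 by rewrite /th kE addrK.
exists (fun t => complex.Re (l t)), th; split => // t tI; split; first exact: E.
have /andP[t0 t1] := tI.
have [n1 n2] := nz t tI; apply/andP; split.
  rewrite ltNge; apply/negP => h.
  have [|s] := @IVT R th 0 t 0 t0 (continuous_subspaceT cth).
    by rewrite ge_min le_max th_0 h (ltW a01) orbT.
  rewrite in_itv /= => /andP[s0 st] Es.
  by have [/eqP + _] := nz s (ltac:(by rewrite s0 (le_trans st t1))); apply.
rewrite ltNge; apply/negP => h.
have [|s] := @IVT R th 0 t (2 * pi) t0 (continuous_subspaceT cth).
  by rewrite ge_min le_max th_0 h (ltW a02) orbT.
rewrite in_itv /= => /andP[s0 st] Es.
by have [_ /eqP] := nz s (ltac:(by rewrite s0 (le_trans st t1))); apply.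
Qed.

Variable a : R[i].
Let D : set R[i] := [set w | slit_plane g (w - a)].

Lemma slit_plane_region : region D.
Proof.
have p2 := pi_ge2 R; split.
- by exists (pt g 0 1 + a); rewrite /D /= addrK; exists 0, 1; split => //; lra.
- move=> w; rewrite /D /= => -[x [th [t0 t1 wE]]]; apply/nbhs_nm.
  pose e := Num.min th (2 * pi - th).
  have e0 : 0 < e by rewrite lt_min t0 subr_gt0.
  have [e1 e2] : e <= th /\ e <= 2 * pi - th by split; rewrite ge_min lexx ?orbT.
  have [b b0 hb] := pt_near cg x th e0; exists b => // u uw.
  have [s [t [uE _ tt]]] := hb (u - a) ltac:(by rewrite -wE opprD opprK addrACA addNr addr0).
  by move: tt; rewrite ltr_norml => tt; exists s, t; split => //; clear - e1 e2 tt; lra.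
apply: connected_eps => B BD oB cB z0 Bz0 z Dz.
have [W [cW W0 W1 hW]] := slit_path cg (BD _ Bz0) Dz.
have cZ : continuous (fun t => W t + a) := cont_add cW (@cont_cst R R[i] a).
have := path_same oB cB cZ; rewrite W0 W1 !subrK => H.
by apply/(H _).1 => // t tI; rewrite /D /= addrK; exact: (hW t tI).1.
Qed.

Lemma slit_plane_simply_connected : simply_connected_region D.
Proof.
split; first exact: slit_plane_region.
move=> G [cG DG G01]; pose F t := G (clamp 0 1 t) - a.
have cF : continuous F := cont_add (cont_clamp_within cG) (@cont_cst R R[i] (- a)).
have cI t : 0 <= t <= 1 -> F t = G t - a by move=> tI; rewrite /F clamp_id.
have hF t : 0 <= t <= 1 -> slit_plane g (F t).
  by move=> tI; rewrite cI//; apply: DG; rewrite in_itv.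
have [x [th [cx cth E]]] := slit_coordinates cF hF.
have I0 : 0 <= (0:R) <= (1:R) by rewrite lexx ler01.
have I1 : 0 <= (1:R) <= (1:R) by rewrite ler01 lexx.
have [E0 r0] := E 0 I0; have [E1 r1] := E 1 I1.
have [x01 th01] : x 0 = x 1 /\ th 0 = th 1.
  by apply: pt_range => //; rewrite -E0 -E1 !cI// G01.
pose H (u : R * R) := pt g ((1 - u.1) * x u.2 + u.1 * x 0) ((1 - u.1) * th u.2 + u.1 * th 0) + a.
have c1 : continuous (fun u : R * R => u.1) by move=> u; exact: cvg_fst.
have c2 : continuous (fun u : R * R => u.2) by move=> u; exact: cvg_snd.
have cmix (k : R -> R) : continuous k -> continuous (fun u : R * R => (1 - u.1) * k u.2 + u.1 * k 0).
  move=> ck; apply: contR_add.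
    exact: (contR_mul (contR_add (@cont_cst (R * R)%type R 1) (contR_opp c1)) (cont_comp c2 ck)).
  exact: (contR_mul c1 (@cont_cst (R * R)%type R (k 0))).
have cH : continuous H := cont_add (pt_cont cg (cmix x cx) (cmix th cth)) (@cont_cst (R * R)%type R[i] a).
exists H; split.
- exact: continuous_subspaceT.
- move=> s t; rewrite !in_itv /= => /andP[s0 s1] tI; rewrite /D /H /= addrK.
  have [_ /andP[t1 t2]] := E t tI; case/andP: r0 => r1' r2'.
  exists ((1 - s) * x t + s * x 0), ((1 - s) * th t + s * th 0).
  have co (p q y : R) : y < p -> y < q -> y < (1 - s) * p + s * q.
    move=> yp yq; have -> : (1 - s) * p + s * q = y + ((1 - s) * (p - y) + s * (q - y)) by ring.
    have a1 : 0 <= s * (q - y) by rewrite mulr_ge0// subr_ge0 ltW.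
    have [->|s1'] := eqVneq s 1; first by rewrite subrr mul0r mul1r; clear - yq; lra.
    have : 0 < (1 - s) * (p - y) by rewrite mulr_gt0// subr_gt0// lt_neqAle s1'.
    by clear - a1; lra.
  split => //; first exact: co.
  by have := co (- th t) (- th 0) (- (2 * pi)) ltac:(clear - t2; lra) ltac:(clear - r1' r2'; lra); clear; lra.
- move=> t; rewrite in_itv /= => tI; rewrite /H /= subr0 !mul1r !mul0r !addr0.
  by rewrite -(E t tI).1 cI// subrK.
- move=> t _; rewrite /H /= subrr !mul1r !mul0r !add0r -E0 cI// subrK //.
move=> s _; rewrite /H /= -x01 -th01.
have -> : (1 - s) * x 0 + s * x 0 = x 0 by ring.
have -> : (1 - s) * th 0 + s * th 0 = th 0 by ring.
by rewrite -E0 cI// subrK.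
Qed.

Lemma slit_plane_base : ~ D a.
Proof. by rewrite /D /= subrr; exact: slit_plane0. Qed.

End SimplyConnected.

(** * Translation to the hypotheses of the theorem *)

Section Transfer.
Variable R : realType.
Implicit Types (z w u a c d v q p : R[i]) (x y t s r e M S T B b h l : R) (f : R[i] -> R[i]).

Lemma entire_cder f z : entire f -> cder f z (derive1 f z).
Proof.
move=> /(_ z) df e e0; rewrite derive1E.
have h : (fun h : R[i] => h^-1 *: (f (h *: 1 + z) - f z)) @ 0^' --> 'D_1 f z by exact: df.
have e0' : 0 < e%:C by rewrite ltcR.
have : \forall h \near 0^', `|'D_1 f z - h^-1 *: (f (h *: 1 + z) - f z)| < e%:C.
  by move/cvgrPdist_lt : h => /(_ _ e0').
rewrite near_withinE => /nbhs_nm[r r0 hr]; exists r => // u uz.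
have [->|uzn] := eqVneq u z; first by rewrite !subrr mulr0 subr0 nm0 mulr0.
have uz0 : u - z != 0 by rewrite subr_eq0.
have := hr (u - z); rewrite subr0 => /(_ uz uz0).
rewrite /= /GRing.scale /= mulr1 subrK distrC normE ltcR => hn.
have -> : f u - f z - 'D_1 f z * (u - z) = ((u - z)^-1 * (f u - f z) - 'D_1 f z) * (u - z).
  by rewrite mulrBl mulrAC mulVf// mul1r.
by rewrite nmM ler_wpM2r ?nm_ge0// ltW.
Qed.

Lemma sub_cder f a z : entire f -> cder (fun z => f z - a) z (derive1 f z).
Proof.
move=> ef; rewrite -[derive1 f z]subr0.
exact: (cder_sub (entire_cder z ef) (cder_cst a z)).
Qed.

Lemma sub_noncst f a : transcendental_entire f -> noncst (fun z => f z - a).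
Proof.
move=> [_ nf] w; apply: contrapT => h; apply: nf; exists (w + a)%:P => z; rewrite hornerC.
by apply/eqP; apply: contrapT => hz; apply: h; exists z; rewrite subr_eq; apply/negP.
Qed.

Lemma sub_growth f a : finite_order f -> exists B n, 0 <= B /\ growth (fun z => f z - a) B n.
Proof.
move=> [C [rho [C0 rho0 h]]]; pose n := (Num.trunc rho).+1.
have a0 := nm_ge0 a; exists (C + nm a + 1), n; split; first lra.
move=> z; have z0 := nm_ge0 z; set X := (1 + nm z) ^+ n.
have X1 : 1 <= X by rewrite exprn_ege1// lerDl.
have hX : nm z `^ rho <= X.
  rewrite /X -powR_mulrn; last lra.
  apply: (@le_trans _ _ ((1 + nm z) `^ rho)).
    by apply: ge0_ler_powR; rewrite ?nnegrE ?(ltW rho0)//; lra.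
  apply: ler_powR; first lra.
  by rewrite ltW// truncnS_gt.
apply: (@le_trans _ _ ((C + nm a) * expR X)).
  rewrite mulrDl; apply: (le_trans (nmD _ _)); rewrite nmN; apply: lerD.
    by apply: (le_trans (h z)); rewrite ler_wpM2l ?ler_expR// ltW.
  by rewrite ler_peMr// -expR0 ler_expR; lra.
have E1 : C + nm a <= expR ((C + nm a) * X).
  apply: (@le_trans _ _ (expR (C + nm a))); first by have := expR_ge1Dx (C + nm a); lra.
  by rewrite ler_expR ler_peMr//; lra.
have -> : (C + nm a + 1) * X = (C + nm a) * X + X by ring.
by rewrite expRD ler_wpM2r// expR_ge0.
Qed.

Lemma sub_simple_zeros f a : entire f -> ~ critical_value f a -> simple_zeros (fun z => f z - a).
Proof.
move=> ef ncv z /eqP; rewrite subr_eq0 => /eqP fz; apply/eqP => dz0; apply: ncv; exists z; split => //.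
have hf : holo (fun z => f z - a) by move=> u; exists (derive1 f u); exact: sub_cder.
by rewrite -dz0; exact: (cder_uniq (sub_cder a z ef) (holo_dz z hf)).
Qed.

Lemma sub_unomitted f a : ~ locally_omitted f a -> unomitted (fun z => f z - a).
Proof.
move=> nlo r G z0 r0 Gz0 Gr oG cG; apply: contrapT => nz; apply: nlo.
have ballE w : ball a r%:C w <-> nm (w - a) < r.
  by rewrite -ball_normE /ball_ /= distrC normE ltcR.
pose P : set R[i] := f @^-1` ball a r%:C.
exists r, (connected_component P z0); split => //.
  by exists z0 => //; apply/ballE; exact: Gr.
have openG : open G by move=> z /oG[e e0 he]; apply/nbhs_nm; exists e.
have PG z : P z -> closure G z -> G z.
  move=> /ballE Pz cl; apply: cG => // e e0.
  have [u [Gu uz]] := cl [set u | nm (u - z) < e] (ltac:(by apply/nbhs_nm; exists e)).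
  by exists u.
have Pz0 : P z0 by apply/ballE; exact: Gr.
have sub : connected_component P z0 `&` G = connected_component P z0.
  apply: (@component_connected _ P z0).
  - by exists z0; split => //; exact: connected_component_refl.
  - by exists G.
  exists (closure G); first exact: closed_closure.
  apply/seteqP; split => [z [cz Gz]|z [cz Gz]]; split => //; first exact: subset_closure.
  by apply: PG => //; exact: (connected_component_sub cz).
move=> z; rewrite -sub => -[_ Gz] fz; apply: nz; exists z => //.
by rewrite fz subrr.
Qed.

End Transfer.

Theorem theorem3 (R : realType) (f : R[i] -> R[i]) (a : R[i]) :
  transcendental_entire f -> finite_order f ->
  ~ critical_value f a -> ~ locally_omitted f a ->
  exists D : set R[i],
    [/\ simply_connected_region D, ~ D a & connected (f @^-1` D)].
Proof.
move=> tf fo ncv nlo; have ef := tf.1; pose f0 z := f z - a.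
have hf : holo f0 by move=> z; exists (derive1 f z); exact: sub_cder.
have nf : noncst f0 := sub_noncst a tf.
have sf : simple_zeros f0 := sub_simple_zeros ef ncv.
have uf : unomitted f0 := sub_unomitted nlo.
have [B [n [B0 gf]]] := sub_growth a fo.
have all_reach z : dz f0 z != 0 -> f0 z != 0 -> reaches f0 z.
  move=> dzz fz; apply: contrapT => nr.
  by apply: (@no_lost _ _ hf nf _ _ z B0 gf sf uf); split.
have [g cg descend] := descending_curve hf nf all_reach.
exists [set w | slit_plane g (w - a)]; split.
- exact: slit_plane_simply_connected.
- exact: slit_plane_base.
exact: (slit_preimage_connected hf nf sf cg descend).
Qed.
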